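(* Let $X$ be a locally compact geodesically complete CAT(0) cube complex and let $\Gamma$ be an infinite discrete group acting properly and cocompactly on $X$ by cubical automorphisms. Then $X$ is a product of two geodesically complete unbounded convex subcomplexes, or $\Gamma$ contains a rank one isometry.
   Context: A CAT(0) cube complex is a simply connected cell complex all of whose cells are Euclidean cubes with edge length one and such that the link of each vertex is a flag complex; it is endowed with the induced length metric, which is CAT(0). A subcomplex is convex if it is convex for this metric. A product of cube complexes carries the product cubical structure and the $\ell^2$-product metric. A CAT(0) space is geodesically complete if every geodesic segment can be prolonged to some (not necessarily unique) bi-infinite geodesic line. A rank one isometry of a complete CAT(0) space is a hyperbolic isometry none of whose axes bounds a flat half-plane. *)

(* Defs.v *)
(* MathComp-Analysis world. *)
From HB Require Import structures.
From mathcomp Require Import all_boot all_order all_algebra.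
From mathcomp Require Import boolp classical_sets functions cardinality.
From mathcomp Require Import reals topology normedtype.

Set Implicit Arguments.
Unset Strict Implicit.
Unset Printing Implicit Defensive.

Import Order.TTheory GRing.Theory Num.Theory.
Import numFieldNormedType.Exports.

Local Open Scope classical_set_scope.
Local Open Scope ring_scope.

Section EuclideanCubes.
Context {R : realType}.

(* The norm the library puts on row vectors is the sup norm, hence this. *)
Definition euclid_dist (n : nat) (u v : 'rV[R]_n) : R :=
  Num.sqrt (\sum_(i < n) (u 0 i - v 0 i) ^+ 2).

Definition euclid_isometry (m n : nat) (A : set 'rV[R]_m) (B : set 'rV[R]_n)
    (h : 'rV[R]_m -> 'rV[R]_n) : Prop :=
  h @` A = B /\
  (forall u v, A u -> A v -> euclid_dist (h u) (h v) = euclid_dist u v).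

Definition cube (n : nat) : set 'rV[R]_n :=
  [set u | forall i, 0 <= u 0 i <= 1].

(* For n = 0 this is the whole one-point cube. *)
Definition open_cube (n : nat) : set 'rV[R]_n :=
  [set u | forall i, 0 < u 0 i < 1].

Definition cube_vertex (n : nat) (w : {ffun 'I_n -> bool}) : 'rV[R]_n :=
  \row_i (w i)%:R.

(* The face through the vertex w on which the coordinates in A are frozen. *)
Definition cube_face (n : nat) (A : {set 'I_n}) (w : {ffun 'I_n -> bool}) :
    set 'rV[R]_n :=
  [set u | cube u /\ forall i, i \in A -> u 0 i = cube_vertex w 0 i].

End EuclideanCubes.

(* A cube complex with underlying point set X: the open cells partition X, and
   the restriction of a characteristic map to any face of its cube is, up to an
   isometry of that face with a standard cube, again a characteristic map.
   Closed cells need not be embedded. *)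
Record cube_complex (R : realType) (X : Type) := CubeComplex {
  cell : Type;
  cdim : cell -> nat;
  chi : forall c : cell, 'rV[R]_(cdim c) -> X;
  chi_cover : forall x, exists c, exists2 u, open_cube u & chi (c := c) u = x;
  chi_disjoint : forall c c' (u : 'rV[R]_(cdim c)) (u' : 'rV[R]_(cdim c')),
    open_cube u -> open_cube u' -> chi u = chi u' -> c = c';
  chi_inj : forall c (u u' : 'rV[R]_(cdim c)),
    open_cube u -> open_cube u' -> chi u = chi u' -> u = u';
  chi_face : forall c (A : {set 'I_(cdim c)}) (w : {ffun 'I_(cdim c) -> bool}),
    exists c' (h : 'rV[R]_(cdim c) -> 'rV[R]_(cdim c')),
      euclid_isometry (cube_face A w) (@cube R (cdim c')) h /\
      (forall u, cube_face A w u -> chi u = chi (h u))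
}.

Arguments cell {R X} K : rename.
Arguments cdim {R X K} c : rename.
Arguments chi {R X K} c u : rename.

Section CubeComplex.
Context {R : realType} {X : Type} (K : cube_complex R X).

Definition closed_cell (c : cell K) : set X := chi c @` @cube R (cdim c).

Definition is_vertex (v : X) : Prop :=
  exists2 c : cell K, cdim c = 0%N & closed_cell c v.

(* A corner of a k-cube located at the vertex v is a (k-1)-simplex of the link
   of v; the vertex v itself (k = 0) stands for the empty simplex. *)
Definition corner := {c : cell K & {ffun 'I_(cdim c) -> bool}}.

Definition corner_pt (s : corner) : 'rV[R]_(cdim (tag s)) :=
  cube_vertex (tagged s).

Definition corner_at (v : X) : set corner :=
  [set s | chi (tag s) (corner_pt s) = v].

Definition corner_face (t s : corner) : Prop :=
  exists A (h : 'rV[R]_(cdim (tag s)) -> 'rV[R]_(cdim (tag t))),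
    [/\ euclid_isometry (cube_face A (tagged s)) (@cube R (cdim (tag t))) h,
        forall u, cube_face A (tagged s) u -> chi (tag s) u = chi (tag t) (h u)
      & h (corner_pt s) = corner_pt t].

Definition link_vertices (s : corner) : set corner :=
  [set p | cdim (tag p) = 1%N /\ corner_face p s].

(* The first two clauses say that the link of v is a simplicial complex. *)
Definition flag_link (v : X) : Prop :=
  [/\ forall s, corner_at v s -> (link_vertices s #= `I_(cdim (tag s)))%card,
      forall s t, corner_at v s -> corner_at v t ->
        link_vertices s = link_vertices t -> s = t
    & forall S : set corner, finite_set S ->
        (forall p, S p -> corner_at v p /\ cdim (tag p) = 1%N) ->
        (forall p q, S p -> S q -> p <> q ->
          exists2 s, corner_at v s & link_vertices s = [set p; q]) ->
        exists2 s, corner_at v s & link_vertices s = S].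

(* A string from x to y is a finite sequence of straight segments, each inside
   the cube of some cell, with matching endpoints in X. *)
Definition cube_segment := {c : cell K & ('rV[R]_(cdim c) * 'rV[R]_(cdim c))%type}.

Fixpoint is_string (x : X) (s : seq cube_segment) (y : X) : Prop :=
  match s with
  | [::] => x = y
  | p :: s' =>
      [/\ cube (tagged p).1, cube (tagged p).2, chi (tag p) (tagged p).1 = x
        & is_string (chi (tag p) (tagged p).2) s' y]
  end.

Definition string_length (s : seq cube_segment) : R :=
  \sum_(p <- s) euclid_dist (tagged p).1 (tagged p).2.

Definition cubical_automorphism (f : X -> X) : Prop :=
  bijective f /\
  forall c : cell K, exists (c' : cell K) (h : 'rV[R]_(cdim c) -> 'rV[R]_(cdim c')),
    euclid_isometry (@cube R (cdim c)) (@cube R (cdim c')) h /\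
    (forall u, cube u -> f (chi c u) = chi c' (h u)).

Definition is_subcomplex (Y : set X) : Prop :=
  exists D : set (cell K), Y = \bigcup_(c in D) closed_cell c.

End CubeComplex.

Section SimplyConnected.
Context {R : realType} (X : topologicalType).

Definition path_connected : Prop :=
  forall x y : X, exists g : R -> X,
    [/\ {within `[0, 1]%classic, continuous g}, g 0 = x & g 1 = y].

Definition loops_contractible : Prop :=
  forall g : R -> X,
    {within `[0, 1]%classic, continuous g} -> g 0 = g 1 ->
    exists H : R * R -> X,
      [/\ {within `[0, 1]%classic `*` `[0, 1]%classic, continuous H},
          forall t : R, 0 <= t <= 1 -> H (0, t) = g t,
          forall t : R, 0 <= t <= 1 -> H (1, t) = g 0
        & forall s : R, 0 <= s <= 1 -> H (s, 0) = g 0 /\ H (s, 1) = g 0].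

Definition simply_connected : Prop :=
  [/\ [set: X] !=set0, path_connected & loops_contractible].

End SimplyConnected.

Section MetricGeometry.
Context {R : realType} {X : metricType R}.

Definition geodesic_on (I : set R) (c : R -> X) : Prop :=
  forall s t, I s -> I t -> mdist (c s) (c t) = `|s - t|.

(* Geodesic completeness of A with the metric restricted from X. *)
Definition geodesically_complete (A : set X) : Prop :=
  forall (l : R) (c : R -> X), 0 <= l -> geodesic_on `[0, l]%classic c ->
    (forall t : R, 0 <= t <= l -> A (c t)) ->
    exists c' : R -> X,
      [/\ geodesic_on setT c', forall t, A (c' t)
        & forall t : R, 0 <= t <= l -> c' t = c t].

Definition geodesically_convex (A : set X) : Prop :=
  forall (l : R) (c : R -> X), 0 <= l -> geodesic_on `[0, l]%classic c ->
    A (c 0) -> A (c l) -> forall t : R, 0 <= t <= l -> A (c t).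

Definition unbounded (A : set X) : Prop :=
  ~ exists M : R, forall x y, A x -> A y -> mdist x y <= M.

Definition isometry (f : X -> X) : Prop :=
  bijective f /\ forall x y, mdist (f x) (f y) = mdist x y.

Definition hyperbolic (f : X -> X) : Prop :=
  isometry f /\
  exists x, 0 < mdist x (f x) /\ forall y, mdist x (f x) <= mdist y (f y).

Definition is_axis (f : X -> X) (c : R -> X) : Prop :=
  geodesic_on setT c /\ exists2 a : R, 0 < a & forall t, f (c t) = c (t + a).

Definition bounds_flat_half_plane (c : R -> X) : Prop :=
  exists F : R * R -> X,
    (forall p q : R * R, 0 <= p.2 -> 0 <= q.2 ->
       mdist (F p) (F q) = Num.sqrt ((p.1 - q.1) ^+ 2 + (p.2 - q.2) ^+ 2)) /\
    (forall t, F (t, 0) = c t).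

Definition rank_one (f : X -> X) : Prop :=
  hyperbolic f /\ forall c, is_axis f c -> ~ bounds_flat_half_plane c.

Context (K : cube_complex R X).

(* The nonemptiness clause is needed because the library sets inf set0 = 0. *)
Definition induced_length_metric : Prop :=
  forall x y : X,
    let lengths := [set string_length s | s in [set s | is_string (K := K) x s y]]
    in lengths !=set0 /\ mdist x y = inf lengths.

Definition CAT0_cube_complex : Prop :=
  [/\ @simply_connected R X, forall v, is_vertex K v -> flag_link K v
    & induced_length_metric].

(* X is isomorphic to Y x Z by a bijection Phi which is an isometry for the
   l^2-product metric and sends each product of a cell of Y and a cell of Z
   isometrically onto a cell of X.  Phi only matters on Y `*` Z, where its
   injectivity follows from the metric identity. *)
Definition is_product (Y Z : set X) : Prop :=
  exists Phi : X * X -> X,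
    [/\ Phi @` (Y `*` Z) = setT,
        forall y z y' z', Y y -> Z z -> Y y' -> Z z' ->
          mdist (Phi (y, z)) (Phi (y', z')) =
          Num.sqrt (mdist y y' ^+ 2 + mdist z z' ^+ 2)
      & forall a b : cell K, closed_cell a `<=` Y -> closed_cell b `<=` Z ->
          exists (c : cell K) (h : 'rV[R]_(cdim a + cdim b) -> 'rV[R]_(cdim c)),
            euclid_isometry (@cube R (cdim a + cdim b)) (@cube R (cdim c)) h /\
            (forall u v, cube u -> cube v ->
               Phi (chi a u, chi b v) = chi c (h (row_mx u v)))].

End MetricGeometry.

Section Actions.
Context {R : realType} {X : metricType R} {Gamma : groupType}.

Definition is_action (rho : Gamma -> X -> X) : Prop :=
  (forall x, rho 1%g x = x) /\
  (forall g h x, rho (g * h)%g x = rho g (rho h x)).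

(* Gamma carries the discrete topology, so compact subsets are finite. *)
Definition proper_action (rho : Gamma -> X -> X) : Prop :=
  forall C : set X, compact C ->
    finite_set [set g : Gamma | (rho g @` C) `&` C !=set0].

Definition cocompact_action (rho : Gamma -> X -> X) : Prop :=
  exists2 C : set X, compact C & \bigcup_(g in setT) (rho g @` C) = setT.

End Actions.

(* Main.v *)
(* No CAT(0) geometry is used; everything is read off the hyperplanes. The flag
   condition makes the vertices and edges a square complex in which reduced edge
   words are compared up to swapping the two sides of a square, and simple
   connectivity (lifting a homotopy to the local system of classes of reduced words)
   shows that reduced paths with the same ends agree up to such swaps. This gives
   halfspaces [hs e] with the usual properties. Each halfspace [a] defines
   [fa a : X -> [0, 1]], affine on cubes; families of these functions are 1-Lipschitz
   in the l^2 sense, isometric on cubes, and separate points.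
   If the halfspaces split into two nonempty classes crossing each other, X is the
   product of the two slices on which the functions of one class are constant.
   Otherwise the group has an element g and a halfspace a with g a < a such that no
   hyperplane crosses both a and g a. Such a g has no fixed point and attains its
   minimal displacement; a flat half-plane bounded by an axis is impossible, because a
   path of length O(L) around a ball of radius L would cross arbitrarily many of the
   strips between g^n a and g^(n+1) a, and crossing a strip at distance L from the axis
   costs a fixed multiple of L. *)
Require Import Defs.
From Stdlib Require List.
From HB Require Import structures.
From mathcomp Require Import all_boot all_order all_algebra.
From mathcomp Require Import boolp classical_sets functions cardinality.
From mathcomp Require Import reals topology normedtype derive.
From mathcomp Require Import ring lra zify.

Set Implicit Arguments.
Unset Strict Implicit.
Unset Printing Implicit Defensive.

Import Order.TTheory GRing.Theory Num.Theory.
Import numFieldNormedType.Exports.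

Local Open Scope classical_set_scope.
Local Open Scope ring_scope.

(** * Square complexes and reduced words *)

(** The existence of [g], which the overview only asserts, splits on whether every halfspace can be
    moved by the group into its own complement. If so, two such moves carry a halfspace [p] into any
    [q] inside it. Were every nested pair then crossed by a common hyperplane, sectors of crossing
    halfspaces would produce pairwise crossing families of every size, against the bound on degrees.
    If some halfspace cannot be flipped, its translates meet pairwise and so single out a direction
    at infinity preserved by the group. Pushing all vertices in this direction is equivariant, and a
    pigeonhole argument along a flow line produces a central element [z]. As the halfspaces do not
    split into two classes crossing each other, a power of [z] nests every halfspace with its image,
    and any two halfspaces are comparable up to complements and powers of [z]; a high enough power
    then works as [g]. *)

Record sqc := Sqc {
  vtx : Type;
  edg : Type;
  src : edg -> vtx;
  tgt : edg -> vtx;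
  opp : edg -> edg;
  (* [sq e x e' x']: a square with sides e, x at one corner, e' opposite to e
     and x' opposite to x, so that e x' and x e' have the same endpoints. *)
  sq : edg -> edg -> edg -> edg -> Prop;
  oppK : forall e, opp (opp e) = e;
  src_opp : forall e, src (opp e) = tgt e;
  sq_src : forall e x e' x', sq e x e' x' -> src e = src x;
  sq_mid : forall e x e' x', sq e x e' x' -> src x' = tgt e;
  sq_tgt : forall e x e' x', sq e x e' x' -> tgt e' = tgt x';
  sq_sym : forall e x e' x', sq e x e' x' -> sq x e x' e';
  sq_rot : forall e x e' x', sq e x e' x' -> sq (opp e) x' (opp e') x;
  sq_irr : forall e e' x', ~ sq e e e' x';
  sq_det : forall e x e1 x1 e2 x2, sq e x e1 x1 -> sq e x e2 x2 ->
    e1 = e2 /\ x1 = x2;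
  sq_cube : forall e x y e1 x1 e2 y1 x2 y2,
    sq e x e1 x1 -> sq e y e2 y1 -> sq x y x2 y2 ->
    exists e3 x3 y3, [/\ sq e1 y2 e3 y3, sq e2 x2 e3 x3 & sq x1 y1 x3 y3]
}.

Lemma cat_cons2_inv (T : Type) (A0 B0 A B : seq T) (a b f : T) :
  A0 ++ a :: b :: B0 = A ++ f :: B ->
  [\/ exists C, A = A0 ++ a :: b :: C /\ B0 = C ++ f :: B,
      [/\ A = A0 ++ [:: a], f = b & B = B0],
      [/\ A = A0, f = a & B = b :: B0] |
      exists C, A0 = A ++ f :: C /\ B = C ++ a :: b :: B0].
Proof.
elim: A0 A => [|c A0 IH] [|d A] /=.
- by case=> <- <-; apply: Or43.
- case=> <-; case: A => [|d' A] /=.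
    by case=> <- <-; apply: Or42.
  by case=> <- ->; apply: Or41; exists A.
- by case=> <- <-; apply: Or44; exists A0.
case=> <- /IH[[C [-> ->]]|[-> -> ->]|[-> -> ->]|[C [-> ->]]].
- by apply: Or41; exists C.
- exact: Or42.
- exact: Or43.
- by apply: Or44; exists C.
Qed.

Section Words.
Variable S : sqc.
Implicit Types (u v : vtx S) (e f x y : edg S) (p q r w A B : seq (edg S)).

Lemma tgt_opp e : tgt (opp e) = src e.
Proof. by rewrite -src_opp oppK. Qed.

Lemma sq_rot2 e x e' x' : sq e x e' x' -> sq e' (opp x) e (opp x').
Proof. by move=> /sq_sym/sq_rot/sq_sym. Qed.

Lemma sq_rotK e x e' x' : sq (opp e) x' (opp e') x -> sq e x e' x'.
Proof. by move/sq_rot; rewrite !oppK. Qed.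

Lemma sq_far e x e' x' : sq e x e' x' -> sq (opp e') (opp x') (opp e) (opp x).
Proof. by move=> /sq_rot/sq_rot2. Qed.

(* a square is also determined by one of its two-letter words [e x'] *)
Lemma sq_detw e x e' x' y e'' : sq e x e' x' -> sq e y e'' x' -> x = y /\ e' = e''.
Proof.
move=> /sq_rot h /sq_rot h'; have [h1 ->] := sq_det h h'; split => //.
by rewrite -(oppK e') h1 oppK.
Qed.

Lemma sq_mid2 e x e' x' : sq e x e' x' -> src e' = tgt x.
Proof. by move/sq_sym/sq_mid. Qed.

Fixpoint ispath u p v : Prop :=
  if p is e :: p' then src e = u /\ ispath (tgt e) p' v else u = v.

Lemma ispath_cat u p q v' :
  ispath u (p ++ q) v' <-> exists2 v, ispath u p v & ispath v q v'.
Proof.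
elim: p u => [|e p IH] u /=; first by split=> [h|[v ->]//]; exists u.
split=> [[<- /IH[v h1 h2]]|[v [<- h1] h2]]; first by exists v.
by split=> //; apply/IH; exists v.
Qed.

Definition revp p := rev (map (@opp S) p).

Lemma revp_cat p q : revp (p ++ q) = revp q ++ revp p.
Proof. by rewrite /revp map_cat rev_cat. Qed.

Lemma revp_cons e p : revp (e :: p) = revp p ++ [:: opp e].
Proof. by rewrite /revp /= rev_cons -cats1. Qed.

Lemma revpK p : revp (revp p) = p.
Proof. by elim: p => // e p IH; rewrite revp_cons revp_cat IH /revp /= oppK. Qed.

Lemma ispath_rev u p v : ispath u p v -> ispath v (revp p) u.
Proof.
elim: p u => [|e p IH] u /=; first by move->.
move=> [<- /IH h]; rewrite revp_cons; apply/ispath_cat.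
by exists (tgt e) => //=; rewrite src_opp tgt_opp.
Qed.

Lemma ispath_rcons u p e v :
  ispath u (p ++ [:: e]) v <-> ispath u p (src e) /\ tgt e = v.
Proof.
split=> [/ispath_cat[w h /= [-> <-]]//|[h <-]].
by apply/ispath_cat; exists (src e).
Qed.

Inductive sw1 : seq (edg S) -> seq (edg S) -> Prop :=
  Sw1 A B e x e' x' : sq e x e' x' ->
    sw1 (A ++ e :: x' :: B) (A ++ x :: e' :: B).

Inductive sw p : seq (edg S) -> Prop :=
| sw_refl : sw p p
| sw_step q r : sw p q -> sw1 q r -> sw p r.

Lemma sw1_sym p q : sw1 p q -> sw1 q p.
Proof. by case=> A B e x e' x' /sq_sym h; constructor. Qed.

Lemma sw_trans q p r : sw p q -> sw q r -> sw p r.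
Proof. by move=> h; elim=> // a b _ IH h'; exact: sw_step IH h'. Qed.

Lemma sw1_sw p q : sw1 p q -> sw p q.
Proof. exact: sw_step (sw_refl p). Qed.

Lemma sw_sym p q : sw p q -> sw q p.
Proof.
elim=> [|a b _ IH h]; first exact: sw_refl.
exact: sw_trans (sw1_sw (sw1_sym h)) IH.
Qed.

Lemma sw1_ctx A B p q : sw1 p q -> sw1 (A ++ p ++ B) (A ++ q ++ B).
Proof.
case=> C D e x e' x' h; rewrite -!catA !cat_cons !(catA A).
exact: Sw1.
Qed.

Lemma sw_ctx A B p q : sw p q -> sw (A ++ p ++ B) (A ++ q ++ B).
Proof.
by elim=> [|a b _ IH h]; [exact: sw_refl|exact: sw_step IH (sw1_ctx A B h)].
Qed.

Lemma sw_catl A p q : sw p q -> sw (A ++ p) (A ++ q).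
Proof. by move/(sw_ctx A [::]); rewrite !cats0. Qed.

Lemma sw_catr B p q : sw p q -> sw (p ++ B) (q ++ B).
Proof. exact: (@sw_ctx [::]). Qed.

Lemma sw_cons e p q : sw p q -> sw (e :: p) (e :: q).
Proof. exact: (@sw_catl [:: e]). Qed.

Lemma sw_size p q : sw p q -> size p = size q.
Proof. by elim=> // a b _ -> [A B e x e' x' _]; rewrite !size_cat. Qed.

Lemma sw1_path u v p q : sw1 p q -> ispath u p v -> ispath u q v.
Proof.
case=> A B e x e' x' h /ispath_cat[w hA /= [he [hx hB]]].
apply/ispath_cat; exists w => //=.
by rewrite -(sq_src h) (sq_mid2 h) (sq_tgt h).
Qed.

Lemma sw_path u v p q : sw p q -> ispath u p v -> ispath u q v.
Proof. by move=> + h; elim=> // a b _ IH h'; exact: sw1_path h' IH. Qed.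

Lemma sw1_rev p q : sw1 p q -> sw1 (revp p) (revp q).
Proof.
case=> A B e x e' x' h; rewrite !revp_cat !revp_cons -!catA /=.
by apply: Sw1; apply: sq_sym; apply: sq_far.
Qed.

Lemma sw_rev p q : sw p q -> sw (revp p) (revp q).
Proof.
by elim=> [|a b _ IH h]; [exact: sw_refl|exact: sw_step IH (sw1_rev h)].
Qed.

(** A ladder of squares: [e] slides along the rail [A] and arrives as [f], the opposite rail being
    [A']. Ladders carry an edge along its hyperplane. *)
Inductive pass : edg S -> seq (edg S) -> edg S -> seq (edg S) -> Prop :=
| pass0 e : pass e [::] e [::]
| passS e x e' x' B f B' : sq e x e' x' -> pass e' B f B' ->
    pass e (x' :: B) f (x :: B').

Lemma pass0_inv e f B' : pass e [::] f B' -> f = e /\ B' = [::].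
Proof. by move=> h; inversion h. Qed.

Lemma passS_inv e y B f C : pass e (y :: B) f C ->
  exists x e' B', [/\ C = x :: B', sq e x e' y & pass e' B f B'].
Proof. by move=> h; inversion h; subst; exists x, e', B'. Qed.

Lemma pass1 e x e' x' : sq e x e' x' -> pass e [:: x'] e' [:: x].
Proof. by move=> h; apply: passS h _; exact: pass0. Qed.

Lemma pass_cat e A f A' B g B' :
  pass e A f A' -> pass f B g B' -> pass e (A ++ B) g (A' ++ B').
Proof. by elim=> //= {}e x e' x' C f' C' h _ IH /IH; exact: passS. Qed.

Lemma pass_cat_inv e A B g C : pass e (A ++ B) g C ->
  exists f A' B', [/\ C = A' ++ B', pass e A f A' & pass f B g B'].
Proof.
elim: A e C => [|y A IH] e C /=.
  by move=> h; exists e, [::], C; split=> //; exact: pass0.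
move=> /passS_inv[x [e' [B' [-> hs /IH[f [A' [B'' [-> h1 h2]]]]]]]].
by exists f, (x :: A'), B''; split=> //; exact: passS h1.
Qed.

Lemma pass_det e A f A' g A'' : pass e A f A' -> pass e A g A'' ->
  f = g /\ A' = A''.
Proof.
move=> h; elim: h g A'' => [e0|e0 x e' x' B f0 B' hs _ IH] g A''.
  by case/pass0_inv=> -> ->.
case/passS_inv=> y [e'' [C [-> hs' h']]].
by case: (sq_detw hs hs') h' => -> <- /IH[-> ->].
Qed.

Lemma pass_opp e A f A' : pass e A f A' -> pass (opp e) A' (opp f) A.
Proof.
by elim=> [?|{}e x e' x' C f' C' /sq_rot h _ IH]; [exact: pass0|exact: passS h IH].
Qed.

Lemma pass_rev e A f A' : pass e A f A' -> pass f (revp A) e (revp A').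
Proof.
elim=> [?|{}e x e' x' C f' C' h _ IH]; first exact: pass0.
rewrite !revp_cons; apply: pass_cat IH (pass1 _).
exact: sq_rot2 h.
Qed.

Lemma pass_sw e A f A' : pass e A f A' -> sw (e :: A) (A' ++ [:: f]).
Proof.
elim=> [?|{}e x e' x' C f' C' h _ IH] /=; first exact: sw_refl.
apply: sw_trans (sw1_sw (Sw1 [::] C h)) _; exact: sw_cons.
Qed.

Lemma pass_path e A f A' : pass e A f A' ->
  ispath (tgt e) A (tgt f) /\ ispath (src e) A' (src f).
Proof.
elim=> [//|{}e x e' x' C f' C' h _ [h1 h2]] /=.
by rewrite (sq_mid h) (sq_src h) -(sq_tgt h) -(sq_mid2 h).
Qed.

(* The three faces meeting at the middle vertex of the swapped pair span a cube. *)
Lemma pass_sw1 e A f A' B : pass e A f A' -> sw1 A B ->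
  exists B', pass e B f B' /\ sw1 A' B'.
Proof.
move=> hp hs; case: hs hp => A0 A1 a b a' b' hs.
move=> /pass_cat_inv[e0 [A0' [C0 [-> hA0]]]].
move=> /passS_inv[a0 [e1 [C1 [-> h1]]]] /passS_inv[c [e2 [A1' [-> h2 hA1]]]].
have k1 := sq_rot h2.
have k2 : sq (opp e1) (opp a) (opp e0) (opp a0) by exact: sq_far h1.
have k3 := sq_rot hs.
have [e3 [x3 [y3 [m1 m2 m3]]]] := sq_cube k2 k1 k3.
have n1 : sq e0 y3 (opp e3) b by apply: sq_rotK; rewrite oppK.
have n2 : sq (opp e3) (opp x3) e2 a'.
  apply: sq_sym; have := sq_rot (sq_sym (sq_rot m2)).
  by rewrite !oppK.
exists (A0' ++ y3 :: opp x3 :: A1'); split.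
  by apply: pass_cat hA0 (passS n1 (passS n2 hA1)).
by apply: Sw1; apply: sq_rotK; rewrite oppK.
Qed.

(** One letter of [w] can be slid to the end and arrives there as [a]. A concrete ladder is used,
    not swap classes, so that the effect of a single swap can be checked by cases. *)
Definition last_letter (w : seq (edg S)) a w1 :=
  exists A f B B', [/\ w = A ++ f :: B, pass f B a B' & w1 = A ++ B'].

Lemma last_letter0 w a : last_letter (w ++ [:: a]) a w.
Proof. exists w, a, [::], [::]; split; rewrite ?cats0 //; exact: pass0. Qed.

(** The cases are the positions of the swapped pair relative to the sliding letter. Only a pair
    behind that letter needs the cube axiom, through [pass_sw1]; a pair containing it is handled by
    uniqueness of squares. *)
Lemma last_letter_sw1 w w2 a w1 : sw1 w w2 -> last_letter w a w1 ->
  exists2 w1', last_letter w2 a w1' & sw w1 w1'.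
Proof.
case=> A0 B0 e x e' x' hs [A [f [B [B' [hw hp ->]]]]].
case: (cat_cons2_inv hw).
- move=> [C [hA hB0]]; exists ((A0 ++ x :: e' :: C) ++ B').
    by exists (A0 ++ x :: e' :: C), f, B, B'; rewrite hB0 -!catA.
  by rewrite hA -!catA; apply: sw1_sw; exact: Sw1.
- move=> [hA hf hB]; subst A f B; exists (A0 ++ e :: B'); last first.
    by rewrite -catA; exact: sw_refl.
  exists A0, x, (e' :: B0), (e :: B'); split => //.
  by apply: passS hp; exact: sq_sym.
- move=> [hA hf hB]; subst A f B.
  case/passS_inv: hp => x0 [e'0 [B'0 [-> hs' hp]]].
  have [? ?] := sq_detw hs hs'; subst x0 e'0.
  exists ((A0 ++ [:: x]) ++ B'0); last by rewrite -catA; exact: sw_refl.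
  by exists (A0 ++ [:: x]), e', B0, B'0; rewrite -!catA.
- move=> [C [hA hB]]; subst A0 B.
  have [B2 [h1 h2]] := pass_sw1 hp (Sw1 C B0 hs).
  exists (A ++ B2); last by apply: sw_catl; exact: sw1_sw.
  by exists A, f, (C ++ x :: e' :: B0), B2; rewrite -!catA.
Qed.

Lemma last_letter_swap w w2 a w1 : sw w w2 -> last_letter w a w1 ->
  exists2 w1', last_letter w2 a w1' & sw w1 w1'.
Proof.
move=> h hl; elim: h => [|q r _ [w' hl' hs'] h1]; first by exists w1 => //; exact: sw_refl.
have [w3 h3 h4] := last_letter_sw1 h1 hl'.
by exists w3 => //; exact: sw_trans hs' h4.
Qed.

(* Two edges ending at the start of B and spanning a square stay so along B. *)
Lemma pass_square f g f0 g0 B a B1 b B2 :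
  sq g0 f0 g f -> pass f B a B1 -> pass g B b B2 ->
  exists a0 b0 B3, [/\ sq b0 a0 b a, pass f0 B2 a0 B3 & pass g0 B1 b0 B3].
Proof.
move=> hs hf; elim: hf g f0 g0 b B2 hs => [e|e x e' x' C f' C' h _ IH] g f0 g0 b B2 hs.
  case/pass0_inv=> -> ->; exists f0, g0, [::]; split=> //; exact: pass0.
case/passS_inv=> y [g1 [D [-> hg hD]]].
have k1 := sq_far hs; have k2 := sq_rot hg; have k3 := sq_rot h.
have [e3 [x3 [y3 [m1 m2 m3]]]] := sq_cube k1 k2 k3.
have n1 : sq g0 y3 (opp e3) x by apply: sq_rotK; rewrite oppK.
have n3 : sq f0 y3 (opp x3) y by apply: sq_rotK; rewrite oppK.
have n2 : sq (opp e3) (opp x3) g1 e'.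
  apply: sq_sym; have := sq_rot (sq_sym (sq_rot m2)).
  by rewrite !oppK.
have [a0 [b0 [B3 [p1 p2 p3]]]] := IH _ _ _ _ _ n2 hD.
by exists a0, b0, (y3 :: B3); split=> //; [exact: passS n3 p2|exact: passS n1 p3].
Qed.

Lemma last_letter_two w a w1 b w2 :
  last_letter w a w1 -> last_letter w b w2 ->
  (a = b /\ w1 = w2) \/
  exists w3 a0 b0, [/\ sq b0 a0 b a, sw w1 (w3 ++ [:: b0]) & sw w2 (w3 ++ [:: a0])].
Proof.
have key A f B1 g B2 C1 a' C2 b' : pass f (B1 ++ g :: B2) a' C1 -> pass g B2 b' C2 ->
    exists w3 a0 b0, [/\ sq b0 a0 b' a', sw (A ++ C1) (w3 ++ [:: b0])
      & sw (A ++ f :: B1 ++ C2) (w3 ++ [:: a0])].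
  case/pass_cat_inv=> f1 [B1' [D [-> h1]]] /passS_inv[g0 [f2 [B2' [-> hs h2]]]] h3.
  have [a0 [b0 [B3 [k1 k2 k3]]]] := pass_square (sq_sym hs) h2 h3.
  exists (A ++ B1' ++ B3), a0, b0; split => //.
    by rewrite -!catA; do 2!apply: sw_catl; exact: pass_sw k3.
  rewrite -!catA; apply: sw_catl; rewrite -cat_cons.
  apply: (@sw_trans ((B1' ++ [:: f1]) ++ C2)); first by apply: sw_catr; exact: pass_sw.
  by rewrite -catA; apply: sw_catl; exact: pass_sw k2.
move=> [A [f [B [B' [-> hp ->]]]]] [A2 [g [D [D' [hw hq ->]]]]].
have: [\/ exists C, A2 = A ++ f :: C /\ B = C ++ g :: D, [/\ A = A2, f = g & B = D] |
          exists C, A = A2 ++ g :: C /\ D = C ++ f :: B].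
  elim: A A2 hw => [|c A IH] [|d A2] /=.
  - by case=> -> ->; apply: Or32.
  - by case=> <- ->; apply: Or31; exists A2.
  - by case=> <- <-; apply: Or33; exists A.
  - case=> <- /IH[[C [-> ->]]|[-> -> ->]|[C [-> ->]]].
    + by apply: Or31; exists C.
    + exact: Or32.
    + by apply: Or33; exists C.
case=> [[C [? ?]]|[? ? ?]|[C [? ?]]]; subst.
- right; have [w3 [a0 [b0 [h1 h2 h3]]]] := key A _ _ _ _ _ _ _ _ hp hq.
  by exists w3, a0, b0; rewrite -catA.
- by left; have [-> ->] := pass_det hp hq.
- right; have [w3 [a0 [b0 [h1 h2 h3]]]] := key A2 _ _ _ _ _ _ _ _ hq hp.
  exists w3, b0, a0; rewrite -catA; split=> //; exact: sq_sym.
Qed.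

(** Both last letters are carried by swaps to one word; there one of them slides past the other,
    which forces a square at the end. This exchange property plays the part of a confluence argument
    for the reduction of words. *)
Lemma sw_last2 w w1 a w2 b : sw w (w1 ++ [:: a]) -> sw w (w2 ++ [:: b]) ->
  (a = b /\ sw w1 w2) \/
  exists w3 a0 b0, [/\ sq b0 a0 b a, sw w1 (w3 ++ [:: b0]) & sw w2 (w3 ++ [:: a0])].
Proof.
move=> h1 h2; have [w1' l1 s1] := last_letter_swap (sw_sym h1) (last_letter0 w1 a).
have [w2' l2 s2] := last_letter_swap (sw_sym h2) (last_letter0 w2 b).
case: (last_letter_two l1 l2) => [[-> e12]|[w3 [a0 [b0 [k1 k2 k3]]]]].
  by left; split=> //; apply: sw_trans s1 _; rewrite e12; exact: sw_sym.
by right; exists w3, a0, b0; split=> //; [exact: sw_trans s1 k2|exact: sw_trans s2 k3].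
Qed.

Definition reduced (p : seq (edg S)) :=
  forall q A e B, sw p q -> q <> A ++ e :: opp e :: B.

Lemma reduced_sw p q : sw p q -> reduced p -> reduced q.
Proof. by move=> h hp r A e B hr; apply: hp; exact: sw_trans h hr. Qed.

Lemma reduced_sub A p B : reduced (A ++ p ++ B) -> reduced p.
Proof.
move=> h q C e D /(sw_ctx A B) hs hq; apply: (h _ (A ++ C) e (D ++ B) hs).
by rewrite hq -!catA.
Qed.

Lemma reduced_nil : reduced [::].
Proof. by move=> q A e B /sw_size h hq; move: h; rewrite hq size_cat /= addnS. Qed.

Lemma reduced_rev p : reduced p -> reduced (revp p).
Proof.
move=> h q A e B /sw_rev; rewrite revpK => hs hq.
apply: (h _ (revp B) e (revp A) hs).
by rewrite hq revp_cat !revp_cons -!catA /= oppK.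
Qed.

Lemma pass_opp_head e B f C : ~ pass e (opp e :: B) f C.
Proof.
move=> /passS_inv[x [e' [_ [_ h _]]]]; exact: (sq_irr (sq_rot h)).
Qed.

(** Suppose that a cancelling pair shows up after swaps, and follow the letter [e]. If it belongs to
    the pair, [w] could end in [opp e]. Otherwise the pair is already visible in a word for [w]: a
    letter sliding through [x], [opp x] leaves a cancelling pair behind. *)
Lemma reduced_rcons w e : reduced w ->
  ~ (exists w1, sw w (w1 ++ [:: opp e])) -> reduced (w ++ [:: e]).
Proof.
move=> hw hn q A x B hs hq; subst q.
have [w' [C [f [D [D' [h1 h2 h3]]]]] hsw] := last_letter_swap hs (last_letter0 w e).
subst w'; case: (cat_cons2_inv h1).
- move=> [G [hC hB]]; subst C B; apply: (hw _ A x (G ++ D') hsw).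
  by rewrite -catA.
- move=> [hC hf hD]; subst C f D; apply: hn; exists (A ++ B).
  apply: sw_trans hsw _; rewrite -!catA; apply: sw_catl.
  by apply: pass_sw; rewrite -(oppK x); exact: pass_opp.
- by move=> [hC hf hD]; subst C f D; exact: pass_opp_head h2.
- move=> [G [hA hD]]; subst A D.
  case/pass_cat_inv: h2 => f1 [G' [E [hE hG]]].
  move=> /passS_inv[y [f2 [E2 [hE2 k1]]]] /passS_inv[y' [f3 [E3 [hE3 k2 k3]]]].
  subst D' E E2.
  have hy : y' = opp y.
    by have [-> _] := sq_detw k2 (sq_rot2 k1).
  apply: (hw _ (C ++ G') y E3 hsw); by rewrite hy -catA.
Qed.

Definition cls p : set (seq (edg S)) := [set q | sw p q].

Lemma cls_eq p q : sw p q -> cls p = cls q.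
Proof.
move=> h; apply/seteqP; split=> r hr; first exact: sw_trans (sw_sym h) hr.
exact: sw_trans h hr.
Qed.

Lemma cls_inv p q : cls p = cls q -> sw p q.
Proof. by move=> h; have : cls q q by [exact: sw_refl]; rewrite -h. Qed.

(** Right multiplication by a letter, with cancellation. It is given on sets of words, without a
    choice of representative, so that classes can be the points of a fibre. *)
Definition act (C : set (seq (edg S))) e : set (seq (edg S)) :=
  [set r | exists w, C w /\
    ((exists w1, sw w (w1 ++ [:: opp e]) /\ sw w1 r) \/
     (~ (exists w1, sw w (w1 ++ [:: opp e])) /\ sw (w ++ [:: e]) r))].

Lemma act_cancel w w1 e : sw w (w1 ++ [:: opp e]) -> act (cls w) e = cls w1.
Proof.
move=> h; apply/seteqP; split=> r.
  move=> [w' [hw' [[w1' [h1 h2]]|[hn _]]]]; last first.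
    by exfalso; apply: hn; exists w1; exact: sw_trans (sw_sym hw') h.
  case: (sw_last2 (sw_trans (sw_sym hw') h) h1) => [[_ h3]|[w3 [a0 [b0 [h3 _ _]]]]].
    exact: sw_trans h3 h2.
  by case: (sq_irr (sq_far h3)).
move=> hr; exists w; split; first exact: sw_refl.
by left; exists w1.
Qed.

Lemma act_ext w e : ~ (exists w1, sw w (w1 ++ [:: opp e])) ->
  act (cls w) e = cls (w ++ [:: e]).
Proof.
move=> h; apply/seteqP; split=> r.
  move=> [w' [hw' [[w1 [h1 _]]|[_ h2]]]].
    by exfalso; apply: h; exists w1; exact: sw_trans hw' h1.
  by apply: sw_trans h2; exact: sw_catr.
move=> hr; exists w; split; first exact: sw_refl.
by right.
Qed.

(** The fibre over [v] of the covering made of reduced words from [o]; [act] is its transport along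
    an edge. *)
Definition fib o v (C : set (seq (edg S))) :=
  exists w, [/\ ispath o w v, reduced w & C = cls w].

Lemma act_fib o e C : fib o (src e) C -> fib o (tgt e) (act C e).
Proof.
move=> [w [h1 h2 ->]].
have [[w1 hw]|hn] := pselect (exists w1, sw w (w1 ++ [:: opp e])).
  exists w1; split; last exact: act_cancel.
    by have /ispath_rcons[h _] := sw_path hw h1; rewrite src_opp in h.
  by apply: (@reduced_sub [::] _ [:: opp e]); exact: reduced_sw h2.
exists (w ++ [:: e]); split; first exact/ispath_rcons.
  exact: reduced_rcons.
exact: act_ext.
Qed.

Lemma act_opp o e C : fib o (src e) C -> act (act C e) (opp e) = C.
Proof.
move=> [w [h1 h2 ->]].
have [[w1 hw]|hn] := pselect (exists w1, sw w (w1 ++ [:: opp e])); last first.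
  rewrite act_ext //; apply: act_cancel; rewrite oppK; exact: sw_refl.
rewrite (act_cancel hw) act_ext; first exact/esym/cls_eq.
move=> [w2 hw2]; rewrite oppK in hw2.
apply: (h2 _ w2 e [::] (sw_trans hw (sw_catr [:: opp e] hw2))).
by rewrite -catA.
Qed.

(** The transport has no monodromy around a square. Both letters, one of them, or none may cancel;
    when both [opp e] and [opp x] can come last, [sw_last2] shows that the word ends with the two
    far sides of a square and both cancel. *)
Lemma act_sq o e x e' x' C : sq e x e' x' -> fib o (src e) C ->
  act (act C e) x' = act (act C x) e'.
Proof.
move=> hs [w [h1 h2 ->]].
have half a y a' y' w1 : sq a y a' y' -> sw w (w1 ++ [:: opp a]) ->
    ~ (exists w1, sw w (w1 ++ [:: opp y])) ->
    act (act (cls w) a) y' = act (act (cls w) y) a'.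
  move=> {}hs hw hn; rewrite (act_cancel hw) (act_ext hn) act_ext.
    symmetry; apply: act_cancel; apply: sw_trans (sw_catr [:: y] hw) _.
    rewrite -!catA; apply: sw_catl; apply: sw1_sw; apply: (Sw1 [::] [::]).
    exact: sq_rot.
  move=> [w2 hw2]; apply: hn; exists (w2 ++ [:: opp a']).
  apply: sw_trans hw _; apply: sw_trans (sw_catr _ hw2) _; rewrite -!catA.
  apply: sw_catl; apply: sw1_sw; apply: (Sw1 [::] [::]).
  exact: sq_sym (sq_far hs).
have ne a y a' y' : sq a y a' y' -> ~ (exists w1, sw w (w1 ++ [:: opp a])) ->
    ~ (exists w1, sw w (w1 ++ [:: opp y])) ->
    act (act (cls w) a) y' = cls (w ++ [:: a] ++ [:: y']).
  move=> {}hs na ny; rewrite (act_ext na) act_ext -?catA // => -[w2 hw2].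
  case: (sw_last2 (sw_refl _) hw2) => [[h _]|[w3 [a0 [b0 [k1 k2 k3]]]]].
    by move: (sq_rot hs); rewrite h oppK; exact: sq_irr.
  apply: ny; exists w3; apply: sw_trans k2 _.
  suff -> : b0 = opp y by exact: sw_refl.
  have := sq_far k1; rewrite oppK => k1'.
  by have [/(congr1 (@opp S)) + _] := sq_det k1' (sq_sym (sq_rot hs)); rewrite oppK.
have [[w1 ha]|na] := pselect (exists w1, sw w (w1 ++ [:: opp e])).
  have [[w2 hy]|ny] := pselect (exists w1, sw w (w1 ++ [:: opp x])); last exact: (half _ _ _ _ w1 hs ha ny).
  case: (sw_last2 ha hy) => [[h _]|[w3 [a0 [b0 [k1 k2 k3]]]]].
    have h' : e = x by rewrite -(oppK e) h oppK.
    by move: hs; rewrite h' => /sq_irr.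
  have := sq_far k1; rewrite !oppK => k1'.
  have [h1' h2'] := sq_det k1' (sq_sym hs).
  rewrite (act_cancel ha) (act_cancel hy) (@act_cancel _ w3) -?h1' ?oppK //.
  by rewrite (@act_cancel _ w3) // -h2' oppK.
have [[w2 hy]|ny] := pselect (exists w1, sw w (w1 ++ [:: opp x])).
  by symmetry; exact: (half _ _ _ _ w2 (sq_sym hs) hy na).
rewrite (ne _ _ _ _ hs) // (ne _ _ _ _ (sq_sym hs)) //.
apply: cls_eq; apply: sw_catl; apply: sw1_sw; exact: (Sw1 [::] [::]).
Qed.

End Words.

(** * Halfspaces *)

Lemma in_split (T : Type) (x : T) (s : seq T) : List.In x s ->
  exists A B, s = A ++ x :: B.
Proof.
elim: s => //= y s IH [->|/IH[A [B ->]]]; first by exists [::], s.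
by exists (y :: A), B.
Qed.

Lemma in_cat_cons (T : Type) (x : T) A B : List.In x (A ++ x :: B).
Proof. by elim: A => [|y A IH] /=; [left|right]. Qed.

Lemma in_mapP (T U : Type) (f : T -> U) s y :
  List.In y (map f s) <-> exists2 x, List.In x s & f x = y.
Proof.
elim: s => [|a s IH] /=; first by split=> // -[].
split=> [[h|/IH[x hx hf]]|[x [->|hx] hf]].
- by exists a; [left|].
- by exists x; [right|].
- by left.
- by right; apply/IH; exists x.
Qed.

Definition cross (T : Type) (a b : set T) :=
  [/\ a `&` b !=set0, a `&` ~` b !=set0, ~` a `&` b !=set0 & ~` a `&` ~` b !=set0].

Fixpoint pwcross (T : Type) (s : seq (set T)) : Prop :=
  if s is a :: s' then (forall b, List.In b s' -> cross a b) /\ pwcross s' else True.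

Section Cross.
Variable T : Type.
Implicit Types (a b : set T) (s : seq (set T)).

Lemma cross_sym a b : cross a b -> cross b a.
Proof. by case=> h1 h2 h3 h4; split; rewrite setIC. Qed.

Lemma cross_setCr a b : cross a b -> cross a (~` b).
Proof. by case=> h1 h2 h3 h4; split; rewrite ?setCK. Qed.

Lemma cross_setCl a b : cross a b -> cross (~` a) b.
Proof. by move=> /cross_sym/cross_setCr/cross_sym. Qed.

Lemma cross_irr a : ~ cross a a.
Proof. by case=> _ [x []]. Qed.

Lemma cross_irrC a : ~ cross a (~` a).
Proof. by case=> [[x []]]. Qed.

Lemma ncrossP a b : ~ cross a b ->
  [\/ a `&` b = set0, a `<=` b, b `<=` a | ~` a `<=` b].
Proof.
move=> h; have [/eqP h1|/set0P h1] := boolP (a `&` b == set0); first exact: Or41.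
have [/eqP h2|/set0P h2] := boolP (a `&` ~` b == set0).
  by apply: Or42 => x ax; apply: contrapT => bx; have : set0 x by rewrite -h2.
have [/eqP h3|/set0P h3] := boolP (~` a `&` b == set0).
  by apply: Or43 => x ax; apply: contrapT => bx; have : set0 x by rewrite -h3.
have [/eqP h4|/set0P h4] := boolP (~` a `&` ~` b == set0).
  by apply: Or44 => x ax; apply: contrapT => bx; have : set0 x by rewrite -h4.
by case: h.
Qed.

Lemma pwcross_in s a b : pwcross s -> List.In a s -> List.In b s -> a = b \/ cross a b.
Proof.
elim: s => //= c s IH [h1 h2] [<-|ha] [<-|hb]; first by left.
- by right; exact: h1.
- by right; apply: cross_sym; exact: h1.
- exact: IH.
Qed.

Lemma pwcross_nodup s : pwcross s -> List.NoDup s.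
Proof.
elim: s => [|a s IH] /=; first by constructor.
move=> [h1 /IH h2]; constructor => // /h1; exact: cross_irr.
Qed.

End Cross.

(** [csqc_sc] is the form in which simple connectivity enters: transport around a closed path
    returns the empty class to itself. *)
Record csqc := CSqc {
  csqc_sqc :> sqc;
  csqc_sc : forall (o : vtx csqc_sqc) p, ispath o p o ->
    foldl (@act csqc_sqc) (cls [::]) p = cls [::];
  csqc_conn : forall u v : vtx csqc_sqc, exists p, ispath u p v
}.

Section Walls.
Variable S : csqc.
Let hsc := @csqc_sc S.
Let conn := @csqc_conn S.
Implicit Types (u v : vtx S) (e f x y : edg S) (p q r w A B : seq (edg S)).

Lemma foldl_reduced o p v : ispath o p v -> reduced p ->
  foldl (@act S) (cls [::]) p = cls p.
Proof.
elim/last_ind: p v => [//|p e IH] v; rewrite -cats1 => /ispath_rcons[hp _] hr.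
rewrite foldl_cat (IH _ hp); last exact: (@reduced_sub _ [::] p [:: e]).
rewrite /= act_ext // => -[w1 hw].
apply: (hr _ w1 (opp e) [::] (sw_catr [:: e] hw)).
by rewrite -catA oppK.
Qed.

Lemma foldl_fib o v r v' C : fib o v C -> ispath v r v' ->
  fib o v' (foldl (@act S) C r) /\
  foldl (@act S) (foldl (@act S) C r) (revp r) = C.
Proof.
elim: r v C => [|e r IH] v C hC /=; first by move=> <-.
move=> [he hr]; rewrite -he in hC.
have [h1 h2] := IH _ _ (act_fib hC) hr; split=> //.
by rewrite revp_cons foldl_cat h2 /= (act_opp hC).
Qed.

(** Transport along [p] and then back along [q] returns the empty class; undoing the second half
    shows that transport along [q] leads to the class of [p], while it also leads to the class of
    [q]. *)
Lemma reduced_uniq u v p q : reduced p -> reduced q ->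
  ispath u p v -> ispath u q v -> sw p q.
Proof.
move=> rp rq hp hq; apply: cls_inv.
have hC : fib u v (cls p) by exists p.
have [_ h] := foldl_fib hC (ispath_rev hq).
have h2 : foldl (@act S) (cls [::]) (p ++ revp q) = cls [::].
  by apply: (hsc (o := u)); apply/ispath_cat; exists v => //; exact: ispath_rev.
rewrite foldl_cat (foldl_reduced hp rp) in h2.
by rewrite h2 revpK (foldl_reduced hq rq) in h.
Qed.

Inductive rd p : seq (edg S) -> Prop :=
| rd_refl : rd p p
| rd_sw q r : rd p q -> sw1 q r -> rd p r
| rd_cancel A e B : rd p (A ++ e :: opp e :: B) -> rd p (A ++ B).

Lemma rd_trans q p r : rd p q -> rd q r -> rd p r.
Proof.
move=> h; elim=> // [a b _ h1 h2|A e B _]; first exact: rd_sw h1 h2.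
by move=> h2; exact: rd_cancel h2.
Qed.

Lemma rd_of_sw p q : sw p q -> rd p q.
Proof. by elim=> [|a b _ h1 h2]; [exact: rd_refl|exact: rd_sw h1 h2]. Qed.

Lemma reduce p : exists2 q, rd p q & reduced q.
Proof.
have [n] := ubnP (size p); elim: n p => // n IH p hn.
have [h|/existsNP[q /existsNP[A /existsNP[e /existsNP[B h]]]]] := pselect (reduced p).
  by exists p => //; exact: rd_refl.
have {h} [hs hq] : sw p q /\ q = A ++ e :: opp e :: B.
  by split; apply: contrapT => h'; apply: h.
have hsz : (size (A ++ B) < n)%N.
  move: hn; rewrite (sw_size hs) hq !size_cat /= !addnS ltnS => hn.
  by apply: leq_trans hn; rewrite ltnS.
have [r h1 h2] := IH _ hsz; exists r => //; apply: rd_trans h1.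
by apply: (@rd_cancel _ A e B); rewrite -hq; exact: rd_of_sw.
Qed.

Lemma rd_path u v p q : rd p q -> ispath u p v -> ispath u q v.
Proof.
move=> + h; elim=> // [a b _ IH h'|A e B _]; first exact: sw1_path h' IH.
move=> /ispath_cat[w h1 /= [h2 [_ h3]]]; apply/ispath_cat; exists w => //.
by rewrite -h2 -tgt_opp.
Qed.

Lemma rd_size p q : rd p q -> (size q <= size p)%N.
Proof.
elim=> // [a b _ h /sw1_sw/sw_size <- //|A e B _].
by apply: leq_trans; rewrite !size_cat /= !addnS; apply: leqW.
Qed.

Lemma pass_rd e A f A' B : pass e A f A' -> rd A B -> exists B', pass e B f B'.
Proof.
move=> h; elim=> [|q r _ [B' h1] h2|C g D _ [B' h1]]; first by exists A'.
  by have [B'' [h3 _]] := pass_sw1 h1 h2; exists B''.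
have [f1 [C' [D' [_ h2]]]] := pass_cat_inv h1.
move=> /passS_inv[y [f2 [E2 [_ k1]]]] /passS_inv[y' [f3 [E3 [_ k2 k3]]]].
have [_ hf] := sq_detw k2 (sq_rot2 k1); subst f3.
by exists (C' ++ E3); exact: pass_cat h2 k3.
Qed.

Definition par e f := exists A A', pass e A f A'.

Lemma par_refl e : par e e.
Proof. by exists [::], [::]; exact: pass0. Qed.

Lemma par_trans f e g : par e f -> par f g -> par e g.
Proof.
move=> [A [A' h]] [B [B' h']]; exists (A ++ B), (A' ++ B'); exact: pass_cat h h'.
Qed.

Lemma par_sym e f : par e f -> par f e.
Proof. by move=> [A [A' /pass_rev h]]; exists (revp A), (revp A'). Qed.

Lemma par_opp e f : par e f -> par (opp e) (opp f).
Proof. by move=> [A [A' /pass_opp h]]; exists A', A. Qed.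

Lemma sq_par e x e' x' : sq e x e' x' -> par e e'.
Proof. by move=> h; exists [:: x'], [:: x]; exact: pass1. Qed.

(** A ladder survives swaps and cancellations in its rail, so it can be laid along any reduced path
    with the right ends. *)
Lemma par_ladder e f A : par e f -> reduced A -> ispath (tgt e) A (tgt f) ->
  exists A', pass e A f A'.
Proof.
move=> [L [L' h]] hr hA; have [hL _] := pass_path h.
have [M hM rM] := reduce L; have [M' h1] := pass_rd h hM.
apply: pass_rd h1 _; apply: rd_of_sw.
exact: reduced_uniq rM hr (rd_path hM hL) hA.
Qed.

(** With equal ends the ladder can be laid along the empty path, where it has no square at all.
    Hence a hyperplane neither crosses nor touches itself. *)
Lemma par_tgt e f : par e f -> tgt e = tgt f -> e = f.
Proof.
move=> h ht; have [] := par_ladder h (@reduced_nil S); first by [].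
by move=> A' /pass0_inv[].
Qed.

Lemma par_src e f : par e f -> src e = src f -> e = f.
Proof.
move=> /par_opp/par_tgt; rewrite !tgt_opp => h /h/(congr1 (@opp S)).
by rewrite !oppK.
Qed.

Definition cl e f := par e f \/ par (opp e) f.

Lemma cl_refl e : cl e e. Proof. by left; exact: par_refl. Qed.

Lemma cl_oppl e f : cl (opp e) f <-> cl e f.
Proof. by rewrite /cl oppK; split=> -[]; auto. Qed.

Lemma cl_sym e f : cl e f -> cl f e.
Proof.
case=> /par_sym h; first by left.
by right; rewrite -(oppK e); exact: par_opp.
Qed.

Lemma cl_par e f g : par f g -> cl e f -> cl e g.
Proof. by move=> h [] h'; [left|right]; exact: par_trans h' h. Qed.

Lemma cl_oppr e f : cl e (opp f) <-> cl e f.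
Proof.
have key a b : cl a (opp b) -> cl a b.
  by move=> /cl_sym/cl_oppl/cl_sym.
by split; [exact: key|move=> h; apply: key; rewrite oppK].
Qed.

Lemma sq_ncl e x e' x' : sq e x e' x' -> ~ cl e x.
Proof.
move=> h [h1|h1].
  by have he := par_src h1 (sq_src h); move: h; rewrite he; exact: sq_irr.
have h2 := par_trans h1 (sq_par (sq_sym h)).
have : opp e = x' by apply: par_src h2 _; rewrite src_opp (sq_mid h).
by move=> he; move: (sq_rot h); rewrite he; exact: sq_irr.
Qed.

Definition cnt e p := count (fun f => `[< cl e f >]) p.

Lemma cnt_cat e p q : cnt e (p ++ q) = (cnt e p + cnt e q)%N.
Proof. exact: count_cat. Qed.

Lemma cl_congr e f g : par f g -> `[< cl e f >] = `[< cl e g >].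
Proof.
move=> h; apply/idP/idP => /asboolP h'; apply/asboolP; first exact: cl_par h h'.
exact: cl_par (par_sym h) h'.
Qed.

Lemma cnt_rd e p q : rd p q -> odd (cnt e p) = odd (cnt e q).
Proof.
elim=> // [a b _ -> [A B f x f' x' h]|A f B _ ->].
  rewrite !cnt_cat /cnt /= (cl_congr e (sq_par h)) (cl_congr e (sq_par (sq_sym h))).
  by congr (odd (_ + _)%N); rewrite addnCA.
rewrite !cnt_cat !oddD /cnt /=; congr addb.
have -> : `[< cl e (opp f) >] = `[< cl e f >] by apply: asbool_equiv_eq; exact: cl_oppr.
by rewrite addbA addbb.
Qed.

Lemma cnt_sw e p q : sw p q -> odd (cnt e p) = odd (cnt e q).
Proof. by move/rd_of_sw/cnt_rd. Qed.

Lemma parity e u v p q : ispath u p v -> ispath u q v -> odd (cnt e p) = odd (cnt e q).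
Proof.
move=> hp hq; have [p' dp rp] := reduce p; have [q' dq rq] := reduce q.
rewrite (cnt_rd e dp) (cnt_rd e dq); apply: cnt_sw.
exact: reduced_uniq rp rq (rd_path dp hp) (rd_path dq hq).
Qed.

(** The side of the hyperplane of [e] that contains [tgt e]. Counting crossings modulo 2 makes any
    path usable as a witness, by [parity]. *)
Definition hs e : set (vtx S) :=
  [set v | exists2 p, ispath (tgt e) p v & ~~ odd (cnt e p)].

Lemma hsE e p v : ispath (tgt e) p v -> hs e v <-> ~~ odd (cnt e p).
Proof. by move=> h; split=> [[q hq]|]; [rewrite (parity e h hq)|exists p]. Qed.

Lemma hs_tgt e : hs e (tgt e).
Proof. by exists [::]. Qed.

Lemma cnt1 e f : cl e f -> cnt e [:: f] = 1%N.
Proof. by move=> /asboolP h; rewrite /cnt /= h. Qed.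

Lemma hs_cross e f : cl e f -> hs e (tgt f) <-> ~ hs e (src f).
Proof.
move=> h; have [p hp] := conn (tgt e) (src f).
have hq : ispath (tgt e) (p ++ [:: f]) (tgt f) by apply/ispath_rcons.
rewrite (hsE hp) (hsE hq) cnt_cat cnt1 // addn1 /= negbK.
by case: odd; split.
Qed.

Lemma hs_stay e f : ~ cl e f -> hs e (tgt f) <-> hs e (src f).
Proof.
move=> h; have [p hp] := conn (tgt e) (src f).
have hq : ispath (tgt e) (p ++ [:: f]) (tgt f) by apply/ispath_rcons.
rewrite (hsE hp) (hsE hq) cnt_cat /cnt /=.
by case: asboolP => // _; rewrite !addn0.
Qed.

Lemma hs_src e : ~ hs e (src e).
Proof. by apply/(hs_cross (cl_refl e)); exact: hs_tgt. Qed.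

Lemma cl_trans e f g : cl e f -> cl f g -> cl e g.
Proof.
by move=> h [] h'; [exact: cl_par h' h|apply: cl_par h' _; exact/cl_oppr].
Qed.

Lemma cnt_cl e f p : cl e f -> cnt e p = cnt f p.
Proof.
move=> h; apply: eq_count => g; apply/idP/idP => /asboolP h'; apply/asboolP.
  exact: cl_trans (cl_sym h) h'.
exact: cl_trans h h'.
Qed.

Lemma hs_opp e : hs (opp e) = ~` hs e.
Proof.
have hc : cl e (opp e) by apply/cl_oppr; exact: cl_refl.
apply/seteqP; split=> v; have [p hp] := conn (tgt e) v;
  have hq : ispath (tgt (opp e)) (e :: p) v by rewrite /= tgt_opp.
  rewrite /setC /= (hsE hp) (hsE hq) -(cnt_cl _ hc) -cat1s cnt_cat cnt1 ?cl_refl //=.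
    by rewrite negbK => ->.
  exact: cl_refl.
rewrite /setC /= (hsE hp) (hsE hq) -(cnt_cl _ hc) -cat1s cnt_cat cnt1 /=.
  by move/negP; rewrite negbK.
exact: cl_refl.
Qed.

(** Each edge of the rail of a ladder spans a square with an edge parallel to [e'], so by [sq_ncl]
    it does not cross the hyperplane of [e']. The rail therefore adds nothing to the count. *)
Lemma hs_par e f : par e f -> hs e = hs f.
Proof.
suff key e' f' : par e' f' -> hs f' `<=` hs e'.
  by move=> h; apply/seteqP; split; apply: key => //; exact: par_sym.
move=> h v [p hp hodd]; have [q hq] := conn (tgt e') (tgt f').
have [A hA rA] := reduce q; have pA := rd_path hA hq.
have [A' hA'] := par_ladder h rA pA.
exists (A ++ p); first by apply/ispath_cat; exists (tgt f').
rewrite cnt_cat oddD (cnt_cl p (or_introl h)) (_ : cnt e' A = 0%N) //.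
apply/eqP; rewrite -leqn0 leqNgt -has_count; apply/negP => hh.
have : exists A1 g A2, A = A1 ++ g :: A2 /\ cl e' g.
  elim: (A) hh => //= g B IH /orP[/asboolP hg|/IH[A1 [g' [A2 [-> hg]]]]].
    by exists [::], g, B.
  by exists (g :: A1), g', A2.
move=> [A1 [g [A2 [eA hg]]]]; move: hA'; rewrite eA.
case/pass_cat_inv=> e1 [B1 [B2 [_ k1]]] /passS_inv[g0 [e2 [B3 [_ k2 _]]]].
have h1 : par e' e1 by exists A1, B1.
apply: (sq_ncl k2); apply: cl_trans (cl_sym (or_introl h1)) _.
by apply: cl_par hg; apply: par_sym; exact: sq_par (sq_sym k2).
Qed.

Lemma hs_par_or e f : cl e f -> hs f = hs e \/ hs f = ~` hs e.
Proof.
case=> /hs_par <-; first by left.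
by right; rewrite hs_opp.
Qed.

Lemma hs_neqC e f : hs e = hs f -> hs e = ~` hs f -> False.
Proof.
move=> h1 h2; have := hs_tgt f; rewrite -h1 h2; apply; exact: hs_tgt.
Qed.

Lemma hs_in e f : ~ hs e (src f) -> hs e (tgt f) -> hs f = hs e.
Proof.
move=> h1 h2; have [h|h] := pselect (cl e f); last by move/(hs_stay h): h2.
case: (hs_par_or h) => // hf; case: h1; apply: contrapT => h3.
by apply: (@hs_src f); rewrite hf.
Qed.

Lemma hs_eq_par e f : hs e = hs f -> par e f.
Proof.
move=> h; have [[]|h'] := pselect (cl e f) => //; last first.
  have := hs_tgt f; rewrite -h => /(hs_stay h'); rewrite h.
  by move/(@hs_src f).
by move/hs_par; rewrite hs_opp => h2; case: (hs_neqC (esym h) (esym h2)).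
Qed.

Lemma hs_src_inj e f : src e = src f -> hs e = hs f -> e = f.
Proof. by move=> h1 /hs_eq_par h2; exact: par_src. Qed.

Definition HS (a : set (vtx S)) := exists e, a = hs e.

Lemma HS_hs e : HS (hs e). Proof. by exists e. Qed.

Lemma HSC a : HS a -> HS (~` a).
Proof. by move=> [e ->]; exists (opp e); rewrite hs_opp. Qed.

Lemma HS_neq0 a : HS a -> a !=set0.
Proof. by move=> [e ->]; exists (tgt e); exact: hs_tgt. Qed.

Lemma HS_in a f : HS a -> ~ a (src f) -> a (tgt f) -> hs f = a.
Proof. by move=> [e ->]; exact: hs_in. Qed.

Lemma HS_out a f : HS a -> a (src f) -> ~ a (tgt f) -> hs f = ~` a.
Proof. by move=> ha h1 h2; apply: HS_in => //; exact: HSC. Qed.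

(** After a second crossing of the same hyperplane, a ladder lies along the part of the path between
    the two. If [e] and [f] are parallel, its last square would have two equal sides at a corner; if
    they are antiparallel, [e] slides up to [f] and cancels with it. *)
Lemma red_once e B f C u v : reduced (e :: B ++ f :: C) ->
  ispath u (e :: B ++ f :: C) v -> ~ cl e f.
Proof.
move=> hr [_ /ispath_cat[w h1 /= [h2 _]]] hc; rewrite -{}h2 {w} in h1.
have hr2 : reduced (e :: B ++ [:: f]).
  by apply: (@reduced_sub _ [::] _ C); rewrite /= -catA.
case: hc => hp.
  have hr3 : reduced (B ++ [:: f]).
    by apply: (@reduced_sub _ [:: e] _ [::]); rewrite cats0.
  have [|B'] := par_ladder hp hr3; first exact/ispath_rcons.
  case/pass_cat_inv=> g [B1 [B2 [_ _]]] /passS_inv[x [e' [B3 [_ h3 h4]]]].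
  have [? _] := pass0_inv h4; subst e'.
  by move: (sq_far h3) => /sq_irr.
have hp2 : par e (opp f) by rewrite -(oppK e); exact: par_opp.
have hr3 : reduced B by exact: (@reduced_sub _ [:: e] _ [:: f]).
have [|B' h3] := par_ladder hp2 hr3; first by rewrite tgt_opp.
apply: (hr2 _ B' (opp f) [::] (sw_catr [:: f] (pass_sw h3))).
by rewrite -catA oppK.
Qed.

Lemma cnt_eq0 e p : (forall A f B, p = A ++ f :: B -> ~ cl e f) -> cnt e p = 0%N.
Proof.
elim: p => // f p IH h; rewrite /cnt /= -/(cnt e p) IH ?addn0.
  by case: asboolP => // /(h [::] f p erefl).
by move=> A g B hB; apply: (h (f :: A) g B); rewrite hB.
Qed.

Lemma cnt_gt0 e p : cnt e p <> 0%N -> exists A f B, p = A ++ f :: B /\ cl e f.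
Proof.
move=> h; apply: contrapT => h2; apply: h; apply: cnt_eq0 => A f B hp hc.
by apply: h2; exists A, f, B.
Qed.

Lemma red_sep A f B u v : reduced (A ++ f :: B) -> ispath u (A ++ f :: B) v ->
  ~ hs f u /\ hs f v.
Proof.
move=> hr hp; have := hp => /ispath_cat[w h1 /= [h2 h3]].
have cB : cnt f B = 0%N.
  apply: cnt_eq0 => C g D hB.
  have hr2 : reduced (f :: C ++ g :: D).
    by apply: (@reduced_sub _ A _ [::]); rewrite cats0 -hB.
  by apply: red_once hr2 _; split; [exact: h2|rewrite -hB; exact: h3].
have cA : cnt f A = 0%N.
  apply: cnt_eq0 => C g D hA /cl_sym.
  have hr2 : reduced (g :: D ++ f :: B).
    by apply: (@reduced_sub _ C _ [::]); rewrite cats0; move: hr; rewrite hA -catA.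
  move: hp; rewrite hA -catA => /ispath_cat[w' _ hp'].
  exact: red_once hr2 hp'.
split; last by apply/(hsE h3); rewrite cB.
have hq : ispath (tgt f) (opp f :: revp A) u.
  by rewrite /= src_opp tgt_opp h2; split=> //; exact: ispath_rev.
rewrite (hsE hq) -cat1s cnt_cat cnt1; last by apply/cl_oppr; exact: cl_refl.
rewrite oddD /= (_ : cnt f (revp A) = 0%N) //.
apply: cnt_eq0 => C g D hA hg.
have : exists C' D', A = C' ++ opp g :: D'.
  exists (revp D), (revp C); rewrite -(revpK A) hA revp_cat revp_cons.
  by rewrite -catA.
move=> [C' [D' hA']]; move: cA; rewrite hA' cnt_cat -cat1s cnt_cat cnt1 ?addn1 ?addnS //.
exact/cl_oppr.
Qed.

Lemma geo u v : exists2 p, ispath u p v & reduced p.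
Proof.
by have [p hp] := conn u v; have [q h1 h2] := reduce p; exists q => //; exact: rd_path hp.
Qed.

Definition dist u v : nat := size (projT1 (cid2 (geo u v))).

Lemma distE u p v : ispath u p v -> reduced p -> dist u v = size p.
Proof.
rewrite /dist; case: cid2 => q h1 h2 /= h3 h4.
exact: sw_size (reduced_uniq h2 h4 h1 h3).
Qed.

Lemma dist_le_size u p v : ispath u p v -> (dist u v <= size p)%N.
Proof.
move=> h; have [q h1 h2] := reduce p.
by rewrite (distE (rd_path h1 h) h2); exact: rd_size.
Qed.

Lemma dist_triangle u v v' : (dist u v' <= dist u v + dist v v')%N.
Proof.
have [p h1 h2] := geo u v; have [q h3 h4] := geo v v'.
rewrite (distE h1 h2) (distE h3 h4) -size_cat; apply: dist_le_size.
by apply/ispath_cat; exists v.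
Qed.

Lemma distC u v : dist u v = dist v u.
Proof.
have [p h1 h2] := geo u v; rewrite (distE h1 h2).
rewrite (distE (ispath_rev h1) (reduced_rev h2)).
by rewrite /revp size_rev size_map.
Qed.

Lemma dist0 u v : dist u v = 0%N -> u = v.
Proof. by have [p h1 h2] := geo u v; rewrite (distE h1 h2); case: p h1 {h2}. Qed.

Lemma distxx u : dist u u = 0%N.
Proof. exact: (distE (p := [::]) erefl (@reduced_nil S)). Qed.

Lemma dist_edge e : dist (src e) (tgt e) = 1%N.
Proof.
apply/eqP; rewrite eqn_leq (@dist_le_size _ [:: e]) //= lt0n; apply/eqP => /dist0 h.
by apply: (@hs_src e); rewrite h; exact: hs_tgt.
Qed.

(** A reduced path from [src e] into the halfspace crosses the hyperplane at some edge parallel to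
    [e]; sliding this edge back along the ladder brings it to the front as [e]. *)
Lemma starts e v : hs e v -> exists2 p, reduced (e :: p) & ispath (tgt e) p v.
Proof.
move=> he; have [q h1 h2] := geo (src e) v.
have h3 : ispath (tgt e) (opp e :: q) v by rewrite /= src_opp tgt_opp.
have [|A [f [B [hq hc]]]] := @cnt_gt0 e q.
  move=> h0; move/(hsE h3): he; rewrite -cat1s cnt_cat h0 addn0 cnt1 //.
  by apply/cl_oppr; exact: cl_refl.
rewrite hq in h1 h2; have [s1 s2] := red_sep h2 h1.
have hf : hs f = hs e.
  by case: (hs_par_or hc) => // hf; move: s2; rewrite hf => /(_ he).
have hp : par (opp e) (opp f) by apply: par_opp; exact: hs_eq_par.
have rA : reduced A by exact: (@reduced_sub _ [::] _ (f :: B)).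
have [w h4 /= [h5 h6]] := (ispath_cat _ _ _ _).1 h1.
have [|A' /pass_opp hA] := par_ladder hp rA; first by rewrite !tgt_opp h5.
rewrite !oppK in hA; have hs1 : sw (A ++ f :: B) (e :: A' ++ B).
  apply: (@sw_trans _ ((A ++ [:: f]) ++ B)); first by rewrite -catA; exact: sw_refl.
  by rewrite -cat_cons; apply: sw_catr; apply: sw_sym; exact: pass_sw.
exists (A' ++ B); first exact: reduced_sw hs1 h2.
by have [] := sw_path hs1 h1.
Qed.

Lemma dist_start e v : hs e v -> dist (src e) v = (dist (tgt e) v).+1.
Proof.
move=> /starts[p h1 h2]; rewrite (@distE _ (e :: p)) // (@distE _ p) //.
by apply: (@reduced_sub _ [:: e] _ [::]); rewrite cats0.
Qed.

(** By [starts] there are two reduced paths to [v], beginning with [e] and with [x]. They are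
    equivalent under swaps, and [sw_last2] applied to their reverses gives the square. *)
Lemma adj_sq e x v : src e = src x -> e <> x -> hs e v -> hs x v ->
  exists e' x', sq e x e' x'.
Proof.
move=> hs0 hne /starts[p h1 h2] /starts[q h3 h4].
have hw : sw (e :: p) (x :: q) by apply: (@reduced_uniq (src e) v).
have h5 := sw_rev hw; rewrite !revp_cons in h5.
case: (sw_last2 (sw_refl _) h5) => [[h _]|[w3 [a0 [b0 [h _ _]]]]].
  by case: hne; rewrite -(oppK e) h oppK.
by exists (opp a0), (opp b0); apply: sq_sym; have := sq_far h; rewrite !oppK.
Qed.

Lemma adj_disj e x : src e = src x -> e <> x ->
  ~ (exists e' x', sq e x e' x') -> hs e `<=` ~` hs x.
Proof. by move=> h1 h2 h3 v h4 h5; apply: h3; exact: adj_sq h4 h5. Qed.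

Lemma sq_cross e x e' x' : sq e x e' x' -> cross (hs e) (hs x).
Proof.
move=> h; have n1 := sq_ncl h; have n2 : ~ cl x e by move/cl_sym.
have n3 : ~ cl x e' by move=> h'; apply: n2; exact: cl_par (par_sym (sq_par h)) h'.
split.
- exists (tgt e'); split.
    by rewrite (hs_par (sq_par h)); exact: hs_tgt.
  by rewrite (sq_tgt h) (hs_par (sq_par (sq_sym h))); exact: hs_tgt.
- exists (tgt e); split; first exact: hs_tgt.
  by move/(hs_stay n2); rewrite (sq_src h); exact: hs_src.
- exists (tgt x); split; last exact: hs_tgt.
  by move/(hs_stay n1); rewrite -(sq_src h); exact: hs_src.
- exists (src e); split; first exact: hs_src.
  by rewrite (sq_src h); exact: hs_src.
Qed.

(** Induction on the distance from [u] to [a]. Let [f1] be a first step and [f2] the edge found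
    after it. Either [opp f1] and [f2] span a square, and the parallel copy of [f2] at [u] serves,
    or their halfspaces are disjoint, and then that of [f1] contains that of [f2]. *)
Lemma HS_step a u : HS a -> ~ a u -> exists f, src f = u /\ a `<=` hs f.
Proof.
move=> ha; pose D u n := exists p t, [/\ ispath u p t, a t & size p = n].
suff key n u' : D u' n -> (forall m, (m < n)%N -> ~ D u' m) -> (0 < n)%N ->
    exists f p t, [/\ src f = u', a `<=` hs f, ispath (tgt f) p t, a t & (size p).+1 = n].
  move=> hu; have [t at_] := HS_neq0 ha; have [p hp] := conn u t.
  have hD : exists n, `[< D u n >] by exists (size p); apply/asboolP; exists p, t.
  case: (ex_minnP hD) => n /asboolP hn hmin.
  have [||f [p' [t' [h1 h2 _ _ _]]]] := key n u hn; last by exists f.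
    by move=> m hm /asboolP /hmin; rewrite leqNgt hm.
  case: n hn {hmin} => // -[p' [t' [h1 h2 h3]]]; case: p' h1 h3 => //= h1 _.
  by rewrite h1 in hu.
elim: n u' => // n IH u' [[|f1 p] [t [hp at_ hsz]]] hmin _ //=; case: hsz => hsz.
have [hu hp'] := hp.
have nau : ~ a u' by move=> h; apply: (hmin 0%N) => //; exists [::], u'.
case: n IH hmin hsz => [|n] IH hmin hsz.
  case: p hp hp' hsz => // hp ht _; exists f1, [::], t; split=> //.
  by rewrite (@HS_in a f1) // ?hu //=; rewrite /= in ht; rewrite ht.
have hD : D (tgt f1) n.+1 by exists p, t.
have [|//|f2 [p2 [t2 [k1 k2 k3 k4 k5]]]] := IH _ hD.
  move=> m hm [q [t' [h1 h2 h3]]]; apply: (hmin m.+1) => //.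
  by exists (f1 :: q), t'; rewrite /= h3.
have [[e' [x' hq]]|hn] := pselect (exists e' x', sq (opp f1) f2 e' x').
  have := hq; rewrite -(oppK e') => /sq_rotK hq2.
  exists x', (opp e' :: p2), t2; split=> //.
  - by rewrite -hu (sq_src hq2).
  - by rewrite (hs_par (sq_par (sq_sym hq2))).
  - rewrite /= -(sq_mid2 hq2); split=> //.
    by rewrite (sq_tgt hq2).
  - by rewrite /= k5.
have hne : opp f1 <> f2.
  move=> h; apply: (hmin n); first by rewrite leqW.
  by exists p2, t2; split=> //; [rewrite -hu -(tgt_opp f1) h|case: k5].
exists f1, (f2 :: p2), t2; split=> //=; last by rewrite k5.
have h0 : src (opp f1) = src f2 by rewrite src_opp k1.
move=> v av; have := adj_disj h0 hne hn (t := v); rewrite hs_opp => h2.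
by apply: contrapT => h3; exact: (h2 h3 (k2 _ av)).
Qed.

Lemma crossing a u p v : HS a -> ispath u p v -> a u -> ~ a v ->
  exists A f B, [/\ p = A ++ f :: B, a (src f), ~ a (tgt f) & hs f = ~` a].
Proof.
move=> ha; elim: p u => [|f p IH] u /=; first by move=> ->.
move=> [hf hp] au nav; have [h|h] := pselect (a (tgt f)).
  have [A [g [B [-> h1 h2 h3]]]] := IH _ hp h nav.
  by exists (f :: A), g, B.
by exists [::], f, p; split; rewrite ?hf //; apply: HS_out => //; rewrite hf.
Qed.

Definition seps p : seq (set (vtx S)) := map (fun f => ~` hs f) p.

Lemma seps_in a u p v : HS a -> ispath u p v -> a u -> ~ a v -> List.In a (seps p).
Proof.
move=> ha hp au nav; have [A [f [B [-> _ _ hf]]]] := crossing ha hp au nav.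
by apply/in_mapP; exists f; [exact: in_cat_cons|rewrite hf setCK].
Qed.

Lemma fin_sep u v : exists L : seq (set (vtx S)),
  (forall a, HS a -> a u -> ~ a v -> List.In a L) /\ size L = dist u v.
Proof.
have [p hp hr] := geo u v; exists (seps p); split; last by rewrite (distE hp hr) size_map.
by move=> a ha; exact: seps_in hp.
Qed.

Lemma seps_red u p v : ispath u p v -> reduced p ->
  List.NoDup (seps p) /\ forall a, List.In a (seps p) -> [/\ HS a, a u & ~ a v].
Proof.
move=> hp hr; split; last first.
  move=> a /in_mapP[f hf <-]; have [A [B hAB]] := in_split hf; rewrite hAB in hp hr.
  have [h1 h2] := red_sep hr hp.
  by split=> //; apply: HSC; exact: HS_hs.
elim: p u hp hr => [|f p IH] u /= hp hr; first by constructor.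
have hr2 : reduced p by apply: (@reduced_sub _ [:: f] _ [::]); rewrite cats0.
constructor; last by apply: (IH (tgt f)) => //; case: hp.
move=> /in_mapP[g hg h]; have [A [B hAB]] := in_split hg; rewrite hAB in hp hr.
apply: (red_once hr hp); left; apply: hs_eq_par.
by rewrite -[LHS]setCK -h setCK.
Qed.

Lemma dist_le u v u' v' : (forall a, HS a -> a u -> ~ a v -> a u' /\ ~ a v') ->
  (dist u v <= dist u' v')%N.
Proof.
move=> h; have [p hp hr] := geo u v; have [L [hL <-]] := fin_sep u' v'.
rewrite (distE hp hr); have [h1 h2] := seps_red hp hr.
have -> : size p = size (seps p) by rewrite size_map.
apply/ssrnat.leP; apply: List.NoDup_incl_length h1 _ => a /h2[k1 k2 k3].
by have [k4 k5] := h _ k1 k2 k3; exact: hL.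
Qed.

Lemma vtx_sep u v : (forall a, HS a -> a u -> a v) -> u = v.
Proof.
move=> h; apply: dist0; apply/eqP; rewrite -leqn0 -(distxx u).
by apply: dist_le => a ha au nav; case: nav; exact: h.
Qed.

Lemma no_inf_sep (a : nat -> set (vtx S)) u v : injective a ->
  (forall n, [/\ HS (a n), a n u & ~ a n v]) -> False.
Proof.
move=> ai h; have [L [hL _]] := fin_sep u v.
have h1 : List.NoDup (map a (iota 0 (size L).+1)).
  elim: (iota _ _) (iota_uniq 0 (size L).+1) => [|n s IH] /=; first by constructor.
  move=> /andP[h1 h2]; constructor; last exact: IH.
  move=> /in_mapP[m hm /ai hmn]; move: h1; rewrite -hmn => /negP; apply.
  by elim: s hm {IH h2} => //= k s IH [->|/IH]; rewrite inE ?eqxx // => ->; rewrite orbT.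
have h2 : List.incl (map a (iota 0 (size L).+1)) L.
  by move=> b /in_mapP[n _ <-]; have [k1 k2 k3] := h n; exact: hL.
have h3 : (size (map a (iota 0 (size L).+1)) <= size L)%N.
  by apply/ssrnat.leP; exact: List.NoDup_incl_length h1 h2.
by move: h3; rewrite size_map size_iota ltnn.
Qed.

(** The edge is pushed across one square for each edge of a reduced path from [s] to [s']; the
    square exists because the two hyperplanes cross. *)
Lemma transport e s s' : src e = s ->
  (forall a, HS a -> a s -> ~ a s' -> cross (hs e) a) ->
  exists2 e', src e' = s' & hs e' = hs e.
Proof.
move=> he hcr; have [p hp hr] := geo s s'.
have {hcr} : forall f, List.In f p -> cross (hs e) (hs f).
  move=> f hf; rewrite -(setCK (hs f)); apply: cross_setCr.
  have [] := (seps_red hp hr).2 (~` hs f) _; last exact: hcr.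
  by apply/in_mapP; exists f.
elim: p e s he hp {hr} => [|f p IH] e s he /= hp hcr; first by exists e; rewrite ?he.
have [hf hp'] := hp; have hc := hcr f (or_introl erefl).
have [[v [h1 h2]] _ _ _] := hc.
have hne : e <> f by move=> h; move: hc; rewrite h; exact: cross_irr.
have [e' [f' hsq]] : exists e' f', sq e f e' f' by apply: adj_sq h1 h2; rewrite // he.
have [|e'' h3 h4] := IH e' (tgt f) (sq_mid2 hsq) hp'.
  by move=> g hg; rewrite -(hs_par (sq_par hsq)); apply: hcr; right.
by exists e'' => //; rewrite h4 (hs_par (sq_par hsq)).
Qed.

(** From a vertex in all halfspaces but [a], walk towards [a] with [HS_step]. A step leaving some
    other [b] would have [a] inside the complement of [b], against the pairwise intersections. *)
Lemma helly (u0 : vtx S) (s : seq (set (vtx S))) :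
  (forall a, List.In a s -> HS a) ->
  (forall a b, List.In a s -> List.In b s -> a `&` b !=set0) ->
  exists v, forall a, List.In a s -> a v.
Proof.
elim: s => [|a s IH] hH hI; first by exists u0.
have [u hu] : exists v, forall b, List.In b s -> b v.
  by apply: IH => [b hb|b c hb hc]; [apply: hH; right|apply: hI; right].
have ha : HS a by apply: hH; left.
have [t at_] := HS_neq0 ha.
have [n] := ubnP (dist u t); elim: n u hu => // n IHn u hu hn.
have [au|nau] := pselect (a u); first by exists u => b [<-|/hu].
have [f [hf hsub]] := HS_step ha nau; apply: (IHn (tgt f)) => [b hb|].
  apply: contrapT => nb; have hbf : hs f = ~` b.
    apply: HS_out => //; first by apply: hH; right.
    by rewrite hf; exact: hu.
  have [x [ax bx]] : a `&` b !=set0 by apply: hI; [left|right].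
  by have := hsub _ ax; rewrite hbf; apply.
by rewrite -ltnS -(dist_start (hsub _ at_)) hf.
Qed.

(* A family of pairwise crossing halfspaces has a vertex adjacent to all of them:
   take u in all of them and w in none of them at minimal distance. *)
Lemma pwcross_deg (u0 : vtx S) s : (forall a, List.In a s -> HS a) -> pwcross s ->
  exists u, forall a, List.In a s -> exists2 e, src e = u & hs e = ~` a.
Proof.
move=> hH hp.
have hI a b : List.In a s -> List.In b s -> a `&` b !=set0 /\ ~` a `&` ~` b !=set0.
  move=> ha hb; case: (pwcross_in hp ha hb) => [<-|[]//].
  by rewrite !setIid; split; apply: HS_neq0; [|apply: HSC]; exact: hH.
have [u1 hu1] : exists v, forall a, List.In a s -> a v.
  by apply: helly => // a b ha hb; have [] := hI _ _ ha hb.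
have [w hw] : exists v, forall a, List.In a s -> ~ a v.
  have [||v hv] := @helly u0 (map setC s).
  - by move=> a /in_mapP[b hb <-]; apply: HSC; exact: hH.
  - move=> a b /in_mapP[a' ha <-] /in_mapP[b' hb <-].
    by have [] := hI _ _ ha hb.
  - by exists v => a ha; apply: (hv (~` a)); apply/in_mapP; exists a.
have hD : exists n, `[< exists2 u, (forall a, List.In a s -> a u) & dist u w = n >].
  by exists (dist u1 w); apply/asboolP; exists u1.
case: (ex_minnP hD) => n /asboolP[u hu hn] hmin; exists u => a ha.
have hCa : HS (~` a) by apply: HSC; exact: hH.
have [|f [hf hsub]] := @HS_step (~` a) u hCa; first by move/(_ (hu _ ha)).
have hwf : hs f w by apply: hsub; exact: hw.
exists f => //; have [b hb nb] : exists2 b, List.In b s & ~ b (tgt f).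
  apply: contrapT => h; have /asboolP/hmin : exists2 u, (forall a, List.In a s -> a u)
      & dist u w = dist (tgt f) w.
    by exists (tgt f) => // b hb; apply: contrapT => nb; apply: h; exists b.
  by rewrite -hn -hf (dist_start hwf) ltnn.
have hbf : hs f = ~` b by apply: HS_out => //; [exact: hH|rewrite hf; exact: hu].
rewrite hbf; case: (pwcross_in hp ha hb) => [-> //|[_ _ [x [nax bx]] _]].
by have := hsub _ nax; rewrite hbf => /(_ bx).
Qed.

Lemma pwcross_bound D s : (forall u, exists l : seq (edg S), (size l <= D)%N /\ forall e, src e = u -> List.In e l) ->
  (forall a, List.In a s -> HS a) -> pwcross s -> (size s <= D)%N.
Proof.
move=> hdeg hH hp; case: s hH hp => // a s hH hp.
have [u0 _] : a !=set0 by apply: HS_neq0; apply: hH; left.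
have [u hu] := pwcross_deg u0 hH hp.
have [l [hl hin]] := hdeg u; apply: leq_trans hl.
rewrite -(size_map (fun e => ~` hs e) l); apply/ssrnat.leP.
apply: List.NoDup_incl_length (pwcross_nodup hp) _ => b /hu[e he hb].
by apply/in_mapP; exists e; [exact: hin|rewrite hb setCK].
Qed.

End Walls.

(** * Skewering halfspaces *)

Lemma pigeonhole (T : Type) (f : nat -> T) (L : seq T) :
  (forall n, List.In (f n) L) -> exists i j, (i < j)%N /\ f i = f j.
Proof.
move=> hL; apply: contrapT => hn.
have inj i j : f i = f j -> i = j.
  move=> hij; apply: contrapT => /eqP; rewrite neq_ltn => /orP[h|h]; apply: hn.
    by exists i, j.
  by exists j, i.
have h1 : List.NoDup (map f (iota 0 (size L).+1)).
  elim: (iota _ _) (iota_uniq 0 (size L).+1) => [|n s IH] /=; first by constructor.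
  move=> /andP[h1 h2]; constructor; last exact: IH.
  move=> /in_mapP[m hm /inj hmn]; move: h1; rewrite -hmn => /negP; apply.
  by elim: s hm {IH h2} => //= k s IH [->|/IH]; rewrite inE ?eqxx // => ->; rewrite orbT.
have h2 : List.incl (map f (iota 0 (size L).+1)) L by move=> b /in_mapP[n _ <-].
have h3 : (size (map f (iota 0 (size L).+1)) <= size L)%N.
  by apply/ssrnat.leP; exact: List.NoDup_incl_length h1 h2.
by move: h3; rewrite size_map size_iota ltnn.
Qed.

Lemma list_filter (T : Type) (P : T -> Prop) (L : seq T) :
  (forall x, P x -> List.In x L) ->
  exists l, List.NoDup l /\ forall x, List.In x l <-> P x.
Proof.
elim: L P => [|y L IH] P hP.
  by exists [::]; split; [constructor|move=> x; split=> // /hP].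
have [|l [h1 h2]] := IH (fun x => P x /\ x <> y).
  by move=> x [/hP[->|//]].
have [py|npy] := pselect (P y); last first.
  exists l; split=> // x; split=> [/h2[]//|px]; apply/h2; split=> // hxy.
  by apply: npy; rewrite -hxy.
exists (y :: l); split.
  by constructor=> // /h2[].
move=> x; split=> [[<-//|/h2[]//]|px].
by have [->|hxy] := pselect (x = y); [left|right; apply/h2].
Qed.

Lemma list_tuples (T : Type) (L : seq T) k : exists LL : seq (seq T),
  forall s, size s = k -> (forall y, List.In y s -> List.In y L) -> List.In s LL.
Proof.
elim: k => [|k [LL h]]; first by exists [:: [::]] => s /size0nil -> _; left.
exists (flatten (map (fun y => map (cons y) LL) L)) => -[//|y s] [hs] hin.
have hy : List.In y L by apply: hin; left.
have hsL : List.In s LL by apply: h => // z hz; apply: hin; right.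
elim: L hy {h hin} => //= z L IH [->|/IH h]; last first.
  by apply/List.in_or_app; right.
by apply/List.in_or_app; left; apply/in_mapP; exists s.
Qed.

Lemma cross_between (T : Type) (n p q b : set T) :
  cross n p -> cross n q -> q `<=` b -> b `<=` p -> cross n b.
Proof.
move=> [_ [x [h1 h2]] _ [x' [h1' h2']]] [[y [k1 k2]] _ [y' [k1' k2']] _] qb bp.
split.
- by exists y; split=> //; exact: qb.
- by exists x; split=> // /bp.
- by exists y'; split=> //; exact: qb.
- by exists x'; split=> // /bp.
Qed.

(** * A group acting on an essential and irreducible system of halfspaces *)

Section Rigidity.
Variable S : csqc.
Variable Gamma : groupType.
Variable rv : Gamma -> vtx S -> vtx S.
Variable re : Gamma -> edg S -> edg S.
Hypothesis rv1 : forall v, rv 1%g v = v.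
Hypothesis rvM : forall g h v, rv (g * h)%g v = rv g (rv h v).
Hypothesis src_re : forall g e, src (re g e) = rv g (src e).
Hypothesis tgt_re : forall g e, tgt (re g e) = rv g (tgt e).
Hypothesis opp_re : forall g e, opp (re g e) = re g (opp e).
Hypothesis sq_re : forall g e x e' x', sq e x e' x' ->
  sq (re g e) (re g x) (re g e') (re g x').
Hypothesis reK : forall g e, re g^-1%g (re g e) = e.
Variable D : nat.
Hypothesis hdeg : forall u, exists l : seq (edg S), (size l <= D)%N /\
  forall e, src e = u -> List.In e l.
Variable Reps : seq (vtx S).
Hypothesis horb : forall v, exists g r, List.In r Reps /\ v = rv g r.
Hypothesis hstab : forall u v, exists L : seq Gamma,
  forall g, rv g u = v -> List.In g L.
Hypothesis hess : forall e : edg S, exists f, [/\ src f = tgt e, opp e <> f &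
  ~ exists e' f', sq (opp e) f e' f'].
Hypothesis hirr : forall Q : set (set (vtx S)), (forall a, Q a -> HS a) ->
  (forall a b, Q a -> HS b -> ~ Q b -> cross a b) ->
  Q !=set0 -> forall a, HS a -> Q a.
Hypothesis hne : exists a : set (vtx S), HS a.

Implicit Types (g h : Gamma) (a b c p q : set (vtx S)) (u v w : vtx S) (e f : edg S).

Lemma rvK g v : rv g^-1%g (rv g v) = v.
Proof. by rewrite -rvM mulVg rv1. Qed.

Lemma rvVK g v : rv g (rv g^-1%g v) = v.
Proof. by rewrite -rvM mulgV rv1. Qed.

Definition ga g a : set (vtx S) := [set v | a (rv g^-1%g v)].

Lemma gaE g a v : ga g a (rv g v) <-> a v.
Proof. by rewrite /ga /= rvK. Qed.

Lemma gaM g h a : ga (g * h)%g a = ga g (ga h a).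
Proof. by apply/seteqP; split=> v; rewrite /ga /= invgM rvM. Qed.

Lemma ga1 a : ga 1%g a = a.
Proof. by apply/seteqP; split=> v; rewrite /ga /= invg1 rv1. Qed.

Lemma gaK g a : ga g^-1%g (ga g a) = a.
Proof. by rewrite -gaM mulVg ga1. Qed.

Lemma gaVK g a : ga g (ga g^-1%g a) = a.
Proof. by rewrite -gaM mulgV ga1. Qed.

Lemma gaC g a : ga g (~` a) = ~` ga g a.
Proof. by []. Qed.

Lemma ga_sub g a b : a `<=` b -> ga g a `<=` ga g b.
Proof. by move=> h v; exact: h. Qed.

Lemma ga_neq0 g a : a !=set0 -> ga g a !=set0.
Proof. by move=> [v av]; exists (rv g v); exact/gaE. Qed.

Lemma ga_cross g a b : cross a b -> cross (ga g a) (ga g b).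
Proof. by move=> [/(ga_neq0 g) h1 /(ga_neq0 g) h2 /(ga_neq0 g) h3 /(ga_neq0 g) h4]. Qed.

Lemma reVK g e : re g (re g^-1%g e) = e.
Proof. by have := reK g^-1%g e; rewrite invgK. Qed.

Lemma ispath_re g u s v : ispath u s v -> ispath (rv g u) (map (re g) s) (rv g v).
Proof.
elim: s u => [|e s IH] u /=; first by move->.
by move=> [<- /IH]; rewrite src_re tgt_re.
Qed.

Lemma pass_re g e A f A' : pass e A f A' ->
  pass (re g e) (map (re g) A) (re g f) (map (re g) A').
Proof.
by elim=> [?|{}e x e' x' B f' B' h _ IH]; [exact: pass0|exact: passS (sq_re g h) IH].
Qed.

Lemma cl_re g e f : cl e f -> cl (re g e) (re g f).
Proof.
case=> -[A [A' h]]; [left|right; rewrite opp_re];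
  by exists (map (re g) A), (map (re g) A'); exact: pass_re.
Qed.

Lemma cnt_re g e s : cnt (re g e) (map (re g) s) = cnt e s.
Proof.
rewrite /cnt count_map; apply: eq_count => f /=.
apply/idP/idP => /asboolP h; apply/asboolP; last exact: cl_re.
by have := cl_re g^-1%g h; rewrite !reK.
Qed.

Lemma hs_re g e : hs (re g e) = ga g (hs e).
Proof.
apply/seteqP; split=> v; last first.
  rewrite /ga /= => -[s hs1 hs2]; exists (map (re g) s); last by rewrite cnt_re.
  by have := ispath_re g hs1; rewrite rvVK tgt_re.
move=> [s hs1 hs2]; exists (map (re g^-1%g) s).
  by have := ispath_re g^-1%g hs1; rewrite tgt_re rvK.
by rewrite -(cnt_re g) -map_comp (@eq_map _ _ _ id) ?map_id // => x; exact: reVK.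
Qed.

Lemma HS_ga g a : HS a -> HS (ga g a).
Proof. by move=> [e ->]; exists (re g e); rewrite hs_re. Qed.

Definition gi g n a := iter n (ga g) a.

Lemma HS_gi g n a : HS a -> HS (gi g n a).
Proof. by move=> ha; elim: n => //= n; exact: HS_ga. Qed.

Lemma gi_sub g n a b : a `<=` b -> gi g n a `<=` gi g n b.
Proof. by move=> h; elim: n => //= n; exact: ga_sub. Qed.

Lemma gi_cross g n a b : cross a b -> cross (gi g n a) (gi g n b).
Proof. by move=> h; elim: n => //= n; exact: ga_cross. Qed.

Lemma giD g m n a : gi g (m + n) a = gi g m (gi g n a).
Proof. exact: iterD. Qed.

Lemma giK g n a : gi g^-1%g n (gi g n a) = a.
Proof. by elim: n a => //= n IH a; rewrite /gi -iterS iterSr gaK; exact: IH. Qed.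

Lemma giVK g n a : gi g n (gi g^-1%g n a) = a.
Proof. by have := giK g^-1%g n a; rewrite invgK. Qed.

Lemma giE g n a : gi g n a = ga (g ^+ n)%g a.
Proof.
elim: n a => [|n IH] a; first by rewrite expg0 ga1.
by rewrite expgS gaM -IH.
Qed.

Lemma giC g n a : gi g n (~` a) = ~` gi g n a.
Proof. by rewrite !giE gaC. Qed.

(** The degree bounds pairwise crossing families. In this sequential form it applies to the iterates
    of a halfspace under one group element, some of which then do not cross the first one. *)
Lemma no_inf_cross (a : nat -> set (vtx S)) : (forall n, HS (a n)) ->
  exists i j, (i < j)%N /\ ~ cross (a i) (a j).
Proof.
move=> ha; apply: contrapT => hn.
have hc i j : (i < j)%N -> cross (a i) (a j).
  by move=> hij; apply: contrapT => h; apply: hn; exists i, j.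
have := @pwcross_bound S D (map a (iota 0 D.+1)) hdeg.
rewrite size_map size_iota ltnn => h; suff: false by [].
apply: h => [b /in_mapP[n _ <-]//|].
elim: (D.+1) 0%N => //= n IH m; split=> // b /in_mapP[k hk <-]; apply: hc.
elim: n m hk {IH} => //= n IH m [<-//|/IH]; exact: ltnW.
Qed.

Lemma no_inf_cross_gi g a : HS a -> exists2 n, (0 < n)%N & ~ cross a (gi g n a).
Proof.
move=> ha; have [|i [j [hij h]]] := @no_inf_cross (fun n => gi g n a).
  by move=> n; exact: HS_gi.
exists (j - i)%N; first by rewrite subn_gt0.
by move=> h2; apply: h; rewrite -(subnKC (ltnW hij)) giD; exact: gi_cross.
Qed.

(** The edge [f] beyond [e] spans no square with [opp e], so the halfspaces of these two edges are
    disjoint, which puts that of [f] inside that of [e]. *)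
Lemma essential a : HS a -> exists b, [/\ HS b, b `<=` a & b <> a].
Proof.
move=> [e ->]; have [f [h1 h2 h3]] := hess e; exists (hs f); split.
- exact: HS_hs.
- have h0 : src (opp e) = src f by rewrite src_opp h1.
  move=> v hv; have := adj_disj h0 h2 h3 (t := v); rewrite hs_opp => h.
  by apply: contrapT => hnv; exact: (h hnv hv).
- by move=> h; apply: (@hs_src _ f); rewrite h1 h; exact: hs_tgt.
Qed.

(** The combinatorial counterpart of rank one: as no hyperplane crosses both [a] and its translate,
    the strip between them is narrow in one place only. *)
Definition skewers_strongly := exists g a, [/\ HS a, ga g a `<=` a, ga g a <> a &
  forall m, HS m -> cross m a -> cross m (ga g a) -> False].

(** * Sectors and strongly separated pairs, when nested halfspaces can be skewered *)

Section DoubleSkewering.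
Hypothesis dskew : forall p q, HS p -> HS q -> q `<=` p -> q <> p ->
  exists g, ga g p `<=` q.

(** A halfspace inside [b1] cannot cross [a0], so if there were no [c], all of them would cross
    [b3]. But skewering the complement of [b2] into [b1] moves every positive iterate of [b3] into
    [b1], and one of these does not cross [b3]. *)
Lemma path3_core a0 b1 b2 b3 : HS a0 -> HS b1 -> HS b2 -> HS b3 ->
  cross a0 b2 -> ~ cross a0 b1 -> b1 `<=` ~` b2 -> b3 `<=` ~` b2 ->
  exists c, [/\ HS c, ~ cross a0 c & ~ cross c b3].
Proof.
move=> h0 h1 h2 h3 c02 n01 d12 d32; apply: contrapT => hn.
have {}hn b : HS b -> b `<=` b1 -> cross b b3.
  move=> hb sb; apply: contrapT => hb3; apply: hn; exists b; split=> // c0b.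
  case: (ncrossP n01) => [h|h|h|h].
  - case: c0b => -[x [k1 k2]] _ _ _; have : (a0 `&` b1) x by split=> //; exact: sb.
    by rewrite h.
  - by case: c02 => -[x [/h/d12]].
  - by case: c0b => _ _ [x [k1 /sb/h]].
  - by case: c02 => _ _ [x [/h/d12]].
have hne12 : b1 <> ~` b2.
  by move=> h; apply: n01; rewrite h; exact: cross_setCr.
have [g hg] := dskew (HSC h2) h1 d12 hne12.
have hsub n : gi g n.+1 b3 `<=` b1.
  elim: n => [|n IH] /=; first by apply: subset_trans hg; exact: ga_sub.
  apply: subset_trans hg; apply: ga_sub; exact: subset_trans IH d12.
have [[//|n] _ []] := no_inf_cross_gi g h3.
by apply: cross_sym; apply: hn => //; exact: HS_gi.
Qed.

(** In the graph of non-crossing pairs, a path of length three can be shortened. In the remaining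
    case [a0] crosses [a2] and [a1] crosses [a3]; complements make [a1] and [a2] disjoint, and the
    position of [a3] decides whether it or its complement goes into [path3_core]. *)
Lemma path3 a0 a1 a2 a3 : HS a0 -> HS a1 -> HS a2 -> HS a3 ->
  ~ cross a0 a1 -> ~ cross a1 a2 -> ~ cross a2 a3 ->
  exists c, [/\ HS c, ~ cross a0 c & ~ cross c a3].
Proof.
move=> h0 h1 h2 h3 n01 n12 n23.
have [c02|n02] := pselect (cross a0 a2); last by exists a2.
have [c13|n13] := pselect (cross a1 a3); last by exists a1.
have key b1 b2 : HS b1 -> HS b2 -> cross a0 b2 -> ~ cross a0 b1 ->
    cross b1 a3 -> ~ cross b2 a3 -> b1 `<=` ~` b2 ->
    exists c, [/\ HS c, ~ cross a0 c & ~ cross c a3].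
  move=> k1 k2 k3 k4 k5 k6 k7.
  case: (ncrossP k6) => [h|h|h|h].
  - apply: (@path3_core a0 b1 b2 a3) => // v av bv.
    by have : (b2 `&` a3) v by []; rewrite h.
  - have [|c [l1 l2 l3]] := @path3_core a0 b1 b2 (~` a3) h0 k1 k2 (HSC h3) k3 k4 k7.
      by move=> v nav /h.
    by exists c; split=> // /cross_setCr.
  - by case: k5 => -[x [/k7 l1 /h]].
  - by case: k5 => _ [x [/k7/h l1 l2]].
have nC b c : ~ cross b c -> ~ cross b (~` c) by move=> h /cross_setCr; rewrite setCK.
have nCl b c : ~ cross b c -> ~ cross (~` b) c by move=> h /cross_setCl; rewrite setCK.
case: (ncrossP n12) => [h|h|h|h].
- apply: (key a1 a2) => // v av bv.
  by have : (a1 `&` a2) v by []; rewrite h.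
- apply: (key a1 (~` a2)) => //; [exact: HSC|exact: cross_setCr|exact: nCl|].
  by rewrite setCK.
- apply: (key (~` a1) a2) => //; [exact: HSC|exact: nC|exact: cross_setCl|].
  by move=> v nav /h.
- apply: (key (~` a1) (~` a2)) => //; try exact: HSC.
  + exact: cross_setCr.
  + exact: nC.
  + exact: cross_setCl.
  + exact: nCl.
  + by rewrite setCK.
Qed.

(** By [path3], the halfspaces at distance at most two from [a] in the graph of non-crossing pairs
    cross all the others, so by irreducibility there are no others. *)
Lemma ncross_common a b : HS a -> HS b ->
  exists c, [/\ HS c, ~ cross a c & ~ cross c b].
Proof.
move=> ha hb; suff [] : [set b | HS b /\ exists c, [/\ HS c, ~ cross a c & ~ cross c b]] b by [].
apply: hirr hb => [x []//|b1 b2 [h1 [c [hc1 hc2 hc3]]] h2 h3|]; last first.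
  by exists a; split=> //; exists a; split=> //; exact: cross_irr.
apply: contrapT => h4; apply: h3; split=> //.
exact: path3 hc2 hc3 h4.
Qed.

(** The sector cut out by [a] and [b] is deep: it contains a whole halfspace. *)
Definition sect a b := exists c, [/\ HS c, c `<=` a & c `<=` b].

Lemma sect_sym a b : sect a b -> sect b a.
Proof. by move=> [c []]; exists c. Qed.

(** Let [g] skewer [a] into the halfspace of the sector. Since the iterates of [a] lie in [b], the
    complement of [b], pulled back by a positive power of [g], lies off [a]. For a suitable power it
    does not cross [b], so it fits into one of the two sectors on that side. *)
Lemma sect_next a b : HS a -> HS b -> cross a b -> sect a b ->
  sect (~` a) b \/ sect (~` a) (~` b).
Proof.
move=> ha hb hab [c [hc ca cb]].
have hca : c <> a by move=> h; case: hab => _ [x [k1]] /(_ (cb _ _)); rewrite h; case.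
have [g hg] := dskew ha hc ca hca.
have hsub n : gi g n.+1 a `<=` c.
  elim: n => [|n IH] //=; apply: subset_trans hg; apply: ga_sub.
  exact: subset_trans IH ca.
have [[//|n] _ hn] := no_inf_cross_gi g^-1%g hb.
set x := ~` gi g^-1%g n.+1 b.
have hx : HS x by apply: HSC; exact: HS_gi.
have hxa : x `<=` ~` a.
  move=> v; apply: contra_not => av.
  have := @gi_sub g^-1%g n.+1 _ _ (subset_trans (@hsub n) cb) v.
  by rewrite giK; apply.
case: (ncrossP hn) => [h|h|h|h].
- case: hab => -[v [av bv]] _ _ _; case: (hxa v) => // hv.
  by have : (b `&` gi g^-1%g n.+1 b) v by []; rewrite h.
- by right; exists x; split=> // v; apply: contra_not => /h.
- case: hab => _ [v [av nbv]] _ _; case: (hxa v) => // /h.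
  by [].
- left; exists x; split=> // v hv; apply: contrapT => nbv.
  by apply: hv; apply: h.
Qed.

(** A common halfspace that crosses neither [a] nor [b] lies, up to complement, in one sector. From
    there [sect_next] is applied across [a] and across [b]; either it reaches the opposite sector at
    once, or it reaches both neighbouring sectors, which are opposite to each other. *)
Lemma opp_sect a b : HS a -> HS b -> cross a b ->
  (sect a b /\ sect (~` a) (~` b)) \/ (sect a (~` b) /\ sect (~` a) b).
Proof.
move=> ha hb hab.
have key x y : HS x -> HS y -> cross x y -> sect x y ->
    (sect x y /\ sect (~` x) (~` y)) \/ (sect x (~` y) /\ sect (~` x) y).
  move=> hx hy hxy hs.
  case: (sect_next hx hy hxy hs) => h1; last by left.
  case: (sect_next hy hx (cross_sym hxy) (sect_sym hs)) => h2; last first.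
    by left; split=> //; exact: sect_sym.
  by right; split=> //; exact: sect_sym.
have [c [hc n1 n2]] := ncross_common ha hb.
have [c' [hc' nc' hca]] : exists c', [/\ HS c', ~ cross c' b & c' `<=` a \/ c' `<=` ~` a].
  have nCl x y : ~ cross x y -> ~ cross (~` x) y by move=> h /cross_setCl; rewrite setCK.
  case: (ncrossP n1) => h.
  - by exists c; split=> //; right=> v cv av; have : (a `&` c) v by []; rewrite h.
  - exists (~` c); split; [exact: HSC|exact: nCl|].
    by right=> v; apply: contra_not => /h.
  - by exists c; split=> //; left.
  - exists (~` c); split; [exact: HSC|exact: nCl|].
    by left=> v ncv; apply: contrapT => /h.
have key2 x : HS x -> cross x b -> c' `<=` x ->
    (sect x b /\ sect (~` x) (~` b)) \/ (sect x (~` b) /\ sect (~` x) b).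
  move=> hx hxb hcx.
  have hcb : c' `<=` b \/ c' `<=` ~` b.
    case: (ncrossP nc') => h.
    - by right=> v cv bv; have : (c' `&` b) v by []; rewrite h.
    - by left.
    - by case: hxb => _ _ [v [nxv /h/hcx]].
    - by case: hxb => _ _ _ [v [nxv nbv]]; case: nbv; apply: h => /hcx.
  case: hcb => hcb; first by apply: key => //; exists c'.
  have := key x (~` b) hx (HSC hb) (cross_setCr hxb); rewrite setCK => h.
  by case: h => [|h|h]; [exists c'|right|left].
case: hca => hca; first exact: key2.
have := key2 (~` a) (HSC ha) (cross_setCl hab) hca; rewrite setCK.
by case=> [[h1 h2]|[h1 h2]]; [right|left].
Qed.

(* Placing opposite sectors of (d, n) and of (g d, n) on the two sides turns a
   family of s pairwise crossing separators and a common crosser n into a family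
   of s + 1 pairwise crossing separators. *)
Lemma sep_family :
  (forall p q, HS p -> HS q -> q `<=` p -> q <> p ->
     exists m, [/\ HS m, cross m p & cross m q]) ->
  forall s, exists d d' l, [/\ [/\ HS d, HS d', d' `<=` d & d' <> d],
    size l = s, pwcross l & forall a, List.In a l -> [/\ HS a, d' `<=` a & a `<=` d]].
Proof.
move=> nss; elim=> [|s [d [d' [l [[hd hd' sdd ned] hs hpw hl]]]]].
  have [a ha] := hne; have [b [h1 h2 h3]] := essential ha.
  by exists a, b, [::].
have [g hg] := dskew hd hd' sdd ned.
pose d1 := ga g d; pose d2 := ga g d1.
have hd1 : HS d1 by exact: HS_ga.
have hd2 : HS d2 by exact: HS_ga.
have s1 : d1 `<=` d by exact: subset_trans hg sdd.
have s2 : d2 `<=` d1 by exact: ga_sub.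
have ne2 : d2 <> d.
  move=> h; apply: ned; apply/seteqP; split=> //; rewrite -h.
  exact: subset_trans s2 hg.
have [n [hn n1 n2]] := nss _ _ hd hd2 (subset_trans s2 s1) ne2.
have nd1 : cross n d1 by exact: cross_between n1 n2 s2 s1.
have build m P Q L : HS m -> cross m P -> cross m Q -> Q `<=` P ->
    size L = s -> pwcross L -> (forall a, List.In a L -> [/\ HS a, Q `<=` a & a `<=` P]) ->
    sect (~` P) (~` m) -> sect Q m ->
    exists d d' l, [/\ [/\ HS d, HS d', d' `<=` d & d' <> d],
      size l = s.+1, pwcross l & forall a, List.In a l -> [/\ HS a, d' `<=` a & a `<=` d]].
  move=> hm mP mQ QP sL pL hL [x [hx xP xm]] [y [hy yQ ym]].
  have Px : P `<=` ~` x by move=> v Pv xv; exact: (xP v xv Pv).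
  have mx : m `<=` ~` x by move=> v mv xv; exact: (xm v xv mv).
  exists (~` x), y, (m :: L); split.
  - split; [exact: HSC|by []| |].
      by apply: subset_trans yQ _; exact: subset_trans QP Px.
    move=> h; case: mQ => _ [v [mv nQv]] _ _; apply: nQv; apply: yQ.
    by rewrite h; exact: mx.
  - by rewrite /= sL.
  - split=> // b /hL[hb Qb bP]; exact: cross_between mP mQ Qb bP.
  - move=> a [<-|/hL[ha Qa aP]]; first by [].
    by split=> //; [exact: subset_trans yQ Qa|exact: subset_trans aP Px].
have build2 P Q L : HS P -> HS Q -> cross n P -> cross n Q -> Q `<=` P ->
    size L = s -> pwcross L -> (forall a, List.In a L -> [/\ HS a, Q `<=` a & a `<=` P]) ->
    (sect (~` P) (~` n) /\ sect Q n) \/ (sect (~` P) n /\ sect Q (~` n)) ->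
    exists d d' l, [/\ [/\ HS d, HS d', d' `<=` d & d' <> d],
      size l = s.+1, pwcross l & forall a, List.In a l -> [/\ HS a, d' `<=` a & a `<=` d]].
  move=> hP hQ nP nQ QP sL pL hL [[k1 k2]|[k1 k2]]; first exact: (build n P Q L).
  apply: (build (~` n) P Q L) => //; [exact: HSC|exact: cross_setCl|exact: cross_setCl|].
  by rewrite setCK.
have hl1 a : List.In a l -> [/\ HS a, d1 `<=` a & a `<=` d].
  by move=> /hl[k1 k2 k3]; split=> //; exact: subset_trans hg k2.
have hl2 a : List.In a l -> [/\ HS a, d2 `<=` a & a `<=` d].
  by move=> /hl1[k1 k2 k3]; split=> //; exact: subset_trans s2 k2.
have hl3 a : List.In a (map (ga g) l) -> [/\ HS a, d2 `<=` a & a `<=` d1].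
  by move=> /in_mapP[b /hl1[k1 k2 k3] <-]; split; [exact: HS_ga|exact: ga_sub|exact: ga_sub].
have pw3 : pwcross (map (ga g) l).
  elim: (l) hpw => //= b l' IH [k1 k2]; split; last exact: IH.
  by move=> c /in_mapP[c' /k1 hc <-]; exact: ga_cross.
have b01 := build2 d d1 l hd hd1 n1 nd1 s1 hs hpw hl1.
have b02 := build2 d d2 l hd hd2 n1 n2 (subset_trans s2 s1) hs hpw hl2.
have b12 := build2 d1 d2 _ hd1 hd2 nd1 n2 s2 (etrans (size_map _ _) hs) pw3 hl3.
(* Each of [d], [d1], [d2] together with [n] has one of two pairs of opposite deep sectors. Among
   three choices two agree, and those two go into [build2]; this is why two translates of [d] are
   needed. *)
case: (opp_sect hd hn (cross_sym n1)) => -[p1 p2];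
case: (opp_sect hd1 hn (cross_sym nd1)) => -[p3 p4];
case: (opp_sect hd2 hn (cross_sym n2)) => -[p5 p6];
  try (by apply: b01; (left + right)); try (by apply: b02; (left + right));
  by apply: b12; (left + right).
Qed.

Lemma dskew_strongly : skewers_strongly.
Proof.
have [p [q [hp hq qp neq hst]]] : exists p q, [/\ HS p, HS q, q `<=` p, q <> p &
    forall m, HS m -> cross m p -> cross m q -> False].
  apply: contrapT => hn.
  (* A family of [D.+1] pairwise crossing halfspaces is one more than the degree allows. *)
  have [|d [d' [l [_ hs hpw hl]]]] := sep_family _ D.+1.
    move=> p q hp hq qp nqp; apply: contrapT => hm; apply: hn; exists p, q; split=> //.
    by move=> m h1 h2 h3; apply: hm; exists m.
  have := pwcross_bound hdeg (fun a ha => let: And3 h _ _ := hl a ha in h) hpw.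
  by rewrite hs ltnn.
have [g hg] := dskew hp hq qp neq.
exists g, p; split=> //; first exact: subset_trans hg qp.
  by move=> h; apply: neq; apply/seteqP; split=> //; rewrite -{1}h.
move=> m hm h1 h2; apply: (hst m hm h1).
exact: cross_between h1 h2 hg qp.
Qed.

End DoubleSkewering.

Definition flippable a := exists g, ga g a `<=` ~` a.

(** One element moves [p] off itself, hence off [q]; another moves the complement of [q] into
    [q]. *)
Lemma flip_dskew : (forall a, HS a -> flippable a) ->
  forall p q, HS p -> HS q -> q `<=` p -> q <> p -> exists g, ga g p `<=` q.
Proof.
move=> hf p q hp hq qp _; have [f1 h1] := hf _ (HSC hq); have [f2 h2] := hf _ hp.
exists (f1 * f2)%g; rewrite gaM; apply: subset_trans (@ga_sub f1 _ _ h2) _.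
apply: (@subset_trans _ (ga f1 (~` q))); last by move: h1; rewrite setCK.
by apply: ga_sub => v; apply: contra_not => /qp.
Qed.

Lemma dist_rv_le g u v : (dist (rv g u) (rv g v) <= dist u v)%N.
Proof.
have [s hs hr] := geo u v; rewrite (distE hs hr).
by rewrite -(size_map (re g) s); apply: dist_le_size; exact: ispath_re.
Qed.

Lemma dist_rv g u v : dist (rv g u) (rv g v) = dist u v.
Proof.
apply/eqP; rewrite eqn_leq dist_rv_le /=.
by have := dist_rv_le g^-1%g (rv g u) (rv g v); rewrite !rvK.
Qed.

Lemma dist_seps u v (L : seq (set (vtx S))) :
  (forall a, HS a -> a u -> ~ a v -> List.In a L) -> (dist u v <= size L)%N.
Proof.
move=> h; have [s hsp hr] := geo u v; rewrite (distE hsp hr).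
have [h1 h2] := seps_red hsp hr; rewrite -(size_map (fun f => ~` hs f) s).
apply/ssrnat.leP; apply: List.NoDup_incl_length h1 _ => a /h2[k1 k2 k3].
exact: h.
Qed.

(** Each passage to a strictly smaller halfspace adds one to the distance from the complement of
    [a]: where a path leaves [b'] it is still inside [b], as the two have different hyperplanes. *)
Lemma deep a n : HS a -> exists b, [/\ HS b, b `<=` a &
  forall u t, b u -> (dist u t <= n)%N -> a t].
Proof.
move=> ha; elim: n => [|n [b [hb ba h]]].
  by exists a; split=> // u t au; rewrite leqn0 => /eqP/dist0 <-.
have [b' [hb' b'b ne]] := essential hb; exists b'; split=> //.
  exact: subset_trans b'b ba.
move=> u t b'u hd; apply: contrapT => nat_.
have [s hs hr] := geo u t; rewrite (distE hs hr) in hd.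
have nb't : ~ b' t by move/b'b/ba.
have [A [f [B [hAB k1 k2 k3]]]] := crossing hb' hs b'u nb't.
have bt : b (tgt f).
  apply: contrapT => nbt; have hf := HS_out hb (b'b _ k1) nbt.
  by apply: ne; rewrite -[LHS]setCK -k3 hf setCK.
apply: nat_; apply: h bt _; rewrite hAB in hs hd.
have [w _ /= [_ hB]] := (ispath_cat u A (f :: B) t).1 hs.
apply: leq_trans (dist_le_size hB) _; rewrite -ltnS; apply: leq_trans hd.
by rewrite size_cat /= addnS ltnS leq_addl.
Qed.

Lemma reps_bound u : exists n, forall r, List.In r Reps -> (dist u r <= n)%N.
Proof.
elim: Reps => [|r L [n IH]]; first by exists 0%N.
exists (n + dist u r)%N => r' [<-|/IH h]; first exact: leq_addl.
exact: leq_trans h (leq_addr _ _).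
Qed.

Lemma orbit_dense a v : HS a -> exists g, a (rv g v).
Proof.
move=> ha; have [n hn] := reps_bound v; have [b [hb _ h]] := deep n ha.
have [u bu] := HS_neq0 hb; have [g [r [hr hu]]] := horb u.
exists g; apply: h bu _; rewrite hu dist_rv distC; exact: hn.
Qed.

Lemma finball u u' n : exists L : seq Gamma,
  forall g, (dist u (rv g u') <= n)%N -> List.In g L.
Proof.
elim: n u => [|n IH] u.
  have [L hL] := hstab u' u; exists L => g; rewrite leqn0 => /eqP/dist0 h.
  exact: hL.
have [L0 hL0] := IH u; have [l [_ hl]] := hdeg u.
have [L1 hL1] : exists L1 : seq Gamma, forall e g, List.In e l ->
    (dist (tgt e) (rv g u') <= n)%N -> List.In g L1.
  elim: l {hl} => [|e l [L1 h1]]; first by exists [::].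
  have [L2 h2] := IH (tgt e); exists (L2 ++ L1) => e' g [<-|he] hd; apply/List.in_or_app.
    by left; exact: h2.
  by right; exact: h1 he hd.
exists (L0 ++ L1) => g hg; apply/List.in_or_app.
have [s hs hr] := geo u (rv g u').
case: s hs hr => [|e s] /= hs hr.
  by left; apply: hL0; rewrite hs distxx.
right; have [he hs'] := hs; apply: hL1 (hl _ he) _.
have hr' : reduced s by apply: (@reduced_sub _ [:: e] _ [::]); rewrite cats0.
have hs2 : ispath u (e :: s) (rv g u') by [].
by move: hg; rewrite (distE hs2 hr) (distE hs' hr').
Qed.

Lemma finball_reps n : exists L : seq Gamma,
  forall r g, List.In r Reps -> (dist r (rv g r) <= n)%N -> List.In g L.
Proof.
elim: Reps => [|r L [L1 IH]]; first by exists [::].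
have [L2 h2] := finball r r n; exists (L2 ++ L1) => r' g [<-|hr'] h.
  by apply/List.in_or_app; left; exact: h2.
by apply/List.in_or_app; right; exact: IH hr' h.
Qed.

(* Elements moving a base vertex a bounded amount generate, since the graph is
   connected and the orbit of the base vertex is coarsely dense. *)
Lemma gen_bounded v0 : exists n, forall C : set Gamma,
  (forall g h, C g -> C h -> C (g * h)%g) ->
  (forall g, (dist v0 (rv g v0) <= n)%N -> C g) -> forall g, C g.
Proof.
have [m hm] := reps_bound v0; exists (m + m).+1 => C hmul hC.
have hnear u : exists g, (dist u (rv g v0) <= m)%N.
  have [g [r [hr ->]]] := horb u; exists g; rewrite dist_rv distC; exact: hm.
suff key s u g : ispath v0 s u -> (dist u (rv g v0) <= m)%N -> C g.
  by move=> g; have [s hs _] := geo v0 (rv g v0); apply: key hs _; rewrite distxx.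
elim/last_ind: s u g => [|s e IH] u g.
  move=> /= <- h; apply: hC; apply: leq_trans h _.
  by apply: leqW; exact: leq_addr.
rewrite -cats1 => /ispath_rcons[hs hu] hg.
have [g' hg'] := hnear (src e).
have -> : g = (g' * (g'^-1 * g))%g by rewrite mulVKg.
apply: hmul; first exact: IH hs hg'.
apply: hC; rewrite rvM -(dist_rv g') rvVK.
apply: leq_trans (dist_triangle _ (src e) _) _; rewrite distC -addnS.
apply: leq_add hg' _; apply: leq_trans (dist_triangle _ (tgt e) _) _.
by rewrite dist_edge add1n ltnS hu.
Qed.

(** The edges span a cube with opposite corner [w]. The induction crosses [e] and carries the
    remaining edges over to [tgt e] through squares. *)
Lemma cube_cross u l : (forall e, List.In e l -> src e = u) -> pwcross (map (@hs S) l) ->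
  exists w, (forall e, List.In e l -> hs e w) /\
    forall a, HS a -> a u -> ~ a w -> exists2 e, List.In e l & a = ~` hs e.
Proof.
have [n] := ubnP (size l); elim: n l u => // n IH [|e l] u hn hl hpw; first by exists u.
have he : src e = u by apply: hl; left.
have [hc hpw'] := hpw.
have [l' [hl' hm]] : exists l', (forall f, List.In f l' -> src f = tgt e) /\
    map (@hs S) l' = map (@hs S) l.
  have {hpw hpw' hn} : forall f, List.In f l -> src f = u /\ cross (hs e) (hs f).
    by move=> f hf; split; [apply: hl; right|apply: hc; apply/in_mapP; exists f].
  elim: l {hl hc} => [|f l IHl] h; first by exists [::].
  have [|l' [h1 h2]] := IHl; first by move=> f' hf'; apply: h; right.
  have [hfu [[v [k1 k2]] k3 k4 k5]] := h f (or_introl erefl).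
  have hef : e <> f by move=> h'; case: k3 => x []; rewrite h'.
  have [|e' [f' hsq]] := adj_sq _ hef k1 k2; first by rewrite he hfu.
  exists (f' :: l'); split=> [f2 [<-|/h1//]|]; first exact: sq_mid hsq.
  by rewrite /= h2 (hs_par (sq_par (sq_sym hsq))).
have hsz : (size l' < n)%N.
  by have := size_map (@hs S) l'; rewrite hm size_map => <-; move: hn; rewrite ltnS.
have hpl' : pwcross (map (@hs S) l') by rewrite hm.
have [w [h1 h2]] := IH l' (tgt e) hsz hl' hpl'.
exists w; split=> [f [<-|hf]|a ha au naw].
- apply: contrapT => nw; have [f2 hf2 hef] := h2 _ (HS_hs e) (hs_tgt e) nw.
  have : cross (hs e) (hs f2).
    apply: hc; suff: List.In (hs f2) (map (@hs S) l) by [].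
    by rewrite -hm; apply/in_mapP; exists f2.
  by rewrite hef => /cross_sym/cross_irrC.
- have : List.In (hs f) (map (@hs S) l').
    by rewrite hm; apply/in_mapP; exists f.
  by move=> /in_mapP[f' hf' <-]; exact: h1.
- have [ae|nae] := pselect (a (tgt e)).
    have [f hf haf] := h2 a ha ae naw.
    have : List.In (hs f) (map (@hs S) l) by rewrite -hm; apply/in_mapP; exists f.
    by move=> /in_mapP[f' hf' hff']; exists f'; [right|rewrite hff'].
  exists e; first by left.
  by rewrite (@HS_out _ a e) ?setCK // he.
Qed.

(** * The flow towards the point at infinity of an unflippable halfspace *)

Section Unflippable.
Variable Sg : set (set (vtx S)).
Hypothesis SgHS : forall a, Sg a -> HS a.
Hypothesis Sg_down : forall a b, Sg a -> HS b -> b `<=` a -> Sg b.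
Hypothesis Sg_opp : forall a, Sg a -> ~ Sg (~` a).
Hypothesis Sg_ga : forall g a, Sg a -> Sg (ga g a).
Hypothesis Sg_cover : forall v, exists2 a, Sg a & a v.

Lemma in_edges v : exists l, [/\ List.NoDup l, (size l <= D)%N,
  forall e, List.In e l <-> src e = v /\ Sg (~` hs e) & pwcross (map (@hs S) l)].
Proof.
have [L [hLD hL]] := hdeg v.
have [|l [h1 h2]] := @list_filter _ (fun e => src e = v /\ Sg (~` hs e)) L.
  by move=> e [he _]; exact: hL.
exists l; split=> //.
  apply: leq_trans hLD; apply/ssrnat.leP; apply: List.NoDup_incl_length h1 _.
  by move=> e /h2[he _]; exact: hL.
have {h2} h2 e : List.In e l -> src e = v /\ Sg (~` hs e) by move/h2.
elim: l h1 h2 => //= e l IH hnd h2; split; last first.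
  by apply: IH => [|f hf]; [inversion hnd|apply: h2; right].
move=> b /in_mapP[f hf <-]; have [e1 e2] := h2 e (or_introl erefl).
have [f1 f2] := h2 f (or_intror hf).
have hef : e <> f by move=> h; inversion hnd; subst.
apply: contrapT => /ncrossP[h|h|h|h].
- apply: (Sg_opp e2); rewrite setCK; apply: Sg_down f2 (HS_hs e) _ => x hx nx.
  by have : (hs e `&` hs f) x by []; rewrite h.
- have := h _ (hs_tgt e); have nf : ~ hs f (src e) by rewrite e1 -f1; exact: hs_src.
  by move=> /(hs_in nf) h3; apply: hef; apply: hs_src_inj; rewrite ?e1.
- have := h _ (hs_tgt f); have ne : ~ hs e (src f) by rewrite f1 -e1; exact: hs_src.
  by move=> /(hs_in ne) h3; apply: hef; apply: hs_src_inj; rewrite ?e1.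
- apply: (@hs_src _ f); rewrite f1 -e1; apply: h; exact: hs_src.
Qed.

Definition adjout v a := exists2 e, src e = v & hs e = ~` a.

(** The hyperplanes of the adjacent members of [Sg] cross pairwise, so all these members can be left
    at once across a single cube. Leaving all of them involves no choice, which is what makes the
    resulting map equivariant. *)
Lemma push_ex v : exists w, [/\
  forall a, Sg a -> (a w <-> a v /\ ~ adjout v a),
  forall a, HS a -> ~ Sg a -> ~ Sg (~` a) -> (a w <-> a v) &
  (dist v w <= D)%N].
Proof.
have [l [hnd hD hl hpw]] := in_edges v.
have [|w [h1 h2]] := cube_cross (u := v) _ hpw; first by move=> e /hl[].
exists w; split.
- move=> a sa; split.
    move=> aw; split; last first.
      move=> [e he hea]; have /h1 : List.In e l by apply/hl; rewrite hea setCK.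
      by rewrite hea.
    apply: contrapT => nav; have [|e /hl[_ he] hae] := h2 _ (HSC (SgHS sa)) nav.
      by move/(_ aw).
    by apply: (Sg_opp sa); rewrite hae.
  move=> [av na]; apply: contrapT => naw.
  have [e /hl[he _] hae] := h2 _ (SgHS sa) av naw.
  by apply: na; exists e => //; rewrite hae setCK.
- move=> a ha n1 n2; split=> h.
    apply: contrapT => nav; have [|e /hl[_ he] hae] := h2 _ (HSC ha) nav; first by move/(_ h).
    by apply: n2; rewrite hae.
  apply: contrapT => naw; have [e /hl[_ he] hae] := h2 _ ha h naw.
  by apply: n1; rewrite hae.
- apply: leq_trans hD; rewrite -(size_map (fun e => ~` hs e) l).
  apply: dist_seps => a ha av naw; have [e he hae] := h2 _ ha av naw.
  by apply/in_mapP; exists e.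
Qed.

Definition push v := projT1 (cid (push_ex v)).

Lemma pushS v a : Sg a -> (a (push v) <-> a v /\ ~ adjout v a).
Proof. by rewrite /push; case: cid => w /= [h _ _]; exact: h. Qed.

Lemma pushN v a : HS a -> ~ Sg a -> ~ Sg (~` a) -> (a (push v) <-> a v).
Proof. by rewrite /push; case: cid => w /= [_ h _]; exact: h. Qed.

Lemma push_dist v : (dist v (push v) <= D)%N.
Proof. by rewrite /push; case: cid => w /= [_ _ h]. Qed.

Lemma Sg_gaV g a : Sg (ga g a) -> Sg a.
Proof. by move/(Sg_ga g^-1%g); rewrite gaK. Qed.

Lemma adjout_ga g v a : adjout v a -> adjout (rv g v) (ga g a).
Proof.
move=> [e he hea]; exists (re g e); first by rewrite src_re he.
by rewrite hs_re hea gaC.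
Qed.

Lemma push_rv g v : push (rv g v) = rv g (push v).
Proof.
have key a : Sg a -> (a (push (rv g v)) <-> a (rv g (push v))).
  move=> sa; have sb : Sg (ga g^-1%g a) by exact: Sg_ga.
  have E x : a (rv g x) <-> ga g^-1%g a x by rewrite /ga /= invgK.
  split.
    move=> /(pushS _ sa)[/E h1 h2]; apply/E; apply/(pushS _ sb); split=> // h3.
    by apply: h2; have := adjout_ga g h3; rewrite gaVK.
  move=> /E/(pushS _ sb)[h1 h2]; apply/(pushS _ sa); split; first exact/E.
  by move=> h3; apply: h2; have := adjout_ga g^-1%g h3; rewrite rvK.
apply: vtx_sep => a ha h.
have [sa|nsa] := pselect (Sg a); first exact/key.
have [sa|nsa'] := pselect (Sg (~` a)).
  by apply: contrapT => /(key _ sa) /(_ h).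
have E : a (rv g (push v)) <-> ga g^-1%g a (push v) by rewrite /ga /= invgK.
apply/E; apply/pushN; first exact: HS_ga.
- by move/Sg_gaV.
- by rewrite -gaC => /Sg_gaV.
move/(pushN _ ha nsa nsa'): h.
by rewrite /ga /= invgK.
Qed.

(** The order along the flow: [w] is at least as advanced as [v]. *)
Definition leS v w := forall a, Sg a -> a w -> a v.

Lemma leS_push v : leS v (push v).
Proof. by move=> a sa /(pushS _ sa)[]. Qed.

Lemma push_mono v w : leS v w -> leS (push v) (push w).
Proof.
move=> h a sa /(pushS _ sa)[aw na]; apply/(pushS _ sa); split; first exact: h.
move=> [e he hea].
have [|f [hf hsub]] := HS_step (u := w) (HSC (SgHS sa)); first by move/(_ aw).
have hfa : ~` hs f `<=` a by move=> x nx; apply: contrapT => /hsub.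
have sf : Sg (~` hs f) by apply: Sg_down sa (HSC (HS_hs f)) hfa.
have fw : (~` hs f) w by rewrite -hf; exact: hs_src.
have fv := h _ sf fw.
apply: na; exists f => //.
have fe : ~ (~` hs f) (tgt e).
  by move=> /hfa; have := hs_tgt e; rewrite hea.
have := HS_out (HSC (HS_hs f)) _ fe; rewrite he setCK => /(_ fv) <-.
by [].
Qed.

Lemma push_step e : Sg (~` hs e) -> leS (src e) (tgt e) /\ leS (tgt e) (push (src e)).
Proof.
move=> se; split=> a sa.
  move=> ae; apply: contrapT => na; have h := HS_in (SgHS sa) na ae.
  by apply: (Sg_opp sa); rewrite -h.
move=> /(pushS _ sa)[ae na]; apply: contrapT => nat_; apply: na; exists e => //.
exact: HS_out (SgHS sa) ae nat_.
Qed.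

Definition pushn n v := iter n push v.

Lemma pushn_rv g n v : pushn n (rv g v) = rv g (pushn n v).
Proof. by elim: n => //= n ->; rewrite push_rv. Qed.

Lemma pushn_mono n v w : leS v w -> leS (pushn n v) (pushn n w).
Proof. by move=> h; elim: n => //= n; exact: push_mono. Qed.

Lemma pushnN n v a : HS a -> ~ Sg a -> ~ Sg (~` a) -> (a (pushn n v) <-> a v).
Proof.
by move=> ha h1 h2; elim: n => //= n IH; apply: iff_trans IH; exact: pushN.
Qed.

(** Along an edge that leaves a member of [Sg], the flow line of its end stays between the flow line
    of its start and the next step of that line, at most [D] further. If neither side of the edge is
    in [Sg], both ends are equally advanced and stay at distance at most 1. *)
Lemma pushn_edge e n : (dist (pushn n (src e)) (pushn n (tgt e)) <= D.+1)%N.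
Proof.
have in_case f : Sg (~` hs f) -> (dist (pushn n (src f)) (pushn n (tgt f)) <= D)%N.
  move=> /[dup] sf /push_step[h1 h2]; apply: leq_trans (push_dist (pushn n (src f))).
  have k1 := pushn_mono (n := n) h1; have k2 := pushn_mono (n := n) h2.
  rewrite /pushn -iterSr -/(pushn _ _) in k2.
  apply: dist_le => a ha a1 na2; split=> // a3; apply: na2.
  have [sa|nsa] := pselect (Sg a); first exact: (k2 a sa a3).
  have [sa|nsa'] := pselect (Sg (~` a)).
    by apply: contrapT => na2; exact: (k1 _ sa na2 a1).
  apply/(pushnN n _ ha nsa nsa'); move/(pushnN n _ ha nsa nsa'): a1 => a1.
  apply: contrapT => nat_; have h := HS_out ha a1 nat_.
  by apply: nsa; move: sf; rewrite h setCK.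
have [se|nse] := pselect (Sg (~` hs e)); first exact: leqW (in_case _ se).
have [se|nse'] := pselect (Sg (hs e)).
  have := in_case (opp e); rewrite hs_opp setCK src_opp tgt_opp distC => h.
  exact: leqW (h se).
have hS : leS (src e) (tgt e) /\ leS (tgt e) (src e).
  split=> a sa h; apply: contrapT => na.
    by apply: nse'; rewrite (HS_in (SgHS sa) na h).
  by apply: nse; rewrite (HS_out (SgHS sa) h na) setCK.
apply: (@leq_trans 1%N) => //; rewrite -(dist_edge e).
apply: dist_le => a ha a1 na2.
have [sa|nsa] := pselect (Sg a); first by case: na2; exact: (pushn_mono (n := n) hS.2 sa a1).
have [sa|nsa'] := pselect (Sg (~` a)).
  by case: (pushn_mono (n := n) hS.1 sa na2 a1).
split; first by move/(pushnN n _ ha nsa nsa'): a1.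
by move/(pushnN n _ ha nsa nsa') => h; exact: na2.
Qed.

Lemma pushn_dist n u v : (dist (pushn n u) (pushn n v) <= D.+1 * dist u v)%N.
Proof.
have [s hs hr] := geo u v; rewrite (distE hs hr) {hr}.
elim: s u hs => [|e s IH] u /=; first by move=> ->; rewrite distxx.
move=> [<- /IH h]; apply: leq_trans (dist_triangle _ (pushn n (tgt e)) _) _.
by rewrite mulnS; apply: leq_add h; exact: pushn_edge.
Qed.

(** Write the flow line of [v0] as translates [rv (gam i) (rr i)] of representatives, and conjugate
    by [gam i] the finitely many generators supplied by [gen_bounded]. By [pushn_dist] the
    conjugates displace [rr i] boundedly, so only finitely many tuples occur. Two times with the
    same tuple give an element that commutes with the generators. *)
Lemma commuting_elt v0 : exists z i m, [/\ (0 < m)%N, forall g, (z * g = g * z)%g &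
  rv z (pushn i v0) = pushn (i + m) v0].
Proof.
have [n hgen] := gen_bounded v0; have [A hA] := finball v0 v0 n.
have [gam hgam] : {gam : nat -> Gamma & forall i, exists2 r, List.In r Reps &
    pushn i v0 = rv (gam i) r}.
  apply: (@choice _ _ (fun i g => exists2 r, List.In r Reps & pushn i v0 = rv g r)).
  by move=> i; have [g [r [h1 h2]]] := horb (pushn i v0); exists g, r.
have [rr hrr] : {rr : nat -> vtx S & forall i, List.In (rr i) Reps /\
    pushn i v0 = rv (gam i) (rr i)}.
  apply: (@choice _ _ (fun i r => List.In r Reps /\ pushn i v0 = rv (gam i) r)) => i.
  by have [r h1 h2] := hgam i; exists r.
have [A' [_ hA']] := @list_filter _ (fun g => (dist v0 (rv g v0) <= n)%N) A hA.
have [L hL] := finball_reps (D.+1 * n).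
have [LL hLL] := list_tuples L (size A').
pose F i := (rr i, map (fun x => (gam i)^-1 * x * gam i)%g A').
have hF i : List.In (F i) (List.list_prod Reps LL).
  apply/List.in_prod; first by have [] := hrr i.
  apply: hLL; first by rewrite size_map.
  move=> y /in_mapP[x /hA' hx <-]; have [h1 h2] := hrr i; apply: hL h1 _.
  rewrite -(dist_rv (gam i)) -rvM !mulgA mulgV mul1g rvM -h2 -pushn_rv.
  by apply: leq_trans (pushn_dist _ _ _) _; rewrite leq_mul2l hx orbT.
have [i [j [hij hFij]]] := pigeonhole hF.
case: hFij => hr hx; have [_ hi] := hrr i; have [_ hj] := hrr j.
exists (gam j * (gam i)^-1)%g, i, (j - i)%N; split.
- by rewrite subn_gt0.
- move=> g; apply: (hgen [set g | (gam j * (gam i)^-1 * g = g * (gam j * (gam i)^-1))%g]).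
    move=> x y /= h1 h2; rewrite mulgA h1 -mulgA h2.
    by rewrite mulgA.
  move=> x /hA' hx' /=.
  have hxx : ((gam i)^-1 * x * gam i = (gam j)^-1 * x * gam j)%g.
    elim: (A') hx hx' => //= y l IH [h1 h2] [<-//|/(IH h2)//].
  have -> : (gam j * (gam i)^-1 * x = gam j * ((gam i)^-1 * x * gam i) * (gam i)^-1)%g.
    by rewrite !mulgA mulgK.
  by rewrite hxx !mulgA mulgV mul1g.
- by rewrite subnKC ?(ltnW hij) // hi hj hr -rvM mulgVK.
Qed.

(** The flow commutes with the group, so [z ^+ n] moves [w] to its position on the flow line at time
    [n * m]. A member of [Sg] adjacent to [w] is left at the first step and never entered again. *)
Lemma central_elt : exists z l w, [/\ forall g, (z * g = g * z)%g, HS l, l w &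
  forall n, (0 < n)%N -> ~ l (rv (z ^+ n)%g w)].
Proof.
have [a ha] := hne; have [v0 _] := HS_neq0 ha.
have [z [i [m [hm hz hzi]]]] := commuting_elt v0.
set w := pushn i v0 in hzi.
have hzw n : rv (z ^+ n)%g w = pushn (n * m) w.
  elim: n => [|n IH]; first by rewrite expg0 rv1.
  rewrite expgS rvM IH -pushn_rv hzi addnC /pushn iterD -/(pushn i v0) -/w.
  by rewrite -iterD mulSnr.
have [b sb bw] := Sg_cover w.
have [|f [hf hsub]] := HS_step (u := w) (HSC (SgHS sb)); first by move/(_ bw).
have hfb : ~` hs f `<=` b by move=> x nx; apply: contrapT => /hsub.
have sf : Sg (~` hs f) by apply: Sg_down sb (HSC (HS_hs f)) hfb.
exists z, (~` hs f), w; split=> //; first exact: SgHS.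
  by rewrite -hf; exact: hs_src.
move=> n n0; rewrite hzw; case: (n * m)%N (muln_gt0 n m) => [|k _].
  by rewrite n0 hm.
elim: k => [|k IH] /=; last by move/(leS_push sf).
by move/(pushS _ sf) => [_]; apply; exists f; rewrite ?setCK.
Qed.

End Unflippable.

(** [Sg] consists of the halfspaces inside translates of the complement of the unflippable [h0]. A
    complementary pair in it would put a translate of [h0] inside the complement of another
    translate, that is, give a flip; [orbit_dense] makes it cover all vertices. *)
Lemma unflip_central : ~ (forall a, HS a -> flippable a) ->
  exists z l w, [/\ forall g, (z * g = g * z)%g, HS l, l w &
  forall n, (0 < n)%N -> ~ l (rv (z ^+ n)%g w)].
Proof.
move=> /existsNP[h0 /not_implyP[hh0 hnf]].
apply: (@central_elt [set l | HS l /\ exists g, l `<=` ga g (~` h0)]).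
- by move=> a [].
- by move=> a b [_ [g hg]] hb ba; split=> //; exists g; exact: subset_trans ba hg.
- move=> a [_ [g hg]] [_ [g' hg']]; apply: hnf; exists (g'^-1 * g)%g.
  have h1 : ga g h0 `<=` ga g' (~` h0).
    move=> v hv; apply: hg' => av; exact: (hg _ av hv).
  by rewrite gaM; have := @ga_sub g'^-1%g _ _ h1; rewrite gaK.
- move=> g a [ha [k hk]]; split; first exact: HS_ga.
  by exists (g * k)%g; rewrite gaM; exact: ga_sub.
- move=> v; have [g hg] := orbit_dense v (HSC hh0).
  exists (ga g^-1%g (~` h0)).
    by split; [apply: HS_ga; exact: HSC|exists g^-1%g].
  by rewrite /ga /= invgK.
Qed.

Lemma list_bound (T : Type) (L : seq T) (P : T -> nat -> Prop) :
  (forall x, List.In x L -> exists n, P x n) ->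
  (forall x n m, (n <= m)%N -> P x n -> P x m) ->
  exists n, forall x, List.In x L -> P x n.
Proof.
move=> + hm; elim: L => [|x L IH] h; first by exists 0%N.
have [n hn] := h x (or_introl erefl).
have [|m hm'] := IH; first by move=> y hy; apply: h; right.
exists (n + m)%N => y [<-|hy]; first by apply: hm hn; rewrite leq_addr.
by apply: hm (hm' _ hy); rewrite leq_addl.
Qed.

Lemma HS_orbits : exists L : seq (set (vtx S)), (forall a, List.In a L -> HS a) /\
  forall a, HS a -> exists g b, List.In b L /\ a = ga g b.
Proof.
have [L hL] : exists L : seq (edg S), forall e, List.In (src e) Reps -> List.In e L.
  elim: Reps => [|r l [L IH]]; first by exists [::].
  have [L1 [_ h1]] := hdeg r; exists (L1 ++ L) => e h; apply/List.in_or_app.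
  by case: h => [/esym/h1|/IH]; [left|right].
exists (map (@hs S) L); split; first by move=> a /in_mapP[e _ <-]; exact: HS_hs.
move=> a [e ->]; have [g [r [hr he]]] := horb (src e).
exists g, (hs (re g^-1%g e)); split; last by rewrite -hs_re reVK.
by apply/in_mapP; exists (re g^-1%g e) => //; apply: hL; rewrite src_re he rvK.
Qed.

(** * A central element under which every halfspace is nested with its image *)

Section Skew.
Variable z : Gamma.
Hypothesis zC : forall g, (z * g = g * z)%g.
Hypothesis zskew : forall a, HS a -> ga z a `<=` a \/ a `<=` ga z a.
Hypothesis zaper : forall a n, HS a -> (0 < n)%N -> gi z n a <> a.

Definition zs (k : int) a :=
  match k with Posz n => gi z n a | Negz n => gi z^-1%g n.+1 a end.

Lemma zs_succ k a : zs (k + 1) a = ga z (zs k a).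
Proof.
case: k => n; first by have -> : n%:Z + 1 = n.+1%:Z by lia.
case: n => [|n]; first by have -> : Negz 0 + 1 = 0 by []; rewrite /= gaVK.
have -> : Negz n.+1 + 1 = Negz n by lia.
by rewrite /= gaVK.
Qed.

Lemma zs_pred k a : zs (k - 1) a = ga z^-1%g (zs k a).
Proof. by rewrite -[in RHS](subrK 1 k) zs_succ gaK. Qed.

Lemma zsD i j a : zs (i + j) a = zs i (zs j a).
Proof.
elim: i => [|n IH|n IH]; first by rewrite add0r.
- have -> : n.+1%:Z + j = n%:Z + j + 1 by lia.
  by rewrite zs_succ IH -zs_succ; congr zs; lia.
- have -> : - n.+1%:Z + j = - n%:Z + j - 1 by lia.
  by rewrite zs_pred IH -zs_pred; congr zs; lia.
Qed.

Lemma zsK k a : zs (- k) (zs k a) = a.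
Proof. by rewrite -zsD addNr. Qed.

Lemma zs_ind (P : set (vtx S) -> set (vtx S) -> Prop) :
  (forall a, P a a) -> (forall g a b, P a b -> P a (ga g b)) -> forall k a, P a (zs k a).
Proof.
move=> h0 h1 [] n a /=; first by elim: n => //= n; exact: h1.
by apply: (h1); elim: n => //= n; exact: h1.
Qed.

Lemma HS_zs k a : HS a -> HS (zs k a).
Proof. by apply: (@zs_ind (fun a b => HS a -> HS b)) => // g b c h /h; exact: HS_ga. Qed.

Lemma zs_sub k a b : a `<=` b -> zs k a `<=` zs k b.
Proof. by case: k => n h; exact: gi_sub. Qed.

Lemma zs_neq0 k a : a !=set0 -> zs k a !=set0.
Proof. by apply: (@zs_ind (fun a b => a !=set0 -> b !=set0)) => // g b c h /h; exact: ga_neq0. Qed.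

Lemma zsC k a : zs k (~` a) = ~` zs k a.
Proof. by case: k => n; exact: giC. Qed.

Lemma ga_zs g k a : ga g (zs k a) = zs k (ga g a).
Proof.
have h1 b : ga g (ga z b) = ga z (ga g b) by rewrite -!gaM zC.
have h2 b : ga g (ga z^-1%g b) = ga z^-1%g (ga g b).
  by rewrite -(gaK z (ga g (ga z^-1%g b))) -h1 gaVK.
case: k => n /=; first by elim: n => //= n IH; rewrite h1 IH.
by rewrite h2; congr ga; elim: n => //= n IH; rewrite h2 IH.
Qed.

Definition pos a := HS a /\ ga z a `<=` a.

Lemma pos_or a : HS a -> pos a \/ pos (~` a).
Proof.
move=> ha; case: (zskew ha) => h; [by left|right; split; first exact: HSC].
by rewrite gaC => v; apply: contra_not => /h.
Qed.

Lemma pos_ga g a : pos a -> pos (ga g a).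
Proof.
move=> [ha h]; split; first exact: HS_ga.
by have := ga_zs g 1 a; rewrite /= => <-; exact: ga_sub.
Qed.

Lemma pos_zs k a : pos a -> pos (zs k a).
Proof. by apply: (@zs_ind (fun a b => pos a -> pos b)) => // g b c h /h; exact: pos_ga. Qed.

Lemma zs_mono a i j : pos a -> i <= j -> zs j a `<=` zs i a.
Proof.
move=> [ha h] hij; have [n ->] : exists n : nat, j = i + n%:Z.
  by exists (absz (j - i)%R); lia.
rewrite zsD; apply: zs_sub; elim: n => //= n IH.
apply: subset_trans h; exact: ga_sub.
Qed.

Lemma zs_inj a i j : HS a -> zs i a = zs j a -> i = j.
Proof.
move=> ha; wlog hij : i j / i <= j => [hw|] hz.
  have /orP[h|h] : (i <= j) || (j <= i) by lia.
    exact: hw.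
  by apply/esym; exact: hw.
apply: contrapT => hnij; have [n hn] : exists n : nat, j = i + n.+1%:Z.
  by exists (absz (j - i - 1)%R); lia.
have := @zaper a n.+1 ha; apply=> //.
by rewrite -[RHS](zsK i) hz hn zsD zsK.
Qed.

Lemma zs_absorb a v : pos a -> exists k : nat, zs (- k%:Z) a v.
Proof.
move=> pa; apply: contrapT => hn; have [t at_] := HS_neq0 pa.1.
apply: (@no_inf_sep _ (fun k : nat => zs (- k%:Z) a) t v).
  by move=> i j /(zs_inj pa.1); lia.
move=> n; split; [exact: HS_zs pa.1| |by move=> h; apply: hn; exists n].
have := @zs_mono a (- n%:Z) 0 pa; apply=> //; lia.
Qed.

Lemma zs_escape a v : pos a -> exists k : nat, ~ zs k%:Z a v.
Proof.
move=> pa; apply: contrapT => hn; have [t nat_] := HS_neq0 (HSC pa.1).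
apply: (@no_inf_sep _ (fun k : nat => zs k%:Z a) v t).
  by move=> i j /(zs_inj pa.1) [].
move=> n; split; [exact: HS_zs pa.1|by apply: contrapT => h; apply: hn; exists n|].
by move=> h; apply: nat_; have := @zs_mono a 0 n%:Z pa; apply=> //; lia.
Qed.

(** Among the translates of a positive halfspace by powers of [z], the first one that misses [w0]
    contains [rv z w0]; only finitely many halfspaces separate these two vertices. *)
Lemma zs_reps w0 : exists L, forall b, pos b -> exists k b',
  [/\ List.In b' L, pos b' & b' = zs k b].
Proof.
have [L [hL _]] := fin_sep (rv z w0) w0; exists L => b pb.
have [k0 h0] := zs_absorb w0 pb; have [k1 h1] := zs_escape w0 pb.
have hex : exists n : nat, `[< ~ zs (- k0%:Z + n%:Z) b w0 >].
  by exists (k0 + k1)%N; apply/asboolP; have -> : - k0%:Z + (k0 + k1)%N%:Z = k1%:Z by lia.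
case: (ex_minnP hex) => -[|n] /asboolP hn hmin; first by rewrite addr0 in hn.
exists (- k0%:Z + n.+1%:Z), (zs (- k0%:Z + n.+1%:Z) b); split=> //; last exact: pos_zs.
apply: hL => //; first exact: HS_zs pb.1.
have -> : - k0%:Z + n.+1%:Z = - k0%:Z + n%:Z + 1 by lia.
rewrite zs_succ; apply/gaE; apply: contrapT => h.
by have := hmin n; rewrite ltnn => hf; suff : false by []; apply: hf; apply/asboolP.
Qed.

Definition dom a b := exists n : nat, zs n%:Z b `<=` a.

Lemma dom_trans a b c : dom a b -> dom b c -> dom a c.
Proof.
move=> [n hn] [m hm]; exists (n + m)%N; rewrite PoszD zsD.
by apply: subset_trans hn; apply: zs_sub.
Qed.

(* If a dominated b but not conversely, pigeonhole on the finitely many z-classes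
   of halfspaces yields an element translating b against a arbitrarily far. *)
Lemma dom_sym a b : pos a -> pos b -> dom a b -> dom b a.
Proof.
move=> pa pb [k0 hk0]; apply: contrapT => hn.
have [a1 ha1] := hne; have [w0 _] := HS_neq0 ha1.
have [L hL] := zs_reps w0.
have [K hK] : exists K : nat, forall r, List.In r Reps -> forall c, List.In c L -> pos c ->
    ~ zs K%:Z c r /\ zs (- K%:Z) c r.
  apply: (@list_bound _ Reps (fun r K => forall c, List.In c L -> pos c ->
    ~ zs K%:Z c r /\ zs (- K%:Z) c r)).
    move=> r _; apply: (@list_bound _ L (fun c K => pos c ->
      ~ zs K%:Z c r /\ zs (- K%:Z) c r)).
      move=> c _; have [pc|npc] := pselect (pos c); last by exists 0%N.
      have [k1 h1] := zs_absorb r pc; have [k2 h2] := zs_escape r pc.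
      exists (k1 + k2)%N => _; split.
        by apply: contra_not h2; apply: (zs_mono pc); lia.
      by apply: (zs_mono pc _ h1); lia.
    move=> c n m hnm h pc; have [h1 h2] := h pc; split.
      by apply: contra_not h1; apply: (zs_mono pc); lia.
    by apply: (zs_mono pc _ h2); lia.
  move=> r n m hnm h c hc pc; have [h1 h2] := h c hc pc; split.
    by apply: contra_not h1; apply: (zs_mono pc); lia.
  by apply: (zs_mono pc _ h2); lia.
pose P (n : nat) (d : Gamma * (int * int) * (set (vtx S) * set (vtx S))) :=
  [/\ List.In d.2.1 L, List.In d.2.2 L, a = zs d.1.2.1 (ga d.1.1 d.2.1),
      b = zs d.1.2.2 (ga d.1.1 d.2.2) & n%:Z - 2 * K%:Z < d.1.2.2 - d.1.2.1].
have [d hd] : {d : nat -> _ & forall n, P n (d n)}.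
  apply: choice => n.
  have /existsNP[v /not_implyP[av nbv]] : ~ (zs n%:Z a `<=` b).
    by move=> h; apply: hn; exists n.
  have [g [r [hr hv]]] := horb v.
  have [i [a' [ha' pa' ea']]] := hL _ (pos_ga g^-1%g pa).
  have [j [b' [hb' pb' eb']]] := hL _ (pos_ga g^-1%g pb).
  have ea : a = zs (- i) (ga g a') by rewrite ea' ga_zs gaVK zsK.
  have eb : b = zs (- j) (ga g b') by rewrite eb' ga_zs gaVK zsK.
  exists (g, (- i, - j), (a', b')); split=> //=.
  have h1 : zs (n%:Z - i) a' r.
    by move: av; rewrite hv [in zs n%:Z a]ea -zsD -ga_zs => /gaE.
  have h2 : ~ zs (- j) b' r.
    by move: nbv; rewrite hv eb -ga_zs => h h'; apply: h; apply/gaE.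
  have [k1 _] := hK _ hr _ ha' pa'; have [_ k2] := hK _ hr _ hb' pb'.
  have l1 : n%:Z - i < K%:Z.
    by rewrite ltNge; apply/negP => h; apply: k1; exact: (zs_mono pa' h h1).
  have l2 : - K%:Z < - j.
    by rewrite ltNge; apply/negP => h; apply: h2; exact: (zs_mono pb' h k2).
  by lia.
(* [delta n] exceeds [n - 2K], so the times [sq_ k] can be spaced to make it strictly increase. Two
   of these times share their representatives and therefore differ in their shifts. *)
pose delta n := (d n).1.2.2 - (d n).1.2.1.
pose nx n := (`|delta n| + 2 * K + 1)%N.
have hnx n : delta n < delta (nx n).
  by have [_ _ _ _] := hd (nx n); rewrite -/(delta (nx n)) /nx; lia.
pose sq_ k := iter k nx 0%N.
have hinc k l : (k < l)%N -> delta (sq_ k) < delta (sq_ l).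
  elim: l => // l IH; rewrite ltnS leq_eqVlt => /orP[/eqP ->|/IH h]; first exact: hnx.
  exact: lt_trans h (hnx _).
have [k [l [hkl hkl2]]] := @pigeonhole _ (fun k => (d (sq_ k)).2) (List.list_prod L L)
  (fun k => let: And5 h1 h2 _ _ _ := hd (sq_ k) in
     eq_ind_r (fun x => List.In x _) (proj2 (List.in_prod_iff L L _ _) (conj h1 h2))
       (surjective_pairing (d (sq_ k)).2)).
have {hinc} hlt := hinc _ _ hkl.
have [_ _ ea1 eb1 _] := hd (sq_ k); have [_ _ ea2 eb2 _] := hd (sq_ l).
move: hlt; rewrite /delta.
case: (d (sq_ k)) (d (sq_ l)) hkl2 ea1 eb1 ea2 eb2 => [[g1 [i1 j1]] [a' b']] [[g2 [i2 j2]] ab] /= <- /=.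
move=> ea1 eb1 ea2 eb2 hlt {d hd delta nx hnx sq_ hkl P hK}.
pose g := (g2 * g1^-1)%g.
have ga_ : ga g a = zs (i1 - i2) a.
  by rewrite [in LHS]ea1 [in RHS]ea2 ga_zs /g gaM gaK -zsD subrK.
have gb_ : ga g b = zs (j1 - j2) b.
  by rewrite [in LHS]eb1 [in RHS]eb2 ga_zs /g gaM gaK -zsD subrK.
(* Under [g] the shift of [b] grows less than that of [a]. After enough applications the inclusion
   [hk0] puts arbitrarily negative shifts of [b] inside [a], but these exhaust all vertices. *)
have hit s : zs (k0%:Z + s%:Z * (j1 - j2)) b `<=` zs (s%:Z * (i1 - i2)) a.
  elim: s => [|s IH]; first by rewrite !mul0r addr0.
  have := @ga_sub g _ _ IH; rewrite !ga_zs ga_ gb_ -!zsD.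
  have -> : k0%:Z + s%:Z * (j1 - j2) + (j1 - j2) = k0%:Z + s.+1%:Z * (j1 - j2) by lia.
  by have -> : s%:Z * (i1 - i2) + (i1 - i2) = s.+1%:Z * (i1 - i2) by lia.
have [v nav] := HS_neq0 (HSC pa.1); apply: nav.
have [t ht] := zs_absorb v pb.
pose s := (k0 + t)%N; have := @zs_sub (- (s%:Z * (i1 - i2))) _ _ (hit s) v.
rewrite zsK -zsD; apply; apply: (zs_mono pb _ ht).
rewrite /s; nia.
Qed.

Lemma pos_inter a b v : pos a -> pos b -> exists k : nat, zs (- k%:Z) a v /\ zs (- k%:Z) b v.
Proof.
move=> pa pb; have [k hk] := zs_absorb v pa; have [l hl] := zs_absorb v pb.
by exists (k + l)%N; split; [apply: (zs_mono pa _ hk)|apply: (zs_mono pb _ hl)]; lia.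
Qed.

(** Negative powers of [z] bring a given vertex into both halfspaces and positive powers remove it
    from both, so the two are neither disjoint nor covering; what remains is nesting. *)
Lemma pos_ncross a b : pos a -> pos b -> ~ cross a b -> a `<=` b \/ b `<=` a.
Proof.
have [a1 ha1] := hne; have [v _] := HS_neq0 ha1.
move=> pa pb /ncrossP[h|h|h|h]; [|by left|by right|].
  have [k [h1 h2]] := pos_inter v pa pb.
  have : (zs k%:Z (zs (- k%:Z) a `&` zs (- k%:Z) b)) !=set0.
    by apply: zs_neq0; exists v.
  have -> : zs (- k%:Z) a `&` zs (- k%:Z) b = zs (- k%:Z) (a `&` b).
    by case: (- k%:Z) => n; elim: n => //= n <-.
  by rewrite -zsD subrr /= h => -[].
have [k hk] := zs_escape v pa; have [l hl] := zs_escape v pb.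
have h1 : ~ zs (k + l)%N%:Z a v by apply: contra_not hk; apply: (zs_mono pa); lia.
have h2 : ~ zs (k + l)%N%:Z b v by apply: contra_not hl; apply: (zs_mono pb); lia.
by case: h2; have := @zs_sub (k + l)%N%:Z _ _ h; rewrite zsC; apply.
Qed.

(** Mutual domination passes along non-crossing pairs, so by irreducibility [a] and any positive
    halfspace dominate each other. As there are finitely many classes under powers of [z], a single
    [n] serves for all. A hyperplane crossing both [a] and [zs t%:Z a] is then trapped between
    shifts that force [t < 2 * n]. *)
Lemma skew_strongly : skewers_strongly.
Proof.
have [a [pa]] : exists a, pos a /\ True.
  by have [a ha] := hne; case: (pos_or ha) => h; eexists; split=> //; exact: h.
move=> _; have ha := pa.1.
have [w0 _] := HS_neq0 ha; have [L hL] := zs_reps w0.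
have hdom b : pos b -> dom a b /\ dom b a.
  move=> pb; suff h : dom a b by split=> //; exact: dom_sym.
  have : [set b | exists c, [/\ c = b \/ c = ~` b, pos c & dom a c]] b.
    apply: hirr pb.1 => [x [c [[<-|hc] [pc _] _]]//|x y [c [hc pc hac]] hy nQ|].
    - by rewrite -(setCK x) -hc; exact: HSC.
    - apply: contrapT => nxy; apply: nQ.
      have [c' [hc' pc']] : exists c', (c' = y \/ c' = ~` y) /\ pos c'.
        by case: (pos_or hy) => h; eexists; split; [left|exact: h|right|exact: h].
      exists c'; split=> //.
      have ncc : ~ cross c c'.
        move=> h; apply: nxy; case: hc h => ->; case: hc' => -> //.
        + by move/cross_setCr; rewrite setCK.
        + by move/cross_setCl; rewrite setCK.
        + by move/cross_setCl/cross_setCr; rewrite !setCK.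
      case: (pos_ncross pc pc' ncc) => h; apply: (dom_trans hac); last by exists 0%N.
      by apply: dom_sym => //; exists 0%N.
    - by exists a, a; split; [left| |exists 0%N].
  move=> [c [[->//|hc] pc hac]]; exfalso.
  have [k [h1 h2]] := pos_inter w0 pb pc.
  by move: h2; rewrite hc zsC.
have [n hn] : exists n : nat, forall c, List.In c L -> pos c ->
    zs n%:Z c `<=` a /\ zs n%:Z a `<=` c.
  apply: (@list_bound _ L (fun c n => pos c -> zs n%:Z c `<=` a /\ zs n%:Z a `<=` c)).
    move=> c _; have [pc|npc] := pselect (pos c); last by exists 0%N.
    have [[n hn] [m hm]] := hdom c pc; exists (n + m)%N => _; split.
      by apply: subset_trans hn; apply: (zs_mono pc); lia.
    by apply: subset_trans hm; apply: (zs_mono pa); lia.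
  move=> c i j hij h pc; have [h1 h2] := h pc; split.
    by apply: subset_trans h1; apply: (zs_mono pc); lia.
  by apply: subset_trans h2; apply: (zs_mono pa); lia.
have hst m t : pos m -> cross m a -> cross m (zs t%:Z a) -> (t < 2 * n)%N.
  move=> pm ma mt; have [k [c [hc pc ec]]] := hL m pm.
  have [h1 h2] := hn c hc pc.
  have l1 : - n%:Z < k.
    rewrite ltNge; apply/negP => hk.
    case: ma => _ [v [mv nav]] _ _; apply: nav; apply: h1; rewrite ec -zsD.
    have := @zs_mono m (n%:Z + k) 0 pm; apply=> //; lia.
  have l2 : t%:Z < n%:Z - k.
    rewrite ltNge; apply/negP => hk.
    case: mt => _ _ [v [nmv av]] _; apply: nmv.
    have h3 := @zs_sub (- k) _ _ h2; rewrite ec zsK -zsD in h3; apply: h3.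
    have := @zs_mono a (- k + n%:Z) t%:Z pa; apply=> //; lia.
  by lia.
exists (z ^+ (2 * n).+1)%g, a; rewrite -giE; split=> //.
- exact: (@zs_mono a 0 (2 * n).+1%:Z pa).
- exact: zaper.
move=> m hm ma mt; have key x : pos x -> cross x a -> cross x (gi z (2 * n).+1 a) -> False.
  by move=> px xa /(hst x _ px xa); lia.
case: (pos_or hm) => pm; first exact: key pm ma mt.
by apply: (key (~` m) pm); exact: cross_setCl.
Qed.

End Skew.

(** * From a central element to one that nests every halfspace *)

Section Central.
Variable z : Gamma.
Hypothesis zC : forall g, (z * g = g * z)%g.
Variables (l0 : set (vtx S)) (w0 : vtx S).
Hypothesis hl0 : HS l0.
Hypothesis l0w0 : l0 w0.
Hypothesis l0z : forall n, (0 < n)%N -> ~ l0 (rv (z ^+ n)%g w0).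

(** A central element displaces equivalent vertices equally, hence all vertices by at most some [K];
    an orbit that starts deeper than [n * K] in [a] stays there for [n] steps. *)
Lemma deep_orbit a n : HS a -> exists u, forall i, (i <= n)%N -> a (rv (z ^+ i)%g u).
Proof.
move=> ha.
have [K hK] : exists K : nat, forall r, List.In r Reps -> (dist r (rv z r) <= K)%N.
  apply: (@list_bound _ Reps (fun r K => (dist r (rv z r) <= K)%N)).
    by move=> r _; exists (dist r (rv z r)).
  by move=> r i j hij h; exact: leq_trans h hij.
have hKv v : (dist v (rv z v) <= K)%N.
  have [g [r [hr ->]]] := horb v; rewrite -rvM zC rvM dist_rv; exact: hK.
have [b [hb _ h]] := deep (n * K) ha; have [u bu] := HS_neq0 hb.
exists u => i hi; apply: h bu _; apply: (@leq_trans (i * K)); last by rewrite leq_mul2r hi orbT.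
elim: i {hi} => [|i IH]; first by rewrite expg0 rv1 distxx.
apply: leq_trans (dist_triangle _ (rv (z ^+ i)%g u) _) _.
rewrite mulSn addnC; apply: leq_add IH; rewrite expgSr rvM dist_rv; exact: hKv.
Qed.

(** Some iterate does not cross [a]. Disjointness and covering are excluded by orbits that remain
    long enough in [a], or in its complement. *)
Lemma dichotomy a : HS a -> exists2 n, (0 < n)%N & gi z n a `<=` a \/ a `<=` gi z n a.
Proof.
move=> ha; have [n n0 hn] := no_inf_cross_gi z ha; exists n => //.
case: (ncrossP hn) => h; [|by right|by left|].
  have [u hu] := deep_orbit n ha.
  have : (a `&` gi z n a) (rv (z ^+ n)%g u).
    by split; [exact: hu|rewrite giE; apply/gaE; have := hu 0%N isT; rewrite expg0 rv1].
  by rewrite h.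
have [u hu] := deep_orbit n (HSC ha).
have h1 := h _ (hu n (leqnn n)).
by move: h1; rewrite giE => /gaE; have := hu 0%N isT; rewrite expg0 rv1.
Qed.

Lemma gi_mul n k a : gi z (k * n) a = iter k (gi z n) a.
Proof. by elim: k => //= k IH; rewrite mulSn giD IH. Qed.

Lemma gi_mul_sub n k a : gi z n a `<=` a -> gi z (k * n) a `<=` a.
Proof.
move=> h; rewrite gi_mul; elim: k => //= k IH; apply: subset_trans h.
exact: gi_sub.
Qed.

Lemma gi_mul_sup n k a : a `<=` gi z n a -> a `<=` gi z (k * n) a.
Proof.
move=> h; rewrite gi_mul; elim: k => //= k IH; apply: subset_trans h _.
exact: gi_sub.
Qed.

Definition periodic a := exists2 n, (0 < n)%N & gi z n a = a.

Lemma gi_inj n a b : gi z n a = gi z n b -> a = b.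
Proof. by move=> h; rewrite -(giK z n a) h giK. Qed.

Lemma aper_inj a i j : ~ periodic a -> gi z i a = gi z j a -> i = j.
Proof.
move=> na; wlog hij : i j / (i <= j)%N => [hw|] h.
  by case/orP: (leq_total i j) => hh; [|apply/esym]; exact: hw.
apply: contrapT => hne_; apply: na; exists (j - i)%N; first by lia.
by apply: (@gi_inj i); rewrite -giD subnKC.
Qed.

Lemma periodicC a : periodic a -> periodic (~` a).
Proof. by move=> [n n0 h]; exists n => //; rewrite giC h. Qed.

(** A power of [z] fixes [a] and moves [b] monotonically through distinct halfspaces. Were one of
    the four intersections empty, infinitely many of these would separate the same two vertices. *)
Lemma skew_cross a b : HS a -> HS b -> periodic a -> ~ periodic b -> cross a b.
Proof.
have core x y n m : HS x -> HS y -> ~ periodic y -> (0 < n)%N -> (0 < m)%N ->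
    gi z n x = x -> gi z m y `<=` y -> x `&` y !=set0 /\ x `&` ~` y !=set0.
  move=> hx hy ny n0 m0 xx yy; pose M := (n * m)%N.
  have M0 : (0 < M)%N by rewrite muln_gt0 n0.
  have xM k : gi z (k * M) x = x.
    by rewrite /M mulnA mulnAC gi_mul; elim: (k * m)%N => //= i ->.
  have yM k : gi z (k * M) y `<=` y.
    by rewrite /M mulnA; exact: gi_mul_sub.
  have injM i j : (i * M = j * M)%N -> i = j by move=> /eqP; rewrite eqn_pmul2r // => /eqP.
  have [u xu] := HS_neq0 hx; split; apply: contrapT => /set0P/negP/negPn/eqP h0.
    have [t yt] := HS_neq0 hy.
    apply: (@no_inf_sep _ (fun k => gi z^-1%g (k * M) y) t u).
      move=> i j /= hij; apply: injM; apply: (@aper_inj y) => //.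
      by rewrite -[in LHS](giVK z (j * M) y) -hij -giD addnC giD giVK.
    move=> k; split; first exact: HS_gi.
      have := @gi_sub z^-1%g (k * M) _ _ (yM k); rewrite giK; exact.
    move=> yu; have : gi z^-1%g (k * M) (x `&` y) u.
      rewrite giE; split; last by rewrite giE in yu.
      suff : ga (z^-1 ^+ (k * M))%g x u by [].
      by rewrite -giE -[x](xM k) giK.
    by rewrite h0 giE.
  have hxy : x `<=` y.
    by move=> v xv; apply: contrapT => nyv; have : (x `&` ~` y) v by []; rewrite h0.
  have [t nyt] := HS_neq0 (HSC hy).
  apply: (@no_inf_sep _ (fun k => gi z (k * M) y) u t).
    by move=> i j /(aper_inj ny)/injM.
  move=> k; split; [exact: HS_gi| |by move/(yM k)].
  by have := @gi_sub z (k * M) _ _ hxy; rewrite xM; exact.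
have core2 x y : HS x -> HS y -> periodic x -> ~ periodic y ->
    x `&` y !=set0 /\ x `&` ~` y !=set0.
  move=> hx hy [n n0 xx] ny; have [m m0 [h|h]] := dichotomy hy.
    exact: (core x y n m).
  have [] := core x (~` y) n m hx (HSC hy) _ n0 m0 xx.
  - by move/periodicC; rewrite setCK.
  - by rewrite giC => v; apply: contra_not => /h.
  - by rewrite setCK.
move=> ha hb pa nb; have [h1 h2] := core2 _ _ ha hb pa nb.
by have [h3 h4] := core2 _ _ (HSC ha) hb (periodicC pa) nb.
Qed.

(** [l0] is aperiodic because it loses [w0] for ever. Periodic halfspaces would cross all aperiodic
    ones, so by irreducibility there are none. As [z] is central, the exponent of [dichotomy] is
    constant on orbits of halfspaces, and a product over the finitely many orbits serves for all. *)
Lemma central_strongly : skewers_strongly.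
Proof.
have nper a : HS a -> ~ periodic a.
  move=> ha; suff [] : [set b | HS b /\ ~ periodic b] a by [].
  apply: hirr ha => [b []//|b c [hb nb] hc nc|].
    apply: cross_sym; apply: skew_cross => //.
    by apply: contrapT => h; apply: nc.
  exists l0; split=> // -[n n0 h]; apply: (l0z n0).
  by rewrite -h giE; apply/gaE.
have [N N0 hN] : exists2 N, (0 < N)%N & forall a, HS a -> gi z N a `<=` a \/ a `<=` gi z N a.
  have [L [hL1 hL2]] := HS_orbits.
  have [N N0 hN] : exists2 N, (0 < N)%N & forall a, List.In a L ->
      gi z N a `<=` a \/ a `<=` gi z N a.
    elim: L hL1 {hL2} => [|b L IH] hL; first by exists 1%N.
    have [|N N0 hN] := IH; first by move=> a ha; apply: hL; right.
    have [m m0 hm] := dichotomy (hL b (or_introl erefl)).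
    exists (N * m)%N; first by rewrite muln_gt0 N0.
    move=> a [<-|/hN]; first by case: hm => h; [left; exact: gi_mul_sub|right; exact: gi_mul_sup].
    by rewrite mulnC; case=> h; [left; exact: gi_mul_sub|right; exact: gi_mul_sup].
  exists N => // a /hL2[g [b [/hN hb ->]]].
  have E : gi z N (ga g b) = ga g (gi z N b).
    rewrite !giE -!gaM; congr (ga _ b); apply/esym; elim: (N) => [|k IH].
      by rewrite expg0 mulg1 mul1g.
    by rewrite expgS mulgA -zC -mulgA IH mulgA.
  by rewrite E; case: hb => h; [left|right]; exact: ga_sub.
apply: (@skew_strongly (z ^+ N)%g).
- move=> g; elim: (N) => [|k IH]; first by rewrite expg0 mulg1 mul1g.
  by rewrite expgS -mulgA IH mulgA zC mulgA.
- by move=> a /hN; rewrite giE.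
- move=> a n ha n0 h; apply: (nper _ ha); exists (n * N)%N; first by rewrite muln_gt0 n0.
  by rewrite gi_mul -[RHS]h; apply: eq_iter => b; rewrite giE.
Qed.

End Central.

Theorem rigidity : skewers_strongly.
Proof.
have [h|h] := pselect (forall a, HS a -> flippable a).
  exact: dskew_strongly (flip_dskew h).
have [z [l [w [h1 h2 h3 h4]]]] := unflip_central h.
exact: (@central_strongly z h1 l w).
Qed.

End Rigidity.

(** * Isometries of cubes *)

Section CubeIsometry.
Variable R : realType.

(** Coordinates as offsets from the corner [w]. In such offsets an isometry between a face and a
    cube is a mere permutation. *)
Definition cpt n (w : {ffun 'I_n -> bool}) (t : 'I_n -> R) : 'rV[R]_n :=
  \row_i (if w i then 1 - t i else t i).

Definition off n (w : {ffun 'I_n -> bool}) (u : 'rV[R]_n) (i : 'I_n) : R :=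
  if w i then 1 - u 0 i else u 0 i.

Definition flip n (w : {ffun 'I_n -> bool}) (i : 'I_n) : {ffun 'I_n -> bool} :=
  [ffun j => if j == i then ~~ w j else w j].

Definition unit_box (I : Type) (t : I -> R) := forall i, 0 <= t i <= 1.

Lemma cptE n (w : {ffun 'I_n -> bool}) t i :
  cpt w t 0 i = if w i then 1 - t i else t i.
Proof. by rewrite mxE. Qed.

Lemma offK n (w : {ffun 'I_n -> bool}) u : cpt w (off w u) = u.
Proof.
by apply/rowP => i; rewrite cptE /off; case: (w i); rewrite // opprB addrC subrK.
Qed.

Lemma cptK n (w : {ffun 'I_n -> bool}) t : off w (cpt w t) = t.
Proof.
by apply/funext => i; rewrite /off cptE; case: (w i); rewrite // opprB addrC subrK.
Qed.

Lemma cpt_vertex n (w : {ffun 'I_n -> bool}) : cpt w (fun=> 0) = cube_vertex w.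
Proof. by apply/rowP => i; rewrite !mxE; case: (w i); rewrite ?subr0. Qed.

Lemma cube_cpt n (w : {ffun 'I_n -> bool}) t : cube (cpt w t) <-> unit_box t.
Proof.
by split=> h i; have := h i; rewrite cptE; case: (w i) => //; lra.
Qed.

Lemma cube_off n (w : {ffun 'I_n -> bool}) u : cube u -> unit_box (off w u).
Proof. by rewrite -{1}(offK w u) => /cube_cpt. Qed.

Lemma open_cpt n (w : {ffun 'I_n -> bool}) t :
  open_cube (cpt w t) <-> forall i, 0 < t i < 1.
Proof.
by split=> h i; have := h i; rewrite cptE; case: (w i) => //; lra.
Qed.

Lemma open_cube_cube n (u : 'rV[R]_n) : open_cube u -> cube u.
Proof. by move=> h i; have := h i; lra. Qed.

Definition ed2 n (u v : 'rV[R]_n) : R := \sum_(i < n) (u 0 i - v 0 i) ^+ 2.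

Lemma ed2_ge0 n (u v : 'rV[R]_n) : 0 <= ed2 u v.
Proof. by apply: sumr_ge0 => i _; exact: sqr_ge0. Qed.

Lemma ed2_cpt n (w : {ffun 'I_n -> bool}) t t' :
  ed2 (cpt w t) (cpt w t') = \sum_i (t i - t' i) ^+ 2.
Proof. by apply: eq_bigr => i _; rewrite !cptE; case: (w i) => //; ring. Qed.

Lemma ed2_off n (w : {ffun 'I_n -> bool}) u v :
  ed2 u v = \sum_i (off w u i - off w v i) ^+ 2.
Proof. by rewrite -{1}(offK w u) -{1}(offK w v) ed2_cpt. Qed.

Lemma euclid_ed2 n (u v : 'rV[R]_n) : euclid_dist u v = Num.sqrt (ed2 u v).
Proof. by []. Qed.

Lemma euclid_eq_ed2 m n (u v : 'rV[R]_m) (u' v' : 'rV[R]_n) :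
  euclid_dist u v = euclid_dist u' v' <-> ed2 u v = ed2 u' v'.
Proof.
rewrite !euclid_ed2; split=> [h|-> //].
by rewrite -[LHS]sqr_sqrtr ?ed2_ge0 // h sqr_sqrtr ?ed2_ge0.
Qed.

Lemma unit_vec (I : finType) (o : I -> R) : (forall j, o j = 0 \/ o j = 1) ->
  \sum_j o j ^+ 2 = 1 -> exists j, o j = 1 /\ forall k, k != j -> o k = 0.
Proof.
move=> h01 hs; have [j hj] : exists j, o j = 1.
  apply: contrapT => hn; move: hs; rewrite big1 => [/esym/eqP|i _]; first by rewrite oner_eq0.
  by case: (h01 i) => [->|h]; [rewrite expr0n|case: hn; exists i].
exists j; split=> // k hk; move: hs; rewrite (bigD1 j) //= hj expr1n.
move=> /eqP; rewrite -subr_eq0 addrAC subrr add0r => /eqP h.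
have /psumr_eq0P : forall i, i != j -> 0 <= o i ^+ 2 by move=> i _; exact: sqr_ge0.
by move=> /(_ h k hk) /eqP; rewrite sqrf_eq0 => /eqP.
Qed.

(* A point of a face is given by its offsets [t] from the corner [w]; an isometry
   onto a standard cube permutes the offsets. Corners are recognised as the points
   having a point at distance equal to the diameter. *)
Lemma face_iso m n (A : {set 'I_n}) w (h : 'rV[R]_n -> 'rV[R]_m) :
  euclid_isometry (cube_face A w) (@cube R m) h ->
  exists (w' : {ffun 'I_m -> bool}) (s : 'I_m -> 'I_n), [/\ injective s,
    forall i, i \notin A <-> exists j, s j = i &
    forall t, unit_box t -> (forall i, i \in A -> t i = 0) ->
      h (cpt w t) = cpt w' (t \o s)].
Proof.
case=> himg hiso.
have faceP t : unit_box t -> (forall i, i \in A -> t i = 0) -> cube_face A w (cpt w t).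
  move=> ht hA; split; first exact/cube_cpt.
  by move=> i iA; rewrite !mxE hA //; case: (w i); rewrite ?subr0.
have faceI u : cube_face A w u ->
    [/\ unit_box (off w u), forall i, i \in A -> off w u i = 0 & cpt w (off w u) = u].
  move=> [hu hA]; split; [exact: cube_off| |exact: offK].
  by move=> i iA; rewrite /off hA // mxE; case: (w i); rewrite ?subrr.
have hcube u : cube_face A w u -> cube (h u) by move=> hu; rewrite -himg; exists u.
have hed u v : cube_face A w u -> cube_face A w v -> ed2 (h u) (h v) = ed2 u v.
  by move=> hu hv; apply/euclid_eq_ed2; exact: hiso.
pose k := #|~: A|.
have sumA : \sum_(i < n) ((i \notin A)%:R : R) = k%:R.
  by rewrite /k -sum1_card natr_sum [RHS]big_mkcond /=; apply: eq_bigr => i _; rewrite inE; case: (i \in A).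
have ed_le u v : cube_face A w u -> cube_face A w v -> ed2 u v <= k%:R.
  move=> /faceI[hu hA _] /faceI[hv hA' _]; rewrite (ed2_off w) -sumA.
  apply: ler_sum => i _; have := hu i; have := hv i.
  case: (boolP (i \in A)) => iA; last by move=> /=; nra.
  by rewrite hA // hA' // subrr expr0n.
have mk : (m <= k)%N.
  have c0 : cube (const_mx 0 : 'rV[R]_m) by move=> i; rewrite mxE lexx ler01.
  have c1 : cube (const_mx 1 : 'rV[R]_m) by move=> i; rewrite mxE lexx ler01.
  move: c0 c1; rewrite -{1 2}himg => -[a ha ea] [b hb eb].
  have := ed_le b a hb ha; rewrite -hed // ea eb /ed2.
  rewrite (eq_bigr (fun=> 1)) => [|i _]; last by rewrite !mxE subr0 expr1n.
  by rewrite sumr_const card_ord ler_nat.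
have corner01 t : (forall i, t i = 0 \/ t i = 1) -> (forall i, i \in A -> t i = 0) ->
    m = k /\ forall j, h (cpt w t) 0 j = 0 \/ h (cpt w t) 0 j = 1.
  move=> h01 hA; pose t' i := (i \notin A)%:R - t i : R.
  have f1 : cube_face A w (cpt w t).
    by apply: faceP => // i; case: (h01 i) => ->; rewrite ?lexx ?ler01.
  have f2 : cube_face A w (cpt w t').
    apply: faceP => [i|i iA]; rewrite /t'; last by rewrite iA hA // subrr.
    case: (boolP (i \in A)) => iA; first by rewrite hA // subrr lexx ler01.
    by case: (h01 i) => ->; rewrite ?subr0 ?subrr /= ?lexx ?ler01.
  have hk : ed2 (h (cpt w t)) (h (cpt w t')) = k%:R.
    rewrite hed // ed2_cpt -sumA; apply: eq_bigr => i _; rewrite /t'.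
    case: (boolP (i \in A)) => iA; first by rewrite hA //= !subr0 expr0n.
    by case: (h01 i) => -> /=; ring.
  have hle j : (h (cpt w t) 0 j - h (cpt w t') 0 j) ^+ 2 <= 1.
    by have := hcube _ f1 j; have := hcube _ f2 j; nra.
  have km : (k <= m)%N.
    rewrite -(ler_nat R) -hk -[m in m%:R]card_ord -sumr_const.
    by apply: ler_sum => j _; exact: hle.
  have emk : m = k by apply/eqP; rewrite eqn_leq mk km.
  split=> // j.
  have h0 : \sum_(j < m) (1 - (h (cpt w t) 0 j - h (cpt w t') 0 j) ^+ 2) = 0.
    by rewrite sumrB sumr_const card_ord -/(ed2 _ _) hk emk subrr.
  have /psumr_eq0P /(_ h0 j isT) : forall j, true ->
      0 <= 1 - (h (cpt w t) 0 j - h (cpt w t') 0 j) ^+ 2.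
    by move=> j' _; rewrite subr_ge0 hle.
  have := hcube _ f1 j; have := hcube _ f2 j.
  set x := h (cpt w t) 0 j; set y := h (cpt w t') 0 j => hy hx hxy.
  have [hx2|hx2] : x - y = 1 \/ x - y = -1.
    have : (x - y - 1) * (x - y + 1) = 0 by rewrite -subr_sqr expr1n -opprB hxy oppr0.
    by move/eqP; rewrite mulf_eq0 subr_eq0 addr_eq0 => /orP[/eqP|/eqP]; [left|right].
  - by right; lra.
  - by left; lra.
have t0A : forall i : 'I_n, i \in A -> (fun=> 0 : R) i = 0 by [].
have [emk p01] := corner01 (fun=> 0) (fun i => or_introl erefl) t0A.
set p := h (cpt w (fun=> 0)) in p01.
pose w' : {ffun 'I_m -> bool} := [ffun j => p 0 j == 1].
have pw : p = cpt w' (fun=> 0).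
  apply/rowP => j; rewrite cptE ffunE subr0.
  by case: (p01 j) => ->; rewrite ?eqxx // eq_sym oner_eq0.
have f0 : cube_face A w (cpt w (fun=> 0)) by apply: faceP => // i; rewrite lexx ler01.
pose dl (i : 'I_n) : 'I_n -> R := fun i' => (i' == i)%:R.
have dl01 i i' : dl i i' = 0 \/ dl i i' = 1 by rewrite /dl; case: eqP; [right|left].
have dlA i : i \notin A -> forall i', i' \in A -> dl i i' = 0.
  by move=> iA i' i'A; rewrite /dl; case: eqP => // e; move: iA; rewrite -e i'A.
have fd i : i \notin A -> cube_face A w (cpt w (dl i)).
  by move=> iA; apply: faceP (dlA i iA) => i'; rewrite /dl; case: eqP; rewrite ?lexx ?ler01.
pose o i : 'I_m -> R := off w' (h (cpt w (dl i))).
have o01 i : i \notin A -> forall j, o i j = 0 \/ o i j = 1.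
  move=> iA j; have [_ /(_ j)] := corner01 _ (dl01 i) (dlA i iA).
  by rewrite /o /off; case: (w' j) => -[->|->]; rewrite ?subr0 ?subrr; auto.
have sum_dl i (f : 'I_n -> R) : \sum_i' dl i i' * f i' = f i.
  rewrite (bigD1 i) //= /dl eqxx mul1r big1 ?addr0 // => i' /negPf ->.
  by rewrite mul0r.
have o1 i : i \notin A -> \sum_j o i j ^+ 2 = 1.
  move=> iA; have := hed _ _ (fd i iA) f0; rewrite -/p pw (ed2_off w') cptK ed2_cpt.
  rewrite (eq_bigr (fun j => o i j ^+ 2)) => [->|j _]; last by rewrite subr0.
  rewrite -[RHS](sum_dl i (fun=> 1)); apply: eq_bigr => i' _.
  by rewrite subr0 mulr1; case: (dl01 i i') => ->; rewrite ?expr0n ?expr1n.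
(* Polarisation: the difference of the squared distances to the corner and to its [i]-th neighbour
   is affine in the [i]-th offset, and [h] preserves both distances. *)
have oE i t : i \notin A -> unit_box t -> (forall i, i \in A -> t i = 0) ->
    t i = \sum_j o i j * off w' (h (cpt w t)) j.
  move=> iA ht hA; have ft := faceP t ht hA.
  have e1 := hed _ _ ft (fd i iA); have e2 := hed _ _ ft f0.
  rewrite -/p pw !(ed2_off w') !cptK in e1 e2.
  rewrite -/(o i) in e1.
  have d1 : \sum_i' (t i' - dl i i') ^+ 2 - \sum_i' (t i' - 0) ^+ 2 = 1 - 2 * t i.
    rewrite -sumrB -[X in _ = X - _](sum_dl i (fun=> 1)) -(sum_dl i t) mulr_sumr -sumrB.
    by apply: eq_bigr => i' _ /=; case: (dl01 i i') => ->; ring.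
  set tau := off w' (h (cpt w t)) in e1 e2 *.
  have d2 : \sum_j (tau j - o i j) ^+ 2 - \sum_j (tau j - 0) ^+ 2 =
      1 - 2 * \sum_j o i j * tau j.
    by rewrite -[X in _ = X - _](o1 i iA) -sumrB mulr_sumr -sumrB; apply: eq_bigr => j _; ring.
  rewrite ed2_cpt in e1; rewrite ed2_cpt in e2; rewrite -e1 -e2 in d1.
  by move: d2; rewrite d1 => h2; lra.
have [r hr] : {r : 'I_n -> option 'I_m & forall i, i \notin A -> exists j,
    [/\ r i = Some j, o i j = 1 & forall k, k != j -> o i k = 0]}.
  apply: (@choice _ _ (fun i x => i \notin A -> exists j,
    [/\ x = Some j, o i j = 1 & forall k, k != j -> o i k = 0])) => i.
  case: (boolP (i \in A)) => iA; first by exists None.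
  have [j [h1 h2]] := unit_vec (o01 i iA) (o1 i iA).
  by exists (Some j) => _; exists j.
have sum_o i j (f : 'I_m -> R) : i \notin A -> r i = Some j -> \sum_j' o i j' * f j' = f j.
  move=> iA ri; have [j' [hj' h1 h2]] := hr i iA.
  have {}hj' : j' = j by move: hj'; rewrite ri => -[].
  rewrite -hj' (bigD1 j') //= h1 mul1r big1 ?addr0 // => k' hk.
  by rewrite h2 // mul0r.
have rinj : {in ~: A &, injective r}.
  move=> i i'; rewrite !inE => iA iA' e; have [j [rj oj _]] := hr i' iA'.
  have hu : unit_box (dl i') by move=> i2; rewrite /dl; case: eqP; rewrite ?lexx ?ler01.
  have := oE i (dl i') iA hu (dlA i' iA'); rewrite -/(o i') (sum_o i j) ?e // oj /dl.
  by case: eqP => // _ /esym/eqP; rewrite oner_eq0.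
have rimg : r @: (~: A) = Some @: [set: 'I_m]%SET.
  apply/eqP; rewrite eqEcard; apply/andP; split.
    apply/fintype.subsetP => x /imsetP[i]; rewrite inE => iA ->.
    by have [j [-> _ _]] := hr i iA; apply: imset_f; rewrite inE.
  rewrite (card_in_imset rinj) card_imset => [|x y []//].
  by rewrite cardsT card_ord -/k emk.
have [s hs] : {s : 'I_m -> 'I_n & forall j, s j \notin A /\ r (s j) = Some j}.
  apply: (@choice _ _ (fun j i => i \notin A /\ r i = Some j)) => j.
  have : Some j \in r @: (~: A) by rewrite rimg; apply: imset_f; rewrite inE.
  by move=> /imsetP[i]; rewrite inE => iA ->; exists i.
exists w', s; split.
- by move=> j j' e; have [_] := hs j; have [_] := hs j'; rewrite e => -> [].
- move=> i; split=> [iA|[j <-]]; last by have [] := hs j.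
  have [j [rj _ _]] := hr i iA; exists j; have [h1 h2] := hs j.
  by apply: rinj; rewrite ?inE // h2 rj.
- move=> t ht hA; rewrite -[LHS](offK w'); congr cpt; apply/funext => j /=.
  by have [h1 h2] := hs j; rewrite (oE _ _ h1 ht hA) (sum_o _ j).
Qed.

End CubeIsometry.

(** * The square complex of a cube complex *)

Lemma flipK n (w : {ffun 'I_n -> bool}) i : flip (flip w i) i = w.
Proof. by apply/ffunP => j; rewrite !ffunE; case: eqP; rewrite ?negbK. Qed.

Lemma flipC n (w : {ffun 'I_n -> bool}) i j : flip (flip w i) j = flip (flip w j) i.
Proof. by apply/ffunP => k; rewrite !ffunE; case: eqP; case: eqP. Qed.

Lemma flip_same n (w : {ffun 'I_n -> bool}) i : flip w i i = ~~ w i.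
Proof. by rewrite ffunE eqxx. Qed.

Lemma flip_other n (w : {ffun 'I_n -> bool}) i j : j != i -> flip w i j = w j.
Proof. by rewrite ffunE => /negPf ->. Qed.

Lemma flip_ind n (P : {ffun 'I_n -> bool} -> Prop) (w0 : {ffun 'I_n -> bool}) :
  P w0 -> (forall w i, P w -> P (flip w i)) -> forall w, P w.
Proof.
move=> h0 hs w; have [k] := ubnP #|[set i | w i != w0 i]|%SET.
elim: k w => // k IH w hk; have [i hi|he] := pickP (fun i => w i != w0 i); last first.
  have -> // : w = w0 by apply/ffunP => i; have /negbFE/eqP := he i.
rewrite -(flipK w i); apply: hs; apply: IH; rewrite -ltnS; apply: leq_trans hk.
rewrite ltnS; apply: proper_card; apply/properP; split.
  apply/fintype.subsetP => j; rewrite !inE ffunE; case: (eqVneq j i) => [->|//].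
  by rewrite hi.
exists i; rewrite !inE // ffunE eqxx; move: hi.
by case: (w i); case: (w0 i).
Qed.

Lemma cube_vertex_inj (R : realType) n : injective (@cube_vertex R n).
Proof.
move=> w w' /rowP h; apply/ffunP => i; have := h i; rewrite !mxE.
by case: (w i); case: (w' i) => // /eqP; rewrite ?oner_eq0 // eq_sym oner_eq0.
Qed.

Section Cells.
Variables (R : realType) (X : Type) (K : cube_complex R X).
Implicit Types (c : cell K).

Definition crn c (w : {ffun 'I_(cdim c) -> bool}) : corner K := existT _ c w.

(** The corner [w'] as a face of the corner [w], written in offsets: those outside the image of [s]
    vanish. This replaces the arbitrary isometry provided by [chi_face]. *)
Definition isface c w c' w' (s : 'I_(cdim c') -> 'I_(cdim c)) :=
  injective s /\ forall t : 'I_(cdim c) -> R, unit_box t ->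
    (forall i, (forall j, s j <> i) -> t i = 0) ->
    chi c (cpt w t) = chi c' (cpt w' (t \o s)).

Lemma cpt_ext n (w : {ffun 'I_n -> bool}) (t t' : 'I_n -> R) :
  t =1 t' -> cpt w t = cpt w t'.
Proof. by move/funext ->. Qed.

Lemma face_cpt n (A : {set 'I_n}) w (t : 'I_n -> R) : unit_box t ->
  (forall i, i \in A -> t i = 0) -> cube_face A w (cpt w t).
Proof.
move=> ht hA; split; first exact/cube_cpt.
by move=> i iA; rewrite !mxE hA //; case: (w i); rewrite ?subr0.
Qed.

Lemma iso_isface c w A c' (h : 'rV[R]_(cdim c) -> 'rV[R]_(cdim c')) :
  euclid_isometry (cube_face A w) (@cube R (cdim c')) h ->
  (forall u, cube_face A w u -> chi c u = chi c' (h u)) ->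
  exists w' s, [/\ @isface c w c' w' s, forall i, i \notin A <-> exists j, s j = i &
    h (cube_vertex w) = cube_vertex w'].
Proof.
move=> /face_iso[w' [s [sinj sA hs]]] hchi; exists w', s; split=> //.
  split=> // t ht h0.
  have hA i : i \in A -> t i = 0.
    move=> iA; apply: h0 => j hj; have /sA : exists j, s j = i by exists j.
    by rewrite iA.
  by rewrite hchi ?hs //; exact: face_cpt.
rewrite -!cpt_vertex hs // => i; by rewrite lexx ler01.
Qed.

Lemma face_ex c w (A : {set 'I_(cdim c)}) : exists c' w' s, [/\ @isface c w c' w' s,
  forall i, i \notin A <-> exists j, s j = i & corner_face (crn w') (crn w)].
Proof.
have [c' [h [h1 h2]]] := chi_face A w.
have [w' [s [h3 h4 h5]]] := iso_isface h1 h2.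
by exists c', w', s; split=> //; exists A, h.
Qed.

Lemma corner_face_inv c w c' w' : corner_face (@crn c' w') (@crn c w) ->
  exists s, @isface c w c' w' s.
Proof.
move=> [A [h [h1 h2 h3]]]; have [w2 [s [h4 h5 h6]]] := iso_isface h1 h2.
exists s; suff <- : w2 = w' by [].
by apply: (@cube_vertex_inj R); rewrite -h6; exact: h3.
Qed.

(** Oriented edges: a corner of a 1-cube is an edge together with its starting point. *)
Definition edge_t := {p : corner K | cdim (tag p) = 1%N}.

Lemma edge_val_inj (p q : edge_t) : sval p = sval q -> p = q.
Proof.
case: p q => [p hp] [q hq] /= h; move: hp hq; rewrite h => hp hq.
by congr exist; exact: Prop_irrelevance.
Qed.

Definition ept (p : corner K) (x : R) : X := chi (tag p) (cpt (tagged p) (fun=> x)).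

Lemma edge_ext (p q : edge_t) : (forall x, 0 <= x <= 1 -> ept (sval p) x = ept (sval q) x) ->
  p = q.
Proof.
move=> h; apply: edge_val_inj; move: h.
case: p q => [[c w] hp] [[c' w'] hq] h; rewrite /= in hp hq h *.
(* The parameter 1/3 is interior and is not fixed by the reflection of the interval, so it
   identifies the cell and detects the orientation. *)
have hx : 0 <= (3%:R^-1 : R) <= 1 by lra.
have o n (v : {ffun 'I_n -> bool}) : open_cube (cpt v (fun=> (3%:R^-1 : R))).
  by apply/open_cpt => i; lra.
have ne : (1 - 3%:R^-1 : R) <> 3%:R^-1 by move: hx; clear h hp hq => hx hh; lra.
have := h _ hx; rewrite /ept /= => e.
have ecc := chi_disjoint (o _ w) (o _ w') e; subst c'.
have {e} e := chi_inj (o _ w) (o _ w') e; congr existT.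
apply/ffunP => i; have := congr1 (fun u : 'rV_(cdim c) => u 0 i) e; rewrite !cptE.
by by case: (w i); case: (w' i) => // hh; case: ne.
Qed.

Definition is_edge c w i (p : corner K) := forall x, 0 <= x <= 1 ->
  chi c (cpt w (fun j => if j == i then x else 0)) = ept p x.

Lemma isface_edge c w c' w' s j : @isface c w c' w' s -> cdim c' = 1%N ->
  is_edge w (s j) (crn w').
Proof.
move=> [sinj hs] h1 x hx; rewrite /ept /= hs.
- congr chi; apply: cpt_ext => k /=; suff -> : k = j by rewrite eqxx.
  move: k j; rewrite h1 => k j; apply: val_inj => /=.
  by case: k j => [[|//] ?] [[|//] ?].
- by move=> i; case: eqP => _; rewrite ?hx // lexx ler01.
- by move=> i hi; case: eqP => // e; case: (hi j).
Qed.

Lemma edge_ex c w i : exists p : edge_t, is_edge w i (sval p) /\ corner_face (sval p) (@crn c w).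
Proof.
have [c' [w' [s [h1 h2 h3]]]] := face_ex w (~: [set i])%SET.
have si j : s j = i.
  have /h2 : exists j', s j' = s j by exists j.
  by rewrite !inE negbK => /eqP.
have hd : cdim c' = 1%N.
  have [j hj] : exists j, s j = i by apply/h2; rewrite !inE negbK.
  have [sinj _] := h1; have := card_codom sinj.
  rewrite card_ord => <-; rewrite -(card1 i); apply: eq_card => x; rewrite !inE.
  by apply/codomP/eqP => [[j' ->]//|->]; exists j.
exists (exist _ (crn w') hd); split=> //=.
have [j hj] : exists j, s j = i by apply/h2; rewrite !inE negbK.
by rewrite -hj; exact: isface_edge.
Qed.

Definition edge c w i : edge_t := projT1 (cid (@edge_ex c w i)).

Lemma edgeP c w i : is_edge w i (sval (@edge c w i)).
Proof. by rewrite /edge; case: cid => p []. Qed.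

Lemma edge_corner_face c w i : corner_face (sval (@edge c w i)) (crn w).
Proof. by rewrite /edge; case: cid => p []. Qed.

Lemma edge_eq c w i (p : edge_t) : is_edge w i (sval p) -> @edge c w i = p.
Proof. by move=> h; apply: edge_ext => x hx; rewrite -h // edgeP. Qed.

Lemma edge_self (p : edge_t) i : edge (tagged (sval p)) i = p.
Proof.
apply: edge_eq => x hx; rewrite /ept; congr chi; apply: cpt_ext => j.
suff -> : j = i by rewrite eqxx.
case: p i j => [[c w] /= h] i j; move: i j; rewrite h => i j; apply: val_inj => /=.
by case: i j => [[|//] ?] [[|//] ?].
Qed.

Lemma is_vertex_cp c w : is_vertex K (chi c (cube_vertex w)).
Proof.
have [c' [w' [s [[sinj hs] h2 _]]]] := face_ex w [set: 'I_(cdim c)]%SET.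
have hd : cdim c' = 0%N.
  apply/eqP; rewrite -leqn0 leqNgt; apply/negP => h.
  have /h2 : exists j, s j = s (Ordinal h) by exists (Ordinal h).
  by rewrite inE.
exists c' => //; exists (cube_vertex w').
  by rewrite -cpt_vertex; apply/cube_cpt => i; rewrite lexx ler01.
rewrite -!cpt_vertex hs // => i; by rewrite lexx ler01.
Qed.

Definition vert := {x : X | is_vertex K x}.

Definition cv c w : vert := exist _ _ (@is_vertex_cp c w).

Lemma vert_ext (u v : vert) : sval u = sval v -> u = v.
Proof.
case: u v => [x hx] [y hy] /= h; move: hx hy; rewrite h => hx hy.
by congr exist; exact: Prop_irrelevance.
Qed.

Definition oppc (p : corner K) : corner K :=
  existT _ (tag p) [ffun i => ~~ tagged p i].

Definition eopp (p : edge_t) : edge_t := exist _ (oppc (sval p)) (proj2_sig p).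

Lemma ept_opp p x : ept (oppc p) x = ept p (1 - x).
Proof.
rewrite /ept /=; congr chi; apply/rowP => i; rewrite !cptE ffunE.
by case: (tagged p i); rewrite //= opprB addrC subrK.
Qed.

Definition esrc (p : edge_t) : vert := cv (tagged (sval p)).
Definition etgt (p : edge_t) : vert := cv (tagged (sval (eopp p))).

Lemma esrcE p : sval (esrc p) = ept (sval p) 0.
Proof. by rewrite /= -cpt_vertex. Qed.

Lemma etgtE p : sval (etgt p) = ept (sval p) 1.
Proof. by rewrite /= -cpt_vertex; have := ept_opp (sval p) 0; rewrite subr0. Qed.

Lemma eoppK p : eopp (eopp p) = p.
Proof. by apply: edge_ext => x _; rewrite !ept_opp opprB addrC subrK. Qed.

Lemma esrc_opp p : esrc (eopp p) = etgt p.
Proof. by []. Qed.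

Lemma edge_src c w i : esrc (@edge c w i) = cv w.
Proof.
apply: vert_ext; rewrite esrcE -(@edgeP c w i 0) ?lexx ?ler01 //= -cpt_vertex.
by congr chi; apply: cpt_ext => j; case: eqP.
Qed.

Lemma cpt_flip n (w : {ffun 'I_n -> bool}) i (t : 'I_n -> R) :
  cpt (flip w i) t = cpt w (fun j => if j == i then 1 - t j else t j).
Proof.
apply/rowP => j; rewrite !cptE ffunE; case: eqP => [->|//].
by case: (w i) => //=; rewrite opprB addrC subrK.
Qed.

Lemma edge_opp c w i : eopp (@edge c w i) = edge (flip w i) i.
Proof.
apply: edge_ext => x hx; rewrite ept_opp -!edgeP //; last by lra.
rewrite cpt_flip; congr chi; apply: cpt_ext => j /=.
by case: eqP.
Qed.

Lemma edge_tgt c w i : etgt (@edge c w i) = cv (flip w i).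
Proof. by rewrite -esrc_opp edge_opp edge_src. Qed.

Lemma isface_vtx c w c' w' s : @isface c w c' w' s -> cv w = cv w'.
Proof.
move=> [sinj hs]; apply: vert_ext; rewrite /= -!cpt_vertex hs // => i.
by rewrite lexx ler01.
Qed.

Lemma face_edge c w c' w' s j : @isface c w c' w' s -> edge w (s j) = edge w' j.
Proof.
move=> [sinj hs]; apply: edge_eq => x hx; rewrite -edgeP // hs.
- congr chi; apply: cpt_ext => k /=; rewrite (inj_eq sinj) //.
- by move=> i; case: eqP => _; rewrite ?hx // lexx ler01.
- by move=> i hi; case: eqP => // e; case: (hi j).
Qed.

Lemma face_shift c w c' w' s (w2 : {ffun 'I_(cdim c) -> bool}) : @isface c w c' w' s ->
  (forall i, (forall j, s j <> i) -> w2 i = w i) ->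
  isface w2 [ffun j => w' j (+) w (s j) (+) w2 (s j)] s.
Proof.
move=> [sinj hs] hw2; split=> // t ht h0.
pose t2 i := if w2 i == w i then t i else 1 - t i.
have e1 : cpt w2 t = cpt w t2.
  apply/rowP => i; rewrite !cptE /t2; case: (w2 i); case: (w i) => //=.
  by rewrite opprB addrC subrK.
have e2 : cpt [ffun j => w' j (+) w (s j) (+) w2 (s j)] (t \o s) = cpt w' (t2 \o s).
  apply/rowP => j; rewrite !cptE /t2 ffunE /=.
  by case: (w' j); case: (w (s j)); case: (w2 (s j)) => //=; rewrite opprB addrC subrK.
rewrite e1 e2; apply: hs.
  by move=> i; rewrite /t2; case: eqP => _; have := ht i; lra.
by move=> i hi; rewrite /t2 hw2 // eqxx h0.
Qed.

Lemma face_shift1 c w c' w' s j : @isface c w c' w' s ->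
  isface (flip w (s j)) (flip w' j) s.
Proof.
move=> h; have [sinj _] := h.
have := @face_shift _ _ _ _ _ (flip w (s j)) h; set w2 := [ffun _ => _].
have -> : w2 = flip w' j.
  apply/ffunP => k; rewrite !ffunE (inj_eq sinj); case: eqP => [->|_].
    by case: (w' j); case: (w (s j)).
  by case: (w' k); case: (w (s k)).
apply=> i hi; rewrite flip_other //; apply/eqP => e; exact: (hi j).
Qed.

Lemma link_verticesP c w p : link_vertices (@crn c w) p <->
  exists i, p = sval (@edge c w i).
Proof.
split=> [[hd]|[i ->]]; last first.
  by split; [exact: (proj2_sig (edge w i))|exact: edge_corner_face].
case: p hd => c' w' /= hd hf; have [s hs] := corner_face_inv hf.
have j : 'I_(cdim c') by rewrite hd; exact: ord0.
exists (s j); suff -> : edge w (s j) = exist _ (crn w') hd by [].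
by apply: edge_eq; exact: isface_edge.
Qed.

Hypothesis hfl : forall v, is_vertex K v -> flag_link K v.

(** The link has exactly as many vertices at this corner as the cube has directions, so the
    surjection from directions to link vertices is injective. *)
Lemma edge_inj c w : injective (@edge c w).
Proof.
have [h1 _ _] := hfl (is_vertex_cp w).
have /card_set_bijP[f hf] := h1 (crn w) erefl.
case: hf => fun_f inj_f surj_f.
pose g i : 'I_(cdim c) := Ordinal (fun_f _ ((link_verticesP _ _).2 (ex_intro _ i erefl))).
have [r hr] : {r : 'I_(cdim c) -> 'I_(cdim c) & forall k, g (r k) = k}.
  apply: (@choice _ _ (fun k i => g i = k)) => k.
  have [p /link_verticesP[i ep] hp] := surj_f k (ltn_ord k).
  by exists i; apply: val_inj; rewrite /= -hp ep.
have rinj : injective r by move=> x y e; rewrite -(hr x) -(hr y) e.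
have [r' h2 h3] := injF_bij rinj.
move=> i j e; rewrite -(h3 i) -(h3 j); congr r.
by rewrite -(hr (r' i)) -(hr (r' j)) !h3; apply: val_inj; rewrite /= e.
Qed.

Lemma corner_eq c w c2 w2 : cv w = cv w2 ->
  (forall i, exists j, @edge c w i = @edge c2 w2 j) ->
  (forall j, exists i, edge w2 j = edge w i) -> crn w = crn w2.
Proof.
move=> hv h1 h2; have [_ k2 _] := hfl (is_vertex_cp w).
apply: (k2 (crn w) (crn w2)) => //.
  by have := congr1 sval (esym hv).
apply/seteqP; split=> p /link_verticesP[i ->]; apply/link_verticesP.
  by have [j ->] := h1 i; exists j.
by have [j ->] := h2 i; exists j.
Qed.

(* A corner whose edges are among those of another corner at the same vertex is a
   face of it, compatibly with the characteristic maps. *)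
Lemma corner_sub c w c1 w1 (s : 'I_(cdim c1) -> 'I_(cdim c)) :
  (forall j, @edge c1 w1 j = @edge c w (s j)) -> cv w1 = cv w -> isface w w1 s.
Proof.
move=> hs hv.
have sinj : injective s by move=> i j e; apply: (@edge_inj c1 w1); rewrite !hs e.
pose A := [set i | [forall j, s j != i]]%SET.
have hA i : i \notin A <-> exists j, s j = i.
  rewrite inE negb_forall; split=> [/existsP[j]|[j hj]]; first by rewrite negbK => /eqP; exists j.
  by apply/existsP; exists j; rewrite negbK hj.
have [c' [w' [s' [hf h1 _]]]] := face_ex w A.
have ec : crn w' = crn w1.
  apply: corner_eq; first by rewrite -(isface_vtx hf) hv.
    move=> j; have /h1/hA[i hi] : exists j', s' j' = s' j by exists j.
    by exists i; rewrite hs hi; apply/esym; exact: face_edge.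
  move=> j; have /hA/h1[i hi] : exists j', s j' = s j by exists j.
  by exists i; rewrite hs -hi; exact: face_edge.
have [s2 hf2] : exists s2 : 'I_(cdim c1) -> 'I_(cdim c), isface w w1 s2.
  have : exists s2 : 'I_(cdim (tag (crn w'))) -> 'I_(cdim c),
      isface w (tagged (crn w')) s2 by exists s'.
  by rewrite ec.
suff -> : s = s2 by [].
apply/funext => j; apply: (@edge_inj c w); rewrite -hs; apply/esym; exact: face_edge.
Qed.

Definition esq (e x e' x' : edge_t) := exists c w i j, [/\ i != j, e = @edge c w i,
  x = edge w j, e' = edge (flip w j) i & x' = edge (flip w i) j].

Lemma esq_edge c w i j : i != j ->
  esq (@edge c w i) (edge w j) (edge (flip w j) i) (edge (flip w i) j).
Proof. by move=> h; exists c, w, i, j. Qed.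

Lemma esq_sym e x e' x' : esq e x e' x' -> esq x e x' e'.
Proof. by move=> [c [w [i [j [h -> -> -> ->]]]]]; exists c, w, j, i; rewrite eq_sym. Qed.

Lemma esq_rot e x e' x' : esq e x e' x' -> esq (eopp e) x' (eopp e') x.
Proof.
move=> [c [w [i [j [h -> -> -> ->]]]]]; exists c, (flip w i), i, j.
by rewrite !edge_opp (flipC w j i) flipK.
Qed.

Lemma esq_irr e e' x' : ~ esq e e e' x'.
Proof. by move=> [c [w [i [j [/eqP h -> /edge_inj e2 _ _]]]]]; case: h. Qed.

(** A square inside a larger cube is extracted as a cell of its own, so that [corner_eq] can compare
    squares coming from different cubes. *)
Lemma square_corner c w i j : i != j -> exists c' w' s,
  [/\ @isface c w c' w' s, forall k, s k = i \/ s k = j,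
   exists k, s k = i & exists k, s k = j].
Proof.
move=> hij; have [c' [w' [s [hf h1 _]]]] := face_ex w (~: [set i; j])%SET.
exists c', w', s; split=> //.
- move=> k; have /h1 : exists k', s k' = s k by exists k.
  by rewrite !inE negbK => /orP[/eqP|/eqP]; [left|right].
- by apply/h1; rewrite !inE negbK eqxx.
- by apply/h1; rewrite !inE negbK eqxx orbT.
Qed.

Lemma esq_det e x e1 x1 e2 x2 : esq e x e1 x1 -> esq e x e2 x2 -> e1 = e2 /\ x1 = x2.
Proof.
move=> [c [w [i [j [hij he hx -> ->]]]]] [c2 [w2 [i2 [j2 [hij2 he2 hx2 -> ->]]]]].
have [c0 [w0 [s0 [f0 g0 [ki hki] [kj hkj]]]]] := square_corner w hij.
have [c3 [w3 [s3 [f3 g3 [li hli] [lj hlj]]]]] := square_corner w2 hij2.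
have ei : edge w0 ki = e by rewrite -(face_edge ki f0) hki he.
have ej : edge w0 kj = x by rewrite -(face_edge kj f0) hkj hx.
have ei3 : edge w3 li = e by rewrite -(face_edge li f3) hli he2.
have ej3 : edge w3 lj = x by rewrite -(face_edge lj f3) hlj hx2.
have ec : crn w0 = crn w3.
  apply: corner_eq.
  - by rewrite -(edge_src w0 ki) -(edge_src w3 li) ei ei3.
  - move=> k; have h := g0 k; rewrite -(face_edge k f0).
    by case: h => ->; [exists li; rewrite ei3 he|exists lj; rewrite ej3 hx].
  - move=> k; have h := g3 k; rewrite -(face_edge k f3).
    by case: h => ->; [exists ki; rewrite ei he2|exists kj; rewrite ej hx2].
have h1 : edge (flip w j) i = edge (flip w0 kj) ki.
  by rewrite -hki -hkj; apply: face_edge; exact: face_shift1.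
have h2 : edge (flip w i) j = edge (flip w0 ki) kj.
  by rewrite -hki -hkj; apply: face_edge; exact: face_shift1.
have h3 : edge (flip w2 j2) i2 = edge (flip w3 lj) li.
  by rewrite -hli -hlj; apply: face_edge; exact: face_shift1.
have h4 : edge (flip w2 i2) j2 = edge (flip w3 li) lj.
  by rewrite -hli -hlj; apply: face_edge; exact: face_shift1.
rewrite h1 h2 h3 h4.
have step (s : corner K) : crn w0 = s ->
   forall (ki kj : 'I_(cdim c0)) (li lj : 'I_(cdim (tag s))),
   edge w0 ki = e -> edge w0 kj = x -> edge (tagged s) li = e ->
   edge (tagged s) lj = x ->
   edge (flip w0 kj) ki = edge (flip (tagged s) lj) li /\
   edge (flip w0 ki) kj = edge (flip (tagged s) li) lj.
  move=> <- pi pj qi qj /= a1 a2 a3 a4.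
  have -> : qi = pi by apply: (@edge_inj c0 w0); rewrite a3.
  by have -> : qj = pj by apply: (@edge_inj c0 w0); rewrite a4.
exact: (step (crn w3)).
Qed.

Lemma clique_corner (v : vert) (l : seq edge_t) :
  (forall e, List.In e l -> esrc e = v) ->
  (forall e x, List.In e l -> List.In x l -> e <> x -> exists e' x', esq e x e' x') ->
  exists c w, cv w = v /\ forall e, List.In e l <-> exists i, e = @edge c w i.
Proof.
move=> hv hc; have [_ _ k3] := hfl (proj2_sig v).
pose T : set (corner K) := [set p | exists2 e : edge_t, List.In e l & p = sval e].
have hT1 : finite_set T.
  have -> : T = \bigcup_(e in [set e | List.In e l]) [set sval e].
    by apply/seteqP; split=> p; [move=> [e h ->]; exists e|move=> [e h ->]; exists e].
  apply: bigcup_finite => [|e _]; last exact: finite_set1.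
  elim: (l) => [|e l' IH].
    by rewrite (_ : [set e | _] = set0) //; apply/seteqP; split.
  rewrite (_ : [set e0 | _] = [set e] `|` [set e | List.In e l']).
    by rewrite finite_setU; split; [exact: finite_set1|].
  by apply/seteqP; split=> x /= [->|]; auto.
have hT2 p : T p -> corner_at (sval v) p /\ cdim (tag p) = 1%N.
  move=> [e he ->]; split; last exact: (proj2_sig e).
  by rewrite -(hv e he).
have hT3 p q : T p -> T q -> p <> q -> exists2 s, corner_at (sval v) s &
    link_vertices s = [set p; q].
  move=> [e he ->] [x hx ->] hpq; have hne : e <> x by move=> h; apply: hpq; rewrite h.
  have [e' [x' [c [w [i [j [hij ee ex _ _]]]]]]] := hc e x he hx hne.
  have [c0 [w0 [s0 [f0 g0 [ki hki] [kj hkj]]]]] := square_corner w hij.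
  exists (crn w0).
    have : cv w0 = v by rewrite -(isface_vtx f0) -(edge_src w i) -ee hv.
    by move/(congr1 sval).
  apply/seteqP; split=> p'.
    move=> /link_verticesP[k ->]; have h := g0 k; rewrite -(face_edge k f0).
    by case: h => ->; [left; rewrite ee|right; rewrite ex].
  move=> [->|->]; apply/link_verticesP.
    by exists ki; rewrite -(face_edge ki f0) hki ee.
  by exists kj; rewrite -(face_edge kj f0) hkj ex.
have [[c w] hs hlink] := k3 T hT1 hT2 hT3.
exists c, w; split=> //; first exact: vert_ext.
move=> e; split=> [he|[i ->]].
  have : link_vertices (crn w) (sval e) by rewrite hlink; exists e.
  by move=> /link_verticesP[i /edge_val_inj hi]; exists i.
have : link_vertices (crn w) (sval (edge w i)) by apply/link_verticesP; exists i.
by rewrite hlink => -[e' he' /edge_val_inj ->].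
Qed.

(** The three edges are pairwise joined in the link, hence by flagness they are the edges of one
    corner; in its cube the three missing squares are visible. *)
Lemma esq_cube e x y e1 x1 e2 y1 x2 y2 :
  esq e x e1 x1 -> esq e y e2 y1 -> esq x y x2 y2 ->
  exists e3 x3 y3, [/\ esq e1 y2 e3 y3, esq e2 x2 e3 x3 & esq x1 y1 x3 y3].
Proof.
move=> hex hey hxy.
have src_eq a b a' b' : esq a b a' b' -> esrc a = esrc b.
  by move=> [c [w [i [j [_ -> -> _ _]]]]]; rewrite !edge_src.
have [|e0 x0 h1 h2 hne|c [w [hv hl]]] := @clique_corner (esrc e) [:: e; x; y].
- by move=> a /= [<-|[<-|[<-|[]]]] //; apply/esym; [exact: src_eq hex|exact: src_eq hey].
- case: h1 h2 hne => [<-|[<-|[<-|[]]]] [<-|[<-|[<-|[]]]] // _.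
  + by exists e1, x1.
  + by exists e2, y1.
  + by exists x1, e1; exact: esq_sym.
  + by exists x2, y2.
  + by exists y1, e2; exact: esq_sym.
  + by exists y2, x2; exact: esq_sym.
have /hl[i ei] : List.In e [:: e; x; y] by left.
have /hl[j xj] : List.In x [:: e; x; y] by right; left.
have /hl[k yk] : List.In y [:: e; x; y] by right; right; left.
have ij : i != j by apply/eqP => h; move: hex; rewrite ei xj h; exact: esq_irr.
have ik : i != k by apply/eqP => h; move: hey; rewrite ei yk h; exact: esq_irr.
have jk : j != k by apply/eqP => h; move: hxy; rewrite xj yk h; exact: esq_irr.
have q1 := esq_edge w ij; have q2 := esq_edge w ik; have q3 := esq_edge w jk.
rewrite -ei -xj in q1; rewrite -ei -yk in q2; rewrite -xj -yk in q3.
have [-> ->] := esq_det hex q1; have [-> ->] := esq_det hey q2.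
have [-> ->] := esq_det hxy q3.
exists (edge (flip (flip w j) k) i), (edge (flip (flip w i) k) j),
  (edge (flip (flip w i) j) k); split.
- by have := esq_edge (flip w j) ik; rewrite (flipC w j i).
- by have := esq_edge (flip w k) ij; rewrite (flipC w k j) (flipC w k i).
- by have := esq_edge (flip w i) jk.
Qed.

Definition cell_sqc : sqc.
Proof.
refine (@Sqc vert edge_t esrc etgt eopp esq eoppK esrc_opp _ _ _ esq_sym esq_rot
  esq_irr esq_det esq_cube).
- by move=> e x e' x' [c [w [i [j [_ -> -> _ _]]]]]; rewrite !edge_src.
- by move=> e x e' x' [c [w [i [j [_ -> _ _ ->]]]]]; rewrite edge_src edge_tgt.
- by move=> e x e' x' [c [w [i [j [_ _ _ -> ->]]]]]; rewrite !edge_tgt flipC.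
Defined.

End Cells.

(** * Distances *)

Section Minkowski.
Variables (R : realType) (I : finType).
Implicit Types a b : I -> R.

Definition nrm a : R := Num.sqrt (\sum_i a i ^+ 2).

Lemma sumsq_ge0 a : 0 <= \sum_i a i ^+ 2.
Proof. by apply: sumr_ge0 => i _; exact: sqr_ge0. Qed.

Lemma nrm_ge0 a : 0 <= nrm a. Proof. exact: sqrtr_ge0. Qed.

Lemma nrm_sq a : nrm a ^+ 2 = \sum_i a i ^+ 2.
Proof. by rewrite sqr_sqrtr ?sumsq_ge0. Qed.

Lemma le_nrm a i : `|a i| <= nrm a.
Proof.
rewrite -(ler_pXn2r (n := 2)) ?nnegrE ?nrm_ge0 // nrm_sq (bigD1 i) //= real_normK ?num_real //.
by rewrite lerDl; apply: sumr_ge0 => j _; exact: sqr_ge0.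
Qed.

Lemma cauchy_schwarz a b : (\sum_i a i * b i) ^+ 2 <= (\sum_i a i ^+ 2) * (\sum_i b i ^+ 2).
Proof.
have h : 0 <= \sum_i \sum_j (a i * b j - a j * b i) ^+ 2.
  by apply: sumr_ge0 => i _; apply: sumr_ge0 => j _; exact: sqr_ge0.
suff e : \sum_i \sum_j (a i * b j - a j * b i) ^+ 2 =
    2 * ((\sum_i a i ^+ 2) * (\sum_i b i ^+ 2)) - 2 * (\sum_i a i * b i) ^+ 2.
  by move: h; rewrite e; lra.
have e1 : \sum_i \sum_j (a i ^+ 2 * b j ^+ 2) = (\sum_i a i ^+ 2) * (\sum_i b i ^+ 2).
  by rewrite mulr_suml; apply: eq_bigr => i _; rewrite mulr_sumr.
have e2 : \sum_i \sum_j (a i * b i * (a j * b j)) = (\sum_i a i * b i) ^+ 2.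
  by rewrite expr2 mulr_suml; apply: eq_bigr => i _; rewrite mulr_sumr.
have e3 : \sum_i \sum_j (a j ^+ 2 * b i ^+ 2) = (\sum_i a i ^+ 2) * (\sum_i b i ^+ 2).
  by rewrite exchange_big /= e1.
transitivity (\sum_i \sum_j (a i ^+ 2 * b j ^+ 2) + \sum_i \sum_j (a j ^+ 2 * b i ^+ 2)
   - 2 * \sum_i \sum_j (a i * b i * (a j * b j))); last by rewrite e1 e2 e3; ring.
rewrite mulr_sumr -big_split -sumrB; apply: eq_bigr => i _ /=.
rewrite mulr_sumr -big_split -sumrB; apply: eq_bigr => j _ /=; ring.
Qed.

Lemma dot_le a b : \sum_i a i * b i <= nrm a * nrm b.
Proof.
apply: le_trans (ler_norm _) _.
rewrite -(ler_pXn2r (n := 2)) ?nnegrE ?mulr_ge0 ?nrm_ge0 //.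
by rewrite exprMn !nrm_sq real_normK ?num_real // cauchy_schwarz.
Qed.

Lemma nrmD a b : nrm (fun i => a i + b i) <= nrm a + nrm b.
Proof.
rewrite -(ler_pXn2r (n := 2)) ?nnegrE ?addr_ge0 ?nrm_ge0 // nrm_sq.
have -> : \sum_i (a i + b i) ^+ 2 =
    \sum_i a i ^+ 2 + \sum_i b i ^+ 2 + 2 * \sum_i a i * b i.
  by rewrite mulr_sumr -!big_split; apply: eq_bigr => i _ /=; ring.
by have := dot_le a b; rewrite -!nrm_sq; lra.
Qed.

Lemma eq_nrm a b : (forall i, a i ^+ 2 = b i ^+ 2) -> nrm a = nrm b.
Proof. by move=> h; congr Num.sqrt; exact: eq_bigr. Qed.

End Minkowski.

Lemma sum_inj (R : realType) (I J : finType) (s : J -> I) (F : I -> R) : injective s ->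
  (forall i, (forall j, s j <> i) -> F i = 0) -> \sum_i F i = \sum_j F (s j).
Proof.
move=> sinj h; rewrite -(big_imset _ (h := s) (A := J)) /=; last by move=> x y _ _; exact: sinj.
rewrite [RHS]big_mkcond /=; apply: eq_bigr => i _; case: ifP => // /negbT hi.
apply: h => j e; move: hi; rewrite -e => /negP; apply; exact: imset_f.
Qed.

Section Distance.
Variable R : realType.

Lemma euclid_nrm n (u v : 'rV[R]_n) : euclid_dist u v = nrm (fun i => u 0 i - v 0 i).
Proof. by []. Qed.

Lemma euclid_triangle n (u v w : 'rV[R]_n) :
  euclid_dist u w <= euclid_dist u v + euclid_dist v w.
Proof.
rewrite !euclid_nrm; apply: le_trans (nrmD _ _); rewrite le_eqVlt; apply/orP; left.
by apply/eqP/eq_nrm => i; congr (_ ^+ 2); ring.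
Qed.

Lemma euclid_refl n (u : 'rV[R]_n) : euclid_dist u u = 0.
Proof.
by rewrite /euclid_dist big1 ?sqrtr0 // => i _; rewrite subrr expr0n.
Qed.

Lemma euclid_ge0 n (u v : 'rV[R]_n) : 0 <= euclid_dist u v.
Proof. exact: sqrtr_ge0. Qed.

Lemma euclid_coord n (u v : 'rV[R]_n) i : `|u 0 i - v 0 i| <= euclid_dist u v.
Proof. by rewrite euclid_nrm; exact: (le_nrm (fun i => u 0 i - v 0 i)). Qed.

Lemma euclid_off n (w : {ffun 'I_n -> bool}) (u v : 'rV[R]_n) :
  euclid_dist u v = nrm (fun i => off w u i - off w v i).
Proof. by rewrite euclid_ed2 (ed2_off w). Qed.

Lemma list_gap (l : seq R) : exists2 e, 0 < e &
  forall a b, a \in l -> b \in l -> `|a - b| < e -> a = b.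
Proof.
elim: l => [|x l [e e0 he]]; first by exists 1.
have [e' e0' he'] : exists2 e, 0 < e & forall b, b \in l -> `|x - b| < e -> x = b.
  elim: (l) => [|y l' [d d0 hd]]; first by exists 1.
  case: (eqVneq x y) => [<-|hxy].
    by exists d => // b; rewrite inE => /orP[/eqP->|]; auto.
  exists (Num.min d `|x - y|); first by rewrite lt_min d0 normr_gt0 subr_eq0.
  move=> b; rewrite inE lt_min => /orP[/eqP->|hb] /andP[h1 h2]; last exact: hd.
  by move: h2; rewrite ltxx.
exists (Num.min e e'); first by rewrite lt_min e0.
move=> a b; rewrite !inE lt_min => /orP[/eqP->|ha] /orP[/eqP->|hb] /andP[h1 h2] //.
- exact: he'.
- by apply/esym/he' => //; rewrite distrC.
- exact: he.
Qed.

(* The supremum of the good initial intervals is [b]. *)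
Lemma real_ind (P : R -> Prop) (a b : R) : a <= b -> P a ->
  (forall t, a <= t <= b -> exists2 d, 0 < d & forall t1 t2, a <= t1 <= t ->
     t <= t2 <= b -> t - d < t1 -> t2 < t + d -> P t1 -> P t2) -> P b.
Proof.
move=> hab Pa hs; pose S : set R := [set t | a <= t <= b /\ P t].
have S0 : S !=set0 by exists a; rewrite /S /= lexx hab.
have Sb : ubound S b by move=> t [/andP[]].
have hsup : has_sup S by split=> //; exists b.
have ha : a <= sup S by apply: (ub_le_sup hsup.2); rewrite /S /= lexx hab.
have hb : sup S <= b by exact: ge_sup.
have [d d0 hd] := hs (sup S) (introT andP (conj ha hb)).
have [t1 [/andP[h1 h2] h3] h4] := sup_adherent d0 hsup.
have h5 : t1 <= sup S by apply: (ub_le_sup hsup.2); rewrite /S /= h1 h2.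
case: (ltP (sup S) b) => hlt; last first.
  have e : sup S = b by apply/eqP; rewrite eq_le hb.
  by rewrite -e; apply: (hd t1) => //; rewrite ?h1 ?lexx ?ltrDl ?hb.
pose t2 := Num.min b (sup S + d / 2).
have h6 : sup S < t2 by rewrite lt_min hlt ltrDl divr_gt0.
have h7 : t2 <= b by rewrite ge_min lexx.
have h8 : t2 < sup S + d by rewrite gt_min; apply/orP; right; rewrite ltrD2l; lra.
have : P t2 by apply: (hd t1) => //; rewrite ?h1 ?h7 ?(ltW h6).
move=> Pt2; have : t2 <= sup S.
  by apply: (ub_le_sup hsup.2); rewrite /S /= h7 (le_trans ha (ltW h6)).
by rewrite leNgt h6.
Qed.

Lemma list_argmin (T : Type) (P : T -> Prop) (f : T -> R) (l : seq T) x0 :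
  P x0 -> List.In x0 l ->
  exists x, P x /\ forall y, P y -> List.In y l -> f x <= f y.
Proof.
elim: l x0 => // z l IH x0 h0 hin.
have [[y [hy1 hy2]]|hn] := pselect (exists y, P y /\ List.In y l).
  have [x [h1 h2]] := IH y hy1 hy2.
  have [hz|hz] := pselect (P z /\ f z < f x).
    exists z; split=> [|y' h [<-//|h']]; first by case: hz.
    by apply: le_trans (h2 y' h h'); apply: ltW; case: hz.
  exists x; split=> // y' h [e|h']; last exact: h2.
  by rewrite -e in h *; rewrite leNgt; apply/negP => h3; apply: hz; split.
exists x0; split=> // y hy [<-|h]; last by case: hn; exists y.
by case: hin => [->//|h]; case: hn; exists x0.
Qed.

Lemma ivt_lip (f : R -> R) (k u v z : R) : u <= v -> 0 < k ->
  (forall s t, u <= s <= v -> u <= t <= v -> `|f s - f t| <= k * `|s - t|) ->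
  f u <= z <= f v -> exists2 t, u <= t <= v & f t = z.
Proof.
move=> huv k0 hf /andP[h1 h2]; apply: contrapT => hn.
have ne t : u <= t <= v -> f t <> z by move=> ht e; apply: hn; exists t.
have hu : u <= u <= v by rewrite lexx.
have hv : u <= v <= v by rewrite lexx huv.
pose P t : Prop := f t < z.
have : P v; last by rewrite /P ltNge h2.
apply: (@real_ind P u v huv); rewrite /P.
  by rewrite lt_neqAle h1 andbT; apply/eqP; exact: ne.
move=> t ht; pose d := `|f t - z| / k.
have d0 : 0 < d by rewrite divr_gt0 // normr_gt0 subr_eq0; apply/eqP; exact: ne.
have hd s : u <= s <= v -> `|t - s| < d -> `|f t - f s| < `|f t - z|.
  by move=> hs h; apply: le_lt_trans (hf t s ht hs) _; rewrite mulrC -ltr_pdivlMr.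
exists d => // t1 t2 a1 a2 a3 a4 hlt.
have b1 : u <= t1 <= v by move: ht a1 a2 => /andP[? ?] /andP[? ?] /andP[? ?]; apply/andP; split; lra.
have b2 : u <= t2 <= v by move: ht a1 a2 => /andP[? ?] /andP[? ?] /andP[? ?]; apply/andP; split; lra.
have c1 : `|f t - f t1| < `|f t - z|.
  by apply: hd => //; move: a1 => /andP[_ h]; rewrite ger0_norm ?subr_ge0 //; lra.
have c2 : `|f t - f t2| < `|f t - z|.
  by apply: hd => //; move: a2 => /andP[h _]; rewrite distrC ger0_norm ?subr_ge0 //; lra.
have ftz : f t < z.
  rewrite ltNge; apply/negP => h; move: c1; rewrite (ger0_norm (x := f t - z)) ?subr_ge0 //.
  by have := ler_norm (f t - f t1); lra.
move: c2; rewrite (ltr0_norm (x := f t - z)) ?subr_lt0 //.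
by have := ler_norm (f t2 - f t); rewrite (distrC (f t2)); lra.
Qed.

End Distance.

(** * Strings *)

Section Strings.
Variables (R : realType) (X : metricType R) (K : cube_complex R X).
Implicit Types (c : cell K) (x y z : X).

Definition extz m n (s : 'I_m -> 'I_n) (g : 'I_m -> R) (i : 'I_n) : R :=
  if [pick j | s j == i] is Some j then g j else 0.

Lemma extz_in m n (s : 'I_m -> 'I_n) g j : injective s -> extz s g (s j) = g j.
Proof.
by move=> h; rewrite /extz; case: pickP => [k /eqP/h ->//|/(_ j)]; rewrite eqxx.
Qed.

Lemma extz_out m n (s : 'I_m -> 'I_n) g i : (forall j, s j <> i) -> extz s g i = 0.
Proof. by move=> h; rewrite /extz; case: pickP => // k /eqP/h. Qed.

Lemma extz_box m n (s : 'I_m -> 'I_n) g : unit_box g -> unit_box (extz s g).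
Proof. by move=> h i; rewrite /extz; case: pickP => // _; rewrite lexx ler01. Qed.

Lemma extz_comp m n (s : 'I_m -> 'I_n) g : injective s -> extz s g \o s = g.
Proof. by move=> h; apply/funext => j /=; rewrite extz_in. Qed.

Lemma extz_id m n (s : 'I_m -> 'I_n) t : injective s ->
  (forall i, (forall j, s j <> i) -> t i = 0) -> extz s (t \o s) = t.
Proof.
move=> h h0; apply/funext => i; have [j|e] := pickP (fun j => s j == i).
  by move/eqP <-; rewrite extz_in.
have hi j : s j <> i by move/eqP; rewrite e.
by rewrite extz_out // h0.
Qed.

Lemma extz_dist m n (s : 'I_m -> 'I_n) g g' : injective s ->
  \sum_i (extz s g i - extz s g' i) ^+ 2 = \sum_j (g j - g' j) ^+ 2.
Proof.
move=> h; rewrite (sum_inj h); last by move=> i hi; rewrite !extz_out // subrr expr0n.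
by apply: eq_bigr => j _; rewrite !extz_in.
Qed.

Definition car_sig x : {c : cell K & {u : 'rV[R]_(cdim c) | open_cube u /\ chi c u = x}}.
Proof.
have /cid[c h] := chi_cover K x.
by exists c; apply: cid; have [u h1 h2] := h; exists u.
Defined.

Definition car x : cell K := tag (car_sig x).
Definition carp x : 'rV[R]_(cdim (car x)) := sval (tagged (car_sig x)).

Lemma carp_open x : open_cube (carp x).
Proof. by rewrite /carp; case: (tagged _) => u []. Qed.

Arguments carp_open : clear implicits.

Lemma chi_carp x : chi (car x) (carp x) = x.
Proof. by rewrite /carp; case: (tagged _) => u []. Qed.

Lemma car_eq c u : open_cube u -> existT (fun c => 'rV[R]_(cdim c)) c u =
  existT (fun c => 'rV[R]_(cdim c)) (car (chi c u)) (carp (chi c u)).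
Proof.
move=> hu; set x := chi c u; have := carp_open x; have := chi_carp x.
move: (carp x); move: (car x) => c' u' e hu'.
have ec := chi_disjoint hu hu' (esym e); subst c'; congr existT.
by apply: chi_inj hu hu' _; rewrite e.
Qed.

Lemma car_ind (P : forall c, 'rV[R]_(cdim c) -> Prop) c u : open_cube u ->
  P c u -> P (car (chi c u)) (carp (chi c u)).
Proof.
by move=> /car_eq e; have := congr1 (fun s => P (tag s) (tagged s)) e => /= ->.
Qed.

(** A representation of [x] in the cube of [c], on the face modelled on its carrier: [t] are the
    offsets from [w], and [s] selects those that the carrier sees. *)
Definition frep c w x w' s t :=
  [/\ @isface _ _ K c w (car x) w' s, unit_box t,
      forall i, (forall j, s j <> i) -> t i = 0 & carp x = cpt w' (t \o s)].

Lemma frep_ex c u x : cube u -> chi c u = x ->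
  exists w w' s t, frep w (x := x) w' s t /\ u = cpt w t.
Proof.
move=> hu hx; pose w : {ffun 'I_(cdim c) -> bool} := [ffun i => u 0 i == 1].
pose A := [set i | (u 0 i == 0) || (u 0 i == 1)]%SET.
have [c' [w' [s [[sinj hf] hs _]]]] := face_ex w A.
have h0 i : (forall j, s j <> i) -> off w u i = 0.
  move=> hi; have : i \in A.
    by apply/negPn/negP => /hs[j]; exact: hi.
  rewrite inE /off ffunE orbC; case: (u 0 i =P 1) => [->|_ /eqP//].
  by rewrite subrr.
have ho : open_cube (cpt w' (off w u \o s)).
  apply/open_cpt => j /=; have : s j \notin A by apply/hs; exists j.
  rewrite inE negb_or => /andP[n0 n1]; rewrite /off ffunE (negPf n1).
  by have := hu (s j); rewrite !lt_neqAle eq_sym n0 n1.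
have e : chi c' (cpt w' (off w u \o s)) = x.
  by rewrite -hf ?offK //; exact: cube_off.
have : exists w2 s2 t, frep w (x := x) w2 s2 t /\ u = cpt w t; last first.
  by move=> [w2 [s2 [t h]]]; exists w, w2, s2, t.
rewrite -e; apply: (car_ind (P := fun c0 u0 => exists w2 s2 t,
  [/\ @isface _ _ K c w c0 w2 s2, unit_box t,
      forall i, (forall j, s2 j <> i) -> t i = 0 & u0 = cpt w2 (t \o s2)]
  /\ u = cpt w t)) => //.
by exists w', s, (off w u); rewrite offK; split=> //; split=> //; exact: cube_off.
Qed.

Lemma frep_pos c w x w' s t : @frep c w x w' s t -> forall j, 0 < t (s j) < 1.
Proof. by move=> [_ _ _ h] j; have := carp_open x; rewrite h => /open_cpt; apply. Qed.

Lemma frep_chi c w x w' s t : @frep c w x w' s t -> chi c (cpt w t) = x.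
Proof. by move=> [[sinj hf] h1 h2 h3]; rewrite hf // -h3 chi_carp. Qed.

(* Moves a point near [v] from one representation of [chi c v] to another. *)
Lemma face_transfer c u v c2 v2 : cube u -> cube v -> cube v2 -> chi c v = chi c2 v2 ->
  (forall i, v 0 i = 0 \/ v 0 i = 1 -> u 0 i = v 0 i) ->
  exists u2, [/\ cube u2, chi c2 u2 = chi c u & euclid_dist u2 v2 = euclid_dist u v].
Proof.
move=> hu hv hv2 e hface.
have [z hz] : exists z, chi c2 v2 = z by exists (chi c2 v2).
rewrite hz in e.
have [w [w' [s [t [hr ev]]]]] := frep_ex hv e.
have [w2 [w2' [s2 [t2 [hr2 ev2]]]]] := frep_ex hv2 hz.
have [[sinj hs] ht h0 ec] := hr; have [[sinj2 hs2] ht2 h02 ec2] := hr2.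
pose a := off w u; have ea : cpt w a = u by exact: offK.
have ha : unit_box a by exact: cube_off.
have ha0 i : (forall j, s j <> i) -> a i = 0.
  move=> hi; have := h0 i hi; have := hface i; rewrite -ea ev !cptE => h ti.
  rewrite ti in h; move: h; case: (w i) => h.
    by have := h (or_intror (subr0 _)); lra.
  exact: h (or_introl erefl).
pose p := cpt w' (a \o s); pose b := off w2' p.
have hb : unit_box b by apply: cube_off; apply/cube_cpt => j; exact: ha.
exists (cpt w2 (extz s2 b)); split.
- by apply/cube_cpt; exact: extz_box.
- rewrite hs2; [|exact: extz_box|exact: extz_out].
  by rewrite extz_comp // /b offK /p -hs // ea.
- rewrite ev2 -{1}(extz_id sinj2 h02) !euclid_ed2 ed2_cpt extz_dist //.
  have -> : t2 \o s2 = off w2' (carp z) by rewrite ec2 cptK.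
  rewrite -ed2_off ec /p ed2_cpt -ea ev ed2_cpt; congr Num.sqrt; apply/esym.
  by apply: sum_inj => // i hi; rewrite ha0 // h0 // subrr expr0n.
Qed.

(** All coordinates that a preimage of [x] can have, in whatever cube: those in the carrier, their
    reflections, 0 and 1. The list is finite however many cubes contain [x], and this yields the
    positive number [gap x]. *)
Definition coords x : seq R := 0 :: 1 ::
  [seq carp x 0 j | j <- enum 'I_(cdim (car x))] ++
  [seq 1 - carp x 0 j | j <- enum 'I_(cdim (car x))].

Lemma coordsP c u i : cube u -> u 0 i \in coords (chi c u).
Proof.
move=> hu; move ex : (chi c u) => x.
have [w [w' [s [t [hr ev]]]]] := frep_ex hu ex.
have [[sinj hs] ht h0 ec] := hr; rewrite ev cptE /coords !inE.
have [j /eqP ej|he] := pickP (fun j => s j == i).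
  have hj : t i = carp x 0 j \/ t i = 1 - carp x 0 j.
    by rewrite ec cptE /= ej; case: (w' j); [right|left] => //; lra.
  apply/orP; right; apply/orP; right; rewrite mem_cat.
  have [h|h] : (if w i then 1 - t i else t i) = carp x 0 j \/
      (if w i then 1 - t i else t i) = 1 - carp x 0 j.
  - by case: (w i); case: hj => ->; [right|left|left|right] => //; lra.
  - by rewrite h map_f // mem_enum.
  - by rewrite h (map_f (fun j => 1 - carp x 0 j)) ?orbT // mem_enum.
rewrite h0 => [|j /eqP]; last by rewrite he.
by case: (w i); rewrite ?subr0 eqxx ?orbT.
Qed.

Definition gap x : R := sval (cid2 (list_gap (coords x))).

Lemma gap_gt0 x : 0 < gap x.
Proof. by rewrite /gap; case: cid2. Qed.

Lemma gapP x a b : a \in coords x -> b \in coords x -> `|a - b| < gap x -> a = b.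
Proof. by rewrite /gap; case: cid2 => e h1 h2 /=; exact: h2. Qed.

Lemma coords_bool x (b : bool) : b%:R \in coords x.
Proof. by case: b; rewrite /coords !inE eqxx ?orbT. Qed.

Lemma preim_uniq c u u' : cube u -> cube u' -> chi c u = chi c u' ->
  (forall i, `|u 0 i - u' 0 i| < gap (chi c u)) -> u = u'.
Proof.
move=> hu hu' e h; apply/rowP => i; apply: (gapP (x := chi c u)) (h i).
  exact: coordsP.
by rewrite e coordsP.
Qed.

(** A string shorter than [gap x] cannot leave the star of [x]. Where it passes into another cube at
    a point with a coordinate 0 or 1, the preimage of [x] has that coordinate within [gap x] of it,
    hence equal to it, and can be transferred to the other cube. *)
Lemma string_preim x z s y L :
  (forall c v, cube v -> chi c v = z ->
     exists u, [/\ cube u, chi c u = x & euclid_dist u v <= L]) ->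
  is_string (K := K) z s y -> L + string_length s < gap x ->
  forall c v, cube v -> chi c v = y ->
     exists u, [/\ cube u, chi c u = x & euclid_dist u v <= L + string_length s].
Proof.
elim: s z L => [|[c1 [a b]] s IH] z L hQ /=.
  by move=> <-; rewrite /string_length big_nil addr0.
move=> [ha hb ea hs]; rewrite /string_length big_cons /= -/(string_length s) addrA => hlt.
have hs0 : 0 <= string_length s by apply: sumr_ge0 => p _; exact: euclid_ge0.
apply: (IH (chi c1 b)) => // c v hv ev.
have [u1 [hu1 eu1 hd]] := hQ c1 a ha ea.
have hd1 : euclid_dist u1 b <= L + euclid_dist a b.
  by apply: le_trans (euclid_triangle _ a _) _; rewrite lerD2r.
have [|u2 [h1 h2 h3]] := @face_transfer c1 u1 b c v hu1 hb hv (esym ev).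
  move=> i hi; apply: (gapP (x := x)).
  - by rewrite -eu1 coordsP.
  - by case: hi => ->; [exact: (coords_bool x false)|exact: (coords_bool x true)].
  - by apply: le_lt_trans (euclid_coord _ _ _) _; lra.
by exists u2; rewrite h2 h3 eu1.
Qed.

Hypothesis hlm : induced_length_metric K.

Lemma string_len_ge0 (s : seq (cube_segment K)) : 0 <= string_length s.
Proof. by apply: sumr_ge0 => p _; exact: euclid_ge0. Qed.

Lemma mdist_le_string x s y : is_string (K := K) x s y -> mdist x y <= string_length s.
Proof.
move=> hs; have [_ ->] := hlm x y; apply: ge_inf; last by exists s.
by exists 0 => _ [s' _ <-]; exact: string_len_ge0.
Qed.

Lemma string_lt x y e : mdist x y < e ->
  exists2 s, is_string (K := K) x s y & string_length s < e.
Proof.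
have [hne ->] := hlm x y => he.
set L := [set string_length s | s in _] in hne he *.
have hL : has_inf L by split=> //; exists 0 => _ [s' _ <-]; exact: string_len_ge0.
have he' : 0 < e - inf L by rewrite subr_gt0.
by have [_ [s hs <-]] := inf_adherent he' hL; rewrite addrC subrK => h; exists s.
Qed.

Lemma mdist_chi c u v : cube u -> cube v -> mdist (chi c u) (chi c v) <= euclid_dist u v.
Proof.
move=> hu hv; have := @mdist_le_string (chi c u) [:: existT _ c (u, v)] (chi c v).
by rewrite /string_length big_seq1; apply; split.
Qed.

Lemma near_preim x c v r : cube v -> mdist x (chi c v) < r -> r <= gap x ->
  exists u, [/\ cube u, chi c u = x & euclid_dist u v < r].
Proof.
move=> hv /string_lt[s hs hl] hr.
have h0 c' v' : cube v' -> chi c' v' = x ->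
    exists u, [/\ cube u, chi c' u = x & euclid_dist u v' <= 0].
  by move=> h1 h2; exists v'; rewrite euclid_refl.
have h1 : 0 + string_length s < gap x by rewrite add0r; apply: lt_le_trans hl hr.
have [u [h2 h3 h4]] := string_preim h0 hs h1 hv erefl.
by exists u; split=> //; rewrite add0r in h4; apply: le_lt_trans h4 hl.
Qed.

End Strings.

Arguments carp_open {R X} K x i.

(** * Local systems and simple connectivity *)

Lemma norm_pm (R : realType) (r p q : R) : p = q \/ p = - q -> `|q| < r -> `|p| < r.
Proof. by case=> ->; rewrite ?normrN. Qed.

Section LocalSystem.
Variables (R : realType) (X : metricType R) (K : cube_complex R X).
Implicit Types (c : cell K) (x y z : X).
Variables (T : Type) (F : vert K -> T -> Prop) (tr : T -> edge_t K -> T).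
Hypothesis trF : forall e C, F (esrc e) C -> F (etgt e) (tr C e).
Hypothesis trK : forall e C, F (esrc e) C -> tr (tr C e) (eopp e) = C.
Hypothesis trsq : forall (e x e' x' : edge_t K) C, esq e x e' x' -> F (esrc e) C ->
  tr (tr C e) x' = tr (tr C x) e'.

(** A parallel section of the local system over the corners of one cube; its value at one corner
    determines it. *)
Definition flat c (f : {ffun 'I_(cdim c) -> bool} -> T) :=
  (forall w, F (cv w) (f w)) /\ forall w i, f (flip w i) = tr (f w) (edge w i).

Lemma flat_uniq c f f' w : @flat c f -> flat f' -> f w = f' w -> f = f'.
Proof.
move=> [_ h] [_ h'] e; apply/funext; apply: flip_ind w e _ => w i e.
by rewrite h h' e.
Qed.

(** Induction on the number [k] of coordinates that may differ from [w0]. A new direction is filled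
    by transport along it, and [trsq] makes the result parallel in the earlier directions too. *)
Lemma flat_ex c w0 C : F (@cv _ _ K c w0) C -> exists2 f, flat f & f w0 = C.
Proof.
move=> hC; pose agree k (w : {ffun 'I_(cdim c) -> bool}) :=
  forall i : 'I_(cdim c), (k <= i)%N -> w i = w0 i.
have agree_flip k w (i : 'I_(cdim c)) : (i < k)%N -> agree k w -> agree k (flip w i).
  move=> hi hw j hj; rewrite flip_other ?hw //; apply/eqP => e.
  by move: hj; rewrite e leqNgt hi.
suff H k : (k <= cdim c)%N -> exists f, [/\ f w0 = C,
    forall w, agree k w -> F (cv w) (f w) & forall w (i : 'I_(cdim c)), (i < k)%N ->
      agree k w -> f (flip w i) = tr (f w) (edge w i)].
  have [f [h1 h2 h3]] := H _ (leqnn _).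
  have ha w : agree (cdim c) w by move=> i; rewrite leqNgt ltn_ord.
  by exists f => //; split=> [w|w i]; [exact: h2|exact: h3].
elim: k => [_|k IH hk].
  exists (fun=> C); split=> // w hw; suff -> : w = w0 by [].
  by apply/ffunP => i; exact: hw.
have [f [f0 f1 f2]] := IH (ltnW hk); pose i0 := Ordinal hk.
have ag w : agree k.+1 w -> w i0 = w0 i0 -> agree k w.
  move=> hw e j; rewrite leq_eqVlt => /orP[/eqP hj|]; last exact: hw.
  by have -> : j = i0 by apply: val_inj; rewrite /= hj.
have ag' w : agree k.+1 w -> w i0 != w0 i0 -> agree k (flip w i0).
  move=> hw e; apply: ag; first exact: agree_flip.
  by rewrite flip_same; move: e; case: (w i0); case: (w0 i0).
pose f' (w : {ffun 'I_(cdim c) -> bool}) :=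
  if w i0 == w0 i0 then f w else tr (f (flip w i0)) (edge (flip w i0) i0).
exists f'; split.
- by rewrite /f' eqxx.
- move=> w hw; rewrite /f'; case: eqP => [e|/eqP ne]; first exact/f1/ag.
  have := trF (e := edge (flip w i0) i0) (C := f (flip w i0)).
  by rewrite edge_src edge_tgt flipK; apply; exact/f1/ag'.
move=> w i hi hw; case: (eqVneq i i0) => [->|nei].
  rewrite /f' flip_same flipK; case: (eqVneq (w i0) (w0 i0)) => [->|ne].
    by case: (w0 i0).
  have -> : ~~ w i0 == w0 i0 by move: ne; case: (w i0); case: (w0 i0).
  have -> : edge w i0 = eopp (edge (flip w i0) i0) by rewrite edge_opp flipK.
  by rewrite trK // edge_src; exact/f1/ag'.
have hik : (i < k)%N.
  by move: hi; rewrite ltnS leq_eqVlt => /orP[/eqP e|//]; case/eqP: nei; apply: val_inj.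
rewrite /f' flip_other 1?eq_sym //; case: (eqVneq (w i0) (w0 i0)) => [e|ne].
  by apply: f2 => //; exact: ag.
have ha := ag' _ hw ne; rewrite flipC f2 //.
have q := esq_edge (flip w i0) nei.
by rewrite (trsq q) ?edge_src ?flipK //; exact: f1.
Qed.

Lemma face_flat c w c' w' s f f' : @isface _ _ K c w c' w' s -> flat f -> flat f' ->
  f w = f' w' -> forall v', exists v, [/\ isface v v' s, f v = f' v',
    forall i, (forall j, s j <> i) -> v i = w i &
    forall j, v (s j) = w (s j) (+) w' j (+) v' j].
Proof.
move=> hf [_ h] [_ h'] e; apply: (flip_ind (w0 := w')).
  exists w; split=> // j; by case: (w _); case: (w' _).
move=> v' j [v [h1 h2 h3 h4]]; have [sinj _] := hf.
exists (flip v (s j)); split.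
- exact: face_shift1.
- by rewrite h h' (face_edge j h1) h2.
- by move=> i hi; rewrite flip_other ?h3 //; apply/eqP => ei; exact: (hi j).
- move=> k; rewrite !ffunE (inj_eq sinj); case: eqP => [->|_]; rewrite h4 //.
  by rewrite addbN.
Qed.

Lemma isface_comp c w c' w' s c2 w2 s2 : @isface _ _ K c w c' w' s ->
  @isface _ _ K c' w' c2 w2 s2 -> isface w w2 (s \o s2).
Proof.
move=> [i1 h1] [i2 h2]; split; first exact: inj_comp.
move=> t ht h0; rewrite h1 //; last by move=> i hi; apply: h0 => j; exact: hi.
rewrite h2 // => [i|i hi]; first exact: ht.
by apply: h0 => j /i1; exact: hi.
Qed.

(** The section [f] over [c] restricts to the section [f'] over the carrier of [x], the point [u]
    telling which face is meant. *)
Definition EX c u x (f : {ffun 'I_(cdim c) -> bool} -> T)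
    (f' : {ffun 'I_(cdim (car K x)) -> bool} -> T) :=
  exists w w' s t, [/\ frep w (x := x) w' s t, u = cpt w t & f w = f' w'].

Lemma frep_off c w x w' s t i : @frep _ _ K c w x w' s t ->
  (forall j, s j <> i) <-> (cpt w t 0 i = 0 \/ cpt w t 0 i = 1).
Proof.
move=> hr; have [hf ht h0 _] := hr; rewrite cptE; split=> [hi|h j e].
  by rewrite h0 //; case: (w i); [right|left]; rewrite ?subr0.
have := frep_pos hr j; rewrite e => hi.
by move: h; case: (w i) => -[]; lra.
Qed.

Lemma frep_corner c w x w' s t i : @frep _ _ K c w x w' s t ->
  (forall j, s j <> i) -> cpt w t 0 i = (w i)%:R.
Proof. by move=> [_ _ h0 _] hi; rewrite cptE h0 //; case: (w i); rewrite ?subr0. Qed.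

Lemma cpt_third_inj n (w w' : {ffun 'I_n -> bool}) :
  cpt w (fun=> 3%:R^-1 : R) = cpt w' (fun=> 3%:R^-1) -> w = w'.
Proof.
have ne : 1 - 3%:R^-1 <> 3%:R^-1 :> R by move=> h; lra.
move=> e; apply/ffunP => i; have := congr1 (fun u : 'rV_n => u 0 i) e; rewrite !cptE.
by case: (w i); case: (w' i) => // h; case: ne.
Qed.

(* The combinatorial face map is forced by the characteristic maps. *)
Lemma frep_uniq c f x f' w1 w1' s1 t1 w2 w2' s2 t2 : @flat c f -> flat f' ->
  @frep _ _ K c w1 x w1' s1 t1 -> @frep _ _ K c w2 x w2' s2 t2 ->
  cpt w1 t1 = cpt w2 t2 -> f w1 = f' w1' -> f w2 = f' w2'.
Proof.
move=> hf hf' r1 r2 eu e1.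
have im i : (forall j, s1 j <> i) <-> (forall j, s2 j <> i).
  by rewrite (frep_off i r1) (frep_off i r2) eu.
have [F1 _ _ _] := r1; have [F2 _ _ _] := r2.
pose v' := [ffun j => w1' j (+) w1 (s1 j) (+) w2 (s1 j)].
have [v [g1 g2 g3 g4]] := face_flat F1 hf hf' e1 v'.
have ev : v = w2.
  apply/ffunP => i; have [hi|] := pselect (forall j, s1 j <> i).
    rewrite g3 //; have := frep_corner r2 ((im i).1 hi); rewrite -eu (frep_corner r1 hi).
    by case: (w1 i); case: (w2 i) => // /eqP; rewrite ?oner_eq0 // eq_sym oner_eq0.
  move=> /existsNP[j /contrapT <-]; rewrite g4 ffunE.
  by case: (w1' j); case: (w1 (s1 j)); case: (w2 (s1 j)).
rewrite -ev g2; congr f'; rewrite ev in g1.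
pose tau := extz s1 (fun=> 3%:R^-1 : R).
have hx : 0 <= (3%:R^-1 : R) <= 1 by lra.
have htau : unit_box tau by apply: extz_box => j.
have [i1 h1] := g1; have [i2 h2] := F2.
have c1 : tau \o s1 = fun=> 3%:R^-1 by rewrite extz_comp.
have c2 : tau \o s2 = fun=> 3%:R^-1.
  apply/funext => j /=; have [|] := pselect (forall k, s1 k <> s2 j).
    by move/im => /(_ j).
  by move=> /existsNP[k /contrapT <-]; rewrite /tau extz_in.
have := h1 tau htau (fun i hi => extz_out _ hi).
rewrite h2 //; last by move=> i /im hi; exact: extz_out.
rewrite c1 c2 => /esym e; apply: cpt_third_inj; apply: chi_inj e; apply/open_cpt => j; lra.
Qed.

Lemma EX_fun c u x f f1 f2 : @flat c f -> flat f1 -> flat f2 ->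
  EX u (x := x) f f1 -> EX u (x := x) f f2 -> f1 = f2.
Proof.
move=> h h1 h2 [w1 [w1' [s1 [t1 [r1 e1 a1]]]]] [w2 [w2' [s2 [t2 [r2 e2 a2]]]]].
apply: (flat_uniq (w := w2')) => //; rewrite -a2; apply/esym.
by apply: frep_uniq r1 r2 _ a1; rewrite // -e1.
Qed.

Lemma EX_inj c u x f f1 f2 : @flat c f1 -> flat f2 -> flat f ->
  EX u (x := x) f1 f -> EX u (x := x) f2 f -> f1 = f2.
Proof.
move=> h1 h2 h [w1 [w1' [s1 [t1 [r1 e1 a1]]]]] [w2 [w2' [s2 [t2 [r2 e2 a2]]]]].
apply: (flat_uniq (w := w2)) => //; rewrite a2.
by apply: frep_uniq r1 r2 _ a1; rewrite // -e1.
Qed.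

Lemma EX_down c u x f : cube u -> chi c u = x -> flat f ->
  exists2 f', flat f' & EX u (x := x) f f'.
Proof.
move=> hu hx hf; have [w [w' [s [t [hr eu]]]]] := frep_ex hu hx.
have [hs _ _ _] := hr.
have [|f' h1 h2] := @flat_ex _ w' (f w); first by rewrite -(isface_vtx hs); apply: hf.1.
by exists f' => //; exists w, w', s, t.
Qed.

Lemma EX_up c u x f' : cube u -> chi c u = x -> flat f' ->
  exists2 f, @flat c f & EX u (x := x) f f'.
Proof.
move=> hu hx hf; have [w [w' [s [t [hr eu]]]]] := frep_ex hu hx.
have [hs _ _ _] := hr.
have [|f h1 h2] := @flat_ex _ w (f' w'); first by rewrite (isface_vtx hs); apply: hf.1.
by exists f => //; exists w, w', s, t.
Qed.

Lemma EX_cube c u x f f' : @EX c u x f f' -> cube u.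
Proof. by move=> [w [w' [s [t [[_ ht _ _] -> _]]]]]; exact/cube_cpt. Qed.

Lemma EX_chi c u x f f' : @EX c u x f f' -> chi c u = x.
Proof. by move=> [w [w' [s [t [hr -> _]]]]]; exact: frep_chi hr. Qed.

Lemma EX_comp c x y f g h w w' s t u : @flat c f -> flat g -> flat h ->
  @frep _ _ K c w y w' s t -> f w = g w' -> EX u (x := x) g h ->
  EX (cpt w (extz s (off w' u))) f h.
Proof.
move=> hf hg hh hr e [w1 [w1' [s1 [t1 [hr1 eu e1]]]]].
have [hs ht h0 ec] := hr; have [hs1 ht1 h01 ec1] := hr1.
have [v [g1 g2 g3 g4]] := face_flat hs hf hg e w1; have [sinj _] := hs.
have [sinj1 _] := hs1.
exists v, w1', (s \o s1), (extz s t1); split; last by rewrite g2.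
  split; first exact: isface_comp g1 hs1.
  - exact: extz_box.
  - move=> i hi; have [hn|] := pselect (forall j, s j <> i); first exact: extz_out.
    move=> /existsNP[j /contrapT ej]; rewrite -ej extz_in // h01 // => k hk.
    by apply: (hi k); rewrite /= hk.
  - by rewrite ec1; apply: cpt_ext => j /=; rewrite extz_in.
rewrite eu; apply/rowP => i; rewrite !cptE.
have [hi|] := pselect (forall j, s j <> i); first by rewrite !extz_out // g3.
move=> /existsNP[j /contrapT <-]; rewrite !extz_in // g4 /off cptE.
by case: (w (s j)); case: (w' j); case: (w1 j) => //=; rewrite opprB addrC subrK.
Qed.

Definition FR r x (f : {ffun 'I_(cdim (car K x)) -> bool} -> T)
    y (g : {ffun 'I_(cdim (car K y)) -> bool} -> T) :=
  exists2 u, EX u (x := x) g f & forall i, `|u 0 i - carp K y 0 i| < r.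

Lemma FR_trans r r' x f y g z h : 0 < r -> flat f -> flat g -> flat h ->
  @FR r x f y g -> @FR r' y g z h -> FR (r + r') f h.
Proof.
move=> r0 hf hg hh [u hu hur] [v [w [w' [s [t [hr ev e]]]]] hvr].
have [[sinj _] ht h0 ec] := hr.
exists (cpt w (extz s (off w' u))); first exact: (EX_comp hh hg hf hr e hu).
move=> i; suff h1 : `|cpt w (extz s (off w' u)) 0 i - v 0 i| < r.
  by have := hvr i; have := ler_distD (v 0 i) (cpt w (extz s (off w' u)) 0 i) (carp K z 0 i); lra.
rewrite ev !cptE; have [hi|] := pselect (forall j, s j <> i).
  by rewrite extz_out // h0 // subrr normr0.
move=> /existsNP[j /contrapT <-]; rewrite extz_in //.
have -> : t (s j) = off w' (carp K y) j by rewrite ec cptK.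
have := hur j; rewrite /off.
by case: (w (s j)); case: (w' j); refine (norm_pm _); first [by left; ring|by right; ring].
Qed.

Lemma FR_refl r x f : 0 < r -> flat f -> @FR r x f x f.
Proof.
move=> r0 hf; exists (carp K x); last by move=> i; rewrite subrr normr0.
pose w : {ffun 'I_(cdim (car K x)) -> bool} := [ffun => false].
exists w, w, id, (off w (carp K x)); split; rewrite ?offK //.
split; rewrite ?offK //; first by split=> // t _ _; congr chi; apply: cpt_ext.
- by apply: cube_off; apply: open_cube_cube; exact: carp_open.
- by move=> i /(_ i).
Qed.

Lemma FR_near c u v x y f f1 f2 r : @flat c f -> flat f1 -> flat f2 -> r <= gap K x ->
  EX u (x := x) f f1 -> EX v (x := y) f f2 ->
  (forall i, `|u 0 i - v 0 i| < r) -> FR r f1 f2.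
Proof.
move=> hf hf1 hf2 hr hu hv huv; have cu := EX_cube hu; have ex := EX_chi hu.
have [w [w' [s [t [hr2 ev e]]]]] := hv; have [[sinj hs] ht h0 ec] := hr2.
have ha0 i : (forall j, s j <> i) -> off w u i = 0.
  move=> hi; have hvi : v 0 i = (w i)%:R by rewrite ev; exact: frep_corner hr2 hi.
  have : u 0 i = (w i)%:R.
    apply: (gapP (K := K) (x := x)); first by rewrite -ex coordsP.
    - exact: coords_bool.
    - by rewrite -hvi; apply: lt_le_trans hr.
  by rewrite /off => ->; case: (w i); rewrite ?subrr.
pose u' := cpt w' (off w u \o s).
have cu' : cube u' by apply/cube_cpt => j; exact: (cube_off w cu).
have eu' : chi (car K y) u' = x.
  by rewrite -ex -[in RHS](offK w u) hs //; exact: cube_off.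
have [g hg hx] := EX_down cu' eu' hf2.
have := EX_comp hf hf2 hg hr2 e hx; rewrite /u' cptK extz_id // offK => h.
have -> : f1 = g by exact: EX_fun hu h.
exists u' => // j; have := huv (s j); rewrite ev ec /u' !cptE /off /=.
by case: (w (s j)); case: (w' j); refine (norm_pm _); first [by left; ring|by right; ring].
Qed.

(** The total space of the covering of [X]: a point with a parallel section over its carrier. [NE r]
    below says that two of its points lie on one sheet with coordinates closer than [r]. *)
Definition E := {x : X & {ffun 'I_(cdim (car K x)) -> bool} -> T}.
Implicit Types (a b : E).

Definition eflat a := flat (tagged a).
Definition NE r a b := FR r (tagged a) (tagged b).

Lemma NE_le r r' a b : r <= r' -> NE r a b -> NE r' a b.
Proof. by move=> h [u h1 h2]; exists u => // i; apply: lt_le_trans h. Qed.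

Lemma NE_u_uniq r x y u u' : r + r <= gap K x ->
  cube u -> cube u' -> chi (car K y) u = x -> chi (car K y) u' = x ->
  (forall i, `|u 0 i - carp K y 0 i| < r) -> (forall i, `|u' 0 i - carp K y 0 i| < r) ->
  u = u'.
Proof.
move=> hr hu hu' e e' h h'; apply: preim_uniq => //; first by rewrite e'.
move=> i; rewrite e; apply: lt_le_trans hr.
have := h i; have := h' i; rewrite (distrC (u' 0 i)).
by have := ler_distD (carp K y 0 i) (u 0 i) (u' 0 i); lra.
Qed.

(** Two preimages of the first point within [r] of the same place are within [gap] of each other, so
    they coincide, and then so do the sections extending a given one. *)
Lemma NE_fun r a b b' : r + r <= gap K (tag a) -> eflat a -> eflat b -> eflat b' ->
  tag b = tag b' -> NE r a b -> NE r a b' -> b = b'.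
Proof.
case: a b b' => [x f] [y g] [y' g'] /= hr hf hg hg' e; move: g' hg'; rewrite -e.
move=> g' hg' [u hu hur] [u' hu' hur']; congr existT.
have eu : u = u'.
  by apply: NE_u_uniq hr (EX_cube hu) (EX_cube hu') (EX_chi hu) (EX_chi hu') hur hur'.
by rewrite -eu in hu'; apply: EX_inj hu hu'.
Qed.

Lemma NE_inj r a a' b : r + r <= gap K (tag a) -> eflat a -> eflat a' -> eflat b ->
  tag a = tag a' -> NE r a b -> NE r a' b -> a = a'.
Proof.
case: a a' b => [x f] [x' f'] [y g] /= hr hf hf' hg e; move: f' hf'; rewrite -e.
move=> f' hf' [u hu hur] [u' hu' hur']; congr existT.
have eu : u = u'.
  by apply: NE_u_uniq hr (EX_cube hu) (EX_cube hu') (EX_chi hu) (EX_chi hu') hur hur'.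
by rewrite -eu in hu'; apply: EX_fun hu hu'.
Qed.

Hypothesis hlm : induced_length_metric K.

Lemma NE_ex r a y : eflat a -> mdist (tag a) y < r -> r <= gap K (tag a) ->
  exists b, [/\ tag b = y, eflat b & NE r a b].
Proof.
case: a => [x f] /= hf hd hr.
have cy : cube (carp K y) by apply: open_cube_cube; exact: carp_open.
have := @near_preim _ _ K hlm x (car K y) (carp K y) r cy; rewrite chi_carp => /(_ hd hr).
move=> [u [h1 h2 h3]]; have [g hg he] := EX_up h1 h2 hf.
exists (existT _ y g); split=> //; exists u => // i.
by apply: le_lt_trans h3; exact: euclid_coord.
Qed.

Lemma NE_exr r x b : eflat b -> mdist x (tag b) < r -> r <= gap K x ->
  exists a, [/\ tag a = x, eflat a & NE r a b].
Proof.
case: b => [y g] /= hg hd hr.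
have cy : cube (carp K y) by apply: open_cube_cube; exact: carp_open.
have := @near_preim _ _ K hlm x (car K y) (carp K y) r cy; rewrite chi_carp => /(_ hd hr).
move=> [u [h1 h2 h3]]; have [f hf he] := EX_down h1 h2 hg.
exists (existT _ x f); split=> //; exists u => // i.
by apply: le_lt_trans h3; exact: euclid_coord.
Qed.

(** * Lifting a homotopy to the total space *)

Definition near2 (p q : R * R) (d : R) := `|p.1 - q.1| < d /\ `|p.2 - q.2| < d.

Lemma near2_le p q d d' : d <= d' -> near2 p q d -> near2 p q d'.
Proof. by move=> h [h1 h2]; split; apply: lt_le_trans h. Qed.

Definition flatS (D : set (R * R)) (L : R * R -> E) :=
  (forall p, D p -> eflat (L p)) /\
  forall p r, D p -> 0 < r -> exists2 d, 0 < d &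
    forall q, D q -> near2 p q d -> NE r (L p) (L q).

Definition lifts (D : set (R * R)) (H : R * R -> X) L :=
  flatS D L /\ forall p, D p -> tag (L p) = H p.

Definition Hcont (D : set (R * R)) (H : R * R -> X) :=
  forall p r, D p -> 0 < r -> exists2 d, 0 < d &
    forall q, D q -> near2 p q d -> mdist (H p) (H q) < r.

Definition good H (D : set (R * R)) := forall p a, D p -> eflat a -> tag a = H p ->
  exists2 L, lifts D H L & L p = a.

Lemma lifts_sub D D' H L : D' `<=` D -> lifts D H L -> lifts D' H L.
Proof.
move=> s [[h1 h2] h3]; split; last by move=> p /s; exact: h3.
split=> [p /s|p r /s hp r0]; first exact: h1.
by have [d d0 hd] := h2 p r hp r0; exists d => // q /s; exact: hd.
Qed.

Lemma good_sub H D D' : D' `<=` D -> good H D -> good H D'.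
Proof.
move=> s h p a /s hp ha ea; have [L h1 h2] := h p a hp ha ea.
by exists L => //; exact: lifts_sub h1.
Qed.

Lemma local_good H D p0 : Hcont D H -> D p0 -> exists2 d, 0 < d &
  good H [set q | D q /\ near2 p0 q d].
Proof.
(* A quarter of the gap: two such radii add up to a half, the largest radius for which [NE_fun]
   applies. *)
move=> hc h0; set x := H p0; pose r0 := gap K x / 4%:R.
have g0 := gap_gt0 K x; have r00 : 0 < r0 by rewrite divr_gt0.
have hr0 : r0 <= gap K x by rewrite /r0; lra.
have [d d0 hd] := hc p0 r0 h0 r00; exists d => // p a [hp np] ha ea.
have [a0 [t0 f0 n0]] : exists a0, [/\ tag a0 = x, eflat a0 & NE r0 a0 a].
  by apply: NE_exr => //; rewrite ea; exact: hd.
have [L hL] : {L : R * R -> E & forall q, D q /\ near2 p0 q d ->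
    [/\ tag (L q) = H q, eflat (L q) & NE r0 a0 (L q)]}.
  apply: (@choice _ _ (fun q b => D q /\ near2 p0 q d ->
    [/\ tag b = H q, eflat b & NE r0 a0 b])) => q.
  have [hq|hn] := pselect (D q /\ near2 p0 q d); last by exists a.
  have [b hb] : exists b, [/\ tag b = H q, eflat b & NE r0 a0 b].
    by apply: NE_ex; rewrite ?t0 //; apply: hd; case: hq.
  by exists b.
exists L; last first.
  have [t1 f1 n1] := hL p (conj hp np).
  by apply: (NE_fun _ f0 _ _ _ n1 n0); rewrite ?t0 ?t1 ?ea // /r0; lra.
split; last by move=> q /hL[].
split=> [q /hL[]//|q r hq r1]; have [t1 f1 n1] := hL q hq.
pose r' := Num.min r (Num.min r0 (gap K (H q))).
have r'0 : 0 < r' by rewrite !lt_min r1 r00 gap_gt0.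
have r'1 : r' <= r by rewrite ge_min lexx.
have r'2 : r' <= r0 by rewrite !ge_min lexx orbT.
have r'3 : r' <= gap K (H q) by rewrite !ge_min lexx !orbT.
have [d' d'0 hd'] := hc q r' hq.1 r'0.
exists d' => // q' hq' nq'; have [t2 f2 n2] := hL q' hq'.
have [b [tb fb nb]] : exists b, [/\ tag b = H q', eflat b & NE r' (L q) b].
  by apply: NE_ex; rewrite ?t1 //; apply: hd' => //; case: hq'.
have n3 : NE (r0 + r') a0 b by apply: (FR_trans r00 f0 f1 fb n1 nb).
suff <- : b = L q' by exact: NE_le nb.
apply: (NE_fun _ f0 fb f2 _ n3); first by rewrite t0; move: r'2; rewrite /r0; lra.
  by rewrite tb t2.
by apply: NE_le n2; lra.
Qed.

Definition seg (p q : R * R) (t : R) : R * R :=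
  (p.1 + t * (q.1 - p.1), p.2 + t * (q.2 - p.2)).

Lemma seg0 p q : seg p q 0 = p.
Proof. by rewrite /seg !mul0r !addr0; case: p. Qed.

Lemma seg1 p q : seg p q 1 = q.
Proof. by rewrite /seg !mul1r !(addrC _ (_ - _)) !subrK; case: q. Qed.

Lemma lifts_uniq H D L L' p q : (forall t, 0 <= t <= 1 -> D (seg p q t)) ->
  lifts D H L -> lifts D H L' -> L p = L' p -> L q = L' q.
Proof.
move=> hD [[l1 l2] l3] [[m1 m2] m3] e0.
pose P t := L (seg p q t) = L' (seg p q t).
have P0 : P 0 by rewrite /P !seg0.
suff : P 1 by rewrite /P !seg1.
apply: (real_ind ler01 P0); rewrite /P.
move=> t ht; have hp := hD t ht; set pt := seg p q t in hp *.
pose r := gap K (H pt) / 2%:R; have g0 := gap_gt0 K (H pt).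
have r0 : 0 < r by rewrite divr_gt0.
have [d d0 hd] := l2 pt r hp r0; have [d' d'0 hd'] := m2 pt r hp r0.
pose M := 1 + `|q.1 - p.1| + `|q.2 - p.2|.
have M0 : 0 < M by rewrite /M; have := normr_ge0 (q.1 - p.1); have := normr_ge0 (q.2 - p.2); lra.
pose m := Num.min d d'; have m0 : 0 < m by rewrite lt_min d0.
have hn s : `|t - s| < m / M -> near2 pt (seg p q s) m.
  move=> hs; have hs' : `|t - s| * M < m by rewrite -ltr_pdivlMr.
  have hx := normr_ge0 (t - s).
  have e (x y : R) : x + t * y - (x + s * y) = (t - s) * y by ring.
  split; rewrite /pt /seg /= e normrM; apply: le_lt_trans hs'; apply: ler_wpM2l => //;
    by rewrite /M; have := normr_ge0 (q.1 - p.1); have := normr_ge0 (q.2 - p.2); lra.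
exists (m / M); first exact: divr_gt0.
move=> t1 t2 /andP[a1 a2] /andP[a3 a4] a5 a6 e1.
have h1 : 0 <= t1 <= 1 by move: ht => /andP[_ h]; rewrite a1 (le_trans a2).
have h2 : 0 <= t2 <= 1 by move: ht => /andP[h _]; rewrite a4 (le_trans h).
have n1 : near2 pt (seg p q t1) m by apply: hn; rewrite ger0_norm ?subr_ge0 //; lra.
have n2 : near2 pt (seg p q t2) m.
  by apply: hn; rewrite distrC ger0_norm ?subr_ge0 //; lra.
have md : m <= d by rewrite ge_min lexx.
have md' : m <= d' by rewrite ge_min lexx orbT.
have b1 := hd _ (hD _ h1) (near2_le md n1); have b2 := hd _ (hD _ h2) (near2_le md n2).
have c1 := hd' _ (hD _ h1) (near2_le md' n1); have c2 := hd' _ (hD _ h2) (near2_le md' n2).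
have hg : r + r <= gap K (tag (L pt)) by rewrite l3 // /r; lra.
have ept : L pt = L' pt.
  apply: (NE_inj hg _ _ _ _ b1); rewrite ?e1 ?l3 ?m3 //; try exact: l1; try exact: m1.
  by apply: m1; exact: hD.
rewrite -ept in c2; apply: (NE_fun hg _ _ _ _ b2 c2); rewrite ?l3 ?m3 //.
- exact: l1.
- by apply: l1; exact: hD.
- by apply: m1; exact: hD.
- exact: hD.
- exact: hD.
Qed.

(** The overlap contains the segments between its points, so by [lifts_uniq] two lifts that agree at
    [m] agree on all of it. The openness conditions keep continuity at points that lie in one piece
    only. *)
Lemma glue H D1 D2 m : D1 m -> D2 m ->
  (forall p q t, D1 p -> D2 p -> D1 q -> D2 q -> 0 <= t <= 1 ->
    D1 (seg p q t) /\ D2 (seg p q t)) ->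
  (forall p, D1 p -> ~ D2 p -> exists2 d, 0 < d & forall q, near2 p q d -> ~ D2 q) ->
  (forall p, D2 p -> ~ D1 p -> exists2 d, 0 < d & forall q, near2 p q d -> ~ D1 q) ->
  good H D1 -> good H D2 -> forall p a, D1 p -> eflat a -> tag a = H p ->
  exists2 L, lifts (D1 `|` D2) H L & L p = a.
Proof.
move=> m1 m2 hseg c1 c2 g1 g2 p a hp ha ea.
have [L1 l1 <-] := g1 p a hp ha ea.
have [L2 l2 e2] := g2 m (L1 m) m2 (l1.1.1 m m1) (l1.2 m m1).
have agr q : D1 q -> D2 q -> L1 q = L2 q.
  move=> q1 q2; pose I := D1 `&` D2.
  apply: (@lifts_uniq H I L1 L2 m q) => //.
  - by move=> t ht; exact: hseg.
  - by apply: lifts_sub l1 => x [].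
  - by apply: lifts_sub l2 => x [].
pose L q := if `[< D1 q >] then L1 q else L2 q.
have LE1 q : D1 q -> L q = L1 q by rewrite /L => /asboolT ->.
have LE2 q : D2 q -> L q = L2 q by rewrite /L; case: asboolP => // h1 h2; exact: agr.
exists L; last exact: LE1.
split; last by move=> q [h|h]; [rewrite LE1 //; exact: l1.2|rewrite LE2 //; exact: l2.2].
split=> [q [h|h]|q r]; [by rewrite LE1 //; exact: l1.1.1|by rewrite LE2 //; exact: l2.1.1|].
move=> hq r0; have [q1|q1] := pselect (D1 q); have [q2|q2] := pselect (D2 q); last by case: hq.
- have [d d0 hd] := l1.1.2 q r q1 r0; have [d' d'0 hd'] := l2.1.2 q r q2 r0.
  exists (Num.min d d'); first by rewrite lt_min d0.
  move=> q' [h|h] hn.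
    by rewrite !LE1 //; apply: hd => //; apply: near2_le hn; rewrite ge_min lexx.
  by rewrite !LE2 //; apply: hd' => //; apply: near2_le hn; rewrite ge_min lexx orbT.
- have [d d0 hd] := l1.1.2 q r q1 r0; have [d' d'0 hd'] := c1 q q1 q2.
  exists (Num.min d d'); first by rewrite lt_min d0.
  move=> q' [h|h] hn.
    by rewrite !LE1 //; apply: hd => //; apply: near2_le hn; rewrite ge_min lexx.
  by case: (hd' q') => //; apply: near2_le hn; rewrite ge_min lexx orbT.
- have [d d0 hd] := l2.1.2 q r q2 r0; have [d' d'0 hd'] := c2 q q2 q1.
  exists (Num.min d d'); first by rewrite lt_min d0.
  move=> q' [h|h] hn; last first.
    by rewrite !LE2 //; apply: hd => //; apply: near2_le hn; rewrite ge_min lexx.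
  by case: (hd' q') => //; apply: near2_le hn; rewrite ge_min lexx orbT.
Qed.

Lemma glue_half H (D : set (R * R)) (f : R * R -> R) (b : R) m :
  (f = fst \/ f = snd) -> D m -> f m = b ->
  (forall p q t, D p -> D q -> 0 <= t <= 1 -> D (seg p q t)) ->
  good H [set p | D p /\ f p <= b] -> good H [set p | D p /\ b <= f p] -> good H D.
Proof.
move=> hf dm fm hcv g1 g2.
have fn p q d : near2 p q d -> `|f p - f q| < d by case=> h1 h2; case: hf => ->.
have fs p q t : f (seg p q t) = f p + t * (f q - f p) by case: hf => ->.
set D1 := [set p | D p /\ f p <= b] in g1; set D2 := [set p | D p /\ b <= f p] in g2.
have m1 : D1 m by split; rewrite ?fm.
have m2 : D2 m by split; rewrite ?fm.
have hI p q t : D1 p -> D2 p -> D1 q -> D2 q -> 0 <= t <= 1 ->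
    D1 (seg p q t) /\ D2 (seg p q t).
  move=> [dp h1] [_ h2] [dq h3] [_ h4] ht; have hd := hcv p q t dp dq ht.
  have e1 : f p = b by apply/eqP; rewrite eq_le h1.
  have e2 : f q = b by apply/eqP; rewrite eq_le h3.
  by split; split=> //; rewrite fs e1 e2 subrr mulr0 addr0.
have c1 p : D1 p -> ~ D2 p -> exists2 d, 0 < d & forall q, near2 p q d -> ~ D2 q.
  move=> [dp h1] h2; have h3 : f p < b by rewrite ltNge; apply/negP => h; apply: h2.
  exists (b - f p); first by rewrite subr_gt0.
  by move=> q /fn hq [_ h4]; have := ler_norm (f q - f p); rewrite distrC; lra.
have c2 p : D2 p -> ~ D1 p -> exists2 d, 0 < d & forall q, near2 p q d -> ~ D1 q.
  move=> [dp h1] h2; have h3 : b < f p by rewrite ltNge; apply/negP => h; apply: h2.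
  exists (f p - b); first by rewrite subr_gt0.
  by move=> q /fn hq [_ h4]; have := ler_norm (f p - f q); lra.
have hI' p q t : D2 p -> D1 p -> D2 q -> D1 q -> 0 <= t <= 1 ->
    D2 (seg p q t) /\ D1 (seg p q t).
  by move=> a1 a2 a3 a4 ht; have [] := hI p q t a2 a1 a4 a3 ht.
have sD : D `<=` D1 `|` D2.
  by move=> p dp; case: (leP (f p) b) => h; [left|right; split=> //; exact: ltW].
move=> p a dp ha ea; case: (sD p dp) => hp.
  have [L hL <-] := glue m1 m2 hI c1 c2 g1 g2 hp ha ea.
  by exists L => //; exact: lifts_sub hL.
have [L hL <-] := glue m2 m1 hI' c2 c1 g2 g1 hp ha ea.
by exists L => //; apply: lifts_sub hL; rewrite setUC.
Qed.

Definition sqU : set (R * R) := [set p | 0 <= p.1 <= 1 /\ 0 <= p.2 <= 1].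

Lemma conv_le (x y t b : R) : 0 <= t <= 1 -> x <= b -> y <= b -> x + t * (y - x) <= b.
Proof. by move=> /andP[h1 h2] h3 h4; nra. Qed.

Lemma conv_ge (x y t b : R) : 0 <= t <= 1 -> b <= x -> b <= y -> b <= x + t * (y - x).
Proof. by move=> /andP[h1 h2] h3 h4; nra. Qed.

(** Continuous induction twice, in place of a Lebesgue number: small squares are stacked into a thin
    vertical strip, and strips are added from left to right. *)
Lemma square_good H : Hcont sqU H -> good H sqU.
Proof.
move=> hc.
have cvU p q t : sqU p -> sqU q -> 0 <= t <= 1 -> sqU (seg p q t).
  move=> [/andP[a1 a2] /andP[a3 a4]] [/andP[b1 b2] /andP[b3 b4]] ht.
  by split; rewrite /= conv_le // conv_ge.
have strip s : 0 <= s <= 1 -> exists2 d, 0 < d &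
    good H [set p | sqU p /\ `|p.1 - s| <= d /\ p.2 <= 1].
  move=> hs; pose P t := exists2 d, 0 < d &
    good H [set p | sqU p /\ `|p.1 - s| <= d /\ p.2 <= t].
  apply: (@real_ind R P 0 1 ler01).
    have [|d d0 hd] := @local_good H sqU (s, 0) hc; first by split; rewrite //= lexx ler01.
    exists (d / 2); first by rewrite divr_gt0.
    apply: good_sub hd => p [h1 [h2 h3]]; split=> //; split=> /=.
      by rewrite distrC; apply: le_lt_trans h2 _; lra.
    by have [_ /andP[h4 _]] := h1; rewrite (_ : p.2 = 0) ?subrr ?normr0 //; lra.
  move=> t ht; have [|d d0 hd] := @local_good H sqU (s, t) hc; first by split.
  exists d => // t1 t2 /andP[a1 a2] /andP[a3 a4] a5 a6 [d1 d10 h1].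
  pose e := Num.min d1 (d / 2).
  have e0 : 0 < e by rewrite lt_min d10 divr_gt0.
  have e1 : e <= d1 by rewrite ge_min lexx.
  have e2 : e < d by apply: (@le_lt_trans _ _ (d / 2)); [rewrite ge_min lexx orbT|lra].
  exists e => //; apply: (@glue_half H _ snd t1 (s, t1)) => //.
  - by right.
  - split; first by split=> //=; move: ht a1 a2; lra.
    by rewrite /= subrr normr0 ltW //; split=> //; lra.
  - move=> p q x [p1 [p2 p3]] [q1 [q2 q3]] hx; split; first exact: cvU.
    split; last exact: conv_le.
    move: p2 q2; rewrite !ler_norml /= => /andP[p2 p4] /andP[q2 q4].
    by apply/andP; split; nra.
  - apply: good_sub h1 => p [[p1 [p2 p3]] p4]; split=> //; split=> //; exact: le_trans e1.
  - apply: good_sub hd => p [[p1 [p2 p3]] p4]; split=> //; split=> /=.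
      by rewrite distrC; apply: le_lt_trans e2.
    by rewrite ltr_norml; apply/andP; split; lra.
pose P s := good H [set p | sqU p /\ p.1 <= s].
suff : P 1 by apply: good_sub => p hp; split=> //; have [/andP[]] := hp.
apply: (@real_ind R P 0 1 ler01).
  have [|d d0 hd] := strip 0; first by rewrite lexx ler01.
  apply: good_sub hd => p [h1 h2]; have [/andP[h3 h4] /andP[h5 h6]] := h1.
  by split=> //; split=> //; rewrite (_ : p.1 = 0) ?subrr ?normr0 ?ltW //; lra.
move=> s hs; have [d d0 hd] := strip s hs.
exists d => // t1 t2 /andP[a1 a2] /andP[a3 a4] a5 a6 h1.
apply: (@glue_half H _ fst t1 (t1, 0)) => //.
- by left.
- by split; [split=> /=; [move: hs a1 a2; lra|rewrite lexx ler01]|rewrite /=; lra].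
- move=> p q x [p1 p2] [q1 q2] hx; split; first exact: cvU.
  exact: conv_le.
- by apply: good_sub h1 => p [[p1 p2] p3].
- apply: good_sub hd => p [[p1 p2] p3]; split=> //; split; last by have [_ /andP[]] := p1.
  by rewrite ler_norml; apply/andP; split; lra.
Qed.

(** The lift of the homotopy follows [G] on the first side by uniqueness. On the other three sides
    the homotopy is constant, hence so is the lift, and going round identifies the two ends of
    [G]. *)
Lemma loop_lift H (G : R -> E) : Hcont sqU H ->
  (forall t, 0 <= t <= 1 -> H (0, t) = tag (G t)) ->
  (forall t, 0 <= t <= 1 -> H (1, t) = tag (G 0)) ->
  (forall s, 0 <= s <= 1 -> H (s, 0) = tag (G 0) /\ H (s, 1) = tag (G 0)) ->
  (forall t, 0 <= t <= 1 -> eflat (G t)) ->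
  (forall t r, 0 <= t <= 1 -> 0 < r -> exists2 d, 0 < d &
    forall t', 0 <= t' <= 1 -> `|t - t'| < d -> NE r (G t) (G t')) -> G 1 = G 0.
Proof.
move=> hc hl hr hb hf hG.
have b0 : 0 <= (0 : R) <= 1 by rewrite lexx ler01.
have b1 : 0 <= (1 : R) <= 1 by rewrite lexx ler01.
have [L lL L0] : exists2 L, lifts sqU H L & L (0, 0) = G 0.
  by apply: (square_good hc) => //; [exact: hf|rewrite hl].
have sb (f g : R) t : 0 <= f <= 1 -> 0 <= g <= 1 -> 0 <= t <= 1 -> 0 <= f + t * (g - f) <= 1.
  by move=> /andP[? ?] /andP[? ?] ?; rewrite conv_le // conv_ge.
have L1 : L (0, 1) = G 1.
  pose D : set (R * R) := [set p | p.1 = 0 /\ 0 <= p.2 <= 1].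
  apply: (@lifts_uniq H D L (fun p => G p.2) (0, 0) (0, 1)) => //.
  - by move=> t ht; split=> /=; [lra|exact: sb].
  - by apply: lifts_sub lL => p [h1 h2]; split; rewrite ?h1.
  - split; last by move=> [x y] [/= -> h]; rewrite hl.
    split=> [[x y] [_ /hf]//|[x y] r [/= -> hy] r0].
    by have [d d0 hd] := hG y r hy r0; exists d => // -[x' y'] [_ h] [_ h']; exact: hd.
have const p q : sqU p -> sqU q -> (p.1 = q.1 \/ p.2 = q.2) ->
    (forall t, 0 <= t <= 1 -> H (seg p q t) = tag (G 0)) -> L p = G 0 -> L q = G 0.
  move=> hp hq _ hH; pose D := [set x | exists2 t, 0 <= t <= 1 & x = seg p q t].
  apply: (@lifts_uniq H D L (fun=> G 0) p q).
  - by move=> t ht; exists t.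
  - apply: lifts_sub lL => _ [t ht ->]; have [h1 h2] := hp; have [h3 h4] := hq.
    by split; exact: sb.
  - split; last by move=> _ [t ht ->]; rewrite hH.
    split=> [x _|x r _ r0]; first exact: hf.
    by exists 1 => // q' _ _; apply: FR_refl => //; exact: hf.
have e1 : L (1, 0) = G 0.
  apply: (const (0, 0) (1, 0)) => //; first by right.
  by move=> t ht; rewrite /seg /= !subrr mulr0 addr0; case: (hb (0 + t * (1 - 0))) => //; exact: sb.
have e2 : L (1, 1) = G 0.
  apply: (const (1, 0) (1, 1)) => //; first by left.
  by move=> t ht; rewrite /seg /= !subrr mulr0 addr0 hr //; exact: sb.
rewrite -L1; apply: (const (1, 1) (0, 1)) => //; first by right.
move=> t ht; rewrite /seg /= !subrr mulr0 addr0; case: (hb (1 + t * (0 - 1))) => //; exact: sb.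
Qed.

Hypothesis hfl : forall v, is_vertex K v -> flag_link K v.

Lemma vtx_dim x : is_vertex K x -> cdim (car K x) = 0%N.
Proof.
move=> [c hc [u hu <-]]; apply: (car_ind (P := fun c _ => cdim c = 0%N)) => // i.
by have := ltn_ord i; rewrite {2}hc.
Qed.

Lemma vtx_cv (u : vert K) (w : {ffun 'I_(cdim (car K (sval u))) -> bool}) : cv w = u.
Proof.
apply: vert_ext; rewrite /= -[RHS](chi_carp K (sval u)); congr chi.
by apply/rowP => i; have := ltn_ord i; rewrite {2}(vtx_dim (proj2_sig u)).
Qed.

Lemma vtx_val c v x f f' w' : is_vertex K x -> @EX c (cube_vertex v) x f f' ->
  f' w' = f v.
Proof.
move=> hx [w [w1 [s [t [hr e ef]]]]].
have noI (j : 'I_(cdim (car K x))) : False by have := ltn_ord j; rewrite {2}(vtx_dim hx).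
have -> : w' = w1 by apply/ffunP => j; case: (noI j).
rewrite -ef; congr f; apply/ffunP => i.
have := frep_corner hr (i := i); rewrite -e mxE => /(_ (fun j => False_ind _ (noI j))).
by case: (w i); case: (v i) => // /eqP; rewrite ?oner_eq0 // eq_sym oner_eq0.
Qed.

Lemma E_vtx_eq a b C : tag a = tag b -> (forall w, tagged a w = C) ->
  (forall w, tagged b w = C) -> a = b.
Proof.
case: a b => [x f] [y g] /= e; move: g; rewrite -e => g h h'; congr existT.
by apply/funext => w; rewrite h h'.
Qed.

Definition Econt (G : R -> E) := forall t r, 0 <= t <= 1 -> 0 < r ->
  exists2 d, 0 < d & forall t', 0 <= t' <= 1 -> `|t - t'| < d ->
    mdist (tag (G t)) (tag (G t')) < r /\ NE r (G t) (G t').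

Definition Epath (u : vert K) C (v : vert K) C' (G : R -> E) :=
  [/\ forall t, 0 <= t <= 1 -> eflat (G t), Econt G,
      tag (G 0) = sval u /\ tag (G 1) = sval v,
      forall w, tagged (G 0) w = C & forall w, tagged (G 1) w = C'].

Lemma edge_path e C : F (esrc e) C ->
  exists G, Epath (esrc e) C (etgt e) (tr C e) G.
Proof.
move=> hC; pose c := tag (sval e); pose w : {ffun 'I_(cdim c) -> bool} := tagged (sval e).
have hd : cdim c = 1%N := proj2_sig e.
have [f hf fw] := @flat_ex c w C hC.
have i0 : 'I_(cdim c) by rewrite hd; exact: ord0.
pose pt (t : R) : 'rV[R]_(cdim c) := cpt w (fun=> t).
have cpt_ t : 0 <= t <= 1 -> cube (pt t) by move=> ht; apply/cube_cpt => i.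
have [G hG] : {G : R -> E & forall t, 0 <= t <= 1 ->
    [/\ tag (G t) = ept (sval e) t, eflat (G t) & EX (pt t) f (tagged (G t))]}.
  apply: (@choice _ _ (fun t a => 0 <= t <= 1 ->
    [/\ tag a = ept (sval e) t, eflat a & EX (pt t) f (tagged a)])) => t.
  have [ht|hn] := pselect (0 <= t <= 1).
    have [f' h1 h2] := EX_down (cpt_ t ht) erefl hf.
    by exists (existT _ (chi c (pt t)) f').
  by exists (existT _ (sval (esrc e)) (fun=> C)) => /hn.
have b0 : 0 <= (0 : R) <= 1 by rewrite lexx ler01.
have b1 : 0 <= (1 : R) <= 1 by rewrite lexx ler01.
exists G; split.
- by move=> t /hG[].
- move=> t r ht r0; have [t1 f1 x1] := hG t ht.
  pose r' := Num.min r (gap K (tag (G t))).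
  exists r'; first by rewrite lt_min r0 gap_gt0.
  move=> t' ht'; rewrite lt_min => /andP[d1 d2]; have [t2 f2 x2] := hG t' ht'; split.
    rewrite t1 t2 /ept; apply: le_lt_trans (mdist_chi hlm (cpt_ t ht) (cpt_ t' ht')) _.
    by rewrite euclid_ed2 ed2_cpt sumr_const card_ord hd mulr1n sqrtr_sqr.
  have rg : r' <= gap K (tag (G t)) by rewrite ge_min lexx orbT.
  apply: (NE_le (r := r')); first by rewrite ge_min lexx.
  apply: (FR_near hf f1 f2 rg x1 x2) => i; rewrite !cptE.
  have hh : `|t - t'| < r' by rewrite lt_min d1.
  by case: (w i) => //; apply: norm_pm hh; right; ring.
- by have [g0 _ _] := hG 0 b0; have [g1 _ _] := hG 1 b1; rewrite g0 g1 esrcE etgtE.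
- move=> v; have [e0 _ h] := hG 0 b0.
  have hv : is_vertex K (tag (G 0)) by rewrite e0 -esrcE; exact: proj2_sig.
  by rewrite -fw; apply: vtx_val hv _; rewrite /pt -cpt_vertex in h *.
- move=> v; have [e0 _ h] := hG 1 b1.
  have hv : is_vertex K (tag (G 1)) by rewrite e0 -etgtE; exact: proj2_sig.
  have -> : tr C e = f (flip w i0) by rewrite hf.2 fw (_ : edge w i0 = e) //; exact: edge_self e i0.
  apply: vtx_val hv _; suff -> : cube_vertex (flip w i0) = pt 1 by [].
  rewrite -cpt_vertex cpt_flip; apply: cpt_ext => j.
  have -> : j = i0.
    move: (j) (i0); rewrite hd => j1 j2; apply: val_inj => /=.
    by case: j1 j2 => [[|//] ?] [[|//] ?].
  by rewrite eqxx subr0.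
Qed.

Lemma Epath_cat u C v C1 (z : vert K) C2 G1 G2 : Epath u C v C1 G1 -> Epath v C1 z C2 G2 ->
  exists G, Epath u C z C2 G.
Proof.
move=> [f1 c1 st1 a1 b1] [f2 c2 st2 a2 b2].
have e (P : E -> Prop) : P (G2 0) -> P (G1 1).
  by rewrite (E_vtx_eq _ b1 a2) // st1.2 st2.1.
pose G (t : R) := if t <= 1 / 2%:R then G1 (2%:R * t) else G2 (2%:R * t - 1).
have n0 : (0 : R) <= 1 / 2%:R by lra.
have n1 : (1 <= 1 / 2%:R :> R) = false by apply/negbTE; rewrite -ltNge; lra.
have nI : 2%:R - 1 = 1 :> R by lra.
suff [fG cG] : (forall t, 0 <= t <= 1 -> eflat (G t)) /\ Econt G.
  exists G; split=> //.
  - by rewrite /G n0 n1 mulr0 mulr1 nI; case: st1; case: st2.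
  - by rewrite /G n0 mulr0.
  - by rewrite /G n1 mulr1 nI.
split.
  by move=> t ht; rewrite /G; case: leP => h; [apply: f1; lra|apply: f2; lra].
have key (t t' d : R) : `|t - t'| < d / 2%:R -> `|2%:R * t - 2%:R * t'| < d.
  by move=> h; rewrite -mulrBr normrM ger0_norm //; lra.
move=> t r ht r0; rewrite /G; case: (ltgtP t (1 / 2%:R)) => hc.
- have [|d d0 hd] := c1 (2%:R * t) r _ r0; first by lra.
  exists (Num.min (d / 2%:R) (1 / 2%:R - t)).
    by rewrite lt_min divr_gt0 // subr_gt0.
  move=> t' ht'; rewrite lt_min => /andP[h1 h2].
  have h3 : t' <= 1 / 2%:R by have := ler_norm (t' - t); rewrite distrC; lra.
  by rewrite h3; apply: hd; [lra|exact: key].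
- have [|d d0 hd] := c2 (2%:R * t - 1) r _ r0; first by lra.
  exists (Num.min (d / 2%:R) (t - 1 / 2%:R)).
    by rewrite lt_min divr_gt0 // subr_gt0.
  move=> t' ht'; rewrite lt_min => /andP[h1 h2].
  have h3 : 1 / 2%:R < t' by have := ler_norm (t - t'); lra.
  rewrite leNgt h3 /=; apply: hd; first by lra.
  have -> : 2%:R * t - 1 - (2%:R * t' - 1) = 2%:R * t - 2%:R * t' by ring.
  exact: key.
- have ct : 2%:R * t = 1 by lra.
  have [|d d0 hd] := c1 (2%:R * t) r _ r0; first by lra.
  have [|d' d'0 hd'] := c2 0 r _ r0; first by lra.
  exists (Num.min (d / 2%:R) (d' / 2%:R)); first by rewrite lt_min !divr_gt0.
  move=> t' ht'; rewrite lt_min => /andP[h1 h2]; case: (leP t') => h3.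
    by apply: hd; [lra|exact: key].
  rewrite ct; set b := G2 _; apply: (e (fun a => mdist (tag a) (tag b) < r /\ NE r a b)).
  apply: hd'; first by lra.
  have -> : 0 - (2%:R * t' - 1) = 2%:R * t - 2%:R * t' by lra.
  exact: key.
Qed.

Lemma path_lift p u v C : ispath (S := cell_sqc hfl) u p v -> F u C ->
  exists G, Epath u C v (foldl tr C p) G.
Proof.
elim: p u C => [|e p IH] u C /=.
  move=> <- hC; have hf : @flat (car K (sval u)) (fun=> C).
    split=> [w|w i]; first by rewrite vtx_cv.
    by have := ltn_ord i; rewrite {2}(vtx_dim (proj2_sig u)).
  exists (fun=> existT _ (sval u) (fun=> C)); split=> // t r _ r0; exists 1 => // t' _ _.
  by rewrite mdistxx; split=> //; exact: FR_refl.
move=> [eu hp] hC; rewrite -eu in hC *.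
have [G1 h1] := edge_path hC; have [G2 h2] := IH _ (tr C e) hp (trF hC).
exact: Epath_cat h1 h2.
Qed.

End LocalSystem.

(** * The square complex of a CAT(0) cube complex is connected and without monodromy *)

Section CellComplex.
Variables (R : realType) (X : metricType R) (K : cube_complex R X).
Hypothesis HX : CAT0_cube_complex K.

Lemma cat0_flag : forall v, is_vertex K v -> flag_link K v.
Proof. by case: HX. Qed.

Lemma cat0_length : induced_length_metric K.
Proof. by case: HX. Qed.

Let hfl := cat0_flag.
Let S := cell_sqc hfl.

Lemma within_cont (g : R -> X) :
  (forall t r, 0 <= t <= 1 -> 0 < r -> exists2 d, 0 < d &
    forall t', 0 <= t' <= 1 -> `|t - t'| < d -> mdist (g t) (g t') < r) ->
  {within `[0, 1]%classic, continuous g}.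
Proof.
move=> h; apply/subspace_continuousP => t; rewrite /= in_itv /= => ht.
apply/cvg_ballP => r r0; have [d d0 hd] := h t r ht r0.
rewrite nearE; apply/nbhs_ballP; exists d => //= t' ht'.
by rewrite /= in_itv /= => h'; rewrite ballEmdist; exact: hd.
Qed.

Lemma cont_Hcont (H : R * R -> X) :
  {within `[0, 1]%classic `*` `[0, 1]%classic, continuous H} -> Hcont (@sqU R) H.
Proof.
move=> /subspace_continuousP h p r [hp1 hp2] r0.
have hp : (`[0, 1]%classic `*` `[0, 1]%classic) p by split; rewrite /= in_itv.
have /cvg_ballP/(_ r r0) := h p hp; rewrite nearE => /nbhs_ballP[d /= d0 hd].
exists d => // q [hq1 hq2] [n1 n2]; have := hd q (conj n1 n2).
by rewrite ballEmdist; apply; split; rewrite /= in_itv.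
Qed.

(** The closed edge path lifts to a path of classes whose projection to [X] is a loop; contracting
    the loop and lifting the contraction shows that the final class is the initial one. *)
Lemma cell_sc (o : vtx S) p : ispath o p o -> foldl (@act S) (cls [::]) p = cls [::].
Proof.
move=> hp; pose F v C := fib (S := S) o v C.
have trF (e : edge_t K) C : F (esrc e) C -> F (etgt e) (act C e).
  exact: (act_fib (S := S)).
have trK (e : edge_t K) C : F (esrc e) C -> act (act C e) (eopp e) = C.
  exact: (act_opp (S := S)).
have trsq (e x e' x' : edge_t K) C : esq e x e' x' -> F (esrc e) C ->
    act (S := S) (act C e) x' = act (act C x) e'.
  exact: (act_sq (S := S)).
have F0 : F o (cls [::]).
  by exists [::]; split=> //; exact: reduced_nil.
have [G [hf hc [h0 h1] hv0 hv1]] :=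
  @path_lift _ _ _ _ F (@act S) trF trK trsq cat0_length hfl p o o _ hp F0.
have [[_ _ hl] _ _] := HX.
have [||H [c1 c2 c3 c4]] := hl (fun t => tag (G t)).
- apply: within_cont => t r ht r0; have [d d0 hd] := hc t r ht r0.
  by exists d => // t' ht' hn; have [] := hd t' ht' hn.
- by rewrite h0 h1.
have eG : G 1 = G 0.
  apply: (@loop_lift _ _ _ _ F (@act S) trF trK trsq cat0_length H G) => //.
  - exact: cont_Hcont.
  - move=> t r ht r0; have [d d0 hd] := hc t r ht r0.
    by exists d => // t' ht' hn; have [] := hd t' ht' hn.
have := hv1 [ffun => false]; rewrite eG => <-; exact: hv0.
Qed.

Definition vconn (u v : vtx S) := exists p, ispath u p v.

Lemma vconn_refl u : vconn u u. Proof. by exists [::]. Qed.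

Lemma vconn_trans u v w : vconn u v -> vconn v w -> vconn u w.
Proof.
move=> [p hp] [q hq]; exists (p ++ q); apply/ispath_cat; by exists v.
Qed.

Lemma vconn_cell (c : cell K) (w w' : {ffun 'I_(cdim c) -> bool}) : vconn (cv w) (cv w').
Proof.
apply: (flip_ind (w0 := w) (P := fun w' => vconn (cv w) (cv w'))).
  exact: vconn_refl.
move=> v i h; apply: vconn_trans h _; exists [:: edge v i] => /=.
by rewrite edge_src edge_tgt.
Qed.

Lemma vconn_string v0 z s y : (forall c u, cube u -> chi c u = z -> forall w, vconn v0 (@cv _ _ _ c w)) ->
  is_string (K := K) z s y ->
  (forall c u, cube u -> chi c u = y -> forall w, vconn v0 (@cv _ _ _ c w)).
Proof.
elim: s z => [|[c1 [a b]] s IH] z hz /=; first by move=> <-.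
move=> [ha hb ea hs]; apply: IH hs => c u hu eu w.
have [w1 [w1' [s1 [t1 [[f1 _ _ _] _]]]]] := frep_ex hu eu.
have [w2 [w2' [s2 [t2 [[f2 _ _ _] _]]]]] := frep_ex hb erefl.
apply: vconn_trans (vconn_cell w1 w); rewrite (isface_vtx f1).
apply: vconn_trans (vconn_cell w2' w1'); rewrite -(isface_vtx f2).
exact: hz ea _.
Qed.

Lemma cell_conn (u v : vtx S) : exists p, ispath u p v.
Proof.
have [s hs _] : exists2 s, is_string (K := K) (sval u) s (sval v) &
    string_length s < mdist (sval u) (sval v) + 1.
  by apply: (string_lt cat0_length); rewrite ltrDl.
have c0 (c : cell K) w : cube (cube_vertex (R := R) (n := cdim c) w).
  by move=> i; rewrite mxE; case: (w i); rewrite lexx ler01.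
have := @vconn_string u _ _ _ _ hs (car K (sval v)) (carp K (sval v)).
rewrite chi_carp => /(_ _ _ erefl [ffun => false]); rewrite vtx_cv; apply.
  move=> c x hx ex w; have [w1 [w1' [s1 [t1 [[f1 _ _ _] _]]]]] := frep_ex hx ex.
  apply: vconn_trans (vconn_cell w1 w); rewrite (isface_vtx f1) vtx_cv.
  exact: vconn_refl.
by apply: open_cube_cube; exact: carp_open.
Qed.

Definition cell_csqc : csqc := @CSqc S cell_sc cell_conn.

End CellComplex.

(** * Wall functions *)

Section WallFunctions.
Variables (R : realType) (X : metricType R) (K : cube_complex R X).
Hypothesis HX : CAT0_cube_complex K.
Let S := cell_csqc HX.
Let hlm := cat0_length HX.
Implicit Types (a : set (vtx S)) (c : cell K) (x y : X).

Lemma face_corner c w c' w' s : @isface _ _ K c w c' w' s -> forall v', exists v,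
  [/\ isface v v' s, forall i, (forall j, s j <> i) -> v i = w i &
      forall j, v (s j) = w (s j) (+) w' j (+) v' j].
Proof.
move=> hf v'.
have fl c0 : @flat R X K unit (fun _ _ => True) (fun _ _ => tt) c0 (fun=> tt) by [].
by have [v [h1 _ h2 h3]] := face_flat hf (fl c) (fl c') erefl v'; exists v.
Qed.

Lemma srcE c w i : src (s := S) (@edge _ _ K c w i) = cv w.
Proof. exact: edge_src. Qed.

Lemma tgtE c w i : tgt (s := S) (@edge _ _ K c w i) = cv (flip w i).
Proof. exact: edge_tgt. Qed.

Lemma hs_edge c (w : {ffun 'I_(cdim c) -> bool}) i w' : hs (S := S) (@edge _ _ K c w' i) =
  if w' i == w i then hs (S := S) (edge w i) else ~` hs (S := S) (edge w i).
Proof.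
apply: (flip_ind (w0 := w) (P := fun w' => hs (S := S) (@edge _ _ K c w' i) =
  if w' i == w i then hs (S := S) (edge w i) else ~` hs (S := S) (edge w i))).
  by rewrite eqxx.
move=> v j h; case: (eqVneq j i) => [->|ne].
  rewrite -edge_opp (hs_opp (S := S)) h flip_same.
  by case: (v i); case: (w i) => //=; rewrite setCK.
rewrite eq_sym in ne; rewrite flip_other // -h; have q := esq_edge v ne.
by apply/esym; apply: (hs_par (S := S)); exact: (sq_par (S := S)) q.
Qed.

Lemma hs_edge_cv c w i w' :
  hs (S := S) (@edge _ _ K c w i) (cv w') <-> w' i != w i.
Proof.
have h := hs_edge w i w'; have hn := @hs_src S (edge w' i).
rewrite srcE in hn; move: h; case: (eqVneq (w' i) (w i)) => _ e; rewrite e in hn; split=> //.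
by move=> _; apply: contrapT.
Qed.

(** The hyperplane of [a] cuts the cube of [c] across the direction [i], and [b] tells which side is
    [a]. *)
Definition dirn a c (i : 'I_(cdim c)) (b : bool) :=
  forall w, a (@cv _ _ K c w) <-> w i = b.

Lemma cell_cases a c : HS a -> [\/ exists i b, @dirn a c i b,
  forall w, a (@cv _ _ K c w) | forall w, ~ a (@cv _ _ K c w)].
Proof.
move=> ha; have [[w [i [h1 h2]]]|hn] := pselect (exists w i, ~ a (@cv _ _ K c w) /\ a (cv (flip w i))).
  apply: Or31; exists i, (~~ w i) => w'.
  have ea : hs (S := S) (edge w i) = a.
    by apply: HS_in; rewrite ?srcE ?tgtE.
  by rewrite -ea hs_edge_cv; case: (w' i); case: (w i).
have st w i : a (@cv _ _ K c w) <-> a (cv (flip w i)).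
  split=> h; apply: contrapT => h'; apply: hn; last by exists w, i.
  by exists (flip w i), i; rewrite flipK.
pose w0 : {ffun 'I_(cdim c) -> bool} := [ffun => false].
have al w : a (cv w0) <-> a (@cv _ _ K c w).
  apply: (flip_ind (w0 := w0) (P := fun w => a (cv w0) <-> a (@cv _ _ K c w))) => //.
  by move=> v i h; rewrite h; exact: st.
have [h|h] := pselect (a (cv w0)); first by apply: Or32 => w; apply/al.
by apply: Or33 => w /al.
Qed.

Lemma dirn_hs a c i b (w : {ffun 'I_(cdim c) -> bool}) : HS a -> @dirn a c i b -> w i = ~~ b ->
  hs (S := S) (@edge _ _ K c w i) = a.
Proof.
move=> ha hd hw; apply: HS_in => //; rewrite ?srcE ?tgtE.
  by move/hd; rewrite hw; case: (b).
by apply/hd; rewrite flip_same hw negbK.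
Qed.

Lemma dirn_edge c (w : {ffun 'I_(cdim c) -> bool}) i : @dirn (hs (S := S) (@edge _ _ K c w i)) c i (~~ w i).
Proof. by move=> w'; rewrite hs_edge_cv; case: (w' i); case: (w i). Qed.

Lemma dirn_uniq a a' c i b : HS a -> HS a' -> @dirn a c i b -> @dirn a' c i b -> a = a'.
Proof.
move=> h h' d d'; rewrite -(dirn_hs (w := [ffun => ~~ b]) h d) ?ffunE //.
by rewrite (dirn_hs h' d') ?ffunE.
Qed.

Lemma dirnC a c i b : @dirn a c i b -> @dirn (~` a) c i (~~ b).
Proof. by move=> d w; rewrite /setC /= d; case: (w i); case: (b); split=> //; case. Qed.

Lemma dirn_inj a c i j b b' : @dirn a c i b -> @dirn a c j b' -> i = j.
Proof.
move=> d d'; apply: contrapT => /eqP ne.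
pose w : {ffun 'I_(cdim c) -> bool} := [ffun k => if k == i then b else ~~ b'].
have : a (cv w) by apply/d; rewrite ffunE eqxx.
by move/d'; rewrite ffunE eq_sym (negPf ne); case: (b').
Qed.

Definition fval a c (u : 'rV[R]_(cdim c)) (r : R) :=
  [\/ exists i b, @dirn a c i b /\ r = if b then u 0 i else 1 - u 0 i,
      (forall w, a (@cv _ _ K c w)) /\ r = 1 |
      (forall w, ~ a (@cv _ _ K c w)) /\ r = 0].

Lemma fval_ex a c u : HS a -> exists r, @fval a c u r.
Proof.
move=> ha; have [[i [b h]]|h|h] := @cell_cases a c ha.
- by eexists; apply: Or31; exists i, b.
- by exists 1; apply: Or32.
- by exists 0; apply: Or33.
Qed.

Lemma dirn_both a c i b : @dirn a c i b ->
  (exists w, a (@cv _ _ K c w)) /\ exists w, ~ a (@cv _ _ K c w).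
Proof.
move=> d; split; [exists [ffun => b]|exists [ffun => ~~ b]]; first by apply/d; rewrite ffunE.
by move/d; rewrite ffunE; case: (b).
Qed.

Lemma fval_uniq a c u r r' : @fval a c u r -> fval a u r' -> r = r'.
Proof.
pose w0 : {ffun 'I_(cdim c) -> bool} := [ffun => false].
case=> [[i [b [d ->]]]|[h ->]|[h ->]] [[j [b' [d' ->]]]|[h' ->]|[h' ->]] //.
- have e := dirn_inj d d'; move: d'; rewrite -e => d'; suff -> : b = b' by [].
  by have := (d' [ffun => b]).1 ((d [ffun => b]).2 (ffunE _ _)); rewrite ffunE.
- by have [_ [w /(_ (h' w))]] := dirn_both d.
- by have [[w /h' []] _] := dirn_both d.
- by have [_ [w /(_ (h w))]] := dirn_both d'.
- by case: (h' w0).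
- by have [[w /h []] _] := dirn_both d'.
- by case: (h w0).
Qed.

Lemma fval_frep a c w x w' s t r : @frep _ _ K c w x w' s t ->
  fval a (cpt w t) r -> fval a (carp K x) r.
Proof.
move=> [hf ht h0 ec]; have fc := face_corner hf.
have cvE v v' : isface (c := c) v (c' := car K x) v' s -> cv v = cv v' := @isface_vtx _ _ _ _ _ _ _ _.
case=> [[i [b [d ->]]]|[h ->]|[h ->]]; last 2 first.
- by apply: Or32; split=> // v'; have [v [/cvE <- _ _]] := fc v'.
- by apply: Or33; split=> // v'; have [v [/cvE <- _ _]] := fc v'.
have [hi|] := pselect (forall j, s j <> i); last first.
  move=> /existsNP[j /contrapT ej].
  apply: Or31; exists j, (b (+) w i (+) w' j); split.
    move=> v'; have [v [/cvE <- _ hv]] := fc v'; rewrite d -ej hv ej.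
    by case: (v' j); case: (w i); case: (w' j); case: (b).
  rewrite ec !cptE /= ej; case: (b); case: (w i); case: (w' j) => //=; ring.
have ew : cpt w t 0 i = (w i)%:R by rewrite cptE h0 //; case: (w i); rewrite ?subr0.
have [hb|hb] : w i = b \/ w i = ~~ b by case: (w i); case: (b); auto.
- apply: Or32; split; last by rewrite ew hb; case: (b); rewrite ?subr0.
  by move=> v'; have [v [/cvE <- hv _]] := fc v'; apply/d; rewrite hv.
- apply: Or33; split; last by rewrite ew hb; case: (b); rewrite ?subrr.
  move=> v'; have [v [/cvE <- hv _]] := fc v'; move/d; rewrite hv // hb.
  by case: (b).
Qed.

(** The value is taken in the carrier, while [fval] is a relation over all cubes, which lets
    [fval_frep] show that the choice of cube does not matter. For a halfspace the default 0 is never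
    the reason for the value, as a related number always exists. *)
Definition fa a x : R := xget 0 [set r | fval a (carp K x) r].

Lemma faE a c u : HS a -> cube u -> @fval a c u (fa a (chi c u)).
Proof.
move=> ha hu; have [r hr] := fval_ex u ha.
have [w [w' [s [t [hf eu]]]]] := frep_ex hu erefl.
have hr' : fval a (carp K (chi c u)) r by apply: fval_frep hf _; rewrite -eu.
suff -> : fa a (chi c u) = r by [].
by apply: xget_unique => // r' /= h; exact: fval_uniq h hr'.
Qed.

Lemma fa_dir a c u i b : HS a -> cube u -> @dirn a c i b ->
  fa a (chi c u) = if b then u 0 i else 1 - u 0 i.
Proof. by move=> ha hu d; apply: fval_uniq (faE ha hu) _; apply: Or31; exists i, b. Qed.

Lemma fa_in a c u : HS a -> cube u -> (forall w, a (@cv _ _ K c w)) -> fa a (chi c u) = 1.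
Proof. by move=> ha hu d; apply: fval_uniq (faE ha hu) _; apply: Or32. Qed.

Lemma fa_out a c u : HS a -> cube u -> (forall w, ~ a (@cv _ _ K c w)) -> fa a (chi c u) = 0.
Proof. by move=> ha hu d; apply: fval_uniq (faE ha hu) _; apply: Or33. Qed.

Lemma carp_cube x : cube (carp K x).
Proof. by apply: open_cube_cube; exact: carp_open. Qed.

Arguments carp_cube : clear implicits.

Lemma fa_casesP a x : HS a ->
  [\/ exists i b, @dirn a (car K x) i b /\
        fa a x = if b then carp K x 0 i else 1 - carp K x 0 i,
      (forall w, a (@cv _ _ K (car K x) w)) /\ fa a x = 1 |
      (forall w, ~ a (@cv _ _ K (car K x) w)) /\ fa a x = 0].
Proof. by move=> ha; have := faE ha (carp_cube x); rewrite chi_carp. Qed.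

Lemma fa_open a x i b : HS a -> @dirn a (car K x) i b -> 0 < fa a x < 1.
Proof.
move=> ha d; have := fa_dir ha (carp_cube x) d; rewrite chi_carp => ->.
by have := carp_open K x i; case: (b); lra.
Qed.

Lemma fa01 a x : HS a -> 0 <= fa a x <= 1.
Proof.
move=> ha; have [[i [b [_ ->]]]|[_ ->]|[_ ->]] := fa_casesP x ha; rewrite ?lexx ?ler01 //.
by have := carp_cube x i; case: (b); lra.
Qed.

Lemma fa_vert a (v : vert K) : HS a -> fa a (sval v) = (`[< a v >])%:R.
Proof.
move=> ha; have hv w : @cv _ _ K (car K (sval v)) w = v := vtx_cv w.
have e := chi_carp K (sval v); rewrite -e; case: asboolP => h.
  by rewrite fa_in //; [exact: carp_cube|move=> w; rewrite hv].
by rewrite fa_out //; [exact: carp_cube|move=> w; rewrite hv].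
Qed.

Lemma faC a x : HS a -> fa (~` a) x = 1 - fa a x.
Proof.
move=> ha; have hC := HSC ha; have hc := carp_cube x; rewrite -(chi_carp K x).
have [[i [b h]]|h|h] := @cell_cases a (car K x) ha.
- rewrite (fa_dir ha hc h) (fa_dir hC hc (dirnC h)); case: (b) => //=.
  by rewrite opprB addrC subrK.
- by rewrite (fa_in ha hc h) (fa_out hC hc) ?subrr // => w /(_ (h w)).
- by rewrite (fa_out ha hc h) (fa_in hC hc) ?subr0.
Qed.

Lemma fa_mono a b x : HS a -> HS b -> a `<=` b -> fa a x <= fa b x.
Proof.
move=> ha hb hab.
have [[i [e [d ->]]]|[h1 ->]|[_ ->]] := fa_casesP x ha; last first.
- by have /andP[] := fa01 x hb.
- have := fa_in hb (carp_cube x); rewrite chi_carp => -> // w; exact: hab.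
have hx := carp_cube x i.
have [[j [e' [d' ->]]]|[h1 ->]|[h1 _]] := fa_casesP x hb.
- have [eij|/eqP ne] := pselect (i = j).
    move: d'; rewrite -eij => d'; suff -> : e = e' by [].
    by have := (d' [ffun => e]).1 (hab _ ((d [ffun => e]).2 (ffunE _ _))); rewrite ffunE.
  pose w : {ffun 'I_(cdim (car K x)) -> bool} := [ffun k => if k == i then e else ~~ e'].
  have /hab/d' : a (cv w) by apply/d; rewrite ffunE eqxx.
  by rewrite ffunE eq_sym (negPf ne); case: (e').
- by case: (e); lra.
- by have [[w /hab /h1 []] _] := dirn_both d.
Qed.

(** Distinct hyperplanes, not just distinct halfspaces: complementary halfspaces would count one
    coordinate of a cube twice. *)
Definition walls (I : Type) (h : I -> set (vtx S)) :=
  (forall i, HS (h i)) /\ forall i j, i <> j -> h i <> h j /\ h i <> ~` h j.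

Section Family.
Variables (I : finType) (h : I -> set (vtx S)).
Hypothesis hw : walls h.

(** Distinct hyperplanes cutting a cube take up distinct coordinates, and the other wall functions
    are constant on it. [G] will be the square for the l^2 estimate and the absolute value for the
    l^1 estimate. *)
Lemma segment_walls c (u v : 'rV[R]_(cdim c)) (G : R -> R) : cube u -> cube v ->
  (forall r, 0 <= G r) -> G 0 = 0 -> (forall r, G (- r) = G r) ->
  \sum_i G (fa (h i) (chi c u) - fa (h i) (chi c v)) <= \sum_k G (u 0 k - v 0 k).
Proof.
move=> hu hv G0 Gz Gn; have [hH hd] := hw.
have [d hdP] : {d : I -> option 'I_(cdim c) & forall i,
    (exists k b, d i = Some k /\ @dirn (h i) c k b) \/
    (d i = None /\ fa (h i) (chi c u) = fa (h i) (chi c v))}.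
  apply: (@choice _ _ (fun i o => (exists k b, o = Some k /\ @dirn (h i) c k b) \/
    (o = None /\ fa (h i) (chi c u) = fa (h i) (chi c v)))) => i.
  have [[k [b hk]]|hk|hk] := @cell_cases (h i) c (hH i).
  - by exists (Some k); left; exists k, b.
  - by exists None; right; split=> //; rewrite !fa_in.
  - by exists None; right; split=> //; rewrite !fa_out.
have dinj i j k : d i = Some k -> d j = Some k -> i = j.
  move=> ei ej; apply: contrapT => /hd[n1 n2].
  case: (hdP i) => [[k1 [b1 [e1 d1]]]|[e1 _]]; last by rewrite e1 in ei.
  case: (hdP j) => [[k2 [b2 [e2 d2]]]|[e2 _]]; last by rewrite e2 in ej.
  move: e1 e2; rewrite ei ej => -[ek1] [ek2]; subst k1 k2.
  have [e|e] : b1 = b2 \/ b1 = ~~ b2 by case: (b1); case: (b2); auto.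
    by apply: n1; subst b1; exact: dirn_uniq d1 d2.
  by apply: n2; subst b1; apply: dirn_uniq d1 (dirnC d2) => //; exact: HSC.
have e1 i : G (fa (h i) (chi c u) - fa (h i) (chi c v)) =
    \sum_k (d i == Some k)%:R * G (u 0 k - v 0 k).
  case: (hdP i) => [[k [b [e hk]]]|[e ->]]; last first.
    by rewrite subrr Gz big1 // => k _; rewrite e mul0r.
  rewrite (bigD1 k) //= e eqxx mul1r big1 ?addr0.
    rewrite !(fa_dir _ _ hk) //; case: (b) => //.
    by rewrite -[RHS]Gn; congr G; ring.
  move=> k' ne; rewrite (_ : (Some k == Some k') = false) ?mul0r //.
  by apply/negbTE/eqP => -[e']; rewrite e' eqxx in ne.
rewrite (eq_bigr _ (fun i _ => e1 i)) exchange_big /=; apply: ler_sum => k _.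
rewrite -mulr_suml -[leRHS]mul1r; apply: ler_wpM2r => //.
have [i hi|hn] := pickP (fun i => d i == Some k); last first.
  by rewrite big1 ?ler01 // => i _; rewrite hn.
rewrite (bigD1 i) //= hi big1 ?addr0 // => j ne; case: eqP => // ej.
by case/eqP: ne; move/eqP: hi => hi; exact: dinj ej hi.
Qed.

Lemma string_walls s x y : is_string (K := K) x s y ->
  nrm (fun i => fa (h i) x - fa (h i) y) <= string_length s.
Proof.
elim: s x => [|[c [u v]] s IH] x /=.
  move=> ->; rewrite /string_length big_nil /nrm big1 ?sqrtr0 // => i _.
  by rewrite subrr expr0n.
move=> [hu hv <- /IH hs]; rewrite /string_length big_cons /= -/(string_length s).
have : nrm (fun i => fa (h i) (chi c u) - fa (h i) (chi c v)) <= euclid_dist u v.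
  rewrite euclid_nrm /nrm ler_wsqrtr //.
  by apply: (segment_walls (G := fun r => r ^+ 2)) => // [r||r]; rewrite ?sqr_ge0 ?expr0n ?sqrrN.
move=> h1; have h2 := lerD h1 hs; apply: le_trans h2; apply: le_trans (nrmD _ _).
by rewrite le_eqVlt; apply/orP; left; apply/eqP/eq_nrm => i; congr (_ ^+ 2); ring.
Qed.

Lemma mdist_walls x y : nrm (fun i => fa (h i) x - fa (h i) y) <= mdist x y.
Proof.
rewrite leNgt; apply/negP => /(string_lt hlm)[s hs]; rewrite ltNge => /negP; apply.
exact: string_walls.
Qed.

Lemma mdist_walls2 x y : \sum_i (fa (h i) x - fa (h i) y) ^+ 2 <= mdist x y ^+ 2.
Proof. by rewrite -nrm_sq ler_pXn2r ?nnegrE ?nrm_ge0 ?mdist_ge0 // mdist_walls. Qed.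

Variable D : nat.
Hypothesis hD : forall c : cell K, (cdim c <= D)%N.

Lemma string_walls1 s x y : is_string (K := K) x s y ->
  \sum_i `|fa (h i) x - fa (h i) y| <= D%:R * string_length s.
Proof.
elim: s x => [|[c [u v]] s IH] x /=.
  by move=> ->; rewrite /string_length big_nil mulr0 big1 // => i _; rewrite subrr normr0.
move=> [hu hv <- /IH hs]; rewrite /string_length big_cons /= -/(string_length s) mulrDr.
have h1 : \sum_i `|fa (h i) (chi c u) - fa (h i) (chi c v)| <= D%:R * euclid_dist u v.
  apply: le_trans (segment_walls (G := fun r => `|r|) hu hv _ _ _) _ => //.
  - by rewrite normr0.
  - by move=> r; rewrite normrN.
  apply: le_trans (_ : \sum_(k < cdim c) euclid_dist u v <= _).
    by apply: ler_sum => k _; exact: euclid_coord.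
  rewrite sumr_const card_ord -[_ *+ cdim c]mulr_natl; apply: ler_wpM2r; first exact: euclid_ge0.
  by rewrite ler_nat.
apply: le_trans (lerD h1 hs); rewrite -big_split; apply: ler_sum => i _ /=.
exact: ler_distD.
Qed.

Lemma mdist_walls1 x y : \sum_i `|fa (h i) x - fa (h i) y| <= D%:R * mdist x y.
Proof.
apply/ler_addgt0Pr => e e0; pose e' := e / (D%:R + 1).
have D1 : 0 < D%:R + 1 :> R by apply: ltr_wpDl.
have e'0 : 0 < e' by rewrite divr_gt0.
have hlt : mdist x y < mdist x y + e' by rewrite ltrDl.
have [s hs hl] := string_lt hlm hlt.
apply: le_trans (string_walls1 hs) _.
have h1 : D%:R * string_length s <= D%:R * (mdist x y + e') by apply: ler_wpM2l => //; exact: ltW.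
apply: le_trans h1 _; rewrite mulrDr lerD2l /e' mulrA ler_pdivrMr //.
by have : 0 <= D%:R :> R by []; nra.
Qed.

End Family.

Lemma mdist_fa a x y : HS a -> `|fa a x - fa a y| <= mdist x y.
Proof.
move=> ha; have hw : walls (fun _ : unit => a) by split=> // -[] [].
apply: le_trans (mdist_walls hw x y); exact: (le_nrm (fun _ : unit => fa a x - fa a y) tt).
Qed.

(** The wall functions of the hyperplanes cutting the cube are its own coordinates, and they bound
    the distance from below; the straight segment bounds it from above. *)
Lemma mdist_cell c u v : cube u -> cube v ->
  mdist (chi c u) (chi c v) = euclid_dist u v.
Proof.
move=> hu hv; apply/eqP; rewrite eq_le (mdist_chi hlm) //=.
pose w : {ffun 'I_(cdim c) -> bool} := [ffun => false].
pose h i := hs (S := S) (edge w i).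
have hd i : @dirn (h i) c i true by have := dirn_edge w i; rewrite ffunE.
have hH i : HS (h i) by exists (edge w i).
have hw : walls h.
  split=> // i j ne; split=> e; apply: ne; have := hd i; rewrite e => d.
    exact: dirn_inj d (hd j).
  by move/dirnC: d; rewrite setCK => d; exact: dirn_inj d (hd j).
apply: le_trans (mdist_walls hw _ _); rewrite euclid_nrm le_eqVlt; apply/orP; left.
by apply/eqP/eq_nrm => i; rewrite !(fa_dir (hH i) _ (hd i)).
Qed.

(** A value strictly between 0 and 1 reveals a hyperplane cutting the carrier, so both carriers are
    cut by the same ones. Matching corners are then the same vertex with the same edges, [corner_eq]
    identifies the cells, and the values are the coordinates. *)
Lemma fa_sep x y : (forall a, HS a -> fa a x = fa a y) -> x = y.
Proof.
move=> hxy.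
have dxy a i b : HS a -> @dirn a (car K x) i b -> exists j b', @dirn a (car K y) j b'.
  move=> ha d; have := fa_open ha d; rewrite hxy // => h.
  have [[j [b' [d' _]]]|[_ e]|[_ e]] := fa_casesP y ha; first by exists j, b'.
    by move: h; rewrite e ltxx andbF.
  by move: h; rewrite e ltxx.
have dyx a i b : HS a -> @dirn a (car K y) i b -> exists j b', @dirn a (car K x) j b'.
  move=> ha d; have := fa_open ha d; rewrite -hxy // => h.
  have [[j [b' [d' _]]]|[_ e]|[_ e]] := fa_casesP x ha; first by exists j, b'.
    by move: h; rewrite e ltxx andbF.
  by move: h; rewrite e ltxx.
pose w : {ffun 'I_(cdim (car K x)) -> bool} := [ffun => false].
pose w0 : {ffun 'I_(cdim (car K y)) -> bool} := [ffun => false].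
pose w' : {ffun 'I_(cdim (car K y)) -> bool} :=
  [ffun j => `[< hs (S := S) (edge w0 j) (cv w) >]].
have dw0 j : @dirn (hs (S := S) (edge w0 j)) (car K y) j true.
  by have := dirn_edge w0 j; rewrite ffunE.
have agree a : HS a -> a (cv w) <-> a (cv w').
  move=> ha; have [[i [b d]]|h|h] := @cell_cases a (car K x) ha.
  - have [j [b' d']] := dxy a i b ha d.
    have [e|e] : a = hs (S := S) (edge w0 j) \/ a = ~` hs (S := S) (edge w0 j).
      case: b' d' => d'; [left|right].
        by apply: dirn_uniq d' (dw0 j) => //; exists (edge w0 j).
      apply: dirn_uniq d' (dirnC (dw0 j)) => //; apply: HSC; by exists (edge w0 j).
    + by rewrite e (dw0 j w') ffunE; split=> [/asboolT//|/asboolP].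
    + by rewrite e /setC /= (dw0 j w') ffunE; split=> h h1; apply: h; [exact/asboolP|exact/asboolT].
  - split=> _ //; have [[j [b' [d' _]]]|[h' _]|[h' _]] := fa_casesP y ha => //.
      by have [i [b /dirn_both[_ [v nv]]]] := dyx _ _ _ ha d'; case: (nv (h v)).
    have := fa_in ha (carp_cube x) h; have := fa_out ha (carp_cube y) h'.
    rewrite !chi_carp hxy // => -> /eqP; by rewrite eq_sym oner_eq0.
  - split=> [/h//|h2]; have [[j [b' [d' _]]]|[h' _]|[h' _]] := fa_casesP y ha.
    + by have [i [b /dirn_both[[v /h []] _]]] := dyx _ _ _ ha d'.
    + have := fa_out ha (carp_cube x) h; have := fa_in ha (carp_cube y) h'.
      by rewrite !chi_carp hxy // => -> /eqP; rewrite oner_eq0.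
    + by case: (h' w').
have ev : cv w = cv w' by apply: (vtx_sep (S := S)) => a ha /(agree a ha).
have edg_in (c c' : cell K) (v : {ffun 'I_(cdim c) -> bool}) (v' : {ffun 'I_(cdim c') -> bool}) :
    cv v = cv v' -> (forall a i b, HS a -> @dirn a c i b -> exists j b', @dirn a c' j b') ->
    forall i, exists j, edge v i = edge v' j.
  move=> e hd i; have hH : HS (hs (S := S) (edge v i)) by exists (edge v i).
  have [j [b' d']] := hd _ _ _ hH (dirn_edge v i).
  exists j; apply: (hs_src_inj (S := S)).
    by rewrite !srcE.
  apply/esym; apply: (dirn_hs hH d').
  have : ~ hs (S := S) (edge v i) (cv v') by rewrite -e hs_edge_cv eqxx.
  by move/d'; case: (v' j); case: (b').
have ec : crn w = crn w'.
  apply: (corner_eq (cat0_flag HX)) => //; [exact: edg_in dxy|exact: edg_in dyx].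
rewrite -(chi_carp K x) -(chi_carp K y).
have val i : fa (hs (S := S) (edge w i)) x = carp K x 0 i.
  have hH : HS (hs (S := S) (edge w i)) by exists (edge w i).
  have := fa_dir hH (carp_cube x) (dirn_edge w i); by rewrite chi_carp ffunE.
have hval i : fa (hs (S := S) (edge w i)) y = carp K x 0 i by rewrite -hxy ?val //; exists (edge w i).
move: hval; move: (carp K x); rewrite /crn in ec.
pose P (s : corner K) := forall u : 'rV[R]_(cdim (tag s)),
  (forall i, fa (hs (S := S) (edge (tagged s) i)) y = u 0 i) -> chi (tag s) u = chi (car K y) (carp K y).
suff : P (crn w) by [].
rewrite /crn ec => u hu; congr chi; apply/rowP => j; rewrite -hu /=.
have hH : HS (hs (S := S) (edge w' j)) by exists (edge w' j).
pose Q (s : corner K) := forall i, tagged s i = false.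
have ew : w' j = false.
  by have : Q (crn w'); [rewrite /crn -ec => i; rewrite ffunE|apply].
have := fa_dir hH (carp_cube y) (dirn_edge w' j); by rewrite chi_carp ew.
Qed.

End WallFunctions.

Arguments carp_cube {R X} K x i.

(** * Local finiteness and essential edges *)

Lemma finite_list (T : Type) (A : set T) : finite_set A ->
  exists l : seq T, forall x, A x -> List.In x l.
Proof.
elim/Pchoice: T => T in A *; move=> /finite_seqP[s ->]; exists s => x /=.
elim: s => // y s IH; rewrite inE => /orP[/eqP->|/IH]; [by left|by right].
Qed.

Lemma list_finite (T : Type) (l : seq T) : finite_set [set x | List.In x l].
Proof.
elim: l => [|y l IH]; first by rewrite (_ : [set x | _] = set0) //; apply/seteqP; split.
rewrite (_ : [set x | _] = [set y] `|` [set x | List.In x l]).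
  by rewrite finite_setU; split; [exact: finite_set1|].
by apply/seteqP; split=> x /= [->|]; auto.
Qed.

(** If [B] were infinite, the filter of sets containing all but finitely many of its points would
    cluster in [A]; but a ball of radius [r / 2] holds at most one point of [B]. *)
Lemma compact_sep (R : realType) (X : metricType R) (A B : set X) (r : R) : compact A ->
  0 < r -> B `<=` A -> (forall x y, B x -> B y -> x <> y -> r <= mdist x y) ->
  finite_set B.
Proof.
move=> cA r0 hB hr; apply: contrapT => hinf.
pose F : set_system X := fun P => finite_set (B `\` P).
have FF : ProperFilter F.
  split; first by rewrite /F setD0.
  split=> [|P Q hP hQ|P Q hPQ hP]; rewrite /F.
  - by rewrite setDT.
  - by rewrite setDIr finite_setU.
  - by apply: sub_finite_set hP => x [h1 h2]; split=> // /hPQ.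
have FA : F A by rewrite /F (_ : B `\` A = set0) //; apply/seteqP; split=> // x [/hB].
have [x [_ hx]] := cA F FF FA.
have nx : nbhs x (ball x (r / 2)) by apply: nbhsx_ballx; rewrite divr_gt0.
have sep y z : B y -> B z -> ball x (r / 2) y -> ball x (r / 2) z -> y = z.
  move=> By Bz; rewrite ballEmdist /= => hy hz; apply: contrapT => ne.
  by have := hr y z By Bz ne; have := metric_triangle y x z; rewrite (metric_sym y x); lra.
have FB : F (B `&` ~` ball x (r / 2)).
  have [[y [By hy]]|hn] := pselect (exists y, B y /\ ball x (r / 2) y).
    apply: (@sub_finite_set _ _ [set y]) => // z [Bz hz]; apply/esym.
    by apply: sep => //; apply: contrapT => h; apply: hz.
  rewrite /F (_ : _ `\` _ = set0) //; apply/seteqP; split=> // z [Bz hz]; apply: hz.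
  by split=> // h; apply: hn; exists z.
by have [y [[_ h1] h2]] := hx _ _ FB nx.
Qed.

Section Local.
Variables (R : realType) (X : metricType R) (K : cube_complex R X).
Hypothesis HX : CAT0_cube_complex K.
Let S := cell_csqc HX.
Let hlm := cat0_length HX.
Implicit Types (a : set (vtx S)) (c : cell K) (x y : X) (e f : edge_t K).

Lemma corner_cube c (w : {ffun 'I_(cdim c) -> bool}) : cube (cube_vertex w : 'rV[R]_(cdim c)).
Proof. by move=> i; rewrite mxE; case: (w i); rewrite lexx ler01. Qed.

Lemma ept_cube e r : 0 <= r <= 1 -> cube (cpt (tagged (sval e)) (fun=> r) : 'rV[R]_(cdim (tag (sval e)))).
Proof. by move=> h; apply/cube_cpt. Qed.

Arguments ept_cube e {r} _ i.

Lemma edge_ord e : exists i : 'I_(cdim (tag (sval e))),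
  (forall j, j = i) /\ edge (tagged (sval e)) i = e.
Proof.
have h := proj2_sig e; have i : 'I_(cdim (tag (sval e))) by rewrite h; exact: ord0.
exists i; split; last exact: edge_self.
move: (i); rewrite h => i' j; apply: val_inj.
by case: i' j => [[|//] ?] [[|//] ?].
Qed.

Lemma mdist_ept e r r' : 0 <= r <= 1 -> 0 <= r' <= 1 ->
  mdist (ept (sval e) r) (ept (sval e) r') = `|r - r'|.
Proof.
move=> hr hr'; rewrite /ept (mdist_cell HX) ?euclid_ed2 ?ed2_cpt; try exact: ept_cube.
have [i [hi _]] := edge_ord e; rewrite (big_pred1 i) ?sqrtr_sqr // => j.
by rewrite /= (hi j) eqxx.
Qed.

Lemma fa_ept e r : 0 <= r <= 1 -> fa (hs (S := S) e) (ept (sval e) r) = r.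
Proof.
move=> hr; have [i [_ hi]] := edge_ord e.
have hH : HS (hs (S := S) e) by exists e.
have := dirn_edge HX (tagged (sval e)) i; rewrite hi => d.
rewrite (fa_dir hH (ept_cube e hr) d) cptE; case: (tagged (sval e) i) => //=.
by rewrite opprB addrC subrK.
Qed.

Lemma fa_ept_out a e r : HS a -> 0 <= r <= 1 -> ~ a (esrc e) -> ~ a (etgt e) ->
  fa a (ept (sval e) r) = 0.
Proof.
move=> ha hr h1 h2; apply: (fa_out ha (ept_cube e hr)) => w.
have [i [hi he]] := edge_ord e.
have [->|->] : w = tagged (sval e) \/ w = flip (tagged (sval e)) i.
  have [h|h] : w i = tagged (sval e) i \/ w i = ~~ tagged (sval e) i.
    by case: (w i); case: (tagged (sval e) i); auto.
  - by left; apply/ffunP => j; rewrite (hi j).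
  - by right; apply/ffunP => j; rewrite (hi j) flip_same.
- exact: h1.
- by rewrite -edge_tgt he.
Qed.

Lemma vtx_preim c u (v : vert K) : cube u -> chi c u = sval v ->
  exists w, u = cube_vertex w /\ cv w = v.
Proof.
move=> hu e; have [w [w' [s [t [[hf _ h0 _] ->]]]]] := frep_ex hu e.
exists w; split; last by rewrite (isface_vtx hf) vtx_cv.
rewrite -cpt_vertex; apply: cpt_ext => i; apply: h0 => j.
by have := ltn_ord j; rewrite {2}(vtx_dim (proj2_sig v)).
Qed.

Lemma mdist_vert (u v : vtx S) : mdist (sval u) (sval v) <= (dist u v)%:R.
Proof.
have [p hp hr] := geo u v; rewrite (distE hp hr) {hr}.
elim: p u hp => [|e p IH] u /=; first by move=> ->; rewrite mdistxx.
move=> [<- /IH h]; apply: le_trans (metric_triangle _ (sval (etgt e)) _) _.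
rewrite -nat1r; apply: lerD h.
have -> : mdist (sval (esrc e)) (sval (etgt e)) = 1.
  by rewrite esrcE etgtE mdist_ept ?lexx ?ler01 // sub0r normrN normr1.
by [].
Qed.

Lemma nodup_nth (T : Type) (d : T) (l : seq T) : List.NoDup l ->
  forall i j, (i < size l)%N -> (j < size l)%N -> nth d l i = nth d l j -> i = j.
Proof.
elim=> // x l0 hx _ IH [|i] [|j] //= hi hj e.
- by case: hx; rewrite e; elim: (l0) (j) hj => // y l' IH' [|j'] /= h; [left|right; exact: IH'].
- by case: hx; rewrite -e; elim: (l0) (i) hi => // y l' IH' [|j'] /= h; [left|right; exact: IH'].
- by congr _.+1; exact: IH.
Qed.

Lemma In_nth (T : Type) (d : T) (l : seq T) i : (i < size l)%N -> List.In (nth d l i) l.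
Proof. by elim: l i => // y l' IH' [|j'] /= h; [left|right; exact: IH']. Qed.

Lemma seps_walls (u v : vtx S) : exists h : 'I_(dist u v) -> set (vtx S),
  walls (HX := HX) h /\ forall i, h i u /\ ~ h i v.
Proof.
have [p hp hr] := geo u v; rewrite (distE hp hr); have [hn hin] := seps_red hp hr.
have es : size (seps p) = size p by rewrite size_map.
pose h (i : 'I_(size p)) := nth set0 (seps p) i.
have hh i : [/\ HS (h i), h i u & ~ h i v].
  by apply: hin; apply: In_nth; rewrite es.
exists h; split; last by move=> i; have [] := hh i.
split=> [i|i j ne]; first by have [] := hh i.
split=> e; last by have [_ h1 _] := hh i; have [_ h2 _] := hh j; rewrite e in h1; exact: h1.
by apply: ne; apply: val_inj; apply: (nodup_nth hn) e; rewrite es.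
Qed.

Lemma walls_gap (u v : vtx S) n (h : 'I_n -> set (vtx S)) : walls (HX := HX) h ->
  (forall i, h i u /\ ~ h i v) -> forall i, fa (h i) (sval u) - fa (h i) (sval v) = 1.
Proof.
move=> hw hh i; have [h1 h2] := hh i; rewrite !fa_vert; try by case: hw.
by rewrite asboolT // asboolF // subr0.
Qed.

Lemma dist_sq (u v : vtx S) : (dist u v)%:R <= mdist (sval u) (sval v) ^+ 2.
Proof.
have [h [hw hh]] := seps_walls u v.
apply: le_trans (mdist_walls2 hw _ _).
rewrite (eq_bigr (fun=> 1)) ?sumr_const ?card_ord // => i _.
by rewrite (walls_gap hw hh) expr1n.
Qed.

Lemma dist_lin D (u v : vtx S) : (forall c : cell K, (cdim c <= D)%N) ->
  (dist u v)%:R <= D%:R * mdist (sval u) (sval v).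
Proof.
move=> hD; have [h [hw hh]] := seps_walls u v.
apply: le_trans (mdist_walls1 hw hD _ _).
rewrite (eq_bigr (fun=> 1)) ?sumr_const ?card_ord // => i _.
by rewrite (walls_gap hw hh) normr1.
Qed.

Lemma vert_apart (u v : vtx S) : u <> v -> 1 <= mdist (sval u) (sval v).
Proof.
move=> ne; have h : (0 < dist u v)%N by rewrite lt0n; apply/eqP => /dist0.
have := dist_sq u v; have : 1 <= (dist u v)%:R :> R by rewrite ler1n.
by have := mdist_ge0 (sval u) (sval v); nra.
Qed.

Lemma mdist_corner x (w : {ffun 'I_(cdim (car K x)) -> bool}) :
  mdist x (sval (cv w)) <= (cdim (car K x))%:R.
Proof.
rewrite -[x in mdist x](chi_carp K) /= (mdist_cell HX); [|exact: carp_cube|exact: corner_cube].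
rewrite -(ler_pXn2r (n := 2)) ?nnegrE ?euclid_ge0 // euclid_nrm nrm_sq.
apply: le_trans (_ : \sum_(i < cdim (car K x)) 1 <= _).
  apply: ler_sum => i _; have := carp_cube K x i; have := corner_cube w i; move: (carp K x 0 i) (cube_vertex w 0 i) => p q; nra.
rewrite sumr_const card_ord -natrX ler_nat; case: (cdim _) => // n.
by rewrite expnS leq_pmulr // expn_gt0.
Qed.

Section Degree.
Hypothesis Hlc : locally_compact [set: X].

(** The points at a small distance [r] from [v] on its edges lie in a compact neighbourhood. The
    wall function of one edge is [r] at its own point and 0 at the others, so these points are
    [r]-separated. *)
Lemma finite_degree (v : vtx S) : exists l : seq (edg S), forall e : edg S, src e = v -> List.In e l.
Proof.
have [U hU [cU _]] := @Hlc (sval v) I; move: hU; rewrite /= withinET => /nbhs_ballP[d /= d0 hd].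
pose r := Num.min (d / 2) 1; have r0 : 0 < r by rewrite lt_min divr_gt0 // ltr01.
have r1 : 0 <= r <= 1 by rewrite (ltW r0) ge_min lexx orbT.
have rd : r < d by apply: (@le_lt_trans _ _ (d / 2)); [rewrite ge_min lexx|lra].
pose q (e : edge_t K) := ept (sval e) r; pose A : set (edge_t K) := [set e | esrc e = v].
have sep e f : A e -> A f -> e <> f -> r <= mdist (q e) (q f).
  move=> he hf ne; have hH : HS (hs (S := S) e) by exists e.
  have n1 : ~ hs (S := S) e (esrc f).
    rewrite (_ : esrc f = esrc e); last by rewrite he hf.
    exact: (@hs_src S).
  have n2 : ~ hs (S := S) e (etgt f).
    move=> h; apply: ne; apply: (hs_src_inj (S := S)); first by rewrite [LHS]he [RHS]hf.
    by apply/esym; exact: HS_in.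
  have := mdist_fa (q e) (q f) hH; rewrite fa_ept // fa_ept_out // subr0 ger0_norm //.
  exact: ltW.
have fin : finite_set (q @` A).
  apply: (compact_sep cU r0) => [_ [e he <-]|_ _ [e he <-] [f hf <-] ne].
    apply: hd; rewrite ballEmdist /= -he esrcE mdist_ept ?lexx ?ler01 //.
    by rewrite sub0r normrN ger0_norm // ltW.
  by apply: sep => // e'; apply: ne; rewrite e'.
have inj : {in A &, injective q}.
  move=> e f; rewrite !inE => he hf eq; apply: contrapT => ne.
  have := sep e f he hf ne; rewrite eq mdistxx; lra.
have : finite_set A by rewrite -(eq_finite_set (inj_card_eq inj)).
by move=> /finite_list[l hl]; exists l => e he; exact: hl.
Qed.

End Degree.

Section Essential.
Hypothesis Hgc : geodesically_complete [set: X].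

(** The geodesic from the midpoint of [e] to its end [v] goes on past [v]. If every other edge at
    [v] spanned a square with [opp e], its next point would share a cube with the midpoint, at an
    angle of at most 90 degrees at [v]; a squared distance of at most [1/4 + d^2] is less than
    [(1/2 + d)^2]. *)
Lemma essential_edge (e : edg S) : exists f : edg S, [/\ src f = tgt e, opp e <> f &
  ~ exists e' f', sq (opp e) f e' f'].
Proof.
apply: contrapT => hn.
have hn' f : esrc f = etgt e -> f <> eopp e -> exists e' f', esq (eopp e) f e' f'.
  move=> h1 h2; apply: contrapT => h3; apply: hn; exists f; split=> //.
  by move=> h4; apply: h2; rewrite -h4.
set v := etgt e in hn'.
have half (t : R) : 0 <= t <= 1 / 2%:R -> 0 <= 1 / 2%:R + t <= 1 by move=> h; lra.
pose c0 (t : R) := ept (sval e) (1 / 2%:R + t).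
have [||//|c' [hc' _ ec']] := @Hgc (1 / 2%:R) c0.
- by lra.
- move=> s t; rewrite /= !in_itv /= => hs ht; rewrite mdist_ept ?half //.
  by congr Num.norm; ring.
have g0 := gap_gt0 K (sval v); pose d := gap K (sval v) / 2%:R.
have d0 : 0 < d by rewrite divr_gt0.
pose q := c' (1 / 2%:R + d).
have e0 : c' 0 = ept (sval (eopp e)) (1 / 2%:R).
  rewrite ec' ?lexx ?divr_ge0 // ept_opp /c0; congr ept; lra.
have e1 : c' (1 / 2%:R) = sval v.
  rewrite ec' ?lexx ?divr_ge0 // etgtE /c0; congr ept; lra.
have dq : mdist (c' 0) q = 1 / 2%:R + d by rewrite hc' // sub0r normrN ger0_norm //; lra.
have dv : mdist (sval v) q = d.
  by rewrite -e1 hc' // opprD addrA subrr sub0r normrN ger0_norm // ltW.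
have hq : mdist (sval v) (chi (car K q) (carp K q)) < gap K (sval v).
  by rewrite chi_carp dv /d; lra.
have [u [hu eu _]] := near_preim hlm (carp_cube K q) hq (lexx _).
have [w [ew ecv]] := vtx_preim hu eu.
pose t := off w (carp K q); have ht : unit_box t by apply: cube_off; exact: carp_cube.
have st : \sum_i t i ^+ 2 = d ^+ 2.
  have := mdist_cell HX hu (carp_cube K q); rewrite eu chi_carp dv => ->.
  rewrite euclid_ed2 sqr_sqrtr ?ed2_ge0 // (ed2_off w) ew -cpt_vertex cptK.
  by apply: eq_bigr => i _; rewrite /t; ring.
have [c2 [w2 [ev2 hl]]] : exists c w0, cv w0 = v /\
    (forall f, List.In f (eopp e :: map (edge w) (enum 'I_(cdim (car K q)))) <->
      exists i, f = @edge _ _ K c w0 i).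
  apply: (clique_corner (cat0_flag HX)) => [f /= [<-//|/in_mapP[i _ <-]]|].
    by rewrite edge_src.
  have hsrc i : esrc (edge w i) = etgt e by rewrite edge_src.
  move=> f g /= [<-|/in_mapP[i _ <-]] [<-|/in_mapP[j _ <-]] ne //.
  - by apply: hn' => // h; apply: ne.
  - have [e' [f' h]] := hn' _ (hsrc i) ne; exists f', e'; exact: esq_sym.
  - have nij : i != j by apply/eqP => h; apply: ne; rewrite h.
    by eexists; eexists; exact: esq_edge nij.
have [k hk] : exists k, eopp e = edge w2 k by apply/hl; left.
have [s hs] : {s : 'I_(cdim (car K q)) -> 'I_(cdim c2) & forall i, edge w i = edge w2 (s i)}.
  apply: (@choice _ _ (fun i j => edge w i = edge w2 j)) => i; apply/hl; right.
  apply/in_mapP; exists i => //; have : i \in enum 'I_(cdim (car K q)) by rewrite mem_enum.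
  elim: (enum _) => // y l IH; rewrite inE => /orP[/eqP->|/IH]; [by left|by right].
have hf : isface w2 w s by apply: (corner_sub (cat0_flag HX)) => //; rewrite ecv.
have [sinj hfs] := hf.
pose tau := extz s t; have htau : unit_box tau by exact: extz_box.
have eq : q = chi c2 (cpt w2 tau).
  by rewrite hfs //; [rewrite extz_comp // offK chi_carp|exact: extz_out].
have h2 : 0 <= (1 / 2%:R : R) <= 1 by lra.
have ep : c' 0 = chi c2 (cpt w2 (fun j => if j == k then 1 / 2%:R else 0)).
  by rewrite e0 hk -(edgeP w2 k h2).
have hb : unit_box (fun j : 'I_(cdim c2) => if j == k then 1 / 2%:R else 0 : R).
  by move=> j; case: eqP => _; rewrite ?h2 // lexx ler01.
have := mdist_cell HX ((cube_cpt w2 _).2 hb) ((cube_cpt w2 _).2 htau).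
rewrite -ep -eq dq => /(congr1 (fun r => r ^+ 2)).
rewrite euclid_ed2 sqr_sqrtr ?ed2_ge0 // ed2_cpt => hsum.
have stau : \sum_j tau j ^+ 2 = d ^+ 2.
  rewrite (sum_inj sinj) => [|i hi]; last by rewrite /tau extz_out // expr0n.
  by rewrite -st; apply: eq_bigr => i _; rewrite /tau extz_in.
have : \sum_i ((if i == k then 1 / 2%:R else 0) - tau i) ^+ 2 <= \sum_j tau j ^+ 2 + 1 / 4%:R.
  rewrite (bigD1 k) //= [X in _ <= X + _](bigD1 k) //= eqxx.
  rewrite (eq_bigr (fun j => tau j ^+ 2)) => [|j /negPf ->]; last by ring.
  have := htau k; set x := tau k; set y := bigop _ _ _; nra.
by rewrite -hsum stau; nra.
Qed.

End Essential.

End Local.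

(** * Rank one isometries *)

Section Action.
Variables (R : realType) (X : metricType R) (K : cube_complex R X).
Hypothesis HX : CAT0_cube_complex K.
Variables (Gamma : groupType) (rho : Gamma -> X -> X).
Hypothesis Hact : is_action rho.
Hypothesis Hcub : forall g : Gamma, cubical_automorphism K (rho g).
Let S := cell_csqc HX.
Let hlm := cat0_length HX.
Implicit Types (g h : Gamma) (c : cell K) (x y : X) (e f : edge_t K).

Lemma rhoK g x : rho g^-1%g (rho g x) = x.
Proof. by case: Hact => h1 h2; rewrite -h2 mulVg h1. Qed.

Lemma rhoVK g x : rho g (rho g^-1%g x) = x.
Proof. by case: Hact => h1 h2; rewrite -h2 mulgV h1. Qed.

Lemma rho_string g x s y : is_string (K := K) x s y -> exists2 s',
  is_string (K := K) (rho g x) s' (rho g y) & string_length s' = string_length s.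
Proof.
elim: s x => [|[c [u v]] s IH] x /=.
  by move=> ->; exists [::].
move=> [hu hv <- /IH[s' h1 h2]]; have [_ /(_ c)[c' [h [[himg hiso] hE]]]] := Hcub g.
exists (existT _ c' (h u, h v) :: s'); last first.
  by rewrite /string_length !big_cons /= -/(string_length _) h2 hiso.
by split=> /=; rewrite -?himg -?hE.
Qed.

Lemma rho_le g x y : mdist (rho g x) (rho g y) <= mdist x y.
Proof.
rewrite leNgt; apply/negP => /(string_lt hlm)[s /(rho_string g)[s' h1 <-]].
by rewrite ltNge (mdist_le_string hlm h1).
Qed.

Lemma rho_dist g x y : mdist (rho g x) (rho g y) = mdist x y.
Proof.
apply/eqP; rewrite eq_le rho_le /=.
by have := rho_le g^-1%g (rho g x) (rho g y); rewrite !rhoK.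
Qed.

Lemma rho_isometry g : Defs.isometry (rho g).
Proof. by split; [case: (Hcub g)|exact: rho_dist]. Qed.

Definition cubm g c w c' w' (s : 'I_(cdim c') -> 'I_(cdim c)) :=
  [/\ injective s, forall i, exists j, s j = i & forall t, unit_box t ->
    rho g (chi c (cpt w t)) = chi c' (cpt w' (t \o s))].

Lemma cubm_ex g c w : exists c' w' s, @cubm g c w c' w' s.
Proof.
have [_ /(_ c)[c' [h [hiso hE]]]] := Hcub g.
have ecf : cube_face finset.set0 w = @cube R (cdim c).
  by apply/seteqP; split=> u; [case|move=> hu; split=> // i; rewrite inE].
rewrite -ecf in hiso; have [w' [s [h1 h2 h3]]] := face_iso hiso.
exists c', w', s; split=> // [i|t ht]; first by apply/h2; rewrite inE.
rewrite hE; last exact/cube_cpt.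
by rewrite h3 // => i; rewrite inE.
Qed.

Lemma cubm_flip g c w c' w' s j : @cubm g c w c' w' s ->
  cubm g (flip w (s j)) (flip w' j) s.
Proof.
move=> [h1 h2 h3]; split=> // t ht; rewrite !cpt_flip h3.
  by congr chi; apply: cpt_ext => k /=; rewrite (inj_eq h1).
by move=> i; have := ht i; case: eqP => _; lra.
Qed.

Lemma cubm_dim g c w c' w' s : @cubm g c w c' w' s -> cdim c' = cdim c.
Proof.
move=> [h1 h2 _]; have : #|'I_(cdim c')| = #|'I_(cdim c)|; last by rewrite !card_ord.
rewrite -(card_codom h1); apply: eq_card => i; rewrite !inE.
by have [j <-] := h2 i; rewrite codom_f.
Qed.

Lemma rho_vertex g x : is_vertex K x -> is_vertex K (rho g x).
Proof.
move=> [c hc [u hu <-]]; pose w : {ffun 'I_(cdim c) -> bool} := [ffun => false].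
have [c' [w' [s hm]]] := cubm_ex g w; exists c'; first by rewrite (cubm_dim hm).
have [h1 h2 h3] := hm; rewrite -(offK w u) h3; last exact: cube_off.
exists (cpt w' (off w u \o s)) => //; apply/cube_cpt => j; exact: (cube_off w hu).
Qed.

Definition rv g (v : vtx S) : vtx S := exist _ (rho g (sval v)) (rho_vertex g (proj2_sig v)).

Lemma rv1 v : rv 1%g v = v.
Proof. by apply: vert_ext; case: Hact => h1 _; rewrite /= h1. Qed.

Lemma rvM g h v : rv (g * h)%g v = rv g (rv h v).
Proof. by apply: vert_ext; case: Hact => _ h2; rewrite /= h2. Qed.

Lemma cubm_cv g c w c' w' s : @cubm g c w c' w' s -> rv g (cv w) = cv w'.
Proof.
move=> [_ _ h]; apply: vert_ext; rewrite /= -!cpt_vertex h // => i.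
by rewrite lexx ler01.
Qed.

Lemma re_ex g e : exists e' : edge_t K, forall r, 0 <= r <= 1 ->
  ept (sval e') r = rho g (ept (sval e) r).
Proof.
have [c' [w' [s hm]]] := cubm_ex g (tagged (sval e)).
have hd : cdim c' = 1%N by rewrite (cubm_dim hm); exact: (proj2_sig e).
exists (exist _ (crn w') hd) => r hr; have [_ _ h] := hm.
by rewrite /ept /= h.
Qed.

Definition re g e : edge_t K := projT1 (cid (re_ex g e)).

Lemma reE g e r : 0 <= r <= 1 -> ept (sval (re g e)) r = rho g (ept (sval e) r).
Proof. by rewrite /re; case: cid => e' /= h; exact: h. Qed.

Lemma src_re g (e : edg S) : src (re g e : edg S) = rv g (src e).
Proof.
by apply: vert_ext; rewrite /= -[LHS]/(sval (esrc (re g e))) esrcE reE ?lexx ?ler01 // -esrcE.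
Qed.

Lemma tgt_re g (e : edg S) : tgt (re g e : edg S) = rv g (tgt e).
Proof.
by apply: vert_ext; rewrite /= -[LHS]/(sval (etgt (re g e))) etgtE reE ?lexx ?ler01 // -etgtE.
Qed.

Lemma opp_re g (e : edg S) : opp (re g e : edg S) = re g (opp e).
Proof.
apply: edge_ext => r hr; rewrite reE // !ept_opp reE //.
by move: hr; lra.
Qed.

Lemma reK g e : re g^-1%g (re g e) = e.
Proof. by apply: edge_ext => r hr; rewrite !reE // rhoK. Qed.

Lemma re_edge g c w c' w' s j : @cubm g c w c' w' s -> re g (edge w (s j)) = edge w' j.
Proof.
move=> [h1 _ h]; apply/esym/edge_eq => r hr; rewrite reE // -edgeP // h.
  by congr chi; apply: cpt_ext => k /=; rewrite (inj_eq h1).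
by move=> i; case: eqP => _; rewrite ?hr // lexx ler01.
Qed.

Lemma sq_re g (e x e' x' : edg S) : sq e x e' x' ->
  sq (re g e : edg S) (re g x) (re g e') (re g x').
Proof.
move=> [c [w [i [j [ne -> -> -> ->]]]]]; have [c' [w' [s hm]]] := cubm_ex g w.
have [h1 h2 _] := hm; have [i' ei] := h2 i; have [j' ej] := h2 j.
exists c', w', i', j'; rewrite -ei -ej in ne *; split.
- by apply: contraNneq ne => ->.
- exact: re_edge.
- exact: re_edge.
- by apply: re_edge; exact: cubm_flip.
- by apply: re_edge; exact: cubm_flip.
Qed.

Section Cocompact.
Hypothesis Hlc : locally_compact [set: X].
Hypothesis Hgc : geodesically_complete [set: X].
Hypothesis Hinf : infinite_set [set: Gamma].
Hypothesis Hprop : proper_action rho.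
Hypothesis Hcoc : cocompact_action rho.

(** Distinct vertices are at distance at least 1, so a compact set whose translates cover holds only
    finitely many of them. *)
Lemma orbit_reps : exists Reps : seq (vtx S),
  forall v, exists g r, List.In r Reps /\ v = rv g r.
Proof.
have [C cC hC] := Hcoc; pose A : set (vtx S) := [set v | C (sval v)].
have inj : {in A &, injective (fun v : vert K => sval v)}.
  by move=> u v _ _; exact: vert_ext.
have fin : finite_set ((fun v : vert K => sval v) @` A).
  apply: (compact_sep cC (r := 1)) => // [_ [v hv <-] //|_ _ [u hu <-] [v hv <-] ne].
  by apply: (vert_apart (HX := HX)) => e; apply: ne; rewrite e.
have /finite_list[l hl] : finite_set A by rewrite -(eq_finite_set (inj_card_eq inj)).
exists l => v; have : (\bigcup_(g in setT) (rho g @` C)) (sval v) by rewrite hC.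
move=> [g _ [y Cy ey]]; exists g, (rv g^-1%g v); split; last first.
  by rewrite -rvM mulgV rv1.
by apply: hl; rewrite /A /= -ey rhoK.
Qed.

Lemma finite_stab (u v : vtx S) : exists L : seq Gamma, forall g, rv g u = v -> List.In g L.
Proof.
have cC : compact ([set sval u] `|` [set sval v]).
  by apply: compactU; exact: compact_set1.
have /finite_list[L hL] := Hprop cC; exists L => g e; apply: hL.
exists (sval v); split; last by right.
by exists (sval u); [left|rewrite -e].
Qed.

Lemma uniform_degree : exists D, (forall u : vtx S, exists l : seq (edg S), (size l <= D)%N /\
  forall e : edg S, src e = u -> List.In e l) /\ forall c, (cdim c <= D)%N.
Proof.
have [Reps hR] := orbit_reps.
have [ld hld] : {ld : vtx S -> seq (edg S) & forall u (e : edg S), src e = u -> List.In e (ld u)}.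
  apply: (@choice _ _ (fun u l => forall e : edg S, src e = u -> List.In e l)).
  exact: finite_degree.
have [D hD] : exists D, forall r, List.In r Reps -> (size (ld r) <= D)%N.
  elim: (Reps) => [|r l [D hD]]; first by exists 0%N.
  exists (maxn (size (ld r)) D) => r' [<-|/hD h]; first by rewrite leq_maxl.
  by apply: leq_trans h _; rewrite leq_maxr.
have hdeg (u : vtx S) : exists l : seq (edg S), (size l <= D)%N /\
    forall e : edg S, src e = u -> List.In e l.
  have [g [r [hr ->]]] := hR u; exists (map (re g) (ld r)); rewrite size_map; split; first exact: hD.
  move=> e he; apply/in_mapP; exists (re g^-1%g e); last by have := reK g^-1%g e; rewrite invgK.
  by apply: hld; rewrite src_re he -rvM mulVg rv1.
exists D; split=> // c; pose w : {ffun 'I_(cdim c) -> bool} := [ffun => false].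
have [l [hl hin]] := hdeg (cv w); apply: leq_trans hl.
have [k hk] : {k : 'I_(cdim c) -> 'I_(size l) & forall i, forall d, nth d l (k i) = edge w i}.
  apply: (@choice _ _ (fun i (k : 'I_(size l)) => forall d, nth d l k = edge w i)) => i.
  have hi : List.In (edge w i) l by apply: hin; exact: edge_src.
  have [A [B eAB]] := in_split hi; rewrite eAB.
  have h : (size A < size (A ++ edge w i :: B))%N.
    by rewrite size_cat /= addnS ltnS leq_addr.
  by exists (Ordinal h) => d; rewrite /= nth_cat ltnn subnn.
have kinj : injective k.
  move=> i j e; apply: (edge_inj (cat0_flag HX) (w := w)).
  by rewrite -(hk i (edge w i)) e hk.
by have := leq_card k kinj; rewrite !card_ord.
Qed.

Lemma some_vertex : [set: vtx S] !=set0.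
Proof.
have [[[x _] _ _] _ _] := HX.
by exists (cv (c := car K x) [ffun => false]).
Qed.

(** Otherwise there would be a single vertex, and its finite stabiliser would be the infinite
    group. *)
Lemma some_halfspace : exists a : set (vtx S), HS a.
Proof.
apply: contrapT => hn; have [u _] := some_vertex; apply: Hinf.
have [L hL] := finite_stab u u; apply: sub_finite_set (list_finite L) => g _ /=.
by apply: hL; apply: vtx_sep => a ha; case: hn; exists a.
Qed.

Definition irreducible := forall Q : set (set (vtx S)), (forall a, Q a -> HS a) ->
  (forall a b, Q a -> HS b -> ~ Q b -> cross a b) ->
  Q !=set0 -> forall a, HS a -> Q a.

Lemma irreducible_skewers : irreducible -> skewers_strongly rv.
Proof.
move=> hirr; have [D [hdeg _]] := uniform_degree; have [Reps hR] := orbit_reps.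
exact: (@rigidity S Gamma rv re rv1 rvM src_re tgt_re opp_re sq_re reK D hdeg Reps hR finite_stab
  (essential_edge (HX := HX) Hgc) hirr some_halfspace).
Qed.

Let HSga g (a : set (vtx S)) : HS a -> HS (ga rv g a).
Proof. exact: (HS_ga (S := S) (re := re) rv1 rvM src_re tgt_re opp_re sq_re reK). Qed.

Let hsre g (e : edg S) : hs (re g e : edg S) = ga rv g (hs e).
Proof. exact: (@hs_re S Gamma rv re rv1 rvM src_re tgt_re opp_re sq_re reK). Qed.

Lemma cubm_corner g c w c' w' s : @cubm g c w c' w' s -> forall v', exists v,
  cubm g v v' s /\ forall j, v (s j) = w (s j) (+) w' j (+) v' j.
Proof.
move=> hm; have [sinj _ _] := hm; apply: (flip_ind (w0 := w')).
  by exists w; split=> // j; case: (w _); case: (w' _).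
move=> v' j [v [h1 h2]]; exists (flip v (s j)); split; first exact: cubm_flip.
move=> k; rewrite !ffunE (inj_eq sinj); case: eqP => [->|_]; rewrite h2 //.
by rewrite addbN.
Qed.

Lemma fa_ga g (a : set (vtx S)) x : HS a -> fa (ga rv g a) (rho g x) = fa a x.
Proof.
move=> ha; have hga := HSga g ha.
pose w : {ffun 'I_(cdim (car K x)) -> bool} := [ffun => false].
have [c' [w' [s hm]]] := cubm_ex g w; have [sinj ssur hs_] := hm.
pose t := off w (carp K x); have ht : unit_box t by apply: cube_off; exact: carp_cube.
have ex : rho g x = chi c' (cpt w' (t \o s)) by rewrite -hs_ // offK chi_carp.
have hc : cube (cpt w' (t \o s)) by apply/cube_cpt => j; exact: ht.
have cor v' : exists v, (ga rv g a (cv v') <-> a (cv v)) /\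
    forall j, v (s j) = w (s j) (+) w' j (+) v' j.
  have [v [h1 h2]] := cubm_corner hm v'; exists v; split=> //.
  by rewrite -(cubm_cv h1) gaE //; [exact: rv1|exact: rvM].
have [[i [b [d ->]]]|[h ->]|[h ->]] := fa_casesP x ha.
- have [j ej] := ssur i.
  have d' : @dirn _ _ _ HX (ga rv g a) c' j (b (+) w' j).
    move=> v'; have [v [-> hv]] := cor v'; rewrite d -ej hv ffunE.
    by case: (v' j); case: (w' j); case: (b).
  rewrite ex (fa_dir hga hc d') cptE /= ej /t /off ffunE.
  by case: (b); case: (w' j) => //=; ring.
- by rewrite ex (fa_in hga hc) // => v'; have [v [-> _]] := cor v'.
- by rewrite ex (fa_out hga hc) // => v'; have [v [-> _]] := cor v'.
Qed.

(** * The decreasing sequence of translates of a skewered halfspace *)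

Section Skewer.
Variables (g0 : Gamma) (a : set (vtx S)).
Hypotheses (ha : HS a) (sub_ga : ga rv g0 a `<=` a) (ne_ga : ga rv g0 a <> a).

Let H n : set (vtx S) := ga rv (g0 ^+ n)%g a.

Lemma skew_HS n : HS (H n). Proof. exact: HSga. Qed.

Lemma skew_S n : H n.+1 = ga rv (g0 ^+ n)%g (ga rv g0 a).
Proof. by rewrite /H expgSr gaM //; exact: rvM. Qed.

Lemma skew_le m n : (m <= n)%N -> H n `<=` H m.
Proof.
move=> /subnK <-; elim: (n - m)%N => [|k IH] //; rewrite addSn.
by apply: subset_trans IH; rewrite skew_S; exact: ga_sub.
Qed.

Lemma skew_neS n : H n.+1 <> H n.
Proof.
rewrite skew_S /H => e; apply: ne_ga.
rewrite -[LHS](gaK rv1 rvM (g0 ^+ n)%g) e.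
by rewrite (gaK rv1 rvM).
Qed.

Lemma skew_inj : injective H.
Proof.
have key m n : (m < n)%N -> H m <> H n.
  move=> hmn e; apply: (@skew_neS m); apply/seteqP; split; first exact: skew_le.
  by rewrite e; exact: skew_le.
by move=> m n e; case: (ltngtP m n) => // h; [case: (key m n)|case: (key n m)].
Qed.

(** A vertex in all [H n] would be separated by infinitely many distinct halfspaces from a vertex
    outside [a]. *)
Lemma skew_out v : exists n0, forall n, (n0 <= n)%N -> ~ H n v.
Proof.
apply: contrapT => hn.
have hv n : H n v.
  apply: contrapT => h; apply: hn; exists n => m hm h'; apply: h; exact: skew_le hm _ h'.
have [u hu] := HS_neq0 (HSC ha).
apply: (no_inf_sep (a := H) skew_inj (u := v) (v := u)) => n; split=> //.
  exact: skew_HS.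
move=> h; apply: hu; have := @skew_le 0 n isT u h.
by rewrite /H expg0 ga1 //; exact: rv1.
Qed.

Lemma skew_fa_out x : exists n0, forall n, (n0 <= n)%N -> fa (H n) x = 0.
Proof.
have [n0 hn0] : {n0 : {ffun 'I_(cdim (car K x)) -> bool} -> nat &
    forall w n, (n0 w <= n)%N -> ~ H n (cv w)}.
  by apply: (@choice _ _ (fun w n0 => forall n, (n0 <= n)%N -> ~ H n (cv w))) => w; exact: skew_out.
exists (\max_w n0 w) => n hn; rewrite -(chi_carp K x).
apply: (fa_out (skew_HS n)); first exact: carp_cube.
by move=> w; apply: hn0; apply: leq_trans hn; exact: (leq_bigmax w).
Qed.

End Skewer.

Lemma skew_inv g0 (a : set (vtx S)) : ga rv g0 a `<=` a -> ga rv g0 a <> a ->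
  ga rv g0^-1%g (~` a) `<=` ~` a /\ ga rv g0^-1%g (~` a) <> ~` a.
Proof.
move=> h1 h2; have e b : ga rv g0^-1%g (ga rv g0 b) = b by exact: (gaK rv1 rvM).
split=> [v hv hv'|h]; last first.
  have e2 : ga rv g0 (~` a) = ~` a by rewrite -{1}h (gaVK rv1 rvM).
  by apply: h2; rewrite -[a in LHS]setCK gaC e2 setCK.
apply: hv; rewrite -/(ga rv g0^-1%g a v); apply: (ga_sub h1); by rewrite e.
Qed.

(** * Hyperbolicity and the exclusion of flat half-planes *)

Section RankOne.
Variables (g0 : Gamma) (a : set (vtx S)).
Hypotheses (ha : HS a) (sub_ga : ga rv g0 a `<=` a) (ne_ga : ga rv g0 a <> a).
Let H n : set (vtx S) := ga rv (g0 ^+ n)%g a.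
Let L n : set (vtx S) := ga rv (g0^-1 ^+ n)%g a.

Lemma skew_in v : exists n0, forall n, (n0 <= n)%N -> L n v.
Proof.
have [h1 h2] := skew_inv sub_ga ne_ga; have [n0 hn] := skew_out (HSC ha) h1 h2 v.
by exists n0 => n /hn; rewrite gaC => h; apply: contrapT.
Qed.

Lemma skew_fa_in x : exists n0, forall n, (n0 <= n)%N -> fa (L n) x = 1.
Proof.
have [h1 h2] := skew_inv sub_ga ne_ga; have [n0 hn] := skew_fa_out (HSC ha) h1 h2 x.
exists n0 => n /hn; rewrite gaC faC; first by lra.
exact: HSga.
Qed.

Lemma rho_exp (g : Gamma) n x : rho (g ^+ n)%g x = iter n (rho g) x.
Proof.
case: Hact => h1 h2; elim: n => [|n IH]; first by rewrite expg0 h1.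
by rewrite expgS h2 IH.
Qed.

(** A fixed point keeps the orbit of [v] within distance [2 * B] of [v], while high powers put
    arbitrarily many walls between [v] and its image. *)
Lemma no_fixpoint x : rho g0 x <> x.
Proof.
move=> hx; pose v := cv (c := car K x) [ffun => false]; pose B := mdist x (sval v).
have hxn n : rho (g0 ^+ n)%g x = x by rewrite rho_exp; elim: n => //= n ->.
have dv n : mdist (sval (rv (g0 ^+ n)%g v)) (sval v) <= 2%:R * B.
  apply: le_trans (metric_triangle _ x _) _; rewrite -{2}(hxn n) /= metric_sym.
  by rewrite hxn -{1}(hxn n) rho_dist /B; lra.
have [n0 h0] := skew_in v; have [n1 h1] := skew_out ha sub_ga ne_ga v.
have [M hM] : exists M, (2%:R * B) ^+ 2 < M%:R.
  by exists (Num.bound ((2%:R * B) ^+ 2)); apply: archi_boundP; exact: sqr_ge0.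
(* The walls with index from [n1] on miss [v]; the [k]-th translate of [L n0] is [H (n1 + M)], so
   the [M] walls in between contain the image of [v]. *)
pose k := (n1 + M + n0)%N; pose h (i : 'I_M) := H (n1 + i).
have gv i : h i (rv (g0 ^+ k)%g v).
  have : H (n1 + M) (rv (g0 ^+ k)%g v).
    have -> : H (n1 + M) = ga rv (g0 ^+ k)%g (L n0).
      rewrite /L -gaM; last exact: rvM.
      by rewrite /H /k (expgnDr _ (n1 + M) n0) -mulgA expVgn mulgV mulg1.
    by apply/(gaE rv1 rvM); exact: h0.
  by apply: skew_le => //; rewrite leq_add2l ltnW.
have hw : walls (HX := HX) h.
  split=> [i|i j ne]; first exact: skew_HS.
  split=> e; last by have := gv i; rewrite e => /(_ (gv j)).
  by apply: ne; apply: val_inj; apply: (@addnI n1); exact: (skew_inj sub_ga ne_ga e).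
have := mdist_walls2 hw (sval (rv (g0 ^+ k)%g v)) (sval v).
rewrite (eq_bigr (fun=> 1)) => [|i _]; last first.
  have e1 := gv i; have e2 : ~ h i v by apply: h1; rewrite leq_addr.
  rewrite !fa_vert; try exact: skew_HS.
  by rewrite (asboolT e1) (asboolF e2) subr0 expr1n.
rewrite sumr_const card_ord => h2.
have := dv k; have := mdist_ge0 (sval (rv (g0 ^+ k)%g v)) (sval v); nra.
Qed.

Lemma mdist_lip y x x' : `|mdist y x - mdist y x'| <= mdist x x'.
Proof.
rewrite ler_norml; have := metric_triangle y x x'; have := metric_triangle y x' x.
by rewrite (metric_sym x' x); lra.
Qed.

Lemma lip_continuous (f : X -> R) (k : R) : 0 < k ->
  (forall x y, `|f x - f y| <= k * mdist x y) -> continuous f.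
Proof.
move=> k0 hf x; apply/cvgrPdist_lt => e e0; rewrite nearE; apply/nbhs_ballP.
exists (e / k) => /=; first exact: divr_gt0.
move=> y; rewrite ballEmdist /= => h; apply: le_lt_trans (hf x y) _.
by rewrite mulrC -ltr_pdivlMr.
Qed.

Lemma disp_continuous h : continuous (fun x => mdist x (rho h x)).
Proof.
apply: (@lip_continuous _ 2%:R) => // x y.
have h1 := mdist_lip x (rho h x) (rho h y); rewrite rho_dist in h1.
have h2 := mdist_lip (rho h y) x y.
rewrite (metric_sym (rho h y) x) (metric_sym (rho h y) y) in h2.
have := ler_distD (mdist x (rho h y)) (mdist x (rho h x)) (mdist y (rho h y)).
by lra.
Qed.

Lemma ball_list (u : vtx S) n : exists l : seq (vtx S), forall v, (dist u v <= n)%N -> List.In v l.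
Proof.
have [ld hld] : {ld : vtx S -> seq (edg S) & forall u (e : edg S), src e = u -> List.In e (ld u)}.
  apply: (@choice _ _ (fun u l => forall e : edg S, src e = u -> List.In e l)).
  exact: finite_degree.
elim: n => [|n [l hl]].
  by exists [:: u] => v; rewrite leqn0 => /eqP/dist0 ->; left.
have step (f : vtx S -> seq (vtx S)) (l0 : seq (vtx S)) (x y : vtx S) : List.In x l0 -> List.In y (f x) ->
    List.In y (flatten (map f l0)).
  elim: l0 => //= z l0 IH [<-|h] hy; apply: List.in_or_app; [by left|by right; exact: IH].
exists (l ++ flatten (map (fun w => map (@tgt S) (ld w)) l)) => v hv.
apply: List.in_or_app; have [p hp hr] := geo v u.
have hs : dist u v = size p by rewrite distC; exact: distE.
case: p hp hr hs => [|e p] /= hp hr hs; first by left; apply: hl; rewrite hs.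
right; have [es hp'] := hp.
apply: (step _ _ (tgt e)).
  apply: hl; rewrite distC; apply: leq_trans (dist_le_size hp') _.
  by rewrite hs in hv.
apply/in_mapP; exists (opp e); first by apply: hld; rewrite src_opp.
exact: etrans (tgt_opp e) es.
Qed.

Lemma near_conj (C : set X) (M : R) : compact C -> C !=set0 -> exists L : seq Gamma,
  forall h y, C y -> mdist y (rho h y) <= M -> List.In h L.
Proof.
move=> cC C0; have [r _] := some_vertex.
have cr : {within C, continuous (fun y => mdist (sval r) y)}.
  apply: continuous_subspaceT; apply: (@lip_continuous _ 1) => // x y.
  by rewrite mul1r; exact: mdist_lip.
have [b bC hb] := compact_EVT_max C0 cC cr; pose B := mdist (sval r) b.
have hB y : C y -> mdist (sval r) y <= B by move=> Cy; apply: hb; rewrite inE.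
pose N := Num.bound ((B + `|M| + B) ^+ 2).
have hN : (B + `|M| + B) ^+ 2 < N%:R by apply: archi_boundP; exact: sqr_ge0.
have [V hV] := ball_list r N.
have [st hst] : {st : vtx S -> seq Gamma & forall v h, rv h r = v -> List.In h (st v)}.
  by apply: (@choice _ _ (fun v L => forall h, rv h r = v -> List.In h L)) => v; exact: finite_stab.
exists (flatten (map st V)) => h y Cy hy.
have d1 : mdist (sval r) (sval (rv h r)) <= B + `|M| + B.
  apply: le_trans (metric_triangle _ y _) _.
  apply: le_trans (lerD (lexx _) (metric_triangle _ (rho h y) _)) _.
  rewrite /= (rho_dist h) (metric_sym y (sval r)) addrA.
  by have := hB y Cy; have := ler_norm M; lra.
have : (dist r (rv h r) <= N)%N.
  rewrite -(ler_nat R); apply: le_trans (dist_sq _ _) (ltW (le_lt_trans _ hN)).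
  have := mdist_ge0 (sval r) (sval (rv h r)); nra.
move=> /hV; have := hst _ h erefl; elim: (V) => //= v V' IH h1 [e|h2]; apply: List.in_or_app.
  by left; rewrite e.
by right; exact: IH.
Qed.

(** A point is moved into the compact set [C] at the price of conjugating [g]. Only finitely many
    conjugates have displacement at most [M] somewhere on [C], and each of them attains its minimum
    there. *)
Lemma min_displacement (g : Gamma) : exists x, forall y, mdist x (rho g x) <= mdist y (rho g y).
Proof.
have [C cC hC] := Hcoc; have [r _] := some_vertex.
have inC x : exists k, C (rho k x).
  have : (\bigcup_(k in setT) (rho k @` C)) x by rewrite hC.
  by move=> [k _ [y Cy <-]]; exists k^-1%g; rewrite rhoK.
have C0 : C !=set0 by have [k hk] := inC (sval r); exists (rho k (sval r)).
pose M := mdist (sval r) (rho g (sval r)).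
have [Ls hL] := near_conj M cC C0.
have [y_ hy] : {y_ : Gamma -> X & forall h, C (y_ h) /\
    forall y, C y -> mdist (y_ h) (rho h (y_ h)) <= mdist y (rho h y)}.
  apply: (@choice _ _ (fun h x => C x /\ forall y, C y -> mdist x (rho h x) <= mdist y (rho h y))).
  move=> h; have [z zC hz] := compact_EVT_min C0 cC (continuous_subspaceT (@disp_continuous h)).
  by exists z; rewrite inE in zC; split=> // y Cy; apply: hz; rewrite inE.
pose d h := mdist (y_ h) (rho h (y_ h)).
pose P h := exists k, h = (k * g * k^-1)%g.
have conj k x : mdist (rho k x) (rho (k * g * k^-1)%g (rho k x)) = mdist x (rho g x).
  by case: Hact => h1 h2; rewrite !h2 rhoK rho_dist.
have low x : exists h, P h /\ d h <= mdist x (rho g x) /\ (mdist x (rho g x) <= M -> List.In h Ls).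
  have [k hk] := inC x; exists (k * g * k^-1)%g; split; first by exists k.
  rewrite -(conj k x); split; first by apply: (hy _).2.
  by move=> h; exact: hL hk h.
have [h0 [P0 [_ /(_ (lexx _)) in0]]] := low (sval r).
have [h [[k hk] hmin]] := list_argmin d P0 in0.
exists (rho k^-1%g (y_ h)) => y.
have -> : mdist (rho k^-1%g (y_ h)) (rho g (rho k^-1%g (y_ h))) = d h.
  by rewrite -(conj k) !rhoVK -hk.
have [hle|hlt] := leP (mdist y (rho g y)) M.
  by have [h1 [P1 [h2 h3]]] := low y; apply: le_trans h2; apply: hmin => //; exact: h3.
have [h1 [P1 [h2 h3]]] := low (sval r).
apply: le_trans (ltW hlt); apply: le_trans h2; apply: hmin => //; exact: h3.
Qed.

Hypothesis hss : forall m, HS m -> cross m a -> cross m (ga rv g0 a) -> False.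

Lemma strips n m : HS m -> cross m (H n) -> cross m (H n.+1) -> False.
Proof.
move=> hm h1 h2; apply: (hss (m := ga rv (g0 ^+ n)^-1%g m)); first exact: HSga.
  by have := ga_cross rv1 rvM (g0 ^+ n)^-1%g h1; rewrite (gaK rv1 rvM).
have := ga_cross rv1 rvM (g0 ^+ n)^-1%g h2.
by rewrite /H (skew_S g0 a n) (gaK rv1 rvM).
Qed.

Definition incident (b : set (vtx S)) (u : vtx S) := exists2 e : edg S, src e = u & hs e = b.

Lemma incident_cross b u u' m : incident b u -> incident b u' -> HS m -> m u -> ~ m u' ->
  cross m b.
Proof.
move=> [e es eb] [e' es' eb'] hm mu mu'.
have bu : ~ b u by rewrite -es -eb; exact: hs_src.
have bu' : ~ b u' by rewrite -es' -eb'; exact: hs_src.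
have be : b (tgt e) by rewrite -eb; exact: hs_tgt.
have be' : b (tgt e') by rewrite -eb'; exact: hs_tgt.
have me : m (tgt e).
  apply: contrapT => h; apply: mu'; have := HS_out (f := e) hm; rewrite es eb => /(_ mu h).
  by move=> E1; apply: contrapT => h'; apply: bu'; rewrite E1.
have me' : ~ m (tgt e').
  move=> h; apply: bu; have := HS_in (f := e') hm; rewrite es' eb' => /(_ mu' h) -> //.
by split; [exists (tgt e)|exists u|exists (tgt e')|exists u'].
Qed.

(** A hyperplane separating [u] from [v] crosses [H n], so it does not cross [H n.+1] and cannot
    separate [u'] from [v']. Hence it separates [v'] from [v], or [u] from [u']. *)
Lemma strip_dist n u v u' v' : incident (H n) u -> incident (H n) v ->
  incident (H n.+1) u' -> incident (H n.+1) v' -> (dist u v <= dist v' v + dist u u')%N.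
Proof.
move=> iu iv iu' iv'; have [L1 [h1 s1]] := fin_sep v' v; have [L2 [h2 s2]] := fin_sep u u'.
rewrite -s1 -s2 -size_cat; apply: dist_seps => m hm mu mv; apply: List.in_or_app.
have [mv'|mv'] := pselect (m v'); [by left; exact: h1|right; apply: h2 => // mu'].
apply: (@strips n m hm); first exact: incident_cross iu iv hm mu mv.
exact: incident_cross iu' iv' hm mu' mv'.
Qed.

Variable D : nat.
Hypothesis hD : forall c : cell K, (cdim c <= D)%N.

Lemma mid_incident b x : HS b -> fa b x = 1 / 2%:R ->
  exists2 u, incident b u & mdist x (sval u) <= D%:R.
Proof.
move=> hb e; have [[i [s [d _]]]|[_ e1]|[_ e1]] := fa_casesP x hb; last 2 first.
- by exfalso; rewrite e1 in e; lra.
- by exfalso; rewrite e1 in e; lra.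
pose w : {ffun 'I_(cdim (car K x)) -> bool} := [ffun => ~~ s].
exists (cv w); last by apply: le_trans (mdist_corner HX w) _; rewrite ler_nat.
exists (edge w i); first exact: srcE.
by apply: (dirn_hs hb d); rewrite ffunE.
Qed.

(** The vertices [v n] and [v n.+1] mark a place where the strip has bounded width. By [strip_dist]
    a crossing at distance [l] from that place is long in proportion to [l]; the terms with [D] pay
    for moving [p] and [q] to vertices and for comparing the two distances. *)
Lemma strip_cost n p q (v : nat -> vtx S) (E0 l : R) :
  (forall n, incident (H n) (v n)) ->
  (forall n, mdist (sval (v n.+1)) (sval (v n)) ^+ 2 <= E0) ->
  fa (H n) p = 1 / 2%:R -> fa (H n.+1) q = 1 / 2%:R ->
  l <= mdist p (sval (v n)) ->
  l - D%:R - E0 <= D%:R * (mdist p q + 2%:R * D%:R).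
Proof.
move=> hv hE hp hq hl; have HH k : HS (H k) by exact: skew_HS.
have [u iu du] := mid_incident (HH n) hp; have [u' iu' du'] := mid_incident (HH n.+1) hq.
have h1 := strip_dist iu (hv n) iu' (hv n.+1).
have h2 : (dist u (v n))%:R <= (dist (v n.+1) (v n))%:R + (dist u u')%:R :> R.
  by rewrite -natrD ler_nat.
have h3 := dist_lin u u' hD; have h4 := dist_sq (v n.+1) (v n).
have h5 := mdist_vert u (v n); have h6 := hE n.
have h7 := metric_triangle p (sval u) (sval (v n)).
have h8 : mdist (sval u) (sval u') <= mdist p q + 2%:R * D%:R.
  apply: le_trans (metric_triangle _ p _) _.
  apply: le_trans (lerD (lexx _) (metric_triangle _ q _)) _.
  by rewrite (metric_sym (sval u)); lra.
have h9 : D%:R * mdist (sval u) (sval u') <= D%:R * (mdist p q + 2%:R * D%:R).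
  by apply: ler_wpM2l.
by lra.
Qed.

(** The detour is the tent [y] from [c (- l)] over height [l] down to [c l]. It is 2-Lipschitz and
    stays at distance at least [l / 2] from [c 0], while the wall functions [H n] with [n <= N]
    climb from 0 to 1 along it. *)
Lemma no_half_plane (c : R -> X) : is_axis (rho g0) c -> ~ bounds_flat_half_plane c.
Proof.
move=> [hgeo [tau tau0 hax]] [F [hF Fc]].
have iterc n t : rho (g0 ^+ n)%g (c t) = c (t + n%:R * tau).
  rewrite rho_exp; elim: n => [|n IH]; first by rewrite mul0r addr0.
  by rewrite iterS IH hax -natr1 mulrDl mul1r addrA.
have [e0 ea] := ha; pose v n : vtx S := rv (g0 ^+ n)%g (src e0).
have hv n : incident (H n) (v n).
  by exists (re (g0 ^+ n)%g e0); [exact: src_re|rewrite hsre -ea].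
pose d1 := mdist (sval (v 1%N)) (sval (v 0%N)).
have v1 n : sval (v n) = rho (g0 ^+ n)%g (sval (src e0)) by [].
have dS n : mdist (sval (v n.+1)) (sval (v n)) = d1.
  case: Hact => h1 h2.
  by rewrite /d1 !v1 expg1 expg0 h1 expgSr h2 rho_dist.
have d10 : 0 <= d1 by exact: mdist_ge0.
pose E0 := d1 ^+ 2; have hE n : mdist (sval (v n.+1)) (sval (v n)) ^+ 2 <= E0 by rewrite dS.
(* Up to constants each strip costs [l / 2], while the whole tent provides at most [4 * D * l]. With
   [8 * D + 2] strips the cost exceeds this by [l - N * C2]. *)
pose N := (8 * D + 2)%N; pose C1 := mdist (c 0) (sval (v 0%N)) + N%:R * d1.
have dv n : (n <= N)%N -> mdist (c 0) (sval (v n)) <= C1.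
  move=> hn; have : mdist (c 0) (sval (v n)) <= mdist (c 0) (sval (v 0%N)) + n%:R * d1.
    elim: n {hn} => [|n IH]; first by rewrite mul0r addr0.
    apply: le_trans (metric_triangle _ (sval (v n)) _) _.
    by rewrite (metric_sym (sval (v n))) dS -natr1 mulrDl mul1r addrA; apply: lerD.
  move=> h; apply: le_trans h _; rewrite lerD2l; apply: ler_wpM2r => //.
  by rewrite ler_nat.
have [k1 hk1] := skew_fa_out ha sub_ga ne_ga (c 0).
have [k2 hk2] := skew_fa_in (c 0).
pose C2 := D%:R + C1 + E0 + 2%:R * D%:R * D%:R.
pose k3 := Num.bound (`|N%:R * C2 / tau|).
have hk3 : N%:R * C2 < k3%:R * tau.
  rewrite -ltr_pdivrMr //; apply: le_lt_trans (ler_norm _) _.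
  exact: archi_boundP.
(* [k1] makes the walls vanish at [c (- l)], [k2 + N] makes them equal to 1 at [c l], and [k3] makes
   [l] larger than [N * C2]. *)
pose k := (k1 + (k2 + N) + k3)%N; pose l : R := k%:R * tau.
have l0 : 0 <= l by rewrite mulr_ge0 // ltW.
have hl : N%:R * C2 < l.
  apply: lt_le_trans hk3 _; rewrite /l; apply: ler_wpM2r; first exact: ltW.
  by rewrite ler_nat /k leq_addl.
pose y (t : R) := F (t, l - `|t|).
have rng t : - l <= t <= l -> 0 <= (t, l - `|t|).2 by rewrite /= subr_ge0 ler_norml.
have fa_lo n : fa (H n) (y (- l)) = 0.
  have -> : y (- l) = c (- l) by rewrite /y normrN ger0_norm // subrr Fc.
  apply/eqP; rewrite eq_le; apply/andP; split; last by have /andP[] := fa01 (c (- l)) (skew_HS g0 ha n).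
  have -> : 0 = fa a (c (- l)).
    rewrite -(fa_ga (g0 ^+ k)%g _ ha) iterc -/l addNr hk1 //.
    by rewrite /k -addnA leq_addr.
  apply: fa_mono => //; first exact: skew_HS.
  have := skew_le sub_ga (leq0n n); rewrite expg0 ga1 //; exact: rv1.
have fa_hi n : (n <= N)%N -> fa (H n) (y l) = 1.
  move=> hn; have -> : y l = c l by rewrite /y ger0_norm // subrr Fc.
  have -> : c l = rho (g0 ^+ k)%g (c 0) by rewrite iterc add0r.
  have -> : H n = ga rv (g0 ^+ k)%g (L (k - n)).
    rewrite /L -gaM; last exact: rvM.
    have nk : (n <= k)%N by rewrite /k; lia.
    have -> // : (g0 ^+ k * g0^-1 ^+ (k - n) = g0 ^+ n)%g.
    by rewrite -{1}(subnKC nk) expgnDr -mulgA expVgn mulgV mulg1.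
  rewrite fa_ga; last exact: HSga.
  by apply: hk2; rewrite /k; lia.
have ylip s t : - l <= s <= l -> - l <= t <= l -> mdist (y s) (y t) <= 2%:R * `|s - t|.
  move=> hs ht; rewrite hF; try exact: rng.
  rewrite -(ler_pXn2r (n := 2)) ?nnegrE ?sqrtr_ge0 ?mulr_ge0 // sqr_sqrtr; last first.
    by rewrite addr_ge0 // sqr_ge0.
  rewrite /= exprMn real_normK ?num_real //.
  have h : (l - `|s| - (l - `|t|)) ^+ 2 <= (s - t) ^+ 2.
    rewrite -[leRHS]real_normK ?num_real // -[leLHS]real_normK ?num_real //.
    rewrite ler_pXn2r ?nnegrE //.
    have -> : l - `|s| - (l - `|t|) = `|t| - `|s| by ring.
    by rewrite distrC; exact: ler_dist_dist.
  by have := sqr_ge0 (s - t); nra.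
have yfar t : - l <= t <= l -> l / 2%:R <= mdist (y t) (c 0).
  move=> ht; have ht2 := rng t ht; rewrite /= in ht2.
  rewrite -Fc hF ?lexx //=.
  rewrite -(ler_pXn2r (n := 2)) ?nnegrE ?sqrtr_ge0 ?divr_ge0 // sqr_sqrtr; last first.
    by rewrite addr_ge0 // sqr_ge0.
  rewrite !subr0; have : `|t| ^+ 2 = t ^+ 2 by rewrite real_normK ?num_real.
  move <-; set z := `|t|; have := sqr_ge0 (z - l / 2%:R); have := sqr_ge0 l; lra.
have find n s : (n <= N)%N -> - l <= s <= l -> fa (H n) (y s) <= 1 / 2%:R ->
    exists2 t, s <= t <= l & fa (H n) (y t) = 1 / 2%:R.
  move=> hn hs hle; have /andP[hs1 hs2] := hs.
  apply: (@ivt_lip R (fun t => fa (H n) (y t)) 2%:R s l) => //.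
    move=> r t /andP[r1 r2] /andP[t1 t2]; apply: le_trans (mdist_fa _ _ (skew_HS g0 ha n)) _.
    by apply: ylip; apply/andP; split=> //; exact: le_trans hs1 _.
  by rewrite hle fa_hi //; lra.
have C20 : 0 <= D%:R :> R by [].
(* The walls are nested, so their midpoints are met in order along the tent and the costs of the
   strips add up. *)
have main n : (n <= N)%N -> exists t, [/\ - l <= t <= l, fa (H n) (y t) = 1 / 2%:R &
    n%:R * (l / 2%:R - C2) <= D%:R * (2%:R * (t + l))].
  elim: n => [_|n IH hn].
    have [|||t ht e] := find 0%N (- l) => //; first by rewrite lexx; lra.
      by rewrite fa_lo; lra.
    exists t; split=> //; rewrite mul0r mulr_ge0 // mulr_ge0 //.
    by move: ht => /andP[h _]; lra.
  have [t [ht e hc]] := IH (ltnW hn).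
  have [|||s hs e'] := find n.+1 t => //.
    rewrite -e; apply: fa_mono; try exact: skew_HS.
    exact: skew_le.
  have hs' : - l <= s <= l by move: ht hs => /andP[a1 _] /andP[a2 a3]; apply/andP; split=> //; lra.
  exists s; split=> //.
  have hl2 : l / 2%:R - C1 <= mdist (y t) (sval (v n)).
    have := yfar t ht; have := dv n (ltnW hn).
    have := metric_triangle (y t) (sval (v n)) (c 0); rewrite (metric_sym (sval (v n))); lra.
  have := strip_cost hv hE e e' hl2; have := ylip t s ht hs'.
  rewrite distrC ger0_norm; last by move: hs => /andP[h _]; lra.
  move=> h1 h2.
  have h3 : D%:R * mdist (y t) (y s) <= D%:R * (2%:R * (s - t)) by apply: ler_wpM2l.
  rewrite -natr1 mulrDl mul1r /C2; move: hc; rewrite /C2; lra.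
have [t [/andP[_ ht] _ hc]] := main N (leqnn N).
have h4 : D%:R * (2%:R * (t + l)) <= D%:R * (4%:R * l) by apply: ler_wpM2l => //; lra.
have eN : N%:R = 8%:R * D%:R + 2%:R :> R by rewrite /N natrD natrM.
move: hc hl; rewrite eN mulrBr; nra.
Qed.

Lemma skewers_rank_one : rank_one (rho g0).
Proof.
split; last exact: no_half_plane.
split; first exact: rho_isometry.
have [x hx] := min_displacement g0; exists x; split=> //.
rewrite lt_neqAle mdist_ge0 andbT; apply/eqP => /esym/mdist_positivity e.
exact: (no_fixpoint (x := x)).
Qed.

End RankOne.

Lemma irreducible_rank_one : irreducible -> exists g, rank_one (rho g).
Proof.
move=> /irreducible_skewers[g0 [a [ha h1 h2 h3]]]; have [D [_ hD]] := uniform_degree.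
by exists g0; exact: (skewers_rank_one ha h1 h2 h3 hD).
Qed.

End Cocompact.

End Action.

(** * Products *)

Section Product.
Variables (R : realType) (X : metricType R) (K : cube_complex R X).
Hypothesis HX : CAT0_cube_complex K.
Let S := cell_csqc HX.
Let hlm := cat0_length HX.
Implicit Types (a : set (vtx S)) (c d : cell K).
Hypothesis Hlc : locally_compact [set: X].

Lemma hs_same a (f : edg S) : HS a -> a <> hs f -> a <> ~` hs f -> a (tgt f) <-> a (src f).
Proof.
move=> ha n1 n2; split=> h; apply: contrapT => h'.
  by apply: n1; apply/esym; exact: HS_in.
by apply: n2; rewrite (HS_out ha h h') setCK.
Qed.

(** Used with each of the two classes in turn, to check that a point assembled in the cube of a join
    has the prescribed wall functions. *)
Lemma fa_transfer (P : set (set (vtx S))) c (w : {ffun 'I_(cdim c) -> bool}) u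
    c3 (w3 : {ffun 'I_(cdim c3) -> bool}) t :
  (forall a, P a -> HS a) -> (forall a, P a -> P (~` a)) -> cube u -> unit_box t ->
  (forall a, P a -> a (cv w3) <-> a (cv w)) ->
  (forall i, P (hs (S := S) (edge w i)) -> exists l, hs (S := S) (edge w3 l) = hs (S := S) (edge w i)) ->
  (forall l, P (hs (S := S) (edge w3 l)) -> t l = fa (hs (S := S) (edge w3 l)) (chi c u)) ->
  forall a, P a -> fa a (chi c3 (cpt w3 t)) = fa a (chi c u).
Proof.
move=> hP PC hu ht hj hi hl a Pa; have ha := hP a Pa; have ct := (cube_cpt w3 t).2 ht.
have hE c0 (w0 : {ffun 'I_(cdim c0) -> bool}) i : HS (hs (S := S) (edge w0 i)) by exists (edge w0 i).
have val l : fa (hs (S := S) (edge w3 l)) (chi c3 (cpt w3 t)) = t l.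
  rewrite (fa_dir (hE _ w3 l) ct (dirn_edge HX w3 l)) cptE.
  by case: (w3 l) => //=; rewrite opprB addrC subrK.
have nodir : (forall l b, ~ @dirn _ _ _ HX a c3 l b) -> forall i b, ~ @dirn _ _ _ HX a c i b.
  move=> hn i b d; have e : a = hs (S := S) (edge w i) \/ a = ~` hs (S := S) (edge w i).
    have d' := dirn_edge HX w i; have [eb|eb] : b = ~~ w i \/ b = ~~ ~~ w i.
      by case: (b); case: (w i); auto.
      by left; rewrite eb in d; exact: dirn_uniq d d'.
    right; rewrite eb in d; apply: dirn_uniq d (dirnC d') => //; apply: HSC; exact: hE.
  have [|l hl'] := hi i.
    by case: e => e; [rewrite -e|rewrite -[hs _]setCK -e; exact: PC].
  case: e => e; have d3 := dirn_edge HX w3 l; rewrite hl' in d3.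
    by apply: (hn l (~~ w3 l)); rewrite e.
  by apply: (hn l (~~ ~~ w3 l)); rewrite e; exact: dirnC.
have [[l [b d]]|h|h] := @cell_cases _ _ _ HX a c3 ha.
- have d3 := dirn_edge HX w3 l; have [eb|eb] : b = ~~ w3 l \/ b = ~~ ~~ w3 l.
    by case: (b); case: (w3 l); auto.
    rewrite eb in d; have e := dirn_uniq ha (hE _ w3 l) d d3.
    by rewrite e val hl // -e.
  rewrite eb in d; have e := dirn_uniq ha (HSC (hE _ w3 l)) d (dirnC d3).
  rewrite e !faC ?val ?hl //; rewrite -[hs _]setCK -e; exact: PC.
- rewrite (fa_in ha ct h); have [[i [b d]]|h'|h'] := @cell_cases _ _ _ HX a c ha.
  + exfalso; apply: (nodir _ i b d) => l b' d'.
    by have [_ [v]] := dirn_both d'; apply.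
  + by rewrite (fa_in ha hu h').
  + by case: (h' w); apply/hj.
- rewrite (fa_out ha ct h); have [[i [b d]]|h'|h'] := @cell_cases _ _ _ HX a c ha.
  + exfalso; apply: (nodir _ i b d) => l b' d'.
    by have [[v /h]] := dirn_both d'.
  + by case: (h w3); apply/hj.
  + by rewrite (fa_out ha hu h').
Qed.

(** * Joining points along two classes of halfspaces crossing each other *)

Section Partition.
Variables P1 P2 : set (set (vtx S)).
Hypothesis hP1 : forall a, P1 a -> HS a.
Hypothesis hP2 : forall a, P2 a -> HS a.
Hypothesis hP : forall a, HS a -> P1 a \/ P2 a.
Hypothesis hcr : forall a b, P1 a -> P2 b -> cross a b.

Lemma P1C a : P1 a -> P1 (~` a).
Proof.
move=> h; case: (hP (HSC (hP1 h))) => // h2.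
by case: (@cross_irrC _ a (hcr h h2)).
Qed.

Lemma P2C a : P2 a -> P2 (~` a).
Proof.
move=> h; case: (hP (HSC (hP2 h))) => // h1.
by case: (@cross_irrC _ a (cross_sym (hcr h1 h))).
Qed.

Lemma P12 a : P1 a -> ~ P2 a.
Proof. by move=> h1 h2; case: (@cross_irr _ a (hcr h1 h2)). Qed.

(** Go back along a path from [v] to [u], starting with [j] at [u]. Edges of [P1] leave [j] in
    place. An edge of [P2] is repeated at [j]: the hyperplanes between the path and [j] are all in
    [P1], so [transport] carries it there. *)
Lemma vertex_join (u v : vtx S) : exists j, (forall a, P1 a -> a j <-> a u) /\
  (forall a, P2 a -> a j <-> a v).
Proof.
have [p hp] := csqc_conn v u; elim: p v hp => [|e p IH] v /=.
  by move=> ->; exists u.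
move=> [es /IH[j [h1 h2]]]; rewrite -es.
have hH : HS (hs e) by exists e.
case: (hP hH) => he.
  exists j; split=> // b Pb; rewrite h2 //; apply: hs_same; first exact: hP2.
    by move=> E; apply: (P12 he); rewrite -E.
  by move=> E; apply: (P12 (P1C he)); rewrite -E.
have ho : hs (opp e) = ~` hs e by exact: hs_opp.
have [|e' se' he'] := @transport S (opp e) (tgt e) j (src_opp e).
  move=> a ha a1 a2; rewrite ho; case: (hP ha) => Pa; last by case: a2; apply/h2.
  by apply: cross_sym; apply: hcr => //; exact: P2C.
have P2' : P2 (hs e') by rewrite he' ho; exact: P2C.
have st a : HS a -> a <> hs e -> a <> ~` hs e ->
    (a (tgt e') <-> a j) /\ (a (tgt e) <-> a (src e)).
  move=> ha n1 n2; split; last exact: hs_same.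
  by rewrite -se'; apply: hs_same => //; rewrite he' ho ?setCK.
have te' : ~ hs e (tgt e') by have := hs_tgt e'; rewrite he' ho.
have se := @hs_src S e.
exists (tgt e'); split=> a Pa.
  have [-> _] := st a (hP1 Pa) (fun E => P12 Pa (eq_ind_r P2 he E))
     (fun E => P12 Pa (eq_ind_r P2 (P2C he) E)).
  exact: h1.
have [->|n1] := pselect (a = hs e); first by split.
have [->|n2] := pselect (a = ~` hs e); first by split.
by have [-> <-] := st a (hP2 Pa) n1 n2; exact: h2.
Qed.

(** The cube spanned at the joined corner by the [P1] directions of [w] and the [P2] directions of
    [w'], described through its halfspaces. *)
Definition join_cell c (w : {ffun 'I_(cdim c) -> bool}) d (w' : {ffun 'I_(cdim d) -> bool})
    c3 (w3 : {ffun 'I_(cdim c3) -> bool}) :=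
  [/\ forall a, P1 a -> a (cv w3) <-> a (cv w),
      forall a, P2 a -> a (cv w3) <-> a (cv w'),
      forall i, P1 (hs (S := S) (edge w i)) -> exists l, hs (S := S) (edge w3 l) = hs (S := S) (edge w i),
      forall i, P2 (hs (S := S) (edge w' i)) -> exists l, hs (S := S) (edge w3 l) = hs (S := S) (edge w' i) &
      forall l, (P1 (hs (S := S) (edge w3 l)) /\ exists i, hs (S := S) (edge w3 l) = hs (S := S) (edge w i)) \/
        (P2 (hs (S := S) (edge w3 l)) /\ exists i, hs (S := S) (edge w3 l) = hs (S := S) (edge w' i))].

(** The edges of the two corners, transported to the joined vertex, have pairwise crossing
    hyperplanes and so span squares; flagness fills them with one cube. *)
Lemma join_cell_ex c w d w' : exists c3 w3, @join_cell c w d w' c3 w3.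
Proof.
have [j [j1 j2]] := vertex_join (cv w) (cv w'); have [l0 hl0] := finite_degree Hlc j.
pose C (e : edg S) := src e = j /\ ((P1 (hs e) /\ exists i, hs e = hs (S := S) (edge w i)) \/
  (P2 (hs e) /\ exists i, hs e = hs (S := S) (edge w' i))).
have [L [_ hL']] := @list_filter (edg S) C l0 (fun e he => hl0 e he.1).
have crc c0 (w0 : {ffun 'I_(cdim c0) -> bool}) i k : i != k ->
    cross (hs (S := S) (edge w0 i)) (hs (S := S) (edge w0 k)).
  by move=> ne; apply: (sq_cross (S := S)); exact: (esq_edge w0 ne).
have crossL e x : C e -> C x -> e <> x -> cross (hs e) (hs x).
  move=> [se he] [sx hx] ne.
  have ne' : hs e <> hs x by move=> E; apply: ne; apply: hs_src_inj; rewrite ?se ?sx.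
  case: he hx => [[p1 [i ei]]|[p1 [i ei]]] [[p2 [k ek]]|[p2 [k ek]]].
  - by rewrite ei ek; apply: crc; apply/eqP => E; apply: ne'; rewrite ei ek E.
  - exact: hcr.
  - by apply: cross_sym; exact: hcr.
  - by rewrite ei ek; apply: crc; apply/eqP => E; apply: ne'; rewrite ei ek E.
have [c3 [w3 [e3 h3]]] : exists c w0, cv w0 = j /\
    forall f, List.In f L <-> exists i, f = @edge _ _ K c w0 i.
  apply: (clique_corner (cat0_flag HX)) => [e /hL'[]//|e x /hL' he /hL' hx ne].
  have [[v [v1 v2]] _ _ _] := crossL e x he hx ne.
  by apply: (adj_sq (S := S) (v := v)) => //; case: he => ->; case: hx => ->.
exists c3, w3; split.
- by rewrite e3.
- by rewrite e3.
- move=> i Pi; have [|e' se' he'] := @transport S (edge w i) (cv w) j (srcE HX w i).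
    move=> a ha a1 a2; have [Pa|Pa] := hP ha; first by case: a2; apply/j1.
    exact: hcr.
  have /h3[l el] : List.In e' L.
    by apply/hL'; split=> //; left; rewrite he'; split=> //; exists i.
  by exists l; rewrite -el.
- move=> i Pi; have [|e' se' he'] := @transport S (edge w' i) (cv w') j (srcE HX w' i).
    move=> a ha a1 a2; have [Pa|Pa] := hP ha; last by case: a2; apply/j2.
    by apply: cross_sym; exact: hcr.
  have /h3[l el] : List.In e' L.
    by apply/hL'; split=> //; right; rewrite he'; split=> //; exists i.
  by exists l; rewrite -el.
- move=> l; have /hL'[_ h] : List.In (edge w3 l) L by apply/h3; exists l.
  exact: h.
Qed.

Definition join_off c3 (w3 : {ffun 'I_(cdim c3) -> bool}) (y z : X) l : R :=
  if pselect (P1 (hs (S := S) (edge w3 l))) then fa (hs (S := S) (edge w3 l)) y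
  else fa (hs (S := S) (edge w3 l)) z.

Lemma join_off_box c3 w3 y z : unit_box (@join_off c3 w3 y z).
Proof. by move=> l; rewrite /join_off; case: (pselect _) => h; apply: fa01; exists (edge w3 l). Qed.

Definition is_join (y z x : X) := (forall a, P1 a -> fa a x = fa a y) /\
  (forall a, P2 a -> fa a x = fa a z).

Lemma join_cell_join c w d w' c3 w3 u v : @join_cell c w d w' c3 w3 -> cube u -> cube v ->
  is_join (chi c u) (chi d v) (chi c3 (cpt w3 (join_off w3 (chi c u) (chi d v)))).
Proof.
move=> [k1 k2 k3 k4 k5] hu hv; have hb := join_off_box w3 (chi c u) (chi d v); split.
  apply: (fa_transfer (P := P1) (w := w)) => //; first exact: P1C.
  by move=> l h; rewrite /join_off; case: pselect.
apply: (fa_transfer (P := P2) (w := w')) => //; first exact: P2C.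
by move=> l h; rewrite /join_off; case: pselect => // h'; case: (P12 h' h).
Qed.

Lemma join_ex y z : exists x, is_join y z x.
Proof.
pose w x : {ffun 'I_(cdim (car K x)) -> bool} := [ffun => false].
have [c3 [w3 h]] := join_cell_ex (w y) (w z).
have := join_cell_join h (carp_cube K y) (carp_cube K z); rewrite !chi_carp => h'.
by eexists; exact: h'.
Qed.

Definition J y z : X := projT1 (cid (join_ex y z)).

Lemma JP y z : is_join y z (J y z).
Proof. by rewrite /J; case: cid. Qed.

Lemma join_uniq y z x x' : is_join y z x -> is_join y z x' -> x = x'.
Proof.
move=> [h1 h2] [h1' h2']; apply: (fa_sep (HX := HX)) => a ha.
by case: (hP ha) => Pa; [rewrite h1 // h1'|rewrite h2 // h2'].
Qed.

Lemma J_cell c w d w' c3 w3 u v : @join_cell c w d w' c3 w3 -> cube u -> cube v ->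
  J (chi c u) (chi d v) = chi c3 (cpt w3 (join_off w3 (chi c u) (chi d v))).
Proof. by move=> h hu hv; apply: join_uniq (JP _ _) _; exact: join_cell_join h hu hv. Qed.

Lemma corner_walls c3 (w3 : {ffun 'I_(cdim c3) -> bool}) :
  walls (HX := HX) (fun l => hs (S := S) (edge w3 l)).
Proof.
split=> [l|l k ne]; first by exists (edge w3 l).
have d := dirn_edge HX w3 l; have d' := dirn_edge HX w3 k.
split=> e; apply: ne; rewrite e in d; first exact: dirn_inj d d'.
by move/dirnC: d; rewrite setCK => d; exact: dirn_inj d d'.
Qed.

Lemma J_segment c d u u' v v' : cube u -> cube u' -> cube v -> cube v' ->
  mdist (J (chi c u) (chi d v)) (J (chi c u') (chi d v')) ^+ 2 <=
    @euclid_dist R (cdim c) u u' ^+ 2 + @euclid_dist R (cdim d) v v' ^+ 2.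
Proof.
move=> hu hu' hv hv'.
pose w (x : cell K) : {ffun 'I_(cdim x) -> bool} := [ffun => false].
have [c3 [w3 h]] := join_cell_ex (w c) (w d).
rewrite !(J_cell h) // (mdist_cell HX); try exact/cube_cpt/join_off_box.
rewrite {1}euclid_ed2 sqr_sqrtr ?ed2_ge0 // ed2_cpt.
have b1 : \sum_l (fa (hs (S := S) (edge w3 l)) (chi c u) - fa (hs (S := S) (edge w3 l)) (chi c u')) ^+ 2 <= euclid_dist u u' ^+ 2.
  by apply: le_trans (mdist_walls2 (corner_walls w3) _ _) _; rewrite (mdist_cell HX).
have b2 : \sum_l (fa (hs (S := S) (edge w3 l)) (chi d v) - fa (hs (S := S) (edge w3 l)) (chi d v')) ^+ 2 <= euclid_dist v v' ^+ 2.
  by apply: le_trans (mdist_walls2 (corner_walls w3) _ _) _; rewrite (mdist_cell HX).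
apply: le_trans (lerD b1 b2); rewrite -big_split /=; apply: ler_sum => l _.
by rewrite /join_off; case: (pselect _) => h0 /=; rewrite ?lerDl ?lerDr sqr_ge0.
Qed.

Definition hyp (p q : R) : R := Num.sqrt (p ^+ 2 + q ^+ 2).

Lemma hyp_ge0 p q : 0 <= hyp p q. Proof. exact: sqrtr_ge0. Qed.

Lemma hyp_sq p q : hyp p q ^+ 2 = p ^+ 2 + q ^+ 2.
Proof. by rewrite sqr_sqrtr // addr_ge0 // sqr_ge0. Qed.

Lemma hyp_nrm p q : hyp p q = nrm (fun b : bool => if b then p else q).
Proof. by rewrite /nrm big_bool. Qed.

Lemma hyp_le p q r : 0 <= r -> p ^+ 2 + q ^+ 2 <= r ^+ 2 -> hyp p q <= r.
Proof. by move=> r0 h; rewrite -(ler_pXn2r (n := 2)) ?nnegrE ?hyp_ge0 // hyp_sq. Qed.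

Lemma hyp_mono p q p' q' : 0 <= p <= p' -> 0 <= q <= q' -> hyp p q <= hyp p' q'.
Proof.
move=> /andP[a1 a2] /andP[b1 b2]; apply: hyp_le; first exact: hyp_ge0.
by rewrite hyp_sq; apply: lerD; rewrite ler_pXn2r ?nnegrE //; lra.
Qed.

Lemma hypD p q p' q' : hyp (p + p') (q + q') <= hyp p q + hyp p' q'.
Proof.
rewrite !hyp_nrm; apply: le_trans (nrmD _ _); rewrite le_eqVlt; apply/orP; left.
by apply/eqP/eq_nrm => -[].
Qed.

Lemma hypM p q t : 0 <= t -> hyp (p * t) (q * t) = hyp p q * t.
Proof.
move=> t0; apply/eqP; rewrite -(@eqrXn2 _ 2) ?hyp_ge0 ?mulr_ge0 ?hyp_ge0 //.
by rewrite exprMn !hyp_sq; apply/eqP; ring.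
Qed.

Lemma hyp0 q : 0 <= q -> hyp 0 q = q.
Proof. by move=> h; rewrite /hyp expr0n add0r sqrtr_sqr ger0_norm. Qed.

Lemma hyp0r p : 0 <= p -> hyp p 0 = p.
Proof. by move=> h; rewrite /hyp expr0n addr0 sqrtr_sqr ger0_norm. Qed.

Lemma J_segment_hyp c d u u' v v' : cube u -> cube u' -> cube v -> cube v' ->
  mdist (J (chi c u) (chi d v)) (J (chi c u') (chi d v')) <=
    hyp (@euclid_dist R (cdim c) u u') (@euclid_dist R (cdim d) v v').
Proof.
move=> hu hu' hv hv'; rewrite -(ler_pXn2r (n := 2)) ?nnegrE ?hyp_ge0 ?mdist_ge0 //.
by rewrite hyp_sq; exact: J_segment.
Qed.

Lemma cell_pt z : exists c (v : 'rV[R]_(cdim c)), cube v /\ chi (K := K) c v = z.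
Proof. by exists (car K z), (carp K z); split; [exact: carp_cube|exact: chi_carp]. Qed.

Lemma J_right s y z z' : is_string (K := K) z s z' -> mdist (J y z) (J y z') <= string_length s.
Proof.
have [d [u [hu <-]]] := cell_pt y.
elim: s z => [|[c [v v']] s IH] z /=.
  by move=> ->; rewrite mdistxx string_len_ge0.
move=> [hv hv' <- /IH h]; rewrite /string_length big_cons /= -/(string_length s).
apply: le_trans (metric_triangle _ (J (chi d u) (chi c v')) _) (lerD _ h).
by have := J_segment_hyp hu hu hv hv'; rewrite euclid_refl hyp0 ?euclid_ge0.
Qed.

Lemma J_left s y y' z : is_string (K := K) y s y' -> mdist (J y z) (J y' z) <= string_length s.
Proof.
have [d [v [hv <-]]] := cell_pt z.
elim: s y => [|[c [u u']] s IH] y /=.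
  by move=> ->; rewrite mdistxx string_len_ge0.
move=> [hu hu' <- /IH h]; rewrite /string_length big_cons /= -/(string_length s).
apply: le_trans (metric_triangle _ (J (chi c u') (chi d v)) _) (lerD _ h).
by have := J_segment_hyp hu hu' hv hv; rewrite euclid_refl hyp0r ?euclid_ge0.
Qed.

Definition at_frac n (u v : 'rV[R]_n) (r : R) : 'rV[R]_n := \row_i (u 0 i + r * (v 0 i - u 0 i)).

Lemma at_frac_cube n (u v : 'rV[R]_n) r : 0 <= r <= 1 -> cube u -> cube v -> cube (at_frac u v r).
Proof.
move=> hr hu hv i; rewrite mxE; have /andP[a1 a2] := hu i; have /andP[b1 b2] := hv i.
by rewrite conv_le // conv_ge.
Qed.

Lemma at_frac_l n (u v : 'rV[R]_n) r : 0 <= r -> euclid_dist u (at_frac u v r) = r * euclid_dist u v.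
Proof.
move=> r0; apply/eqP; rewrite -(@eqrXn2 _ 2) ?euclid_ge0 ?mulr_ge0 ?euclid_ge0 //.
rewrite exprMn !euclid_nrm !nrm_sq mulr_sumr; apply/eqP/eq_bigr => i _.
by rewrite mxE; ring.
Qed.

Lemma at_frac_r n (u v : 'rV[R]_n) r : r <= 1 ->
  euclid_dist (at_frac u v r) v = (1 - r) * euclid_dist u v.
Proof.
move=> r1; apply/eqP; rewrite -(@eqrXn2 _ 2) ?euclid_ge0 ?mulr_ge0 ?euclid_ge0 ?subr_ge0 //.
rewrite exprMn !euclid_nrm !nrm_sq mulr_sumr; apply/eqP/eq_bigr => i _.
by rewrite mxE; ring.
Qed.

(* Run along both strings at the constant speeds [p] and [q]: while both stay in
   one cell the join moves in a single cube, at speed [hyp p q]. *)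
Lemma J_strings n s s' y y' z z' p q T : (size s + size s' <= n)%N ->
  is_string (K := K) y s y' -> is_string (K := K) z s' z' ->
  0 < p -> 0 < q -> string_length s = p * T -> string_length s' = q * T ->
  mdist (J y z) (J y' z') <= hyp p q * T.
Proof.
elim: n s s' y z T => [|n IH] s s' y z T.
  case: s => [|? ?] //; case: s' => [|? ?] // _ /= -> -> p0 q0.
  rewrite mdistxx /string_length big_nil => /esym/eqP; rewrite mulf_eq0 gt_eqF //= => /eqP -> _.
  by rewrite mulr0.
case: s => [|[c [u u']] s].
  move=> _ /= -> hs' p0 q0; rewrite /string_length big_nil => /esym/eqP.
  rewrite mulf_eq0 gt_eqF //= => /eqP -> e.
  by apply: le_trans (J_right _ hs') _; rewrite /string_length e !mulr0.
case: s' => [|[d [v v']] s'].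
  move=> _ hs /= -> p0 q0 e; rewrite /string_length big_nil => /esym/eqP.
  rewrite mulf_eq0 (gt_eqF q0) /= => /eqP T0.
  by apply: le_trans (J_left _ hs) _; rewrite e T0 !mulr0.
move=> hn hs hs' p0 q0 l1 l2; have := hs; have := hs'.
move=> /= [hv hv' ev hs1'] [hu hu' eu hs1].
have e1 : string_length s = p * T - euclid_dist u u'.
  by rewrite -l1 /string_length big_cons /= addrC addKr.
have e2 : string_length s' = q * T - euclid_dist v v'.
  by rewrite -l2 /string_length big_cons /= addrC addKr.
set al := euclid_dist u u' in e1; set be := euclid_dist v v' in e2.
have al0 : 0 <= al by exact: euclid_ge0.
have be0 : 0 <= be by exact: euclid_ge0.
have sz1 := string_len_ge0 s; have sz2 := string_len_ge0 s'.
have pn : p != 0 by rewrite gt_eqF.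
have qn : q != 0 by rewrite gt_eqF.
have [hle|hle] := leP (al * q) (be * p).
- pose tau := al / p; pose r := q * tau / be.
  have tau0 : 0 <= tau by rewrite divr_ge0 // ltW.
  have ea : al = p * tau by rewrite /tau mulrC divfK.
  have rbe : r * be = q * tau.
    have [b0|bn] := eqVneq be 0; last by rewrite /r divfK.
    have : al * q <= 0 by move: hle; rewrite b0 mul0r.
    rewrite pmulr_lle0 // => al1; have a0 : al = 0 by apply/eqP; rewrite eq_le al1.
    by rewrite b0 /tau a0 mul0r !mulr0.
  have r01 : 0 <= r <= 1.
    rewrite /r divr_ge0 ?mulr_ge0 ?invr_ge0 ?(ltW q0) ?(ltW p0) //=.
    have [b0|bn] := eqVneq be 0; first by rewrite b0 invr0 mulr0.
    have bp : 0 < be by rewrite lt_neqAle eq_sym bn.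
    by rewrite ler_pdivrMr // mul1r /tau mulrA ler_pdivrMr // mulrC.
  pose m := at_frac v v' r; have hm : cube m := at_frac_cube r01 hv hv'.
  have h1 : mdist (J y z) (J (chi c u') (chi d m)) <= hyp p q * tau.
    rewrite -eu -ev; apply: le_trans (J_segment_hyp hu hu' hv hm) _.
    have /andP[r0 _] := r01.
    by rewrite -hypM // -ea -rbe /m at_frac_l.
  apply: le_trans (metric_triangle _ (J (chi c u') (chi d m)) _) _.
  have -> : hyp p q * T = hyp p q * tau + hyp p q * (T - tau) by ring.
  apply: lerD h1 _; apply: (IH s (existT _ d (m, v') :: s')) => //.
  - by rewrite e1 ea; ring.
  - have /andP[_ r1] := r01; rewrite /string_length big_cons /= -/(string_length s') e2 at_frac_r //.
    by rewrite -/be mulrBl rbe; ring.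
- pose tau := be / q; pose r := p * tau / al.
  have al1 : 0 < al.
    rewrite lt_neqAle al0 andbT; apply/eqP => e; move: hle; rewrite -e mul0r.
    by rewrite ltNge mulr_ge0 // ltW.
  have tau0 : 0 <= tau by rewrite divr_ge0 // ltW.
  have eb : be = q * tau by rewrite /tau mulrC divfK.
  have ral : r * al = p * tau by rewrite /r divfK // gt_eqF.
  have r01 : 0 <= r <= 1.
    rewrite /r divr_ge0 ?mulr_ge0 ?invr_ge0 ?(ltW q0) ?(ltW p0) //=.
    rewrite ler_pdivrMr // mul1r /tau mulrA ler_pdivrMr // mulrC; exact: ltW.
  pose m := at_frac u u' r; have hm : cube m := at_frac_cube r01 hu hu'.
  have h1 : mdist (J y z) (J (chi c m) (chi d v')) <= hyp p q * tau.
    rewrite -eu -ev; apply: le_trans (J_segment_hyp hu hm hv hv') _.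
    have /andP[r0 _] := r01.
    by rewrite -hypM // -eb -ral /m at_frac_l.
  apply: le_trans (metric_triangle _ (J (chi c m) (chi d v')) _) _.
  have -> : hyp p q * T = hyp p q * tau + hyp p q * (T - tau) by ring.
  apply: lerD h1 _; apply: (IH (existT _ c (m, u') :: s) s') => //.
  - by move: hn; rewrite /= !addSn !addnS.
  - have /andP[_ r1] := r01; rewrite /string_length big_cons /= -/(string_length s) e1 at_frac_r //.
    by rewrite -/al mulrBl ral; ring.
  - by rewrite e2 eb; ring.
Qed.

Lemma J_upper y y' z z' : mdist (J y z) (J y' z') <= hyp (mdist y y') (mdist z z').
Proof.
apply/ler_addgt0Pr => e e0; pose h := e / 2%:R; have h0 : 0 < h by rewrite divr_gt0.
have st (x x' : X) : exists2 s, is_string (K := K) x s x' &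
    0 < string_length s + h /\ string_length s <= mdist x x' + h.
  have [|s hs hl] := @string_lt _ _ _ hlm x x' (mdist x x' + h); first by rewrite ltrDl.
  by exists s => //; split; [rewrite ltr_wpDl ?string_len_ge0|exact: ltW].
have [s hs [_ l1]] := st y y'; have [s' hs' [_ l2]] := st z z'.
have s0 := string_len_ge0 s; have s0' := string_len_ge0 s'.
have step : mdist (J y z) (J y' z') <= hyp (string_length s) (string_length s').
  have [e1|n1] := eqVneq (string_length s) 0.
    apply: le_trans (metric_triangle _ (J y' z) _) _.
    apply: le_trans (lerD (J_left z hs) (J_right y' hs')) _.
    by rewrite e1 add0r hyp0.
  have [e2|n2] := eqVneq (string_length s') 0.
    apply: le_trans (metric_triangle _ (J y' z) _) _.
    apply: le_trans (lerD (J_left z hs) (J_right y' hs')) _.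
    by rewrite e2 addr0 hyp0r.
  (* The lengths themselves serve as speeds over unit time; speeds must be positive, so strings of
     length 0 were treated apart. *)
  have := @J_strings _ s s' y y' z z' (string_length s) (string_length s') 1 (leqnn _) hs hs'.
  by rewrite !mulr1; apply=> //; rewrite lt_neqAle eq_sym ?n1 ?n2.
apply: le_trans step _.
apply: le_trans (hyp_mono (p' := mdist y y' + h) (q' := mdist z z' + h) _ _) _.
- by rewrite s0.
- by rewrite s0'.
apply: le_trans (hypD _ _ _ _) _; rewrite lerD2l; apply: hyp_le; first exact: ltW.
have -> : e = 2%:R * h by rewrite /h mulrC divfK // pnatr_eq0.
by have := sqr_ge0 h; move: (h) => k; lra.
Qed.

Lemma fa_off c (w : {ffun 'I_(cdim c) -> bool}) u l : cube u ->
  fa (hs (S := S) (edge w l)) (chi c u) = off w u l.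
Proof.
move=> hu; have hE : HS (hs (S := S) (edge w l)) by exists (edge w l).
by rewrite (fa_dir hE hu (dirn_edge HX w l)) /off; case: (w l).
Qed.

(** The segment is compared with the two perpendicular legs through [m], which has the [P1]
    coordinates of [u] and the [P2] coordinates of [u']. Each projection changes along one leg
    only. *)
Lemma J_lower_segment o c u u' : cube u -> cube u' ->
  hyp (mdist (J (chi c u) o) (J (chi c u') o)) (mdist (J o (chi c u)) (J o (chi c u'))) <=
    @euclid_dist R (cdim c) u u'.
Proof.
move=> hu hu'; pose w : {ffun 'I_(cdim c) -> bool} := [ffun => false].
have jc : join_cell w w w.
  split=> // [i Pi|i Pi|l]; [by exists i|by exists i|].
  have hE : HS (hs (S := S) (edge w l)) by exists (edge w l).
  by case: (hP hE) => h; [left|right]; split=> //; exists l.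
pose m := cpt w (join_off w (chi c u) (chi c u')).
have hm : cube m by exact/cube_cpt/join_off_box.
have em : chi c m = J (chi c u) (chi c u') by rewrite (J_cell jc).
have [j1 j2] := JP (chi c u) (chi c u'); rewrite -em in j1 j2.
have e1 : J (chi c u) o = J (chi c m) o.
  have [k1 k2] := JP (chi c m) o.
  by apply: join_uniq (JP _ _) _; split=> a Pa; [rewrite k1 // j1|rewrite k2].
have e2 : J o (chi c u') = J o (chi c m).
  have [k1 k2] := JP o (chi c m).
  by apply: join_uniq (JP _ _) _; split=> a Pa; [rewrite k1|rewrite k2 // j2].
have [d [v [hv ev]]] := cell_pt o.
have a1 : mdist (J (chi c m) o) (J (chi c u') o) <= euclid_dist m u'.
  by have := J_segment_hyp hm hu' hv hv; rewrite euclid_refl hyp0r ?euclid_ge0 // ev.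
have a2 : mdist (J o (chi c u)) (J o (chi c m)) <= euclid_dist u m.
  by have := J_segment_hyp hv hv hu hm; rewrite euclid_refl hyp0 ?euclid_ge0 // ev.
rewrite e1 e2; apply: hyp_le; first exact: euclid_ge0.
have b1 : mdist (J (chi c m) o) (J (chi c u') o) ^+ 2 <= euclid_dist m u' ^+ 2.
  by rewrite ler_pXn2r ?nnegrE ?mdist_ge0 ?euclid_ge0.
have b2 : mdist (J o (chi c u)) (J o (chi c m)) ^+ 2 <= euclid_dist u m ^+ 2.
  by rewrite ler_pXn2r ?nnegrE ?mdist_ge0 ?euclid_ge0.
apply: le_trans (lerD b1 b2) _.
rewrite !(euclid_off w) !nrm_sq -big_split /= le_eqVlt; apply/orP; left; apply/eqP.
apply: eq_bigr => l _; rewrite cptK /join_off !fa_off //.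
by case: (pselect _) => h /=; ring.
Qed.

Lemma J_lower o x x' :
  mdist (J x o) (J x' o) ^+ 2 + mdist (J o x) (J o x') ^+ 2 <= mdist x x' ^+ 2.
Proof.
have str s x0 : is_string (K := K) x0 s x' ->
    hyp (mdist (J x0 o) (J x' o)) (mdist (J o x0) (J o x')) <= string_length s.
  elim: s x0 => [|[c [u u']] s IH] x0 /=.
    by move=> ->; rewrite !mdistxx hyp0 // string_len_ge0.
  move=> [hu hu' <- /IH h]; rewrite /string_length big_cons /= -/(string_length s).
  apply: le_trans (lerD (J_lower_segment o hu hu') h); apply: le_trans (hypD _ _ _ _).
  by apply: hyp_mono; rewrite mdist_ge0 /=; exact: metric_triangle.
rewrite -hyp_sq ler_pXn2r ?nnegrE ?hyp_ge0 ?mdist_ge0 // leNgt; apply/negP => /(string_lt hlm)[s hs].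
by rewrite ltNge (str _ _ hs).
Qed.

Lemma JJ x o : J (J x o) (J o x) = x.
Proof.
have [k1 k2] := JP x o; have [l1 l2] := JP o x.
apply: join_uniq (JP _ _) _; split=> a Pa; first by rewrite k1.
by rewrite l2.
Qed.

Lemma pythagoras o x x' :
  mdist x x' ^+ 2 = mdist (J x o) (J x' o) ^+ 2 + mdist (J o x) (J o x') ^+ 2.
Proof.
apply/eqP; rewrite eq_le J_lower andbT -hyp_sq ler_pXn2r ?nnegrE ?hyp_ge0 ?mdist_ge0 //.
by rewrite -{1}(JJ x o) -{1}(JJ x' o); exact: J_upper.
Qed.

(** * Slices as factors of the product *)

Section Slice.
Variable o : vert K.
Let O : X := sval o.

Definition slice : set X := [set x | forall a, P2 a -> fa a x = fa a O].

Lemma slice_base : slice O. Proof. by []. Qed.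

Lemma slice_J x : slice (J x O).
Proof. by move=> a Pa; case: (JP x O) => _ ->. Qed.

Lemma slice_JO x : slice x -> J O x = O.
Proof. by move=> hx; apply: join_uniq (JP _ _) _; split=> // a Pa; rewrite hx. Qed.

Lemma slice_eq x x' : slice x -> mdist (J O x) (J O x') = 0 -> slice x'.
Proof.
move=> hx /mdist_positivity e a Pa; rewrite -hx //.
have [_ h1] := JP O x; have [_ h2] := JP O x'.
by rewrite -h1 // e h2.
Qed.

Lemma slice_ndir x a i b : slice x -> P2 a -> ~ @dirn _ _ _ HX a (car K x) i b.
Proof.
move=> hx Pa d; have := fa_open (hP2 Pa) d; rewrite hx // fa_vert; last exact: hP2.
by case: asboolP => _; rewrite ltxx ?andbF.
Qed.

Lemma slice_cell x u : slice x -> cube u -> slice (chi (car K x) u).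
Proof.
move=> hx hu a Pa; rewrite -(hx a Pa) -{2}(chi_carp K x).
have [[i [b d]]|h|h] := @cell_cases _ _ _ HX a (car K x) (hP2 Pa).
- by case: (slice_ndir hx Pa d).
- by rewrite !fa_in //; [exact: hP2|exact: carp_cube|exact: hP2].
- by rewrite !fa_out //; [exact: hP2|exact: carp_cube|exact: hP2].
Qed.

Lemma slice_subcomplex : is_subcomplex K slice.
Proof.
exists [set c | closed_cell c `<=` slice]; apply/seteqP; split=> x; last by move=> [c hc /hc].
move=> hx; exists (car K x); first by move=> _ [u hu <-]; exact: slice_cell.
by exists (carp K x); [exact: carp_cube|exact: chi_carp].
Qed.

(** By [pythagoras] a distance has a part along the slice and a transverse part. Between points of
    the slice the parts along it must already add up to [l], which leaves nothing for the transverse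
    part at time [t]. *)
Lemma slice_convex : geodesically_convex slice.
Proof.
move=> l c l0 hc c0 cl t /andP[t0 tl].
have I0 : `[0, l]%classic 0 by rewrite /= in_itv /= lexx.
have Il : `[0, l]%classic l by rewrite /= in_itv /= l0 lexx.
have It : `[0, l]%classic t by rewrite /= in_itv /= t0.
have d1 := hc _ _ I0 It; have d2 := hc _ _ It Il; have d3 := hc _ _ I0 Il.
rewrite sub0r normrN (ger0_norm t0) in d1; rewrite sub0r normrN (ger0_norm l0) in d3.
rewrite distrC ger0_norm ?subr_ge0 // in d2.
have p1 := pythagoras O (c 0) (c t); have p2 := pythagoras O (c t) (c l).
have p3 := pythagoras O (c 0) (c l).
apply: (slice_eq c0).
have e : J O (c l) = J O (c 0) by rewrite !slice_JO.
rewrite e mdistxx in p3; rewrite e (metric_sym (J O (c t))) in p2.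
move: p1 p2 p3; rewrite d1 d2 d3.
have := metric_triangle (J (c 0) O) (J (c t) O) (J (c l) O).
have := mdist_ge0 (J (c 0) O) (J (c t) O); have := mdist_ge0 (J (c t) O) (J (c l) O).
have := mdist_ge0 (J (c 0) O) (J (c l) O); have := mdist_ge0 (J O (c 0)) (J O (c t)).
move: (mdist (J (c 0) O) (J (c t) O)) (mdist (J (c t) O) (J (c l) O)) (mdist (J (c 0) O) (J (c l) O)).
move: (mdist (J O (c 0)) (J O (c t))) => v p q r v0 r0 q0 p0 tri e1 e2 e3.
have er : l = r.
  by apply/eqP; rewrite -(@eqrXn2 _ 2) // e3 expr0n addr0.
have hp : p <= t by rewrite -(ler_pXn2r (n := 2)) ?nnegrE // e1 lerDl sqr_ge0.
have hq : q <= l - t by rewrite -(ler_pXn2r (n := 2)) ?nnegrE ?subr_ge0 // e2 lerDl sqr_ge0.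
have ep : p = t by lra.
move: e1; rewrite ep -[X in X = _]addr0 => /addrI/esym/eqP; rewrite sqrf_eq0 => /eqP //.
Qed.

(** A geodesic that has run inside the slice for a positive length cannot turn off it: equality in
    the triangle inequality for [x], [y], [z] makes the transverse part from [y] to [z] vanish. *)
Lemma slice_para x y z : slice x -> slice y -> 0 < mdist x y ->
  mdist x z = mdist x y + mdist y z -> slice z.
Proof.
move=> hx hy L0 e; apply: (slice_eq hy).
have p1 := pythagoras O x y; have p2 := pythagoras O y z; have p3 := pythagoras O x z.
have t1 := metric_triangle (J x O) (J y O) (J z O).
have jx := slice_JO hx; have jy := slice_JO hy.
rewrite jx jy mdistxx in p1; rewrite jy in p2 *; rewrite jx e in p3.
move: p1 p2 p3 t1.
have := mdist_ge0 (J x O) (J y O); have := mdist_ge0 (J y O) (J z O).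
have := mdist_ge0 (J x O) (J z O); have := mdist_ge0 O (J O z); have := mdist_ge0 y z.
move: L0; move: (mdist x y) (mdist y z) (mdist O (J O z)) => L M v L0 M0 v0.
move: (mdist (J x O) (J y O)) (mdist (J y O) (J z O)) (mdist (J x O) (J z O)).
move=> p q r r0 q0 p0 e1 e2 e3 tri.
have eL : L = p.
  by apply/eqP; rewrite -(@eqrXn2 _ 2) ?(ltW L0) // e1 expr0n addr0.
have hr : r ^+ 2 <= (p + q) ^+ 2 by rewrite ler_pXn2r ?nnegrE ?addr_ge0.
have hM : M <= q.
  have h : L * M <= L * q by move: e3 e2 hr; rewrite -eL; nra.
  by rewrite ler_pM2l in h.
have hM2 : M ^+ 2 <= q ^+ 2 by rewrite ler_pXn2r ?nnegrE.
have : v ^+ 2 <= 0 by lra.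
by move=> h; apply/eqP; rewrite -sqrf_eq0 eq_le h sqr_ge0.
Qed.

Hypothesis Hgc : geodesically_complete [set: X].

Lemma slice_line (l : R) (c : R -> X) : 0 < l -> geodesic_on `[0, l]%classic c ->
  (forall t : R, 0 <= t <= l -> slice (c t)) ->
  exists c' : R -> X, [/\ geodesic_on setT c', forall t, slice (c' t)
    & forall t : R, 0 <= t <= l -> c' t = c t].
Proof.
move=> l0 hc hs; have [//|c' [hc' _ ec]] := @Hgc l c (ltW l0) hc.
have I0 : 0 <= (0 : R) <= l by rewrite lexx ltW.
have Il : 0 <= l <= l by rewrite lexx ltW.
have s0 : slice (c' 0) by rewrite ec //; exact: hs.
have sl : slice (c' l) by rewrite ec //; exact: hs.
have dl : mdist (c' 0) (c' l) = l by rewrite hc' // sub0r normrN ger0_norm // ltW.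
exists c'; split=> // t; have [h1|h1] := leP 0 t; last first.
  apply: (slice_para sl s0); first by rewrite metric_sym dl.
  by rewrite !hc' // !ger0_norm; lra.
have [h2|h2] := leP t l; first by rewrite ec ?h1 //; apply: hs; rewrite h1.
apply: (slice_para s0 sl); first by rewrite dl.
by rewrite !hc' // !ler0_norm; lra.
Qed.

Hypothesis P1ne : exists a, P1 a.

(** A geodesic of length 0 gives [slice_para] no direction, so a short segment is supplied. Inside a
    carrier of positive dimension one coordinate is increased; at a vertex, [HS_step] towards a
    halfspace of [P1] yields an edge, and its halfspace is again in [P1]. *)
Lemma slice_segment x : slice x -> exists l (c : R -> X), [/\ 0 < l,
  geodesic_on `[0, l]%classic c, c 0 = x & forall t : R, 0 <= t <= l -> slice (c t)].
Proof.
move=> hx; have [[i _]|h0] := pselect (exists i : 'I_(cdim (car K x)), True).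
  have hu := carp_open K x i; set l := 1 - carp K x 0 i.
  pose p (t : R) : 'rV[R]_(cdim (car K x)) :=
    \row_j (if j == i then carp K x 0 i + t else carp K x 0 j).
  have hp t : 0 <= t <= l -> cube (p t).
    move=> ht j; rewrite mxE; case: eqP => _; last exact: carp_cube.
    by move: ht; rewrite /l; lra.
  exists l, (fun t => chi (car K x) (p t)); split.
  - by rewrite /l; lra.
  - move=> s t; rewrite /= !in_itv /= => hs ht.
    rewrite (mdist_cell HX (hp _ hs) (hp _ ht)) euclid_ed2 /ed2 (bigD1 i) //= big1.
      by rewrite !mxE eqxx addr0 (_ : _ - _ = s - t) ?sqrtr_sqr //; ring.
    by move=> j /negPf ne; rewrite !mxE ne subrr expr0n.
  - rewrite -[RHS](chi_carp K x); congr chi; apply/rowP => j; rewrite mxE.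
    by case: eqP => [->|//]; rewrite addr0.
  - by move=> t ht; apply: slice_cell => //; exact: hp.
pose w : {ffun 'I_(cdim (car K x)) -> bool} := [ffun => false].
have ex : sval (cv w) = x.
  rewrite /= -[RHS](chi_carp K x); congr chi; apply/rowP => i.
  by case: h0; exists i.
have [a [Pa na]] : exists a, P1 a /\ ~ a (cv w).
  have [a Pa] := P1ne; have [h|h] := pselect (a (cv w)); last by exists a.
  by exists (~` a); split; [exact: P1C|apply].
have [f [sf hf]] := HS_step (hP1 Pa) na.
have Pf : P1 (hs f).
  have hH : HS (hs f) by exists f.
  case: (hP hH) => // P2f; have [_ [v [v1 v2]] _ _] := hcr Pa P2f.
  by case: v2; exact: hf.
have b0 : 0 <= (0 : R) <= 1 by rewrite lexx ler01.
exists 1, (fun t => ept (sval (f : edge_t K)) t); split=> //.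
- by move=> s t; rewrite /= !in_itv /= => hs_ ht; rewrite mdist_ept.
- by rewrite -esrcE -ex; congr sval; exact: sf.
move=> t ht b Pb; rewrite -hx // -ex; have hb := hP2 Pb.
have same b' : P2 b' -> ~ b' (cv w) -> fa b' (ept (sval (f : edge_t K)) t) = 0.
  move=> Pb' nb; have hb' := hP2 Pb'.
  have st : b' (tgt f) <-> b' (src f).
    apply: hs_same => // E; first by apply: (P12 Pf); rewrite -E.
    by apply: (P12 (P1C Pf)); rewrite -E.
  rewrite sf in st; apply: fa_ept_out => // h; apply: nb; last exact/st.
  by rewrite -sf.
rewrite fa_vert //; case: asboolP => h; last exact: same.
have nb : ~ (~` b) (cv w) by apply.
have := same (~` b) (P2C Pb) nb; rewrite faC // => /eqP; rewrite subr_eq0 => /eqP <-.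
by [].
Qed.

Lemma slice_complete : geodesically_complete slice.
Proof.
move=> l c l0 hc hs; have [lp|ln] := ltP 0 l; first exact: slice_line.
have el : l = 0 by apply/eqP; rewrite eq_le ln.
have I0 : 0 <= (0 : R) <= l by rewrite lexx.
have [l' [c1 [h1 h2 h3 h4]]] := slice_segment (hs 0 I0).
have [c' [k1 k2 k3]] := slice_line h1 h2 h4; exists c'; split=> // t.
rewrite el => ht; have -> : t = 0 by lra.
by rewrite k3 ?h3 // lexx ltW.
Qed.

(** Completeness, applied to the constant geodesic at the base vertex, already gives a line in the
    slice. *)
Lemma slice_unbounded : unbounded slice.
Proof.
move=> [M hM]; have [||c' [k1 k2 _]] := @slice_complete 0 (fun=> O) (lexx _).
- move=> s t; rewrite /= !in_itv /= => hs ht.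
  have -> : s = 0 by lra.
  have -> : t = 0 by lra.
  by rewrite mdistxx subrr normr0.
- by move=> t _; exact: slice_base.
have := hM _ _ (k2 0) (k2 (`|M| + 1)); rewrite k1 // sub0r normrN ger0_norm.
  by have := ler_norm M; lra.
by rewrite addr_ge0.
Qed.

Let coslice : set X := [set x | forall a, P1 a -> fa a x = fa a O].

Lemma slice_cells c w i : closed_cell (K := K) c `<=` slice -> P1 (hs (S := S) (@edge _ _ K c w i)).
Proof.
move=> hc; have hE : HS (hs (S := S) (edge w i)) by exists (edge w i).
case: (hP hE) => // P2h.
have v1 (v : {ffun 'I_(cdim c) -> bool}) : fa (hs (S := S) (edge w i)) (sval (cv v)) = fa (hs (S := S) (edge w i)) O.
  by apply: hc P2h; exists (cube_vertex v) => //; exact: corner_cube.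
have := v1 w; rewrite -(v1 (flip w i)) !fa_vert //.
rewrite asboolF ?asboolT; last 2 first.
- by apply/(hs_edge_cv HX); rewrite flip_same; case: (w i).
- by move/(hs_edge_cv HX); rewrite eqxx.
by move=> /eqP; rewrite eq_sym oner_eq0.
Qed.

Lemma coslice_cells c w i : closed_cell (K := K) c `<=` coslice ->
  P2 (hs (S := S) (@edge _ _ K c w i)).
Proof.
move=> hc; have hE : HS (hs (S := S) (edge w i)) by exists (edge w i).
case: (hP hE) => // P1h.
have v1 (v : {ffun 'I_(cdim c) -> bool}) : fa (hs (S := S) (edge w i)) (sval (cv v)) = fa (hs (S := S) (edge w i)) O.
  by apply: hc P1h; exists (cube_vertex v) => //; exact: corner_cube.
have := v1 w; rewrite -(v1 (flip w i)) !fa_vert //.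
rewrite asboolF ?asboolT; last 2 first.
- by apply/(hs_edge_cv HX); rewrite flip_same; case: (w i).
- by move/(hs_edge_cv HX); rewrite eqxx.
by move=> /eqP; rewrite eq_sym oner_eq0.
Qed.

Lemma corner_walls_inj c (w : {ffun 'I_(cdim c) -> bool}) i j :
  hs (S := S) (edge w i) = hs (S := S) (edge w j) -> i = j.
Proof. by move=> e; apply: contrapT => ne; case: ((corner_walls w).2 i j ne). Qed.

(** All hyperplanes of [c] are in [P1] and all those of [d] in [P2], so the directions of the joined
    cube match those of [c] and [d] together; this bijection permutes the coordinates. *)
Lemma slice_cell_product (c d : cell K) : closed_cell c `<=` slice -> closed_cell d `<=` coslice ->
  exists (c3 : cell K) (h : 'rV[R]_(cdim c + cdim d) -> 'rV[R]_(cdim c3)),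
    euclid_isometry (@cube R (cdim c + cdim d)) (@cube R (cdim c3)) h /\
    (forall u v, cube u -> cube v -> J (chi c u) (chi d v) = chi c3 (h (row_mx u v))).
Proof.
move=> hc hd; pose w (x : cell K) : {ffun 'I_(cdim x) -> bool} := [ffun => false].
have [c3 [w3 jc]] := join_cell_ex (w c) (w d); have [_ _ k3 k4 k5] := jc.
pose good3 l (k : 'I_(cdim c + cdim d)) :=
  (exists i, [/\ k = lshift (cdim d) i, P1 (hs (S := S) (edge w3 l)) &
     hs (S := S) (edge w3 l) = hs (S := S) (edge (w c) i)]) \/
  (exists i, [/\ k = rshift (cdim c) i, P2 (hs (S := S) (edge w3 l)) &
     hs (S := S) (edge w3 l) = hs (S := S) (edge (w d) i)]).
have [s hs_] : {s : 'I_(cdim c3) -> 'I_(cdim c + cdim d) & forall l, good3 l (s l)}.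
  apply: (@choice _ _ good3) => l; case: (k5 l) => -[Pl [i ei]].
    by exists (lshift (cdim d) i); left; exists i.
  by exists (rshift (cdim c) i); right; exists i.
have sinj : injective s.
  move=> l l' e; apply: (@corner_walls_inj _ w3).
  case: (hs_ l) => -[i [e1 _ ->]]; case: (hs_ l') => -[i' [e2 _ ->]].
  - by move: e; rewrite e1 e2 => /lshift_inj ->.
  - by move: e; rewrite e1 e2 => /eqP; rewrite eq_lrshift.
  - by move: e; rewrite e1 e2 => /eqP; rewrite eq_rlshift.
  - by move: e; rewrite e1 e2 => /rshift_inj ->.
have ssur k : exists l, s l = k.
  case: (split_ordP k) => i ->.
    have Pi : P1 (hs (S := S) (edge (w c) i)) by exact: slice_cells.
    have [l el] := k3 i Pi; exists l; case: (hs_ l) => -[i' [e1 P' e2]].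
      by rewrite e1; congr lshift; apply: (@corner_walls_inj _ (w c)); rewrite -e2 el.
    by case: (P12 _ P'); rewrite el.
  have Pi : P2 (hs (S := S) (edge (w d) i)) by exact: coslice_cells.
  have [l el] := k4 i Pi; exists l; case: (hs_ l) => -[i' [e1 P' e2]].
    by case: (P12 P'); rewrite el.
  by rewrite e1; congr rshift; apply: (@corner_walls_inj _ (w d)); rewrite -e2 el.
pose h (p : 'rV[R]_(cdim c + cdim d)) := cpt w3 (fun l => p 0 (s l)).
exists c3, h; split; last first.
  move=> u v hu hv; rewrite (J_cell jc) //; congr chi; apply: cpt_ext => l.
  rewrite /join_off; case: (hs_ l) => -[i [e1 Pl e2]]; case: (pselect _) => Q /=.
  - by rewrite e1 row_mxEl e2 fa_off // /off ffunE.
  - by case: Q.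
  - by case: (P12 Q Pl).
  - by rewrite e1 row_mxEr e2 fa_off // /off ffunE.
split; last first.
  move=> p q _ _; rewrite !euclid_ed2 ed2_cpt; congr Num.sqrt; apply/esym.
  by apply: sum_inj => // k hk; have [l /hk] := ssur k.
apply/seteqP; split=> [_ [p hp <-]|v hv]; first by apply/cube_cpt => l; exact: hp.
exists (\row_k extz s (off w3 v) k).
  by move=> k; rewrite mxE; apply: extz_box; exact: cube_off.
by rewrite -[RHS](offK w3); apply: cpt_ext => l; rewrite mxE extz_in.
Qed.

Lemma slice_product : is_product K slice coslice.
Proof.
exists (fun p => J p.1 p.2); split.
- apply/seteqP; split=> // x _; exists (J x O, J O x); last exact: JJ.
  by split=> /=; [exact: slice_J|move=> a Pa; case: (JP O x) => ->].
- move=> y z y' z' hy hz hy' hz' /=.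
  have prj y0 z0 : slice y0 -> coslice z0 -> J (J y0 z0) O = y0 /\ J O (J y0 z0) = z0.
    move=> h0 h1; have [k1 k2] := JP y0 z0; split.
      by apply: join_uniq (JP _ _) _; split=> a Pa; rewrite ?k1 // h0.
    by apply: join_uniq (JP _ _) _; split=> a Pa; rewrite ?k2 // h1.
  have [e1 e2] := prj y z hy hz; have [e3 e4] := prj y' z' hy' hz'.
  have := pythagoras O (J y z) (J y' z'); rewrite e1 e2 e3 e4 => <-.
  by rewrite sqrtr_sqr ger0_norm // mdist_ge0.
- by move=> c d hc hd /=; exact: slice_cell_product.
Qed.

End Slice.

End Partition.

Lemma crossing_partition (Q : set (set (vtx S))) : geodesically_complete [set: X] ->
  (forall a, Q a -> HS a) -> (forall a b, Q a -> HS b -> ~ Q b -> cross a b) ->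
  Q !=set0 -> (exists2 b, HS b & ~ Q b) ->
  exists Y Z : set X,
     [/\ is_product K Y Z,
         [/\ is_subcomplex K Y, geodesically_convex Y,
             geodesically_complete Y & unbounded Y]
       & [/\ is_subcomplex K Z, geodesically_convex Z,
             geodesically_complete Z & unbounded Z]].
Proof.
move=> Hgc hQ hcr Qne [b0 hb0 nb0]; pose Q' : set (set (vtx S)) := [set b | HS b /\ ~ Q b].
have hQ' b : Q' b -> HS b by case.
have hall a : HS a -> Q a \/ Q' a by move=> ha; case: (pselect (Q a)); [left|right].
have hall' a : HS a -> Q' a \/ Q a by move=> /hall[]; [right|left].
have cr a b : Q a -> Q' b -> cross a b by move=> Qa [hb nb]; exact: hcr.
have cr' a b : Q' a -> Q b -> cross a b by move=> h1 h2; apply: cross_sym; exact: cr.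
have [[[x _] _ _] _ _] := HX.
pose o : vert K := cv (c := car K x) [ffun => false].
have Qne' : exists a, Q' a by exists b0.
exists (slice Q' o), (slice Q o); split.
- exact: slice_product hQ hQ' hall cr o.
- split; [exact: slice_subcomplex|exact: (slice_convex hQ hQ' hall cr)| |].
    exact: (slice_complete hQ hQ' hall cr).
  exact: (slice_unbounded hQ hQ' hall cr).
- split; [exact: slice_subcomplex|exact: (slice_convex hQ' hQ hall' cr')| |].
    exact: (slice_complete hQ' hQ hall' cr').
  exact: (slice_unbounded hQ' hQ hall' cr').
Qed.

End Product.

Theorem corollary2 (R : realType) (X : metricType R) (K : cube_complex R X)
    (HX : CAT0_cube_complex K)
    (Hlc : locally_compact [set: X])
    (Hgc : geodesically_complete [set: X])
    (Gamma : groupType) (rho : Gamma -> X -> X)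
    (Hinf : infinite_set [set: Gamma])
    (Hact : is_action rho)
    (Hcub : forall g : Gamma, cubical_automorphism K (rho g))
    (Hprop : proper_action rho)
    (Hcoc : cocompact_action rho) :
  (exists Y Z : set X,
     [/\ is_product K Y Z,
         [/\ is_subcomplex K Y, geodesically_convex Y,
             geodesically_complete Y & unbounded Y]
       & [/\ is_subcomplex K Z, geodesically_convex Z,
             geodesically_complete Z & unbounded Z]])
  \/ (exists g : Gamma, rank_one (rho g)).
Proof.
have [hirr|hred] := pselect (irreducible HX).
  by right; exact: irreducible_rank_one Hact Hcub Hlc Hgc Hinf Hprop Hcoc hirr.
left; apply: contrapT => hn; apply: hred => ? Q hQ hcr Qne a ha.
apply: contrapT => na; apply: hn.
by apply: (crossing_partition Hlc Hgc hQ hcr Qne); exists a.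
Qed.
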